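(* Let $n\ge0$ be an integer. For otherwise generic parameters $t_0,\dots,t_{n+1},u_0,\dots,u_{n+1}\in\mathbb C^*$ and $0<|p|,|q|<1$ satisfying $\prod_{0\le r<n+2}t_ru_r=pq$, $$I^{(0)}_{A_n}(\dots t_i\dots;\dots u_i\dots;p,q)=\prod_{0\le r,s<n+2}\Gamma(t_ru_s;p,q)\prod_{0\le r<n+2}\Gamma(U/u_r,T/t_r;p,q),$$ where $T=\prod_{0\le r<n+2}t_r$ and $U=\prod_{0\le r<n+2}u_r$.
   Context: Notation: for $0<|p|,|q|<1$, $(p;p)=\prod_{k\ge1}(1-p^k)$ and $\Gamma(x;p,q)=\prod_{j,k\ge0}(1-p^{j+1}q^{k+1}/x)(1-p^jq^kx)^{-1}$; several arguments before the semicolon denote a product. $$I^{(0)}_{A_n}(t_0,\dots,t_{n+1};u_0,\dots,u_{n+1};p,q)=\frac{(p;p)^n(q;q)^n}{(n+1)!}\int_{\prod_{0\le i\le n}z_i=1}\frac{\prod_{0\le i\le n}\prod_{0\le r<n+2}\Gamma(t_rz_i,u_r/z_i;p,q)}{\prod_{0\le i<j\le n}\Gamma(z_i/z_j,z_j/z_i;p,q)}\prod_{1\le i\le n}\frac{dz_i}{2\pi\sqrt{-1}z_i}.$$ If $|u_r|<1<1/|t_r|$ for all $r$, the contour is the torus $|z_i|=1$ (with $z_0$ determined by $\prod z_i=1$); outside this range the integral denotes its meromorphic continuation in the parameters. For $n=0$ the integral is the value $\prod_{0\le r<2}\Gamma(t_r,u_r;p,q)$. *)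

(* Defs.v *)
From mathcomp Require Import all_boot all_order all_algebra.
From mathcomp Require Import all_classical all_reals all_analysis.
From mathcomp Require Import complex.

Set Implicit Arguments.
Unset Strict Implicit.
Unset Printing Implicit Defensive.

Import Order.TTheory GRing.Theory Num.Theory.
Import numFieldNormedType.Exports.

Local Open Scope classical_set_scope.
Local Open Scope ring_scope.

(* The complex numbers are R[i] for a realType R.  The alias R[i]^o is the
   same type seen as a normed space over R[i], so that [differentiable] below
   means complex (Frechet) differentiable. *)

Section SeveralComplexVariables.
Variables (R : realType) (V : normedModType R[i]).

Definition holomorphic_on (W : set V) (f : V -> R[i]^o) : Prop :=
  open W /\ forall x, W x -> differentiable f x.

(* X is meant to be a complex submanifold of V.  Holomorphic functions on X are
   locally restrictions of holomorphic functions on open subsets of V, and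
   [locally_nonzero_on X W h] says that h vanishes identically on no nonempty
   relatively open subset of X `&` W. *)
Definition locally_nonzero_on (X W : set V) (h : V -> R[i]^o) : Prop :=
  X `&` W `<=` closure (X `&` W `&` [set y | h y != 0]).

(* F is locally a quotient of holomorphic functions; the values of the total
   function F on the zero set of the denominators are irrelevant. *)
Definition meromorphic_on (X : set V) (F : V -> R[i]^o) : Prop :=
  forall x, X x -> exists (W : set V) (A B : V -> R[i]^o),
    [/\ W x, holomorphic_on W A, holomorphic_on W B,
        locally_nonzero_on X W B
      & forall y, X y -> W y -> B y != 0 -> F y = A y / B y].

(* For X connected and X `&` D nonempty and relatively open in X, such an F is
   unique outside a nowhere dense analytic subset of X. *)
Definition meromorphic_continuation (X D : set V) (f F : V -> R[i]^o) : Prop :=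
  meromorphic_on X F /\ forall x, X x -> D x -> F x = f x.

(* P holds at the generic point of X: outside a thin subset, i.e. one which is
   locally contained in the zero set of a holomorphic function that vanishes
   identically on no nonempty relatively open subset. *)
Definition generically_on (X : set V) (P : V -> Prop) : Prop :=
  forall x, X x -> exists (W : set V) (h : V -> R[i]^o),
    [/\ W x, holomorphic_on W h, locally_nonzero_on X W h
      & forall y, X y -> W y -> h y != 0 -> P y].

End SeveralComplexVariables.

Section EllipticGamma.
Variable R : realType.
Implicit Types p q x : R[i].

Definition qpoch p : R[i] :=
  limn (fun N => \prod_(k < N) (1 - p ^+ k.+1) : R[i]^o).

(* For 0 < |p|, |q| < 1 the double product converges absolutely, so it is the
   limit of its square partial products. *)
Definition egamma p q x : R[i] :=
  limn (fun N => \prod_(j < N) \prod_(k < N)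
    ((1 - p ^+ j.+1 * q ^+ k.+1 / x) / (1 - p ^+ j * q ^+ k * x)) : R[i]^o).

End EllipticGamma.

Section TorusIntegral.
Variable R : realType.

(* The integral of g(z) dz / (2 pi sqrt(-1) z) over the unit circle, through
   the parametrization z = exp(2 pi sqrt(-1) a) with 0 <= a <= 1. *)
Definition circle_integral (g : R[i] -> R[i]) : R[i] :=
  let h (a : R) : R[i] := g (Complex (cos (2 * pi * a)) (sin (2 * pi * a))) in
  Complex (\int[lebesgue_measure]_(a in `[0, 1]) complex.Re (h a))
          (\int[lebesgue_measure]_(a in `[0, 1]) complex.Im (h a)).

(* The integral of g [:: z_1; ..; z_m] against the product of the forms
   dz_i / (2 pi sqrt(-1) z_i) over |z_1| = .. = |z_m| = 1, as an iterated
   integral (it is only used for continuous integrands). *)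
Fixpoint torus_integral (m : nat) (g : seq R[i] -> R[i]) : R[i] :=
  if m is m'.+1 then
    circle_integral (fun z => torus_integral m' (fun zs => g (z :: zs)))
  else g [::].

End TorusIntegral.

(* A point is the pair (t, u) of parameter vectors. *)
Notation params R n := ('rV[R[i]^o]_n.+2 * 'rV[R[i]^o]_n.+2)%type.

Section AnIntegral.
Variables (R : realType) (n : nat).

Implicit Types (p q : R[i]) (x : params R n).

Definition tpar x (r : 'I_n.+2) : R[i] := x.1 ord0 r.
Definition upar x (r : 'I_n.+2) : R[i] := x.2 ord0 r.

Definition balanced p q : set (params R n) :=
  [set x : params R n |
    [/\ forall r, tpar x r != 0, forall r, upar x r != 0
      & \prod_r (tpar x r * upar x r) = p * q]].

Definition torus_range : set (params R n) :=
  [set x : params R n | forall r, `|upar x r| < 1 /\ 1 < `|tpar x r|^-1].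

(* z lists z_0, ..., z_n.  On the torus, where z_i = z_j the factor
   Gamma(z_i/z_j, z_j/z_i) has a pole and [egamma] returns 0, so that its
   inverse has the correct value 0. *)
Definition An_integrand p q x (z : seq R[i]) : R[i] :=
  (\prod_(i < n.+1) \prod_(r < n.+2)
     (egamma p q (tpar x r * z`_i) * egamma p q (upar x r / z`_i))) /
  (\prod_(i < n.+1) \prod_(j < n.+1 | (i < j)%N)
     (egamma p q (z`_i / z`_j) * egamma p q (z`_j / z`_i))).

Definition An_torus_integral p q x : R[i]^o :=
  (qpoch p ^+ n * qpoch q ^+ n) / (n.+1)`!%:R *
  torus_integral n
    (fun zs => An_integrand p q x ((\prod_(w <- zs) w)^-1 :: zs)).

(* The integral as a function on the parameter space X: the meromorphic
   continuation to X of the torus integral. *)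
Definition An_integral (X : set (params R n)) p q : params R n -> R[i]^o :=
  xget (fun=> 0)
    [set F | meromorphic_continuation X torus_range (An_torus_integral p q) F].

End AnIntegral.

Fact An_torus_integral0 (R : realType) (p q : R[i]) (x : params R 0) :
  An_torus_integral p q x =
  \prod_(r < 2) (egamma p q (tpar x r) * egamma p q (upar x r)).
Proof.
rewrite /An_torus_integral /= /An_integrand !big_ord_recl !big_ord0 /=.
rewrite [\prod_(j < 1 | _) _]big_pred0; last by case=> -[].
by rewrite big_nil !expr0 !invr1 !mulr1 !mul1r; exact: divr1.
Qed.

(* Main.v *)
Require Import Defs.
From HB Require Import structures.
From mathcomp Require Import all_boot all_order all_algebra.
From mathcomp Require Import all_classical all_reals all_analysis.
From mathcomp Require Import fingroup perm complex ring lra zify.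
Import Order.TTheory GRing.Theory Num.Theory.
Import numFieldNormedType.Exports.

Set Implicit Arguments.
Unset Strict Implicit.
Unset Printing Implicit Defensive.

Local Open Scope classical_set_scope.
Local Open Scope ring_scope.

(* Both sides satisfy the same first order q-difference equation under
   (q t_0, t_1) -> (t_0, q t_1): by a theta function partial fraction identity,
   the difference of the two integrands is a sum of contour shifts of a function
   that sums to zero.  The quotient of the two sides, as a function of s in
   (s t_0, t_1 / s), is then multiplicatively periodic and holomorphic, hence
   constant; by symmetry it depends only on the products of the t_r and of the
   u_r.  Letting t_0, u_0 -> 1 with these products fixed pinches the torus, and
   the residue, extracted by a Poisson kernel, reduces A_n to A_(n-1), down to
   n = 0.  This settles the range where the contour is the torus; elsewhere the
   right-hand side is a meromorphic continuation, and two continuations agree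
   generically because the parameter space is connected.

   Contour integrals are handled as limits of averages over the grids of
   2^m-th roots of unity. *)

(** * Complex moduli and limits *)

(** The shifted contours reach radius |q|^(-1/(n+1)), so the difference equation is available only
    when the parameters that are not exchanged satisfy |t_r|^(n+1) < |q|, and the periodicity
    argument also confines the moduli of the two exchanged parameters to a window between |p| sqrt
    |q| and sqrt |q|. Such points exist when |p| <= |q|, which the symmetry in p and q allows to
    assume. The invariance is then carried to all parameters of modulus less than 1 along segments
    in logarithmic coordinates, where the domain is convex.

    Contour shifts use no residues: for exponents d of sum 0 the mean of F (t^d z) is holomorphic in
    t and unchanged when t is multiplied by a 2^k-th root of unity, because the grid averages are;
    comparing Laurent coefficients, it is constant. The same argument exploits the q-periodicity.

    Since the quotient of the two sides is the same at all points of the pinching family t_0 = u_0 =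
    s, it can be read off from the limits of both sides multiplied by 1 - s^2. Each step from A_n to
    A_(n-1) contributes the factor (n+1)/((p;p)(q;q)); these factors build up the normalization of
    the integral. *)

Section RealModulus.
Variable R : realType.
Implicit Types x y z : R[i].

(** The norm of [R[i]] has values in [R[i]], which is only partially ordered; the modulus as an
    element of [R] makes [lra] and [nra] applicable. *)
Definition nm z : R := complex.Re `|z|.

Lemma nmE z : `|z| = (nm z)%:C%C.
Proof. by rewrite /nm RRe_real // normr_real. Qed.

Lemma nm_ge0 z : 0 <= nm z.
Proof. by rewrite -ler0c -nmE normr_ge0. Qed.

Lemma nm_lt x y : (`|x| < `|y|) = (nm x < nm y).
Proof. by rewrite !nmE ltcR. Qed.

Lemma nm_real (r : R) : nm r%:C%C = `|r|.
Proof. by rewrite /nm normc_def /= expr0n addr0 sqrtr_sqr. Qed.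

Lemma nm0 : nm 0 = 0. Proof. by rewrite /nm normr0. Qed.
Lemma nm1 : nm 1 = 1. Proof. by rewrite /nm normr1. Qed.
Lemma nmN z : nm (- z) = nm z. Proof. by rewrite /nm normrN. Qed.
Lemma nmBC x y : nm (x - y) = nm (y - x). Proof. by rewrite -opprB nmN. Qed.

Lemma nmM x y : nm (x * y) = nm x * nm y.
Proof. by apply: complexI; rewrite rmorphM -!nmE normrM. Qed.

Lemma nmV z : nm z^-1 = (nm z)^-1.
Proof. by apply: complexI; rewrite fmorphV -!nmE normfV. Qed.

Lemma nmX z n : nm (z ^+ n) = nm z ^+ n.
Proof. by apply: complexI; rewrite rmorphXn -!nmE normrX. Qed.

Lemma nmD x y : nm (x + y) <= nm x + nm y.
Proof. by rewrite -lecR rmorphD /= -!nmE ler_normD. Qed.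

Lemma nmB x y : nm (x - y) <= nm x + nm y.
Proof. by rewrite -(nmN y) nmD. Qed.

Lemma nm_dist x y z : nm (x - z) <= nm (x - y) + nm (y - z).
Proof. by have := nmD (x - y) (y - z); rewrite addrA subrK. Qed.

Lemma nm_sub x y : nm x - nm y <= nm (x - y).
Proof. by have := nmD (x - y) y; rewrite subrK; lra. Qed.

Lemma nm_eq0 z : (nm z == 0) = (z == 0).
Proof. by rewrite -(inj_eq (@complexI R)) -nmE normr_eq0. Qed.

Lemma nm_gt0 z : (0 < nm z) = (z != 0).
Proof. by rewrite lt_def nm_ge0 nm_eq0 andbT. Qed.

Lemma nm_sum (I : Type) (s : seq I) (P : pred I) (F : I -> R[i]) :
  nm (\sum_(i <- s | P i) F i) <= \sum_(i <- s | P i) nm (F i).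
Proof.
elim/big_ind2 : _ => [|x a y b xa yb|//]; first by rewrite nm0.
by apply: (le_trans (nmD _ _)); apply: lerD.
Qed.

Lemma nm_prod (I : Type) (s : seq I) (P : pred I) (F : I -> R[i]) :
  nm (\prod_(i <- s | P i) F i) = \prod_(i <- s | P i) nm (F i).
Proof.
elim/big_ind2 : _ => [|x a y b <- <-|//]; first by rewrite nm1.
by rewrite nmM.
Qed.

Lemma nm_Re z : `|complex.Re z| <= nm z.
Proof. by have := normc_ge_Re z; rewrite nmE lecR. Qed.

Lemma nm_Im z : `|complex.Im z| <= nm z.
Proof.
have := normc_ge_Re (z * 'i%C); rewrite nmE lecR nmM ReiNIm normrN.
suff -> : nm 'i%C = 1 by rewrite mulr1.
by rewrite /nm normc_def /= expr0n expr1n add0r sqrtr1.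
Qed.

Lemma nm_le_ReIm z : nm z <= `|complex.Re z| + `|complex.Im z|.
Proof.
rewrite {1}[z]complexE; apply: le_trans (nmD _ _) _.
rewrite nmM !nm_real.
suff -> : nm 'i%C = 1 by rewrite mul1r.
by rewrite /nm normc_def /= expr0n expr1n add0r sqrtr1.
Qed.

Lemma posc (e : R[i]) : 0 < e -> exists2 d : R, 0 < d & e = d%:C%C.
Proof.
move=> e0; exists (complex.Re e); last by rewrite RRe_real // gtr0_real.
by move: e0; rewrite ltcE /= => /andP[].
Qed.

Lemma cvgCP (u : nat -> R[i]^o) (l : R[i]^o) : u @ \oo --> l <->
  forall e : R, 0 < e -> exists N, forall n, (N <= n)%N -> nm (u n - l) < e.
Proof.
split=> [/cvgrPdist_lt h e e0|h].
  have [|N _ hN] := h e%:C%C; first by rewrite ltcR.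
  by exists N => n Nn; rewrite -ltcR -nmE distrC; exact: hN.
apply/cvgrPdist_lt => _ /posc[e e0 ->].
have [N hN] := h e e0; exists N => // n /= Nn.
by rewrite distrC nmE ltcR hN.
Qed.

(** Completeness is inherited from [R] through the real and imaginary parts, both treated in [key]
    as additive maps dominated by the modulus. *)
Lemma cauchyC (u : nat -> R[i]^o) :
  (forall e : R, 0 < e -> exists N, forall m n, (N <= m)%N -> (N <= n)%N ->
    nm (u m - u n) < e) -> exists l : R[i], u @ \oo --> (l : R[i]^o).
Proof.
move=> h.
have key (f : R[i] -> R) : (forall x y, f x - f y = f (x - y)) ->
    (forall x, `|f x| <= nm x) -> exists l : R, (f \o u) @ \oo --> l.
  move=> fB fn; suff : cvgn (f \o u) by move=> c; exists (limn (f \o u)).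
  apply/cauchy_cvgP/cauchy_ballP => e e0.
  have [N hN] := h e e0.
  exists ([set v | exists2 n, (N <= n)%N & v = f (u n)],
    [set v | exists2 n, (N <= n)%N & v = f (u n)]) => /=.
    by split; exists N => // n /= Nn; exists n.
  move=> [_ _] [/= [m Nm ->] [n Nn ->]].
  by rewrite /ball/= fB; apply: le_lt_trans (fn _) _; exact: hN.
have [a ha] := key (@complex.Re R) (fun x y => esym (raddfB _ x y)) nm_Re.
have [b hb] := key (@complex.Im R) (fun x y => esym (raddfB _ x y)) nm_Im.
exists (Complex a b); apply/cvgCP => e e0.
have e20 : 0 < e / 2 by lra.
move/cvgrPdist_lt : ha => /(_ _ e20) [N1 _ h1].
move/cvgrPdist_lt : hb => /(_ _ e20) [N2 _ h2].
exists (maxn N1 N2) => n; rewrite geq_max => /andP[n1 n2].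
apply: le_lt_trans (nm_le_ReIm _) _.
have := h1 n n1; have := h2 n n2; rewrite /= !raddfB /=.
by rewrite (distrC a) (distrC b); lra.
Qed.

Lemma cvgC_unique (u : nat -> R[i]^o) (l l' : R[i]^o) :
  u @ \oo --> l -> u @ \oo --> l' -> l = l'.
Proof. exact: (@cvg_unique _ (@norm_hausdorff _ _)). Qed.

Lemma cvgC_lim (u : nat -> R[i]^o) (l : R[i]^o) : u @ \oo --> l -> limn u = l.
Proof. exact: (@cvg_lim _ (@norm_hausdorff _ _)). Qed.

Lemma cvgC_le (u : nat -> R[i]^o) (l : R[i]^o) (B : R) N :
  u @ \oo --> l -> (forall n, (N <= n)%N -> nm (u n) <= B) -> nm l <= B.
Proof.
move=> /cvgCP ul uB; rewrite leNgt; apply/negP => lB.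
have /ul[M hM] : 0 < nm l - B by lra.
have := hM (maxn M N) (leq_maxl _ _); have := uB _ (leq_maxr M N).
by have := nm_sub l (u (maxn M N)); rewrite nmBC; lra.
Qed.

Lemma cvgC_ge (u : nat -> R[i]^o) (l : R[i]^o) (B : R) N :
  u @ \oo --> l -> (forall n, (N <= n)%N -> B <= nm (u n)) -> B <= nm l.
Proof.
move=> /cvgCP ul uB; rewrite leNgt; apply/negP => lB.
have /ul[M hM] : 0 < B - nm l by lra.
have := hM (maxn M N) (leq_maxl _ _); have := uB _ (leq_maxr M N).
by have := nm_sub (u (maxn M N)) l; lra.
Qed.

(** Differentiability with an explicit linear remainder; the non-strict bound keeps the increment 0
    admissible. Goursat's theorem and [dif_limit] work with this form. *)
Lemma diffCP (f : R[i]^o -> R[i]^o) (z : R[i]^o) : differentiable f z <->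
  exists L : R[i], forall e : R, 0 < e -> exists2 d : R, 0 < d &
    forall h : R[i], nm h < d -> nm (f (z + h) - f z - L * h) <= e * nm h.
Proof.
rewrite -derivable1_diffP; split=> [|[L hL]].
  move=> /cvg_ex[/= L hL]; exists L => e e0.
  move/cvgrPdist_lt : hL => /(_ e%:C%C); rewrite ltcR => /(_ e0).
  move=> /nbhs_ballP[_ /= /posc[d d0 ->] hd]; exists d => // h hd'.
  have [->|h0] := eqVneq h 0; first by rewrite addr0 mulr0 subrr subr0 nm0 mulr0.
  have /hd : ball (0 : R[i]^o) d%:C%C h.
    by rewrite /ball/= sub0r normrN nmE ltcR.
  move=> /(_ h0); rewrite /= nmE ltcR => hh.
  have -> : f (z + h) - f z - L * h =
      - h * (L - h^-1 *: (f (h%:A + z) - f z)).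
    rewrite mulrBr mulNr -[h^-1 *: _]/(h^-1 * _) [- h * _]mulrA mulNr mulfV //.
    rewrite -[h%:A]/(h * 1) mulr1 [h + z]addrC; ring.
  by rewrite nmM nmN mulrC ler_wpM2r ?nm_ge0// ltW.
apply/cvg_ex; exists L; apply/cvgrPdist_le => _ /posc[e e0 ->].
have [d d0 hd] := hL e e0.
apply/nbhs_ballP; exists d%:C%C => /=; first by rewrite ltcR.
move=> h; rewrite /ball/= sub0r normrN nmE ltcR => /hd hh h0.
rewrite nmE lecR.
have -> : L - h^-1 *: (f (h%:A + z) - f z) =
    - h^-1 * (f (z + h) - f z - L * h).
  rewrite -[h^-1 *: _]/(h^-1 * _) -[h%:A]/(h * 1) mulr1 [h + z]addrC.
  rewrite [RHS]mulrBr !mulNr opprK [in RHS]mulrC.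
  rewrite [h^-1 * (L * h)]mulrCA mulVf // mulr1 [_ / h]mulrC.
  exact: (addrC _ _).
rewrite nmM nmN nmV mulrC ler_pdivrMr ?nm_gt0//.
Qed.

Lemma contCP (f : R[i]^o -> R[i]^o) (z : R[i]^o) : {for z, continuous f} <->
  forall e : R, 0 < e -> exists2 d : R, 0 < d &
    forall w : R[i], nm (w - z) < d -> nm (f w - f z) < e.
Proof.
split=> [/cvgrPdist_lt h e e0|h]; last first.
  apply/(@cvgrPdist_lt _ _ _ _ (nbhs_filter z)) => _ /posc[e e0 ->].
  have [d d0 hd] := h e e0.
  apply/nbhs_ballP; exists d%:C%C => /=; first by rewrite ltcR.
  move=> w; rewrite /ball/= !nmE !ltcR nmBC [X in _ -> X < _]nmBC.
  exact: hd.
have := h e%:C%C; rewrite ltcR => /(_ e0).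
move=> /nbhs_ballP[_ /= /posc[d d0 ->] hd]; exists d => // w wz.
rewrite nmBC -ltcR -nmE; apply: hd.
by rewrite /ball/= nmE ltcR nmBC.
Qed.

End RealModulus.

(** * The complex exponential *)

Section ComplexExponential.
Variable R : realType.
Implicit Types (z w : R[i]) (a b : R).

Definition cexp z : R[i] :=
  (expR (complex.Re z))%:C%C * Complex (cos (complex.Im z)) (sin (complex.Im z)).

Lemma nm_cis a : nm (Complex (cos a) (sin a)) = 1.
Proof. by rewrite /nm normc_def /= cos2Dsin2 sqrtr1. Qed.

Lemma cisD a b : Complex (cos (a + b)) (sin (a + b)) =
  Complex (cos a) (sin a) * Complex (cos b) (sin b).
Proof.
rewrite cosD sinD; apply/eqP; rewrite eq_complex /= eqxx /=.
by rewrite addrC.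
Qed.

Lemma nm_cexp z : nm (cexp z) = expR (complex.Re z).
Proof. by rewrite nmM nm_real nm_cis mulr1 ger0_norm // expR_ge0. Qed.

Lemma cexp_neq0 z : cexp z != 0.
Proof. by rewrite -nm_gt0 nm_cexp expR_gt0. Qed.

Lemma cexpD z w : cexp (z + w) = cexp z * cexp w.
Proof.
rewrite /cexp !raddfD /= expRD cisD rmorphM /=; ring.
Qed.

Lemma cexp0 : cexp 0 = 1.
Proof. by rewrite /cexp /= expR0 cos0 sin0 mul1r. Qed.

Lemma cexpN z : cexp (- z) = (cexp z)^-1.
Proof.
apply: (mulfI (cexp_neq0 z)); rewrite mulfV ?cexp_neq0//.
by rewrite -cexpD subrr cexp0.
Qed.

Lemma cexp_sum (I : finType) (P : pred I) (F : I -> R[i]) :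
  cexp (\sum_(i | P i) F i) = \prod_(i | P i) cexp (F i).
Proof. exact: (big_morph cexp cexpD cexp0). Qed.

(** The argument is plus or minus [acos] of the real part of z / |z|, with the sign of the imaginary
    part. *)
Lemma cexp_onto z : z != 0 -> exists w, cexp w = z.
Proof.
move=> z0; have nz0 : 0 < nm z by rewrite nm_gt0.
set u := z / (nm z)%:C%C.
have nu : nm u = 1.
  by rewrite nmM nmV nm_real ger0_norm ?nm_ge0// mulfV // gt_eqF.
have key (t : R[i]) : nm t = 1 -> exists th, Complex (cos th) (sin th) = t.
  case: t => c s; rewrite /nm normc_def /= => h.
  have cs : c ^+ 2 + s ^+ 2 = 1.
    have := congr1 (fun x => x ^+ 2) h; rewrite expr1n.
    by rewrite sqr_sqrtr // addr_ge0 // sqr_ge0.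
  have c1 : -1 <= c <= 1.
    by rewrite -ler_norml -(ler_pXn2r (n:=2))// ?nnegrE// expr1n real_normK ?num_real//; nra.
  have hc : cos (acos c) = c by apply: acosK; rewrite in_itv.
  have hs : sin (acos c) = `|s|.
    by rewrite sin_acos // -cs addrAC subrr add0r sqrtr_sqr.
  have [s0|s0] := leP 0 s.
    by exists (acos c); rewrite hc hs ger0_norm.
  by exists (- acos c); rewrite cosN sinN hc hs ltr0_norm // opprK.
have [th hth] := key u nu.
exists (Complex (ln (nm z)) th); rewrite /cexp /= lnK ?posrE// hth /u.
by rewrite mulrC divfK // -nm_gt0 nm_real ger0_norm ?nm_ge0.
Qed.

Lemma real_derive_bound (f : R -> R) (x l : R) : is_derive x 1 f l ->
  forall e : R, 0 < e -> exists2 d : R, 0 < d &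
    forall h, `|h| < d -> `|f (x + h) - f x - l * h| <= e * `|h|.
Proof.
move=> [/cvg_ex[/= L hL] dfl] e e0.
have Ll : L = l by rewrite -dfl; symmetry; exact: cvg_lim hL.
move: hL; rewrite Ll {L Ll} => hL.
move/cvgrPdist_lt : hL => /(_ e e0).
move=> /nbhs_ballP[d /= d0 hd]; exists d => // h hd'.
have [->|h0] := eqVneq h 0; first by rewrite addr0 mulr0 subrr subr0 normr0 mulr0.
have /hd : ball (0 : R) d h by rewrite /ball/= sub0r normrN.
move=> /(_ h0); rewrite /= => hh.
have -> : f (x + h) - f x - l * h =
    - h * (l - h^-1 *: (f (h%:A + x) - f x)).
  rewrite mulrBr mulNr -[h^-1 *: _]/(h^-1 * _) [- h * _]mulrA mulNr mulfV //.
  rewrite -[h%:A]/(h * 1) mulr1 [h + x]addrC; ring.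
by rewrite normrM normrN mulrC ler_wpM2r // ltW.
Qed.

(** For h = x + i y the remainder is (e^x - 1 - x) e^(iy) + (cos y - 1) + i (sin y - y) + x (e^(iy)
    - 1), and each of these four pieces is at most e / 5 times |h|. *)
Lemma cexp_diff0 (e : R) : 0 < e -> exists2 d : R, 0 < d &
  forall h, nm h < d -> nm (cexp h - 1 - h) <= e * nm h.
Proof.
move=> e0; have e50 : 0 < e / 5 by lra.
have [d1 d10 h1] := real_derive_bound (is_derive_expR (0 : R)) e50.
have [d2 d20 h2] := real_derive_bound (is_derive_cos (0 : R)) e50.
have [d3 d30 h3] := real_derive_bound (is_derive_sin (0 : R)) e50.
(* The last bound makes |h| (1 + 2 e / 5) < e / 5, which controls the factor e^(iy) - 1 of the
   fourth piece. *)
exists (Num.min (Num.min d1 d2) (Num.min d3 (Num.min 1 (e / 5 / (e / 5 + 1 + e / 5))))) => [|h].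
  by rewrite !lt_min d10 d20 d30 ltr01 /= divr_gt0 //; lra.
rewrite !lt_min => /andP[/andP[n1 n2] /andP[n3 /andP[n4]]].
rewrite ltr_pdivlMr; last by lra.
move=> n5.
have hx := nm_Re h; have hy := nm_Im h.
have := h1 (complex.Re h) (le_lt_trans hx n1).
have := h2 (complex.Im h) (le_lt_trans hy n2).
have := h3 (complex.Im h) (le_lt_trans hy n3).
rewrite !(add0r, expR0, cos0, sin0, oppr0, mul0r, subr0, mul1r).
case: h n1 n2 n3 n4 n5 hx hy => x y /=; set N := nm _ => n1 n2 n3 n4 n5 hx hy.
set C := cos y; set S := sin y; set X := expR x => b3 b2 b1.
have -> : cexp (Complex x y) - 1 - Complex x y =
    ((X - 1 - x)%:C%C * Complex C S + (C - 1)%:C%C) + ('i%C * (S - y)%:C%C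
     + (x%:C%C * ((C - 1)%:C%C + 'i%C * S%:C%C))).
  by apply/eqP; rewrite eq_complex /=; apply/andP; split; apply/eqP; rewrite -/X -/C -/S; ring.
have ni : nm ('i%C : R[i]) = 1.
  by rewrite /nm normc_def /= expr0n expr1n add0r sqrtr1.
have N0 : 0 <= N by exact: nm_ge0.
apply: le_trans (nmD _ _) _.
have := nmD ((X - 1 - x)%:C%C * Complex C S) (C - 1)%:C%C.
have := nmD ('i%C * (S - y)%:C%C) (x%:C%C * ((C - 1)%:C%C + 'i%C * S%:C%C)).
have := nmD (C - 1)%:C%C ('i%C * S%:C%C).
rewrite !nmM ni !nm_real nm_cis !mul1r mulr1.
set Q := nm _; move=> q1 q2 q3.
have s1 : `|S| <= e / 5 * N + N.
  have -> : S = (S - y) + y by rewrite subrK.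
  by apply: le_trans (ler_normD _ _) _; nra.
have b2' : `|C - 1| <= e / 5 * N by nra.
have b3' : `|S - y| <= e / 5 * N by nra.
have b1' : `|X - 1 - x| <= e / 5 * N by nra.
have : `|x| * Q <= N * (e / 5).
  apply: ler_pM => //; first exact: nm_ge0.
  by apply: le_trans q1 _; lra.
move: q2 q3; set U := nm _; set V := nm _; move: (`|x| * Q) => xQ.
have eN : 0 <= e * N by rewrite mulr_ge0 // ltW.
by lra.
Qed.

Lemma cexp_diff z : differentiable (cexp : R[i]^o -> R[i]^o) (z : R[i]^o).
Proof.
apply/diffCP; exists (cexp z) => e e0.
have z0 : 0 < nm (cexp z) by rewrite nm_gt0 cexp_neq0.
have e1 : 0 < e / nm (cexp z) by rewrite divr_gt0.
have [d d0 hd] := cexp_diff0 e1; exists d => // h /hd hh.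
have -> : cexp (z + h) - cexp z - cexp z * h = cexp z * (cexp h - 1 - h).
  by rewrite cexpD; ring.
rewrite nmM; have := ler_wpM2l (ltW z0) hh.
by rewrite mulrA [_ * (e / _)]mulrC divfK // gt_eqF.
Qed.

Definition ee a : R[i] := Complex (cos (2 * pi * a)) (sin (2 * pi * a)).

Lemma eeD a b : ee (a + b) = ee a * ee b.
Proof. by rewrite /ee mulrDr cisD. Qed.

Lemma nm_ee a : nm (ee a) = 1. Proof. exact: nm_cis. Qed.

Lemma ee_neq0 a : ee a != 0. Proof. by rewrite -nm_gt0 nm_ee. Qed.

Lemma ee0 : ee 0 = 1. Proof. by rewrite /ee mulr0 cos0 sin0. Qed.

Lemma ee1 : ee 1 = 1.
Proof. by rewrite /ee mulr1 mulr_natl cos2pi sin2pi. Qed.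

Lemma eeN a : ee (- a) = (ee a)^-1.
Proof.
by apply: (mulfI (ee_neq0 a)); rewrite mulfV ?ee_neq0// -eeD subrr ee0.
Qed.

Lemma ee_nat n : ee n%:R = 1.
Proof. by elim: n => [|n IH]; rewrite ?ee0// -natr1 eeD IH ee1 mulr1. Qed.

Lemma eeM a n : ee (a *+ n) = ee a ^+ n.
Proof. by elim: n => [|n IH]; rewrite ?ee0 ?expr0// mulrS eeD IH exprS. Qed.

Lemma cexp_ee (x y : R) :
  cexp (2 * pi * x +i* (2 * pi * y))%C = (expR (2 * pi * x))%:C%C * ee y.
Proof. by []. Qed.

Lemma nm_i : nm ('i%C : R[i]) = 1.
Proof. by rewrite /nm normc_def /= expr0n expr1n add0r sqrtr1. Qed.

End ComplexExponential.

(** * Goursat's theorem *)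

Section Goursat.
Variable R : realType.
Implicit Types (c z v : R[i]) (w h : R) (f g : R[i] -> R[i]).

Definition inrect c w h z := [/\ complex.Re c <= complex.Re z,
  complex.Re z <= complex.Re c + w, complex.Im c <= complex.Im z
  & complex.Im z <= complex.Im c + h].

Definition subrect c w h c' w' h' := [/\ 0 <= w', 0 <= h',
  inrect c w h c' & inrect c w h (c' + Complex w' h')].

Lemma inrectD a w h x y : 0 <= x <= w -> 0 <= y <= h ->
  inrect a w h (a + Complex x y).
Proof.
case: a => ? ? /andP[? ?] /andP[? ?]; split=> /=; by rewrite ?lerDl ?lerD2l.
Qed.

Lemma inrect_trans c w h a x y z : inrect c w h a ->
  inrect c w h (a + Complex x y) -> inrect a x y z -> inrect c w h z.
Proof.
case: c a z => [? ?] [? ?] [? ?] [/= a1 _ a2 _] [/= _ b1 _ b2] [/= c1 c2 c3 c4].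
split => /=; [exact: le_trans c1|exact: le_trans b1|exact: le_trans c3|exact: le_trans b2].
Qed.

Lemma inrect_refl a w h : 0 <= w -> 0 <= h -> inrect a w h a.
Proof.
by move=> w0 h0; have := @inrectD a w h 0 0; rewrite lexx w0 h0 addr0; exact.
Qed.

Lemma subrectD c w h c' w' h' x y : subrect c w h c' w' h' ->
  0 <= x <= w' -> 0 <= y <= h' -> inrect c w h (c' + Complex x y).
Proof.
by move=> [_ _ i1 i2] hx hy; apply: inrect_trans i1 i2 _; exact: inrectD.
Qed.

Lemma addr_Complex (a : R[i]) (x y x' y' : R) :
  a + Complex x y + Complex x' y' = a + Complex (x + x') (y + y').
Proof. by rewrite -addrA. Qed.

Lemma half_itv (x : R) : 0 <= x -> 0 <= x / 2 <= x.
Proof. by move=> ?; apply/andP; split; lra. Qed.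

Lemma itv_refl (x : R) : 0 <= x -> (0 <= x <= x) * (0 <= (0 : R) <= x).
Proof. by move=> ->; rewrite !lexx. Qed.

Lemma mul_iC (x : R) : 'i%C * x%:C%C = Complex 0 x :> R[i].
Proof.
by apply/eqP; rewrite eq_complex /=; apply/andP; split; apply/eqP; ring.
Qed.

Lemma half_Complex x y : Complex x y / 2 = Complex (x / 2) (y / 2) :> R[i].
Proof.
have t2 : (2 : R[i]) != 0 by rewrite pnatr_eq0.
apply: (mulIf t2); rewrite divfK //; apply/eqP; rewrite eq_complex /=.
by apply/andP; split; apply/eqP; field.
Qed.

(** Compactness as a subdivision principle: a counterexample has a quarter that is again one, and
    the nested quarters shrink to a point where the local hypothesis applies. Width or height 0 is
    allowed. It yields the convergence of Riemann sums, Goursat's theorem and boundedness on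
    annuli. *)
Lemma bisection (Q : R[i] -> R -> R -> Prop) c w h :
  0 <= w -> 0 <= h ->
  (forall c' w' h', subrect c w h c' w' h' ->
    Q c' (w' / 2) (h' / 2) -> Q (c' + (w' / 2)%:C%C) (w' / 2) (h' / 2) ->
    Q (c' + 'i%C * (h' / 2)%:C%C) (w' / 2) (h' / 2) ->
    Q (c' + Complex (w' / 2) (h' / 2)) (w' / 2) (h' / 2) -> Q c' w' h') ->
  (forall z, inrect c w h z -> exists2 d : R, 0 < d & forall c' w' h',
    subrect c w h c' w' h' -> inrect c' w' h' z -> w' + h' < d -> Q c' w' h') ->
  Q c w h.
Proof.
move=> w0 h0 step loc; apply: contrapT => nQ.
pose T := (R[i] * (R * R))%type.
pose good (x : T) := subrect c w h x.1 x.2.1 x.2.2 /\ ~ Q x.1 x.2.1 x.2.2.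
pose child (x y : T) := [/\ inrect x.1 x.2.1 x.2.2 y.1,
  inrect x.1 x.2.1 x.2.2 (y.1 + Complex y.2.1 y.2.2),
  y.2.1 = x.2.1 / 2 & y.2.2 = x.2.2 / 2].
have next (x : T) : good x -> exists y, good y /\ child x y.
  case: x => c' [w' h'] [/= sub nQ'].
  apply: contrapT => /forallNP nx; apply: nQ'.
  have key c1 : inrect c' w' h' c1 ->
      inrect c' w' h' (c1 + Complex (w' / 2) (h' / 2)) -> Q c1 (w' / 2) (h' / 2).
    move=> i1 i2; apply: contrapT => nQ1; apply: (nx (c1, (w' / 2, h' / 2))).
    split=> //; split=> //=; have [w'0 h'0 s1 s2] := sub; split.
    - by rewrite divr_ge0.
    - by rewrite divr_ge0.
    - exact: inrect_trans s1 s2 i1.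
    - exact: inrect_trans s1 s2 i2.
  have [w'0 h'0 _ _] := sub.
  have Ew : w' / 2 + w' / 2 = w' by field.
  have Eh : h' / 2 + h' / 2 = h' by field.
  have [hw hh] := (half_itv w'0, half_itv h'0).
  apply: step; rewrite ?mul_iC //; apply: key; rewrite ?addr_Complex ?Ew ?Eh ?add0r ?addr0;
    by [exact: inrect_refl | apply: inrectD; rewrite ?itv_refl].
have [F hF] : exists F : T -> T, forall x, good x -> good (F x) /\ child x (F x).
  have /choice[F hF] : forall x : T, exists y, good x -> good y /\ child x y.
    move=> x; have [gx|ngx] := pselect (good x); last by exists x.
    by have [y hy] := next x gx; exists y.
  by exists F.
pose x0 : T := (c, (w, h)).
pose s := fun n => iter n F x0.
have gs n : good (s n).
  elim: n => [|n IH] /=; last exact: (hF _ IH).1.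
    by split=> //; split=> //; [exact: inrect_refl|apply: inrectD; rewrite itv_refl].
have cs n : child (s n) (s n.+1) by exact: (hF _ (gs n)).2.
have sz n : (s n).2 = (w / 2 ^+ n, h / 2 ^+ n).
  elim: n => [|n IH]; first by rewrite /= expr0 !divr1.
  have [_ _ e1 e2] := cs n.
  by rewrite [LHS]surjective_pairing e1 e2 IH /= exprSr !invfM !mulrA.
have nest n m : (n <= m)%N -> inrect (s n).1 (s n).2.1 (s n).2.2 (s m).1 /\
    inrect (s n).1 (s n).2.1 (s n).2.2 ((s m).1 + Complex (s m).2.1 (s m).2.2).
  elim: m => [|m IH].
    rewrite leqn0 => /eqP ->.
    by split; [exact: inrect_refl|apply: inrectD; rewrite itv_refl].
  rewrite leq_eqVlt => /orP[/eqP ->|].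
    have [[w'0 h'0 _ _] _] := gs m.+1.
    by split; [exact: inrect_refl|apply: inrectD; rewrite itv_refl].
  rewrite ltnS => /IH[i1 i2]; have [j1 j2 _ _] := cs m.
  by split; [exact: inrect_trans i1 i2 j1|exact: inrect_trans i1 i2 j2].
have small (e : R) : 0 < e -> exists n, (w + h) / 2 ^+ n < e.
  move=> e0; have [n hn] : exists n : nat, (w + h) / e < n%:R.
    exists (Num.truncn ((w + h) / e)).+1; exact: truncnS_gt.
  exists n; rewrite ltr_pdivrMr ?exprn_gt0//.
  move: hn; rewrite ltr_pdivrMr// => hn; apply: lt_trans hn _.
  by rewrite mulrC ltr_pM2l// -natrX ltr_nat ltn_expl.
have [z hz] : exists z : R[i], ((fun n => (s n).1) : nat -> R[i]^o) @ \oo --> (z : R[i]^o).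
  apply: cauchyC => e e0.
  have [n hn] := small (e / 2) ltac:(lra).
  exists n => m k nm_ nk.
  have := (nest _ _ nm_).1; have := (nest _ _ nk).1.
  rewrite sz /= => h1 h2.
  apply: le_lt_trans (nm_le_ReIm _) _.
  have : (w + h) / 2 ^+ n = w / 2 ^+ n + h / 2 ^+ n by rewrite mulrDl.
  move: h1 h2 hn; set a := w / _; set b := h / _; clearbody a b.
  move: ((s n).1) ((s m).1) ((s k).1) => r0 r1 r2; clear -e.
  case: r0 r1 r2 => [x y] [x1 y1] [x2 y2].
  rewrite /inrect /= => -[? ? ? ?] [? ? ? ?] hn e1.
  by move: hn; rewrite e1 => ?; have : `|x1 - x2| <= a /\ `|y1 - y2| <= b; [split; rewrite ler_norml; lra|lra].
have zin n : inrect (s n).1 (s n).2.1 (s n).2.2 z.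
  have key (f : R[i] -> R) (a : R) : (forall x y, f x - f y = f (x - y)) ->
    (forall x, `|f x| <= nm x) -> (forall m, (n <= m)%N -> a <= f (s m).1) -> a <= f z.
    move=> fB fn hm; rewrite leNgt; apply/negP => lt.
    have [N hN] := (proj1 (cvgCP _ _) hz) (a - f z) ltac:(lra).
    have := hN (maxn N n) (leq_maxl _ _); have := hm (maxn N n) (leq_maxr _ _).
    by have := fn ((s (maxn N n)).1 - z); rewrite -fB ler_norml; lra.
  have ReB x y : complex.Re x - complex.Re y = complex.Re (x - y) :> R by rewrite raddfB.
  have ImB x y : complex.Im x - complex.Im y = complex.Im (x - y) :> R by rewrite raddfB.
  split.
  - by apply: (key _ _ ReB (@nm_Re R)) => m /nest[[]].
  - rewrite -lerN2; apply: (key (fun z => - complex.Re z)) => [x y|x|m /nest[[]]].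
    + by rewrite -ReB; lra.
    + by rewrite normrN nm_Re.
    + by rewrite lerN2.
  - by apply: (key _ _ ImB (@nm_Im R)) => m /nest[[]].
  - rewrite -lerN2; apply: (key (fun z => - complex.Im z)) => [x y|x|m /nest[[]]].
    + by rewrite -ImB; lra.
    + by rewrite normrN nm_Im.
    + by rewrite lerN2.
have [d d0 hd] := loc z (zin 0%N).
have [n hn] := small d d0.
have [sub nQn] := gs n; apply: nQn; apply: hd => //.
by rewrite sz /= -mulrDl.
Qed.

(* Dyadic left Riemann sums for the integral of f over the segment [a, a + v]. *)
Fixpoint dsum f (m : nat) a v : R[i] :=
  if m is m'.+1 then dsum f m' a (v / 2) + dsum f m' (a + v / 2) (v / 2)
  else f a * v.

Lemma dsumE f m a v : dsum f m a v =
  (\sum_(k < 2 ^ m) f (a + v * (k%:R / 2 ^+ m))) * (v / 2 ^+ m).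
Proof.
elim: m a v => [|m IH] a v /=.
  by rewrite expn0 big_ord1 expr0 !divr1 mulr0 addr0.
rewrite !IH; have e2 : (2 ^ m.+1 = 2 ^ m + 2 ^ m)%N by rewrite expnS mul2n addnn.
have s2 : v / 2 / 2 ^+ m = v / 2 ^+ m.+1 by rewrite exprS invfM mulrA.
rewrite -mulrDl s2; congr (_ * _); rewrite e2 big_split_ord /=.
have p2 : (2 : R[i]) ^+ m != 0 by rewrite expf_neq0 // pnatr_eq0.
have t2 : (2 : R[i]) != 0 by rewrite pnatr_eq0.
congr (_ + _); apply: eq_bigr => k _; congr f; rewrite exprS ?natrD ?natrX.
  by field; rewrite ?p2 ?t2.
by field; rewrite ?p2 ?t2.
Qed.

Lemma dsumD f g m a v : dsum (fun z => f z + g z) m a v = dsum f m a v + dsum g m a v.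
Proof. by elim: m a v => [|m IH] a v /=; rewrite ?mulrDl// !IH; ring. Qed.

(** The discretization error of an affine function depends on the vector v and the level m only, not
    on the base point a. Around a rectangle the affine contributions therefore cancel at every
    finite level. *)
Lemma dsum_affine (A B : R[i]) m a v : dsum (fun z => A + B * z) m a v =
  v * (A + B * a) + B * v ^+ 2 * ((1 - (2 ^+ m)^-1) / 2).
Proof.
have p2 : (2 : R[i]) ^+ m != 0 by rewrite expf_neq0 // pnatr_eq0.
have t2 : (2 : R[i]) != 0 by rewrite pnatr_eq0.
elim: m a v p2 => [|m IH] a v p2 /=; first by rewrite expr0 invr1 subrr mul0r mulr0 addr0 mulrC.
have p2' : (2 : R[i]) ^+ m != 0 by rewrite expf_neq0 // pnatr_eq0.
by rewrite !IH // [2 ^+ m.+1]exprS; field; rewrite ?p2' ?t2.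
Qed.

Lemma dsum_bound f m (a v : R[i]) (e w h : R) (A : R[i]) :
  v = Complex w h -> 0 <= w -> 0 <= h ->
  (forall z, inrect a w h z -> nm (f z - A) <= e) ->
  nm (dsum f m a v - A * v) <= e * nm v.
Proof.
have t2 : (2 : R[i]) != 0 by rewrite pnatr_eq0.
elim: m a v w h => [|m IH] a v w h ->{v} w0 h0 hf /=.
  rewrite -mulrBl nmM ler_wpM2r ?nm_ge0 // hf //.
  by case: a {hf} => x y; split => /=; lra.
have hv := half_Complex w h.
have n2 : nm (Complex w h / 2) = nm (Complex w h) / 2.
  by rewrite nmM nmV -[2 : R[i]](rmorph_nat (real_complex R)) nm_real ger0_norm.
have i1 := IH a _ _ _ hv ltac:(lra) ltac:(lra).
have i2 := IH (a + Complex w h / 2) _ _ _ hv ltac:(lra) ltac:(lra).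
have -> : forall X Y : R[i], X + Y - A * Complex w h =
    (X - A * (Complex w h / 2)) + (Y - A * (Complex w h / 2)).
  by move=> X Y; field.
apply: le_trans (nmD _ _) _.
have /i1 {}i1 : forall z, inrect a (w / 2) (h / 2) z -> nm (f z - A) <= e.
  move=> z zi; apply: hf; apply: inrect_trans zi; first exact: inrect_refl.
  by apply: inrectD; exact: half_itv.
have /i2 {}i2 : forall z, inrect (a + Complex w h / 2) (w / 2) (h / 2) z -> nm (f z - A) <= e.
  rewrite hv => z zi; apply: hf; apply: inrect_trans zi.
    by apply: inrectD; exact: half_itv.
  by rewrite addr_Complex -!splitr; apply: inrectD; rewrite itv_refl.
by move: i1 i2; rewrite n2; lra.
Qed.

(** The segment is regarded as the diagonal of its bounding rectangle, so that [bisection] applies;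
    only the two quarters along the diagonal matter. The Cauchy bound e (w + h) is additive under
    halving. *)
Lemma dsum_cvg f c w h : 0 <= w -> 0 <= h ->
  (forall z, inrect c w h z -> {for z, continuous (f : R[i]^o -> R[i]^o)}) ->
  exists l : R[i], (fun m => dsum f m c (Complex w h) : R[i]^o) @ \oo --> (l : R[i]^o).
Proof.
move=> w0 h0 fc.
have t2 : (2 : R[i]) != 0 by rewrite pnatr_eq0.
have hv := half_Complex.
have key (e : R) : 0 < e -> exists M, forall m m', (M <= m)%N -> (M <= m')%N ->
    nm (dsum f m c (Complex w h) - dsum f m' c (Complex w h)) <= e * (w + h).
  move=> e0; apply: (@bisection (fun c w h => exists M, forall m m', (M <= m)%N -> (M <= m')%N ->
    nm (dsum f m c (Complex w h) - dsum f m' c (Complex w h)) <= e * (w + h))) => //.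
    move=> c' w' h' _ [M1 h1] _ _ [M2 h2].
    exists (maxn M1 M2).+1 => -[//|m] [//|m']; rewrite !ltnS !geq_max.
    move=> /andP[m1 m2] /andP[m'1 m'2] /=; rewrite hv.
    have -> : forall X Y X' Y' : R[i], X + Y - (X' + Y') = (X - X') + (Y - Y').
      by move=> *; ring.
    apply: le_trans (nmD _ _) _.
    by have := h1 _ _ m1 m'1; have := h2 _ _ m2 m'2; lra.
  move=> z /fc/contCP fz.
  have [d d0 hd] := fz (e / 2) ltac:(lra).
  exists d => // c' w' h' [w'0 h'0 _ _] zi wh; exists 0%N => m m' _ _.
  have hf z' : inrect c' w' h' z' -> nm (f z' - f z) <= e / 2.
    move=> zi'; apply/ltW/hd; apply: le_lt_trans (nm_le_ReIm _) _.
    apply: le_lt_trans _ wh; move: zi zi'; rewrite !raddfB /= => -[? ? ? ?] [? ? ? ?].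
    by apply: lerD; rewrite ler_norml; lra.
  have b1 := dsum_bound m (erefl _) w'0 h'0 hf.
  have b2 := dsum_bound m' (erefl _) w'0 h'0 hf.
  apply: le_trans (nm_dist _ (f z * Complex w' h') _) _.
  rewrite [X in _ + X]nmBC; have := nm_le_ReIm (Complex w' h').
  rewrite /= !ger0_norm // => nn.
  have : e / 2 * nm (Complex w' h') <= e / 2 * (w' + h') by rewrite ler_wpM2l //; lra.
  lra.
apply: cauchyC => e e0.
have [M hM] := key (e / (w + h + 1)) ltac:(by rewrite divr_gt0 //; lra).
exists M => m m' Mm Mm'; apply: le_lt_trans (hM _ _ Mm Mm') _.
by rewrite mulrAC ltr_pdivrMr; nra.
Qed.

Definition sint f a v : R[i] := limn (fun m => dsum f m a v : R[i]^o).

Lemma sintP f c v w h : v = Complex w h -> 0 <= w -> 0 <= h ->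
  (forall z, inrect c w h z -> {for z, continuous (f : R[i]^o -> R[i]^o)}) ->
  (fun m => dsum f m c v : R[i]^o) @ \oo --> (sint f c v : R[i]^o).
Proof.
by move=> -> w0 h0 /(dsum_cvg w0 h0)[l hl]; rewrite /sint (cvgC_lim hl).
Qed.

Lemma sint_split f c v w h : v = Complex w h -> 0 <= w -> 0 <= h ->
  (forall z, inrect c w h z -> {for z, continuous (f : R[i]^o -> R[i]^o)}) ->
  sint f c v = sint f c (v / 2) + sint f (c + v / 2) (v / 2).
Proof.
move=> -> w0 h0 fc.
have t2 : (2 : R[i]) != 0 by rewrite pnatr_eq0.
have hv := half_Complex w h.
have c0 := sintP (erefl _) w0 h0 fc.
have c1 := @sintP f c _ _ _ hv ltac:(lra) ltac:(lra).
have c2 := @sintP f (c + Complex w h / 2) _ _ _ hv ltac:(lra) ltac:(lra).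
have /c1 {}c1 : forall z, inrect c (w / 2) (h / 2) z -> {for z, continuous (f : R[i]^o -> R[i]^o)}.
  move=> z zi; apply: fc; apply: inrect_trans zi; first exact: inrect_refl.
  by apply: inrectD; exact: half_itv.
have /c2 {}c2 : forall z, inrect (c + Complex w h / 2) (w / 2) (h / 2) z -> {for z, continuous (f : R[i]^o -> R[i]^o)}.
  rewrite hv => z zi; apply: fc; apply: inrect_trans zi.
    by apply: inrectD; exact: half_itv.
  by rewrite addr_Complex -!splitr; apply: inrectD; rewrite itv_refl.
apply: cvgC_unique (cvgD c1 c2).
by move: c0; rewrite -(cvg_shiftS (fun m => dsum f m c (Complex w h) : R[i]^o)).
Qed.

(** Goursat's subdivision, applied to the bound e (w + h)^2 for the defect [Om]: each quarter
    carries a quarter of the bound, and locally f is affine up to an error e / 2 (w + h). The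
    boundary is compared as two paths between opposite corners because [sint] runs only in
    directions with nonnegative components. *)
Lemma goursat f c w h : 0 <= w -> 0 <= h ->
  (forall z, inrect c w h z -> differentiable (f : R[i]^o -> R[i]^o) (z : R[i]^o)) ->
  sint f c w%:C%C + sint f (c + w%:C%C) ('i%C * h%:C%C) =
  sint f (c + 'i%C * h%:C%C) w%:C%C + sint f c ('i%C * h%:C%C).
Proof.
move=> w0 h0 fd.
have fc z : inrect c w h z -> {for z, continuous (f : R[i]^o -> R[i]^o)}.
  by move=> /fd; exact: differentiable_continuous.
have t2 : (2 : R[i]) != 0 by rewrite pnatr_eq0.
have iE := @mul_iC.
have rE (y : R) : y%:C%C / 2 = (y / 2)%:C%C :> R[i].
  by rewrite rmorphM fmorphV /= rmorph_nat.
pose Om (g : R[i] -> R[i] -> R[i]) c w h := g c w%:C%C + g (c + w%:C%C) ('i%C * h%:C%C) -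
  (g (c + 'i%C * h%:C%C) w%:C%C + g c ('i%C * h%:C%C)) : R[i].
apply/eqP; rewrite -subr_eq0 -/(Om (sint f) c w h) -nm_eq0.
have cv c' w' h' : subrect c w h c' w' h' ->
    (fun m => Om (dsum f m) c' w' h' : R[i]^o) @ \oo --> (Om (sint f) c' w' h' : R[i]^o).
  move=> sub; have [w'0 h'0 s1 s2] := sub; rewrite /Om !iE.
  have pw := subrectD sub (itv_refl w'0).1 (itv_refl h'0).2.
  have ph := subrectD sub (itv_refl w'0).2 (itv_refl h'0).1.
  apply: cvgB; apply: cvgD.
  - by apply: (@sintP _ _ _ w' 0) => // z zi; apply: fc; exact: inrect_trans s1 pw zi.
  - apply: (@sintP _ _ _ 0 h') => // z zi; apply: fc; apply: inrect_trans pw _ zi.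
    by rewrite addr_Complex addr0 add0r.
  - apply: (@sintP _ _ _ w' 0) => // z zi; apply: fc; apply: inrect_trans ph _ zi.
    by rewrite addr_Complex addr0 add0r.
  - by apply: (@sintP _ _ _ 0 h') => // z zi; apply: fc; exact: inrect_trans s1 ph zi.
suff key (e : R) : 0 < e -> nm (Om (sint f) c w h) <= e * (w + h) ^+ 2.
  apply/eqP/le_anti; rewrite nm_ge0 andbT leNgt; apply/negP => lt.
  (* For this value of e the bound reads B <= B / 2 times a factor less than 1, which is impossible
     for B > 0. *)
  set B := nm _ in key lt; have := key (B / ((w + h) ^+ 2 + 1) / 2).
  have q0 : 0 <= (w + h) ^+ 2 by exact: sqr_ge0.
  have k0 : 0 < B / ((w + h) ^+ 2 + 1) by rewrite divr_gt0 //; lra.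
  have kE : B / ((w + h) ^+ 2 + 1) * ((w + h) ^+ 2 + 1) = B.
    by rewrite divfK // gt_eqF //; lra.
  move: q0 k0 kE; move: (_ ^+ 2) (B / _) => q k q0 k0 kE.
  by move=> /(_ ltac:(lra)); nra.
move=> e0.
apply: (@bisection (fun c w h => nm (Om (sint f) c w h) <= e * (w + h) ^+ 2)) => //.
- move=> c' w' h' sub q1 q2 q3 q4; have [w'0 h'0 s1 s2] := sub.
  have D1 (x : R[i]) : inrect c w h x -> inrect c w h (x + w'%:C%C) ->
      sint f x w'%:C%C = sint f x (w' / 2)%:C%C + sint f (x + (w' / 2)%:C%C) (w' / 2)%:C%C.
    move=> i1 i2; rewrite -rE; apply: (@sint_split _ _ _ w' 0) => // z zi; apply: fc.
    exact: inrect_trans i1 i2 zi.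
  have D2 (x : R[i]) : inrect c w h x -> inrect c w h (x + 'i%C * h'%:C%C) ->
      sint f x ('i%C * h'%:C%C) = sint f x ('i%C * (h' / 2)%:C%C)
        + sint f (x + 'i%C * (h' / 2)%:C%C) ('i%C * (h' / 2)%:C%C).
    rewrite iE => i1 i2; rewrite -iE -rE mulrA.
    apply: (@sint_split _ _ _ 0 h') => // z zi; apply: fc.
    exact: inrect_trans i1 i2 zi.
  have in1 (a b : R) : 0 <= a <= w' -> 0 <= b <= h' -> inrect c w h (c' + a%:C%C + 'i%C * b%:C%C).
    by move=> ha hb; rewrite iE addr_Complex addr0 add0r; exact: (subrectD sub ha hb).
  have E1 : c' = c' + 0%:C%C + 'i%C * 0%:C%C by rewrite mulr0 !addr0.
  have [m1 m2] := (half_itv w'0, half_itv h'0).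
  have [[m3 m4] [m6 m5]] := (itv_refl w'0, itv_refl h'0).
  have p0 (a : R) : c' + 'i%C * a%:C%C = c' + 0%:C%C + 'i%C * a%:C%C by rewrite addr0.
  have p1 (a : R) : c' + a%:C%C = c' + a%:C%C + 'i%C * 0%:C%C by rewrite mulr0 addr0.
  have A1 := D1 c' ltac:(by rewrite E1; exact: in1) ltac:(by rewrite p1; exact: in1).
  have A2 := D1 (c' + 'i%C * h'%:C%C) ltac:(by rewrite p0; exact: in1)
    ltac:(by rewrite addrAC; exact: in1).
  have A3 := D2 c' ltac:(by rewrite E1; exact: in1) ltac:(by rewrite p0; exact: in1).
  have A4 := D2 (c' + w'%:C%C) ltac:(by rewrite p1; exact: in1) ltac:(exact: in1).
  have EC : Complex (w' / 2) (h' / 2) = (w' / 2)%:C%C + 'i%C * (h' / 2)%:C%C :> R[i].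
    by apply/eqP; rewrite eq_complex /=; apply/andP; split; apply/eqP; ring.
  have Ew : w'%:C%C = (w' / 2)%:C%C + (w' / 2)%:C%C :> R[i].
    by rewrite -rmorphD /=; congr (_%:C%C); field.
  have Eh : h'%:C%C = (h' / 2)%:C%C + (h' / 2)%:C%C :> R[i].
    by rewrite -rmorphD /=; congr (_%:C%C); field.
  have -> : Om (sint f) c' w' h' = (Om (sint f) c' (w' / 2) (h' / 2) +
     Om (sint f) (c' + (w' / 2)%:C%C) (w' / 2) (h' / 2)) +
     (Om (sint f) (c' + 'i%C * (h' / 2)%:C%C) (w' / 2) (h' / 2) +
     Om (sint f) (c' + Complex (w' / 2) (h' / 2)) (w' / 2) (h' / 2)).
    rewrite /Om A1 A2 A3 A4 EC Ew Eh mulrDr !addrA.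
    set u := (w' / 2)%:C%C; set y := 'i%C * _.
    have e1 : c' + y + u = c' + u + y by rewrite addrAC.
    have e2 : c' + u + y + u = c' + u + u + y by rewrite addrAC.
    have e3 : c' + y + y + u = c' + u + y + y by rewrite addrAC e1.
    by rewrite e3 e1 e2; ring.
  apply: le_trans (nmD _ _) _.
  have := nmD (Om (sint f) c' (w' / 2) (h' / 2)) (Om (sint f) (c' + (w' / 2)%:C%C) (w' / 2) (h' / 2)).
  have := nmD (Om (sint f) (c' + 'i%C * (h' / 2)%:C%C) (w' / 2) (h' / 2))
     (Om (sint f) (c' + Complex (w' / 2) (h' / 2)) (w' / 2) (h' / 2)).
  have : e * (w' + h') ^+ 2 = 4 * (e * (w' / 2 + h' / 2) ^+ 2) by field.
  lra.
- move=> z /fd/diffCP[L hL].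
  have [d d0 hd] := hL (e / 2) ltac:(lra).
  exists d => // c' w' h' sub zi wh.
  have [w'0 h'0 s1 s2] := sub.
  apply: (@cvgC_le _ _ _ _ 0%N (cv _ _ _ sub)) => m _.
  pose r x := f x + (- (f z - L * z) + (- L) * x).
  have fE x : f x = r x + ((f z - L * z) + L * x) by rewrite /r; ring.
  have rb x : inrect c' w' h' x -> nm (r x - 0) <= e / 2 * (w' + h').
    move=> xi; have xz : nm (x - z) <= w' + h'.
      apply: le_trans (nm_le_ReIm _) _; move: xi zi; rewrite !raddfB /= => -[? ? ? ?] [? ? ? ?].
      by apply: lerD; rewrite ler_norml; lra.
    have := hd (x - z) (le_lt_trans xz wh).
    have -> : z + (x - z) = x by ring.
    have -> : f x - f z - L * (x - z) = r x - 0 by rewrite /r; ring.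
    by move=> b; apply: le_trans b _; rewrite ler_wpM2l //; lra.
  have dE a v : dsum f m a v = dsum r m a v + (v * ((f z - L * z) + L * a) +
      L * v ^+ 2 * ((1 - (2 ^+ m)^-1) / 2)).
    by rewrite -dsum_affine -dsumD; congr (dsum _ _ _ _); apply/funext => x; exact: fE.
  (* By [dsum_affine] the affine part drops out exactly at level m, before any limit is taken. *)
  have -> : Om (dsum f m) c' w' h' = Om (dsum r m) c' w' h'.
    by rewrite /Om !dE; ring.
  have bnd a (x y : R) : 0 <= x -> 0 <= y -> inrect c' w' h' a ->
     inrect c' w' h' (a + Complex x y) ->
     nm (dsum r m a (Complex x y)) <= e / 2 * (w' + h') * nm (Complex x y).
    move=> x0 y0 i1 i2.
    have := @dsum_bound r m a _ (e / 2 * (w' + h')) x y 0 (erefl _) x0 y0.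
    rewrite mul0r subr0; apply=> t ti; apply: rb; exact: inrect_trans i1 i2 ti.
  have B1 : nm (dsum r m c' w'%:C%C) <= e / 2 * (w' + h') * w'.
    have -> : e / 2 * (w' + h') * w' = e / 2 * (w' + h') * nm (Complex w' 0).
      by rewrite nm_real ger0_norm.
    by apply: bnd => //; [exact: inrect_refl|apply: inrectD; rewrite itv_refl].
  have B2 : nm (dsum r m (c' + 'i%C * h'%:C%C) w'%:C%C) <= e / 2 * (w' + h') * w'.
    have -> : e / 2 * (w' + h') * w' = e / 2 * (w' + h') * nm (Complex w' 0).
      by rewrite nm_real ger0_norm.
    by rewrite iE; apply: bnd => //; rewrite ?addr_Complex ?addr0 ?add0r;
      apply: inrectD; rewrite itv_refl.
  have nh : nm (Complex 0 h') = h' by rewrite -iE nmM nm_i mul1r nm_real ger0_norm.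
  have B3 : nm (dsum r m c' ('i%C * h'%:C%C)) <= e / 2 * (w' + h') * h'.
    rewrite -[X in _ <= _ * X]nh iE.
    by apply: bnd => //; [exact: inrect_refl|apply: inrectD; rewrite itv_refl].
  have B4 : nm (dsum r m (c' + w'%:C%C) ('i%C * h'%:C%C)) <= e / 2 * (w' + h') * h'.
    rewrite -[X in _ <= _ * X]nh iE.
    by apply: bnd => //; rewrite ?addr_Complex ?addr0 ?add0r;
      apply: inrectD; rewrite itv_refl.
  rewrite /Om; apply: le_trans (nmB _ _) _.
  have := nmD (dsum r m c' w'%:C%C) (dsum r m (c' + w'%:C%C) ('i%C * h'%:C%C)).
  have := nmD (dsum r m (c' + 'i%C * h'%:C%C) w'%:C%C) (dsum r m c' ('i%C * h'%:C%C)).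
  nra.
Qed.

End Goursat.

(** * Rules of complex differentiation *)

Section Differentiability.
Variables (R : realType) (V : normedModType R[i]).
Implicit Types (f g : V -> R[i]^o) (x : V).

Lemma difM f g x : differentiable f x -> differentiable g x ->
  differentiable (fun y => f y * g y : R[i]^o) x.
Proof. exact: differentiableM. Qed.

Lemma difD f g x : differentiable f x -> differentiable g x ->
  differentiable (fun y => f y + g y : R[i]^o) x.
Proof. exact: differentiableD. Qed.

Lemma difB f g x : differentiable f x -> differentiable g x ->
  differentiable (fun y => f y - g y : R[i]^o) x.
Proof. exact: differentiableB. Qed.

Lemma dif_cst (a : R[i]) x : differentiable (fun _ : V => a : R[i]^o) x.
Proof. exact: differentiable_cst. Qed.

Lemma difV f x : f x != 0 -> differentiable f x ->
  differentiable (fun y => (f y)^-1 : R[i]^o) x.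
Proof. by move=> f0 df; apply: (@differentiableV _ _ f). Qed.

Lemma dif_div f g x : g x != 0 -> differentiable f x -> differentiable g x ->
  differentiable (fun y => f y / g y : R[i]^o) x.
Proof. by move=> g0 df dg; apply: difM => //; exact: difV. Qed.

Lemma difX f n x : differentiable f x ->
  differentiable (fun y => f y ^+ n : R[i]^o) x.
Proof.
move=> df; elim: n => [|n IH]; first exact: dif_cst.
by under eq_fun do rewrite exprS; exact: difM.
Qed.

Lemma dif_prod (I : Type) (s : seq I) (P : pred I) (F : I -> V -> R[i]^o) x :
  (forall i, P i -> differentiable (F i) x) ->
  differentiable (fun y => \prod_(i <- s | P i) F i y : R[i]^o) x.
Proof.
move=> dF; elim: s => [|i s IH].
  by under eq_fun do rewrite big_nil; exact: dif_cst.
have [Pi|nPi] := boolP (P i); last first.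
  by under eq_fun do rewrite big_cons (negbTE nPi).
by under eq_fun do rewrite big_cons Pi; apply: difM => //; exact: dF.
Qed.

Lemma dif_sum (I : Type) (s : seq I) (P : pred I) (F : I -> V -> R[i]^o) x :
  (forall i, P i -> differentiable (F i) x) ->
  differentiable (fun y => \sum_(i <- s | P i) F i y : R[i]^o) x.
Proof.
move=> dF; elim: s => [|i s IH].
  by under eq_fun do rewrite big_nil; exact: dif_cst.
have [Pi|nPi] := boolP (P i); last first.
  by under eq_fun do rewrite big_cons (negbTE nPi).
by under eq_fun do rewrite big_cons Pi; apply: difD => //; exact: dF.
Qed.

Lemma dif_comp (h : R[i]^o -> R[i]^o) f x : differentiable f x ->
  differentiable h (f x) -> differentiable (fun y => h (f y)) x.
Proof. by move=> df dh; exact: (@differentiable_comp _ _ _ _ f h). Qed.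

End Differentiability.

(** * Means over circles and Laurent expansions *)

Section CircleMean.
Variable R : realType.
Local Notation dif f z := (differentiable (f : R[i]^o -> R[i]^o) (z : R[i]^o)).
Implicit Types (F G : R[i] -> R[i]) (z w : R[i]) (r : R).

Lemma dif_id z : dif id z.
Proof. by apply/derivable1_diffP; exact: derivable_id. Qed.

Definition cmean (m : nat) F : R[i] :=
  (2 ^+ m)^-1 * \sum_(k < 2 ^ m) F (ee (k%:R / 2 ^+ m)).

Lemma cmeanD m F G : cmean m (fun z => F z + G z) = cmean m F + cmean m G.
Proof. by rewrite /cmean big_split mulrDr. Qed.

Lemma cmeanZ m a F : cmean m (fun z => a * F z) = a * cmean m F.
Proof. by rewrite /cmean -big_distrr mulrCA. Qed.

Lemma eq_cmean m F G : (forall z, nm z = 1 -> F z = G z) -> cmean m F = cmean m G.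
Proof. by move=> FG; congr (_ * _); apply: eq_bigr => k _; rewrite FG ?nm_ee. Qed.

Lemma nm_2X m : nm ((2 : R[i]) ^+ m) = 2 ^+ m.
Proof.
by rewrite nmX -[2 : R[i]](rmorph_nat (real_complex R)) nm_real ger0_norm.
Qed.

Lemma sum_cst m (B : R) : \sum_(k < 2 ^ m) B = 2 ^+ m * B.
Proof. by rewrite sumr_const card_ord -natrX mulr_natl. Qed.

Lemma cmean_bound m F (f : R[i] -> R) :
  (forall a : R, 0 <= a <= 1 -> nm (F (ee a)) <= f (ee a)) ->
  nm (cmean m F) <= (2 ^+ m)^-1 * \sum_(k < 2 ^ m) f (ee (k%:R / 2 ^+ m)).
Proof.
move=> Ff; rewrite /cmean nmM nmV nm_2X ler_wpM2l ?invr_ge0 ?exprn_ge0//.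
apply: le_trans (nm_sum _ _ _) _; apply: ler_sum => k _; apply: Ff.
rewrite divr_ge0 ?exprn_ge0// ler_pdivrMr ?exprn_gt0// mul1r.
by rewrite -natrX ler_nat ltnW.
Qed.

Lemma cmean_le m F (B : R) :
  (forall a : R, 0 <= a <= 1 -> nm (F (ee a)) <= B) -> nm (cmean m F) <= B.
Proof.
move=> FB; apply: le_trans (cmean_bound m (f := fun=> B) FB) _.
by rewrite sum_cst mulKf // gt_eqF // exprn_gt0.
Qed.

Lemma cmean_cst m a : cmean m (fun=> a) = a.
Proof.
rewrite /cmean sumr_const card_ord -[X in _ * X]mulr_natl natrX mulKf //.
Qed.

Lemma dyadicC k m : (k%:R / 2 ^+ m : R)%:C%C = k%:R / 2 ^+ m :> R[i].
Proof. by rewrite -!natrX fmorph_div /= !rmorph_nat. Qed.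

Lemma nm_frac z : exists2 a : R, 0 <= a <= 1 & z = (nm z)%:C%C * ee a.
Proof.
have [->|/cexp_onto[w wz]] := eqVneq z 0.
  by exists 0; rewrite ?lexx ?ler01// nm0 mul0r.
have pi2 : 0 < 2 * pi :> R by rewrite mulr_gt0 // pi_gt0.
pose b := complex.Im w / (2 * pi).
have wE : z = (nm z)%:C%C * ee b.
  by rewrite -wz nm_cexp /cexp /ee /b [2 * pi * _]mulrC divfK // gt_eqF.
have fl := floor_itv b.
exists (b - (Num.floor b)%:~R).
  by move: fl; rewrite intrD => /andP[? ?]; apply/andP; split; lra.
rewrite {1}wE; congr (_ * _); case: (Num.floor b) => n.
  by rewrite eeD eeN -pmulrn ee_nat invr1 mulr1.
by rewrite NegzE mulrNz opprK eeD -pmulrn ee_nat mulr1.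
Qed.

(** F in logarithmic coordinates: an annulus becomes a vertical strip, and one turn around it a
    translation by i. *)
Let H F z : R[i] := F (cexp (2 * pi%:C%C * z)).

Let HE F (x y : R) : H F (x%:C%C + 'i%C * y%:C%C) = F ((expR (2 * pi * x))%:C%C * ee y).
Proof.
rewrite /H -cexp_ee; congr (F (cexp _)).
by apply/eqP; rewrite eq_complex /=; apply/andP; split; apply/eqP; ring.
Qed.

Let H_dif F z : dif F (cexp (2 * pi%:C%C * z)) -> dif (H F) z.
Proof.
move=> dF.
have d1 : dif (fun w => 2 * pi%:C%C * w) z.
  by apply: difM; [exact: dif_cst|exact: dif_id].
have d2 := @dif_comp _ _ (@cexp R) (fun w : R[i]^o => 2 * pi%:C%C * w) z d1 (cexp_diff _).
exact: (@dif_comp _ R[i]^o F _ z d2 dF).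
Qed.

Let nmH (x y : R) : nm (cexp (2 * pi%:C%C * (Complex x y))) = expR (2 * pi * x).
Proof. by rewrite nm_cexp /=; congr expR; ring. Qed.

(** In logarithmic coordinates the closed annulus is covered by a rectangle of height 1, to which
    [bisection] applies: boundedness passes from the quarters to the whole and holds locally by
    continuity. *)
Lemma annulus_bounded F (s1 s2 : R) : 0 < s1 -> s1 <= s2 ->
  (forall z, s1 <= nm z <= s2 -> dif F z) ->
  exists2 B, 0 <= B & forall z, s1 <= nm z <= s2 -> nm (F z) <= B.
Proof.
move=> s10 s12 dF; have s20 := lt_le_trans s10 s12.
have pi2 : 0 < 2 * pi :> R by rewrite mulr_gt0 // pi_gt0.
pose x s : R := ln s / (2 * pi).
have ex s : 0 < s -> expR (2 * pi * x s) = s.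
  by move=> s0; rewrite /x mulrC divfK ?gt_eqF// lnK.
have x12 : 0 <= x s2 - x s1.
  by rewrite subr_ge0 ler_pM2r ?invr_gt0// ler_ln ?posrE.
have cH z : inrect (x s1)%:C%C (x s2 - x s1) 1 z -> dif (H F) z.
  case: z => a b [/= h1 h2 _ _]; apply/H_dif/dF; rewrite nmH.
  rewrite -[X in X <= _ <= _](ex _ s10) -[X in _ <= _ <= X](ex _ s20) !ler_expR.
  by rewrite !ler_pM2l // h1; move: h2; rewrite addrC subrK.
have [B hB] : exists B : R, forall z, inrect (x s1)%:C%C (x s2 - x s1) 1 z ->
    nm (H F z) <= B.
  apply: (@bisection R (fun c (w h : R) => exists B : R, forall z,
    inrect c w h z -> nm (H F z) <= B)) => //.
    move=> c w h _ [B1 h1] [B2 h2] [B3 h3] [B4 h4].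
    exists (Num.max (Num.max B1 B2) (Num.max B3 B4)) => z [z1 z2 z3 z4].
    rewrite !le_max; rewrite mul_iC in h3.
    have [zw|zw] := leP (complex.Re z) (complex.Re c + w / 2);
    have [zh|zh] := leP (complex.Im z) (complex.Im c + h / 2).
    - by rewrite h1 //; split.
    - rewrite h3 ?orbT //; clear -z1 z2 z3 z4 zw zh.
      by case: c z1 z2 z3 z4 zw zh => ? ? /= *; split=> /=; lra.
    - rewrite h2 ?orbT //; clear -z1 z2 z3 z4 zw zh.
      by case: c z1 z2 z3 z4 zw zh => ? ? /= *; split=> /=; lra.
    - rewrite h4 ?orbT //; clear -z1 z2 z3 z4 zw zh.
      by case: c z1 z2 z3 z4 zw zh => ? ? /= *; split=> /=; lra.
  move=> z /cH/differentiable_continuous/contCP/(_ 1 ltr01)[d d0 hd].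
  exists d => // c w h _ zi wh; exists (nm (H F z) + 1) => z' zi'.
  have : nm (z' - z) < d.
    apply: le_lt_trans (nm_le_ReIm _) _; apply: le_lt_trans wh.
    move: zi zi'; rewrite !raddfB /= => -[? ? ? ?] [? ? ? ?].
    by apply: lerD; rewrite ler_norml; lra.
  by move=> /hd; have := nm_sub (H F z') (H F z); lra.
exists `|B| => // z /andP[z1 z2]; have [a /andP[a0 a1] ->] := nm_frac z.
have z0 := lt_le_trans s10 z1.
apply: le_trans (ler_norm B); rewrite -(ex _ z0) -HE; apply: hB.
rewrite mul_iC; split => /=; rewrite ?addr0 ?add0r //.
  by rewrite ler_pM2r ?invr_gt0// ler_ln ?posrE.
by rewrite addrC subrK ler_pM2r ?invr_gt0// ler_ln ?posrE.
Qed.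

(* By periodicity of F (cexp (2 pi z)) under z -> z + i, the horizontal sides
   of the rectangle cancel in Goursat's theorem. *)
Lemma circle_mean F (r1 r2 : R) : 0 <= r1 ->
  (forall z, r1 < nm z < r2 -> dif F z) ->
  exists l : R[i], forall r, r1 < r < r2 ->
    (fun m => cmean m (fun z => F (r%:C%C * z)) : R[i]^o) @ \oo --> (l : R[i]^o).
Proof.
move=> r10 dF.
have pi2 : 0 < 2 * pi :> R by rewrite mulr_gt0 // pi_gt0.
pose x s : R := ln s / (2 * pi).
have ex s : 0 < s -> expR (2 * pi * x s) = s.
  by move=> s0; rewrite /x mulrC divfK ?gt_eqF// lnK.
have x12 s1 s2 : 0 < s1 -> s1 <= s2 -> 0 <= x s2 - x s1.
  move=> s10 s12; rewrite subr_ge0 ler_pM2r ?invr_gt0// ler_ln ?posrE//.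
  exact: lt_le_trans s12.
have cH s1 s2 z : r1 < s1 -> s1 <= s2 -> s2 < r2 ->
    inrect (x s1)%:C%C (x s2 - x s1) 1 z -> dif (H F) z.
  move=> s1r s12 s2r; have s10 := le_lt_trans r10 s1r.
  have s20 := lt_le_trans s10 s12.
  case: z => a b [/= h1 h2 _ _]; apply/H_dif/dF; rewrite nmH.
  apply/andP; split.
    apply: lt_le_trans s1r _; rewrite -[X in X <= _](ex _ s10) ler_expR.
    by rewrite ler_pM2l.
  apply: le_lt_trans s2r; rewrite -[X in _ <= X](ex _ s20) ler_expR.
  by rewrite ler_pM2l // addrC subrK in h2 *.
(* On a vertical side of length 1 the dyadic sum is, up to the factor i, the average over the grid
   of 2^m-th roots of unity. This is where contour integrals turn into [cmean]. *)
have dE s m : 0 < s -> dsum (H F) m (x s)%:C%C ('i%C * 1%:C%C) =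
    'i%C * cmean m (fun z => F (s%:C%C * z)).
  move=> s0; rewrite dsumE /cmean mulr1 [RHS]mulrCA mulrA mulrC; congr (_ * _).
  rewrite mulrC; congr (_ * _); apply: eq_bigr => k _.
  have -> : (x s)%:C%C + 'i%C * (k%:R / 2 ^+ m) =
      (x s)%:C%C + 'i%C * (k%:R / 2 ^+ m : R)%:C%C.
    by rewrite dyadicC.
  by rewrite HE ex.
have i0 : ('i%C : R[i]) != 0 by rewrite -nm_gt0 nm_i.
have cv s : r1 < s < r2 -> (fun m => cmean m (fun z => F (s%:C%C * z)) : R[i]^o) @ \oo -->
    (- 'i%C * sint (H F) (x s)%:C%C ('i%C * 1%:C%C) : R[i]^o).
  move=> /andP[s1 s2]; have s0 := le_lt_trans r10 s1.
  have -> : (fun m => cmean m (fun z => F (s%:C%C * z)) : R[i]^o) =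
      (fun m => - 'i%C * dsum (H F) m (x s)%:C%C ('i%C * 1%:C%C)).
    apply/funext => m; rewrite dE // mulrA mulNr -expr2 sqr_i opprK mul1r //.
  apply: (@cvgMr _ _ _ _ (fun m => dsum (H F) m (x s)%:C%C ('i%C * 1%:C%C) : R[i]^o)).
  apply: (@sintP _ _ _ _ 0 1) => //; first exact: mul_iC.
  move=> z zi; apply: differentiable_continuous; apply: (cH s s) => //.
  by rewrite subrr.
have const s1 s2 : r1 < s1 -> s1 <= s2 -> s2 < r2 ->
    sint (H F) (x s1)%:C%C ('i%C * 1%:C%C) = sint (H F) (x s2)%:C%C ('i%C * 1%:C%C).
  move=> h1 h2 h3; have s10 := le_lt_trans r10 h1.
  have := @goursat _ (H F) (x s1)%:C%C (x s2 - x s1) 1 (x12 _ _ s10 h2) ler01.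
  have -> : sint (H F) ((x s1)%:C%C + 'i%C * 1%:C%C) (x s2 - x s1)%:C%C =
      sint (H F) (x s1)%:C%C (x s2 - x s1)%:C%C.
    rewrite /sint; set u := (fun m => _ : R[i]^o); set v := (fun m => _ : R[i]^o).
    suff -> : u = v by []; apply/funext => m; rewrite /u /v !dsumE.
    congr (_ * _); apply: eq_bigr => k _; rewrite /H; congr F.
    rewrite addrAC [2 * _ * (_ + 'i%C * _)]mulrDr cexpD.
    have -> : cexp (2 * pi%:C%C * ('i%C * 1%:C%C)) = ee (1 : R).
      have -> : ee (1 : R) = (expR (2 * pi * 0))%:C%C * ee (1 : R).
        by rewrite mulr0 expR0 mul1r.
      rewrite -cexp_ee; congr cexp.
      by apply/eqP; rewrite eq_complex /=; apply/andP; split; apply/eqP; ring.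
    by rewrite ee1 mulr1.
  rewrite -rmorphD /= [x s1 + _]addrC subrK => /(_ _)/addrI<- // z zi.
  exact: (cH s1 s2).
have [[r hr]|none] := pselect (exists r, r1 < r < r2); last first.
  by exists 0 => r hr; exfalso; apply: none; exists r.
exists (- 'i%C * sint (H F) (x r)%:C%C ('i%C * 1%:C%C)) => s hs.
have := cv s hs; suff -> : sint (H F) (x s)%:C%C ('i%C * 1%:C%C) =
  sint (H F) (x r)%:C%C ('i%C * 1%:C%C) by [].
move: hr hs => /andP[? ?] /andP[? ?].
by have [rs|/ltW rs] := leP r s; [symmetry|]; exact: const.
Qed.

End CircleMean.

(** * Laurent coefficients and Fejér sums *)

Section LaurentSeries.
Variable R : realType.
Local Notation dif f z := (differentiable (f : R[i]^o -> R[i]^o) (z : R[i]^o)).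
Implicit Types (F G h : R[i] -> R[i]) (z w l : R[i]) (r : R).

Definition tends (u : nat -> R[i]) l := forall e : R, 0 < e ->
  exists N, forall n, (N <= n)%N -> nm (u n - l) < e.

Lemma tendsP (u : nat -> R[i]) l :
  (u : nat -> R[i]^o) @ \oo --> (l : R[i]^o) <-> tends u l.
Proof. exact: cvgCP. Qed.

Lemma tends_unique u l l' : tends u l -> tends u l' -> l = l'.
Proof. by move=> /tendsP h /tendsP h'; exact: cvgC_unique h h'. Qed.

Lemma tends_le u l (B : R) N : tends u l ->
  (forall n, (N <= n)%N -> nm (u n) <= B) -> nm l <= B.
Proof. by move=> /tendsP; exact: cvgC_le. Qed.

Lemma tends_ge u l (B : R) N : tends u l ->
  (forall n, (N <= n)%N -> B <= nm (u n)) -> B <= nm l.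
Proof. by move=> /tendsP; exact: cvgC_ge. Qed.

Lemma tends_cst a : tends (fun=> a) a.
Proof. by move=> e e0; exists 0%N => n _; rewrite subrr nm0. Qed.

Lemma eq_tends u v l : (forall n, u n = v n) -> tends u l -> tends v l.
Proof.
by move=> uv h e /h[N hN]; exists N => n /hN; rewrite uv.
Qed.

Lemma tendsD u v l l' : tends u l -> tends v l' ->
  tends (fun n => u n + v n) (l + l').
Proof.
move=> hu hv e e0.
have [N hN] := hu (e / 2) ltac:(lra); have [M hM] := hv (e / 2) ltac:(lra).
exists (maxn N M) => n; rewrite geq_max => /andP[/hN h1 /hM h2].
have -> : u n + v n - (l + l') = (u n - l) + (v n - l') by ring.
by apply: le_lt_trans (nmD _ _) _; lra.
Qed.

Lemma tendsM u v l l' : tends u l -> tends v l' ->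
  tends (fun n => u n * v n) (l * l').
Proof.
move=> hu hv e e0.
pose B := nm l + nm l' + 1; have [a0 b0] := (nm_ge0 l, nm_ge0 l').
have B0 : 0 < B by rewrite /B; lra.
pose d := Num.min 1 (e / (2 * B)).
have d0 : 0 < d by rewrite lt_min ltr01 /= divr_gt0 //; lra.
have d1 : d <= 1 by rewrite ge_min lexx.
have dB : d * B <= e / 2.
  have : d <= e / (2 * B) by rewrite ge_min lexx orbT.
  by rewrite ler_pdivlMr ?mulr_gt0//; lra.
have [N hN] := hu d d0; have [M hM] := hv d d0.
exists (maxn N M) => n; rewrite geq_max => /andP[/hN h1 /hM h2].
have -> : u n * v n - l * l' = (u n - l) * (v n - l') + ((u n - l) * l' + l * (v n - l')) by ring.
apply: le_lt_trans (nmD _ _) _.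
have := nmD ((u n - l) * l') (l * (v n - l')).
set T := nm (_ * l' + _); rewrite !nmM => h3.
have := nm_ge0 (u n - l); have := nm_ge0 (v n - l').
move: T h3 h1 h2 a0 b0 dB; rewrite /B.
move: (nm (u n - l)) (nm (v n - l')) (nm l) (nm l') => x y a b s h3 h1 h2 a0 b0 dB y0 x0.
have : x * y <= d * 1 by apply: ler_pM => //; lra.
have : x * b <= d * b by rewrite ler_wpM2r // ltW.
have : a * y <= a * d by rewrite ler_wpM2l // ltW.
by nra.
Qed.

Lemma tendsZ a u l : tends u l -> tends (fun n => a * u n) (a * l).
Proof. by move=> h; exact: tendsM (tends_cst a) h. Qed.

Definition hasmean F l := tends (fun m => cmean m F) l.

Lemma hasmean_unique F l l' : hasmean F l -> hasmean F l' -> l = l'.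
Proof. exact: tends_unique. Qed.

Lemma hasmeanD F G l l' : hasmean F l -> hasmean G l' ->
  hasmean (fun z => F z + G z) (l + l').
Proof.
by move=> hF hG; apply: eq_tends (tendsD hF hG) => n; rewrite cmeanD.
Qed.

Lemma hasmeanZ a F l : hasmean F l -> hasmean (fun z => a * F z) (a * l).
Proof. by move=> hF; apply: eq_tends (tendsZ a hF) => n; rewrite cmeanZ. Qed.

Lemma hasmean_cst a : hasmean (fun=> a) a.
Proof. by apply: eq_tends (tends_cst a) => n; rewrite cmean_cst. Qed.

Lemma hasmean_sum (I : Type) (s : seq I) (F : I -> R[i] -> R[i]) (l : I -> R[i]) :
  (forall i, hasmean (F i) (l i)) ->
  hasmean (fun z => \sum_(i <- s) F i z) (\sum_(i <- s) l i).
Proof.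
move=> hF; elim: s => [|i s IH].
  rewrite big_nil; have -> : (fun z => \sum_(i <- [::]) F i z) = fun=> 0.
    by apply/funext => z; rewrite big_nil.
  exact: hasmean_cst.
rewrite big_cons.
have -> : (fun z => \sum_(i <- i :: s) F i z) =
    (fun z => F i z + \sum_(i <- s) F i z).
  by apply/funext => z; rewrite big_cons.
exact: hasmeanD.
Qed.

Lemma eq_hasmean F G l : (forall z, nm z = 1 -> F z = G z) ->
  hasmean F l -> hasmean G l.
Proof.
by move=> FG; apply: eq_tends => n; exact: eq_cmean.
Qed.

Lemma hasmean_le F l (B : R) : hasmean F l ->
  (forall z, nm z = 1 -> nm (F z) <= B) -> nm l <= B.
Proof.
move=> hF FB; apply: (@tends_le _ _ _ 0%N hF) => m _.
by apply: cmean_le => a _; apply: FB; exact: nm_ee.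
Qed.

(** The Fejér kernel, written as a square to make its positivity visible; it is used at w = z0 / z
    on the circle |z| = |z0|. *)
Definition fejer_kernel K w : R := nm (\sum_(i < K.+1) w ^+ i) ^+ 2 / K.+1%:R.

Lemma fejer_kernel_ge0 K w : 0 <= fejer_kernel K w.
Proof. by rewrite divr_ge0 // sqr_ge0. Qed.

Lemma fejer_kernelE K w : nm w = 1 -> (fejer_kernel K w)%:C%C =
  K.+1%:R^-1 * \sum_(i < K.+1) \sum_(j < K.+1) w ^+ i * w^-1 ^+ j.
Proof.
move=> w1; have w0 : w != 0 by rewrite -nm_gt0 w1.
have wJ : (w^*)%C = w^-1.
  apply: (mulfI w0); rewrite mulfV // -sqr_normc nmE w1.
  by rewrite -rmorphXn /= expr1n.
rewrite /fejer_kernel fmorph_div /= rmorph_nat mulrC; congr (_ * _).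
rewrite rmorphXn /= -nmE sqr_normc rmorph_sum big_distrl; apply: eq_bigr => i _.
rewrite big_distrr; apply: eq_bigr => j _.
by rewrite rmorphXn /= wJ.
Qed.

Lemma fejer_kernel_le K w : nm w = 1 -> w != 1 ->
  fejer_kernel K w <= 4 / (nm (1 - w) ^+ 2 * K.+1%:R).
Proof.
move=> w1 wn1; have d0 : 0 < nm (1 - w) by rewrite nm_gt0 subr_eq0 eq_sym.
rewrite /fejer_kernel invfM mulrA ler_pM2r ?invr_gt0 ?ltr0n//.
rewrite ler_pdivlMr ?exprn_gt0// -exprMn -nmM mulrC -opprB mulNr nmN -subrX1.
have -> : (4 : R) = 2 ^+ 2 by rewrite expr2; ring.
apply: lerXn2r; rewrite ?nnegrE ?nm_ge0 //.
by apply: le_trans (nmB _ _) _; rewrite nmX w1 expr1n nm1.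
Qed.

(** Means over concentric circles agree, but passing from radius 1 to radius 2 multiplies this one
    by 2^(i-j). An integer exponent is represented here and below by a pair of natural numbers. *)
Lemma hasmean_monom i j :
  hasmean (fun z => z ^+ i * z^-1 ^+ j) (i == j)%:R.
Proof.
have [<-|ij] := eqVneq i j.
  apply: (@eq_hasmean (fun=> 1)); last exact: hasmean_cst.
  move=> z z1.
  have z0 : z != 0 by rewrite -nm_gt0 z1.
  by rewrite -exprMn mulfV // expr1n.
have dF z : 0 < nm z < 3 -> dif (fun z => z ^+ i * z^-1 ^+ j) z.
  move=> /andP[]; rewrite nm_gt0 => z0 _; apply: difM; apply: difX.
    exact: dif_id.
  by apply: difV => //; exact: dif_id.
have [l hl] := circle_mean (lexx 0) dF.
have /tendsP h1 := hl 1 ltac:(by apply/andP; split; lra).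
have /tendsP h2 := hl 2 ltac:(by apply/andP; split; lra).
have h1' : hasmean (fun z => z ^+ i * z^-1 ^+ j) l.
  by apply: eq_hasmean h1 => z _; rewrite mul1r.
have h2' : hasmean (fun z => 2 ^+ i * 2^-1 ^+ j * (z ^+ i * z^-1 ^+ j)) l.
  apply: eq_hasmean h2 => z _.
  by rewrite (_ : 2%:C%C = 2) ?rmorph_nat // invfM !exprMn; ring.
have := hasmean_unique h2' (hasmeanZ _ h1').
move/eqP; rewrite -subr_eq0 -{1}[l]mul1r -mulrBl mulf_eq0 => /orP[|/eqP l0]; last by rewrite l0 in h1'.
rewrite subr_eq0 exprVn eq_sym => /eqP/(congr1 (@nm R)).
rewrite nmM nmV !nm_2X nm1 => /eqP.
rewrite -[_ == 1](inj_eq (mulIf (_ : 2 ^+ j != 0))) ?expf_neq0 ?pnatr_eq0//.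
rewrite divfK ?expf_neq0 ?pnatr_eq0// mul1r -!natrX eqr_nat eqn_exp2l //.
by rewrite (negbTE ij).
Qed.

Lemma nat_above (x : R) : exists n : nat, x < n%:R.
Proof. by exists (Num.truncn x).+1; exact: truncnS_gt. Qed.

(** Fejér's theorem on the circle through z0. Here c i j is the Laurent coefficient of exponent i -
    j, and the double sum is the mean of F against the Fejér kernel: near z0 the continuity of F
    controls the error, elsewhere the kernel is O(1 / K). *)
Lemma fejer F z0 (c : nat -> nat -> R[i]) (B : R) : z0 != 0 ->
  {for (z0 : R[i]^o), continuous (F : R[i]^o -> R[i]^o)} ->
  (forall i j, hasmean (fun z => F ((nm z0)%:C%C * z) *
     ((nm z0)%:C%C * z)^-1 ^+ i * ((nm z0)%:C%C * z) ^+ j) (c i j)) ->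
  (forall z, nm z = nm z0 -> nm (F z) <= B) ->
  tends (fun K => K.+1%:R^-1 * \sum_(i < K.+1) \sum_(j < K.+1)
     c i j * z0 ^+ i * z0^-1 ^+ j) (F z0).
Proof.
move=> z00 Fc Fm FB; set r := (nm z0)%:C%C in Fm *.
have nz0 : 0 < nm z0 by rewrite nm_gt0.
have r0 : r != 0 by rewrite -nm_gt0 nm_real ger0_norm // ltW.
have nr : nm r = nm z0 by rewrite nm_real ger0_norm // ltW.
have nw z : nm z = 1 -> nm (z0 / (r * z)) = 1.
  by move=> z1; rewrite nmM nmV nmM nr z1 mulr1 mulfV // gt_eqF.
have K0 K : (K.+1%:R : R[i]) != 0 by rewrite pnatr_eq0.
have hK K : hasmean (fun z => (fejer_kernel K (z0 / (r * z)))%:C%C) 1.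
  have h : hasmean (fun z => K.+1%:R^-1 * \sum_(i < K.+1) \sum_(j < K.+1)
      (z0 / r) ^+ i * (z0 / r)^-1 ^+ j * (z ^+ j * z^-1 ^+ i))
      (K.+1%:R^-1 * \sum_(i < K.+1) \sum_(j < K.+1)
      (z0 / r) ^+ i * (z0 / r)^-1 ^+ j * (j == i :> nat)%:R).
    apply: hasmeanZ; apply: hasmean_sum => i; apply: hasmean_sum => j.
    apply: hasmeanZ; exact: hasmean_monom.
  have -> : 1 = K.+1%:R^-1 * \sum_(i < K.+1) \sum_(j < K.+1)
      (z0 / r) ^+ i * (z0 / r)^-1 ^+ j * (j == i :> nat)%:R :> R[i].
    rewrite -[LHS](mulVf (K0 K)); congr (_ * _).
    rewrite -[X in X%:R]card_ord -sum1_card natr_sum; apply: eq_bigr => i _.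
    rewrite (bigD1 i) //= eqxx mulr1 big1 ?addr0 => [|j ji].
      by rewrite -exprMn mulfV ?expr1n // mulf_neq0 ?invr_eq0.
    by rewrite (_ : (j == i :> nat) = false) ?mulr0 //; exact/negbTE.
  apply: eq_hasmean h => z z1; rewrite fejer_kernelE ?nw //; congr (_ * _).
  apply: eq_bigr => i _; apply: eq_bigr => j _.
  by rewrite /= !invfM !exprMn !exprVn !invrK; ring.
have hS K : hasmean (fun z => (F (r * z) - F z0) * (fejer_kernel K (z0 / (r * z)))%:C%C)
    (K.+1%:R^-1 * \sum_(i < K.+1) \sum_(j < K.+1) c i j * z0 ^+ i * z0^-1 ^+ j - F z0).
  have h1 : hasmean (fun z => K.+1%:R^-1 * \sum_(i < K.+1) \sum_(j < K.+1)
      z0 ^+ i * z0^-1 ^+ j * (F (r * z) * (r * z)^-1 ^+ i * (r * z) ^+ j))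
      (K.+1%:R^-1 * \sum_(i < K.+1) \sum_(j < K.+1) z0 ^+ i * z0^-1 ^+ j * c i j).
    apply: hasmeanZ; apply: hasmean_sum => i; apply: hasmean_sum => j.
    apply: hasmeanZ; exact: Fm.
  have h2 := hasmeanD h1 (@hasmeanZ (- F z0) _ _ (hK K)).
  rewrite mulr1 in h2.
  have -> : \sum_(i < K.+1) \sum_(j < K.+1) c i j * z0 ^+ i * z0^-1 ^+ j =
      \sum_(i < K.+1) \sum_(j < K.+1) z0 ^+ i * z0^-1 ^+ j * c i j.
    by apply: eq_bigr => i _; apply: eq_bigr => j _; ring.
  apply: eq_hasmean h2 => z z1; rewrite mulrBl mulNr; congr (_ - _).
  rewrite fejer_kernelE ?nw // mulrCA; congr (_ * _).
  rewrite big_distrr; apply: eq_bigr => i _; rewrite big_distrr; apply: eq_bigr => j _.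
  by rewrite /= !invfM !exprMn !exprVn !invrK; ring.
have B0 : 0 <= B by apply: le_trans (FB z0 erefl); exact: nm_ge0.
move=> e e0.
move/contCP : Fc => /(_ (e / 4) ltac:(lra))[d d0 hd].
(* D / (K + 1) dominates |F - F z0| times the kernel at distance at least d from z0: the first
   factor is at most 2 B, the second is bounded by [fejer_kernel_le]. *)
pose D := 2 * B * (4 / (d / nm z0) ^+ 2).
have dz0 : 0 < d / nm z0 by rewrite divr_gt0.
have D0 : 0 <= D by rewrite !mulr_ge0 // invr_ge0 exprn_ge0 // ltW.
have [K1 hK1] := nat_above (D / (e / 4)).
exists K1 => K KK1; apply: le_lt_trans (_ : e / 2 + e / 4 < e); last by lra.
have DK : D / K.+1%:R <= e / 4.
  rewrite ler_pdivrMr ?ltr0n// mulrC -ler_pdivrMr; last by lra.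
  by apply/ltW/(lt_le_trans hK1); rewrite ler_nat (leq_trans KK1).
(* The grid averages of the kernel only tend to 1; for m >= N they are at most 2, whence the share e
   / 2 = 2 (e / 4). *)
have [N hN] := hK K 1 ltr01.
apply: (@tends_le _ _ _ N (hS K)) => m Nm.
apply: le_trans (@cmean_bound _ m _ (fun z => e / 4 * fejer_kernel K (z0 / (r * z)) + D / K.+1%:R) _) _.
  move=> a _; set z := ee a; have z1 : nm z = 1 by exact: nm_ee.
  rewrite nmM nm_real ger0_norm ?fejer_kernel_ge0//.
  have [lt|ge] := ltP (nm (r * z - z0)) d.
    have /ltW h := hd _ lt; apply: le_trans (ler_wpM2r (fejer_kernel_ge0 _ _) h) _.
    by rewrite lerDl divr_ge0.
  have FF : nm (F (r * z) - F z0) <= 2 * B.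
    apply: le_trans (nmB _ _) _; have := FB z0 erefl.
    by have := FB (r * z); rewrite nmM nr z1 mulr1 => /(_ erefl); lra.
  have E1 : nm (1 - z0 / (r * z)) = nm (r * z - z0) / nm z0.
    have rz : r * z != 0 by rewrite -nm_gt0 nmM nr z1 mulr1.
    have -> : 1 - z0 / (r * z) = (r * z - z0) / (r * z) by rewrite mulrBl mulfV.
    by rewrite nmM nmV nmM nr z1 mulr1.
  have q0 : d / nm z0 <= nm (1 - z0 / (r * z)) by rewrite E1 ler_pM2r ?invr_gt0.
  have wn1 : z0 / (r * z) != 1.
    rewrite eq_sym -subr_eq0 -nm_gt0; exact: lt_le_trans q0.
  have := fejer_kernel_le K (nw _ z1) wn1.
  set k := fejer_kernel _ _ => hk.
  have : nm (F (r * z) - F z0) * k <= 2 * B * (4 / ((d / nm z0) ^+ 2 * K.+1%:R)).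
    apply: ler_pM => //; first exact: nm_ge0.
      exact: fejer_kernel_ge0.
    apply: le_trans hk _; rewrite ler_pM2l // lef_pV2 ?posrE ?mulr_gt0 ?exprn_gt0 ?ltr0n ?(lt_le_trans dz0 q0) ?invr_gt0 //.
    by rewrite ler_pM2r ?ltr0n// lerXn2r // nnegrE; [exact: ltW|exact: nm_ge0].
  move=> h; apply: le_trans h _; rewrite -[X in X <= _]add0r; apply: lerD.
    by rewrite mulr_ge0 ?fejer_kernel_ge0 //; lra.
  by rewrite /D invfM !mulrA.
rewrite big_split /= sum_cst -big_distrr mulrDr mulKf ?gt_eqF ?exprn_gt0//.
apply: lerD => //; rewrite mulrCA.
have -> : e / 2 = e / 4 * 2 by field.
rewrite ler_pM2l; last by lra.
have -> : (2 ^+ m)^-1 * \sum_(k < 2 ^ m) fejer_kernel K (z0 / (r * ee (k%:R / 2 ^+ m)))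
   = nm (cmean m (fun z => (fejer_kernel K (z0 / (r * z)))%:C%C)).
  rewrite /cmean -rmorph_sum nmM nmV nm_2X nm_real ger0_norm //.
  by apply: sumr_ge0 => k _; exact: fejer_kernel_ge0.
by have := hN m Nm; have := nm_sub (cmean m (fun z => (fejer_kernel K (z0 / (r * z)))%:C%C)) 1; rewrite nm1; lra.
Qed.

(** [circle_mean], applied to F z^(-i) z^j, makes the coefficient independent of the radius. *)
Lemma laurent_coef F (r1 r2 : R) : 0 <= r1 ->
  (forall z, r1 < nm z < r2 -> dif F z) ->
  exists c : nat -> nat -> R[i], forall i j r, r1 < r < r2 ->
    hasmean (fun z => F (r%:C%C * z) * (r%:C%C * z)^-1 ^+ i * (r%:C%C * z) ^+ j) (c i j).
Proof.
move=> r10 dF.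
have h (ij : nat * nat) : exists l, forall r, r1 < r < r2 ->
    hasmean (fun z => F (r%:C%C * z) * (r%:C%C * z)^-1 ^+ ij.1 * (r%:C%C * z) ^+ ij.2) l.
  have [z hz|l hl] := @circle_mean _ (fun z => F z * z^-1 ^+ ij.1 * z ^+ ij.2) _ r2 r10.
    have z0 : z != 0.
      by case/andP: hz => hz _; rewrite -nm_gt0; exact: le_lt_trans hz.
    apply: difM; last by apply: difX; exact: dif_id.
    by apply: difM; [exact: dF|apply: difX; apply: difV => //; exact: dif_id].
  by exists l => r /hl/tendsP.
have [c hc] := choice h.
by exists (fun i j => c (i, j)) => i j; exact: (hc (i, j)).
Qed.

Lemma nm_realM r z : 0 <= r -> nm z = 1 -> nm (r%:C%C * z) = r.
Proof. by move=> r0 z1; rewrite nmM z1 mulr1 nm_real ger0_norm. Qed.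

(** The Fejér sums recover F from its coefficients. *)
Lemma laurent_unique F (r1 r2 : R) (c : nat -> nat -> R[i]) : 0 <= r1 ->
  (forall z, r1 < nm z < r2 -> dif F z) ->
  (forall i j r, r1 < r < r2 ->
    hasmean (fun z => F (r%:C%C * z) * (r%:C%C * z)^-1 ^+ i * (r%:C%C * z) ^+ j) (c i j)) ->
  (forall i j, c i j = 0) ->
  forall z, r1 < nm z < r2 -> F z = 0.
Proof.
move=> r10 dF hc c0 z hz.
have nz : 0 < nm z by case/andP: hz => h _; exact: le_lt_trans h.
have z0 : z != 0 by rewrite -nm_gt0.
have [B _ hB] := @annulus_bounded _ F (nm z) (nm z) nz (lexx _)
  (fun w hw => dF w ltac:(by have /le_anti -> : nm w <= nm z <= nm w; [rewrite andbC|])).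
have := @fejer F z c B z0 (differentiable_continuous (dF z hz)) (fun i j => hc i j _ hz)
  (fun w hw => hB w ltac:(by rewrite hw !lexx)).
move=> h; apply: tends_unique h _; apply: eq_tends (tends_cst 0) => K.
rewrite big1 ?mulr0 // => i _; rewrite big1 // => j _.
by rewrite c0 !mul0r.
Qed.

End LaurentSeries.

(** * Uniform Taylor remainders and limits of holomorphic functions *)

Section Consequences.
Variable R : realType.
Local Notation dif f z := (differentiable (f : R[i]^o -> R[i]^o) (z : R[i]^o)).
Implicit Types (F G h : R[i] -> R[i]) (z w l : R[i]) (r : R).

Lemma dif_shift F a z : dif F (a + z) -> dif (fun w => F (a + w)) z.
Proof.
move=> dF.
have d1 : dif (fun w => a + w) z by apply: difD; [exact: dif_cst|exact: dif_id].
exact: (@dif_comp R R[i]^o F _ z d1 dF).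
Qed.

Lemma dif_scale F a z : dif F (a * z) -> dif (fun w => F (a * w)) z.
Proof.
move=> dF.
have d1 : dif (fun w => a * w) z by apply: difM; [exact: dif_cst|exact: dif_id].
exact: (@dif_comp R R[i]^o F _ z d1 dF).
Qed.

Lemma exp_vanish (B x : R) n : (0 < n)%N -> 0 <= B ->
  (forall r, 0 < r < 1 -> x <= B * r ^+ n) -> x <= 0.
Proof.
case: n => // n _ B0 h; rewrite leNgt; apply/negP => x0.
pose r := Num.min (1 / 2) (x / (2 * (B + 1))).
have r0 : 0 < r by rewrite lt_min !divr_gt0 //; nra.
have r1 : r <= 1 / 2 by rewrite ge_min lexx.
have r2 : r * (2 * (B + 1)) <= x.
  by rewrite -ler_pdivlMr ?ge_min ?lexx ?orbT //; nra.
have := h r ltac:(by apply/andP; split; lra).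
have : r ^+ n.+1 <= r by rewrite exprS ler_piMr ?exprn_ile1 //; lra.
by nra.
Qed.

Lemma geom_tail (q : R) j n : 0 <= q <= 1 / 2 ->
  \sum_(i < n | (j.+2 <= i)%N) q ^+ (i - j) <= 2 * q ^+ 2.
Proof.
move=> /andP[q0 q1].
suff h k : \sum_(i < j.+2 + k | (j.+2 <= i)%N) q ^+ (i - j) <=
    2 * q ^+ 2 - 2 * q ^+ k.+2.
  have [nj|jn] := leqP n j.+2.
    rewrite big_pred0 ?mulr_ge0 ?exprn_ge0// => i.
    by apply/negbTE; rewrite -ltnNge; exact: leq_trans nj.
  rewrite -(subnKC (ltnW jn)); apply: le_trans (h _) _.
  by rewrite lerBlDr lerDl mulr_ge0 ?exprn_ge0.
elim: k => [|k IH].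
  rewrite addn0 big_pred0 ?subrr // => i.
  by apply/negbTE; rewrite -ltnNge.
rewrite addnS big_mkcond big_ord_recr -big_mkcond /= leq_addr.
have -> : (j.+2 + k - j = k.+2)%N by lia.
have := exprn_ge0 k.+2 q0; rewrite [q ^+ k.+3]exprS; nra.
Qed.

Lemma exp_quot (K : fieldType) (a b : K) (i j : nat) : a != 0 -> b != 0 ->
  (j <= i)%N -> a^-1 ^+ i * a ^+ j * (b ^+ i * b^-1 ^+ j) = (b / a) ^+ (i - j).
Proof.
move=> a0 b0 ji; rewrite -{1 2}(subnK ji) !exprD exprMn.
have e (c : K) : c != 0 -> c^-1 ^+ j * c ^+ j = 1.
  by move=> c0; rewrite -exprMn mulVf // expr1n.
by rewrite -[X in X * _]mulrA e // mulr1 -[X in _ * X]mulrA [b ^+ j * _]mulrC e // mulr1 mulrC.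
Qed.

(** Cauchy's estimate on circles shrinking to 0 kills the coefficients of negative exponent,
    continuity at 0 identifies that of exponent 0, and those of exponent at least 2 are estimated on
    the circle of radius R0 / 2. The point is that the constant depends on F only through the bound
    B. *)
Lemma taylor2 F (R0 B : R) : 0 < R0 -> 0 <= B ->
  (forall z, nm z < R0 -> dif F z) -> (forall z, nm z < R0 -> nm (F z) <= B) ->
  exists c : R[i], forall z, nm z < R0 / 4 ->
    nm (F z - F 0 - c * z) <= 8 * B / R0 ^+ 2 * nm z ^+ 2.
Proof.
move=> R00 B0 dF FB.
have [|c hc] := @laurent_coef _ F 0 R0 (lexx _).
  by move=> z /andP[_]; exact: dF.
have cz i j r z : 0 < r < R0 -> nm z = 1 ->
    nm (F (r%:C%C * z) * (r%:C%C * z)^-1 ^+ i * (r%:C%C * z) ^+ j) <= B * (r^-1 ^+ i * r ^+ j).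
  move=> /andP[r0 rR] z1; rewrite -mulrA nmM; have nz := nm_realM (ltW r0) z1.
  rewrite [X in _ * X <= _]nmM !nmX nmV nz ler_wpM2r ?FB ?nz //.
  by rewrite mulr_ge0 // exprn_ge0 // ?invr_ge0 ltW.
have cle i j r : 0 < r < R0 -> nm (c i j) <= B * (r^-1 ^+ i * r ^+ j).
  by move=> hr; apply: hasmean_le (hc i j r hr) _ => z; exact: cz.
have c_neg i j : (i < j)%N -> c i j = 0.
  move=> ij; apply/eqP; rewrite -nm_eq0 eq_le nm_ge0 andbT.
  apply: (@exp_vanish (B * R0 ^+ (j - i)) _ (j - i)); rewrite ?subn_gt0 //.
    by rewrite mulr_ge0 // exprn_ge0 // ltW.
  move=> r /andP[r0 r1]; have rR0 : 0 < R0 * r < R0.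
    by rewrite mulr_gt0 //= gtr_pMr.
  apply: le_trans (cle i j _ rR0) _; rewrite -mulrA ler_wpM2l // -exprMn.
  have n0 : R0 * r != 0 by rewrite gt_eqF // mulr_gt0.
  by rewrite -{1}(subnKC (ltnW ij)) exprD exprVn mulKf // expf_neq0.
have c_diag i : c i i = F 0.
  apply/eqP; rewrite -subr_eq0 -nm_eq0 eq_le nm_ge0 andbT leNgt; apply/negP => lt.
  have [d' d'0 hd'] := proj1 (contCP _ _) (differentiable_continuous (dF 0 ltac:(by rewrite nm0)))
    (nm (c i i - F 0) / 2) ltac:(lra).
  pose r' := Num.min (d' / 2) (R0 / 2).
  have r'0 : 0 < r' by rewrite lt_min !divr_gt0.
  have r'd : r' < d' by rewrite gt_min; apply/orP; left; lra.
  have r'R : r' < R0 by rewrite gt_min; apply/orP; right; lra.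
  have g1 := hc i i r' ltac:(by rewrite r'0).
  have g2 := hasmeanD g1 (hasmean_cst (- F 0)).
  have : nm (c i i - F 0) <= nm (c i i - F 0) / 2.
    apply: hasmean_le g2 _ => z z1; rewrite -mulrA -exprMn mulVf ?expr1n ?mulr1//.
      by apply/ltW/hd'; rewrite subr0 (nm_realM (ltW r'0) z1).
    by rewrite -nm_gt0 (nm_realM (ltW r'0) z1).
  by lra.
have c_sub j : c j.+1 j = c 1 0.
  have hr : 0 < R0 / 2 < R0 by apply/andP; split; lra.
  apply: hasmean_unique (hc j.+1 j _ hr) _.
  apply: eq_hasmean (hc 1 0 _ hr) => z z1.
  have n0 : (R0 / 2)%:C%C * z != 0.
    by rewrite -nm_gt0 (nm_realM _ z1); case/andP: hr => // ? _; exact: ltW.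
  by rewrite expr0 mulr1 expr1 exprS -!mulrA -exprMn mulVf // expr1n mulr1.
exists (c 1 0) => z zR.
have [->|z0] := eqVneq z 0.
  by rewrite mulr0 subrr subr0 nm0 expr0n mulr0.
have nz : 0 < nm z by rewrite nm_gt0.
have zR' : nm z < R0 by lra.
pose G w := F w - F 0 - c 1 0 * w.
have dG w : nm w < R0 -> dif G w.
  move=> wR; apply: difB; last by apply: difM; [exact: dif_cst|exact: dif_id].
  by apply: difB; [exact: dF|exact: dif_cst].
(* The coefficients of G: exponents 0 and 1 have been subtracted, negative ones vanish. *)
pose d i j := if (j.+2 <= i)%N then c i j else 0.
have hd i j : hasmean (fun w => G ((nm z)%:C%C * w) * ((nm z)%:C%C * w)^-1 ^+ i *
    ((nm z)%:C%C * w) ^+ j) (d i j).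
  have n0 w : nm w = 1 -> (nm z)%:C%C * w != 0.
    by move=> w1; rewrite -nm_gt0 (nm_realM (ltW nz) w1).
  have hm a b : hasmean (fun w => ((nm z)%:C%C * w)^-1 ^+ a * ((nm z)%:C%C * w) ^+ b)
      (a == b)%:R.
    have := @hasmeanZ R ((nm z)%:C%C^-1 ^+ a * (nm z)%:C%C ^+ b) _ _ (@hasmean_monom R b a).
    have -> : (nm z)%:C%C^-1 ^+ a * (nm z)%:C%C ^+ b * (b == a)%:R = (a == b)%:R :> R[i].
      have [->|ab] := eqVneq b a; last by rewrite mulr0.
      rewrite mulr1 -exprMn mulVf ?expr1n //.
      by rewrite -nm_gt0 nm_real ger0_norm // ltW.
    apply: eq_hasmean => w w1; rewrite !invfM !exprMn; ring.
  have h0 := hc i j (nm z) ltac:(by rewrite nz).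
  have h1 := @hasmeanZ R (- F 0) _ _ (hm i j).
  have h2 := @hasmeanZ R (- c 1 0) _ _ (hm i j.+1).
  have -> : d i j = c i j + (- F 0 * (i == j)%:R + - c 1 0 * (i == j.+1)%:R).
    rewrite /d; have [lt|] := ltnP i j.
      have [n1 n2 n3] : [/\ (i == j) = false, (i == j.+1) = false & (j.+1 < i)%N = false].
        by clear -lt; split; lia.
      by rewrite c_neg // n1 n2 n3 !mulr0 !addr0.
    rewrite leq_eqVlt => /orP[/eqP <-|].
      have [n1 n2] : (j.+1 < j)%N = false /\ (j == j.+1) = false by clear; split; lia.
      by rewrite eqxx c_diag n1 n2 mulr0 mulr1 addr0 subrr.
    rewrite leq_eqVlt => /orP[/eqP <-|lt].
      have [n1 n2] : (j.+1 < j.+1)%N = false /\ (j.+1 == j) = false by clear; split; lia.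
      by rewrite eqxx c_sub n1 n2 mulr0 mulr1 add0r subrr.
    have [n1 n2] : (i == j) = false /\ (i == j.+1) = false by clear -lt; split; lia.
    by rewrite lt n1 n2 !mulr0 !addr0.
  apply: eq_hasmean (hasmeanD h0 (hasmeanD h1 h2)) => w w1.
  by rewrite /G exprSr; set u := _ * w; ring.
have [M M0 hM] := @annulus_bounded _ G (nm z) (nm z) nz (lexx _)
  (fun w hw => dG w ltac:(by have /le_anti -> : nm w <= nm z <= nm w; [rewrite andbC|])).
have := @fejer _ G z d M z0 (differentiable_continuous (dG z zR')) hd
  (fun w hw => hM w ltac:(by rewrite hw !lexx)).
move=> h; apply: (@tends_le _ _ _ _ 0%N h) => K _.
(* Cauchy's estimate leaves a geometric series in q <= 1 / 2 starting with q^2; its sum 2 q^2 is 8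
   |z|^2 / R0^2. *)
set q := nm z / (R0 / 2).
have q01 : 0 <= q <= 1 / 2.
  by rewrite divr_ge0 ?nm_ge0 ?(ltW (divr_gt0 _ _)) //= ?ler_pdivrMr ?divr_gt0 //; lra.
have -> : 8 * B / R0 ^+ 2 * nm z ^+ 2 = B * (2 * q ^+ 2).
  by rewrite /q; field; lra.
have r20 : 0 < R0 / 2 < R0 by apply/andP; split; lra.
have nK : nm (K.+1%:R : R[i]) = K.+1%:R.
  by rewrite -(rmorph_nat (real_complex R)) nm_real ger0_norm.
rewrite nmM nmV nK mulrC ler_pdivrMr ?ltr0n// exchange_big.
apply: le_trans (nm_sum _ _ _) _.
apply: le_trans (_ : \sum_(j < K.+1) B * (2 * q ^+ 2) <= _); last first.
  by rewrite sumr_const card_ord mulr_natr.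
apply: ler_sum => j _; apply: le_trans (nm_sum _ _ _) _.
have /andP[q0 q1] := q01.
apply: le_trans (_ : B * \sum_(i < K.+1 | (j.+2 <= i)%N) q ^+ (i - j) <= _); last first.
  by rewrite ler_wpM2l // geom_tail.
rewrite big_distrr /= [X in _ <= X]big_mkcond; apply: ler_sum => i _.
rewrite /d; case: ifP => ij; last by rewrite !mul0r nm0.
have [rr0 _] := andP r20.
apply: le_trans (_ : B * ((R0 / 2)^-1 ^+ i * (R0 / 2) ^+ j) * (nm z ^+ i * (nm z)^-1 ^+ j) <= _).
  rewrite -mulrA nmM; apply: ler_pM; rewrite ?nm_ge0 ?cle //.
  by rewrite nmM !nmX nmV.
have ji : (j <= i)%N by clear -ij; lia.
by rewrite -mulrA ler_wpM2l // /q exp_quot // gt_eqF.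
Qed.

(* A locally bounded pointwise limit of holomorphic functions is holomorphic:
   the second order Taylor remainders are uniform. *)
Lemma dif_limit (f : nat -> R[i] -> R[i]) G a (R0 B : R) : 0 < R0 ->
  (forall n z, nm (z - a) < R0 -> dif (f n) z) ->
  (forall n z, nm (z - a) < R0 -> nm (f n z) <= B) ->
  (forall z, nm (z - a) < R0 -> tends (f^~ z) (G z)) -> dif G a.
Proof.
move=> R00 df fB fG.
have sh z : a + z - a = z by rewrite addrC addKr.
have B0 : 0 <= B.
  by apply: le_trans (fB 0%N a _); rewrite ?subrr ?nm0// nm_ge0.
have h n : exists c : R[i], forall z, nm z < R0 / 4 ->
    nm (f n (a + z) - f n a - c * z) <= 8 * B / R0 ^+ 2 * nm z ^+ 2.
  have [z zR|z zR|c hc] := @taylor2 (fun z => f n (a + z)) R0 B R00 B0.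
  - by apply: dif_shift; apply: df; rewrite sh.
  - by apply: fB; rewrite sh.
  - by exists c => z /hc; rewrite addr0.
have [c hc] := choice h; set M := 8 * B / R0 ^+ 2 in hc.
have M0 : 0 <= M by rewrite divr_ge0 ?exprn_ge0 ?mulr_ge0 // ltW.
have [L hL] : exists L, tends c L.
  have [|L /tendsP hL] := @cauchyC R c; last by exists L.
  move=> e e0.
  (* The derivatives c n are Cauchy: each differs from the difference quotient with the fixed step t
     by at most M t <= e / 8, uniformly in n, and these quotients converge. *)
  pose t := Num.min (R0 / 8) (e / (8 * (M + 1))).
  have t0 : 0 < t by rewrite lt_min !divr_gt0 //; lra.
  have tR : t < R0 / 4 by rewrite gt_min; apply/orP; left; lra.
  have tM : t * M <= e / 8.
    have : t <= e / (8 * (M + 1)) by rewrite ge_min lexx orbT.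
    by rewrite ler_pdivlMr ?mulr_gt0//; nra.
  have nt : nm t%:C%C = t by rewrite nm_real ger0_norm // ltW.
  have et : 0 < e * t / 16 by rewrite divr_gt0 // mulr_gt0.
  have [N1 h1] := fG (a + t%:C%C) ltac:(by rewrite sh nt; lra) _ et.
  have [N2 h2] := fG a ltac:(by rewrite subrr nm0) _ et.
  exists (maxn N1 N2) => m n; rewrite !geq_max => /andP[m1 m2] /andP[n1 n2].
  have a1 := h1 m m1; have a2 := h2 m m2; have a3 := h1 n n1; have a4 := h2 n n2.
  have b1 := hc m t%:C%C ltac:(by rewrite nt); have b2 := hc n t%:C%C ltac:(by rewrite nt).
  rewrite nt in b1 b2.
  have : nm (c m - c n) * t < e * t.
    rewrite -[X in _ * X < _]nt -nmM.
    set x1 := f m (a + t%:C%C) in a1 b1; set x2 := f m a in a2 b1.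
    set x3 := f n (a + t%:C%C) in a3 b2; set x4 := f n a in a4 b2.
    set g1 := G (a + _) in a1 a3; set g2 := G a in a2 a4.
    have -> : (c m - c n) * t%:C%C = ((x3 - x4 - c n * t%:C%C) - (x1 - x2 - c m * t%:C%C)) +
      (((x1 - g1) - (x3 - g1)) - ((x2 - g2) - (x4 - g2))) by ring.
    apply: le_lt_trans (nmD _ _) _.
    have e1 := nmB (x3 - x4 - c n * t%:C%C) (x1 - x2 - c m * t%:C%C).
    have e2 := nmB (x1 - g1) (x3 - g1); have e3 := nmB (x2 - g2) (x4 - g2).
    have e4 := nmB ((x1 - g1) - (x3 - g1)) ((x2 - g2) - (x4 - g2)).
    have h5 : M * t ^+ 2 <= e / 8 * t.
      by rewrite expr2 mulrA; apply: ler_wpM2r; [exact: ltW|rewrite mulrC].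
    by have : 0 < e * t; [exact: mulr_gt0|lra].
  by rewrite ltr_pM2r.
apply/diffCP; exists L => e e0.
exists (Num.min (R0 / 4) (e / (M + 1))).
  by rewrite lt_min !divr_gt0 //; lra.
move=> z; rewrite lt_min => /andP[zR]; rewrite ltr_pdivlMr; last by lra.
move=> zM; have nz := nm_ge0 z.
apply: le_trans (_ : M * nm z ^+ 2 <= _); last by rewrite expr2 mulrA ler_wpM2r //; nra.
apply: (@tends_le _ (fun n => f n (a + z) - f n a - c n * z) _ _ 0%N) => [|n _]; last exact: hc.
have h1 := fG (a + z) ltac:(by rewrite sh; lra).
have h2 := fG a ltac:(by rewrite subrr nm0).
have h3 := tendsD (tendsD h1 (tendsZ (-1) h2)) (tendsZ (-1) (tendsM hL (tends_cst z))).
have -> : G (a + z) - G a - L * z = G (a + z) + -1 * G a + -1 * (L * z) by ring.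
by apply: eq_tends h3 => n; ring.
Qed.

End Consequences.

(** * Multiplicative periodicity and the identity theorem *)

Section Uniqueness.
Variable R : realType.
Local Notation dif f z := (differentiable (f : R[i]^o -> R[i]^o) (z : R[i]^o)).
Implicit Types (F G h : R[i] -> R[i]) (z w l : R[i]) (r : R).

Lemma expf_eq1 (t : R) n : 0 < t -> t != 1 -> (0 < n)%N -> t ^+ n != 1.
Proof.
move=> t0 t1 n0; apply/negP => /eqP h; case/negP: t1.
by rewrite -(@pexpr_eq1 _ t n n0 (ltW t0)) h.
Qed.

Lemma expr_quot_neq1 (K : fieldType) (w : K) i j : w != 0 -> i != j ->
  (forall k, (0 < k)%N -> w ^+ k != 1) -> w^-1 ^+ i * w ^+ j != 1.
Proof.
move=> w0 ij hk; apply/negP => /eqP h.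
have e : w ^+ j = w ^+ i.
  by rewrite -[RHS]mulr1 -h mulrA -exprMn mulfV // expr1n mul1r.
wlog ij' : i j ij {h} e / (i < j)%N => [hw|].
  by case: (ltngtP i j) ij => // ij _; [apply: (hw i j)|apply: (hw j i)] => //; rewrite ltn_eqF ?gtn_eqF.
move: e; rewrite -(subnK (ltnW ij')) exprD -[in RHS](mul1r (w ^+ i)).
move=> /(mulIf (expf_neq0 i w0)) e.
by have := hk (j - i)%N ltac:(by rewrite subn_gt0); rewrite e eqxx.
Qed.

(* The limit L(z) of the means of F (z ee a) is holomorphic and depends only on
   the phase of z, hence constant. *)
Lemma circle_mean_phase F (r1 r2 : R) : 0 <= r1 ->
  (forall z, r1 < nm z < r2 -> dif F z) ->
  exists l, forall z, r1 < nm z < r2 -> hasmean (fun w => F (z * w)) l.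
Proof.
move=> r10 dF.
have hL z : exists l, r1 < nm z < r2 ->
    forall r, 0 < r -> r1 < r * nm z < r2 -> hasmean (fun w => F (r%:C%C * z * w)) l.
  have [hz|nz] := pselect (r1 < nm z < r2); last by exists 0 => /nz.
  have nz : 0 < nm z by case/andP: hz => h _; exact: le_lt_trans h.
  pose u := z / (nm z)%:C%C.
  have nu : nm u = 1.
    by rewrite nmM nmV nm_real ger0_norm ?nm_ge0// mulfV // gt_eqF.
  have [w hw|l hl] := @circle_mean R (fun w => F (u * w)) r1 r2 r10.
    by apply: dif_scale; apply: dF; rewrite nmM nu mul1r.
  exists l => _ r r0 hr; have /tendsP := hl _ hr.
  apply: eq_hasmean => w _; congr F.
  have nC : (nm z)%:C%C != 0 :> R[i] by rewrite -nm_gt0 nm_real ger0_norm ?nm_ge0.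
  by rewrite rmorphM /u /=; field.
have [L hL'] := choice hL.
have LF z : r1 < nm z < r2 -> hasmean (fun w => F (z * w)) (L z).
  move=> hz; have := hL' z hz 1 ltr01; rewrite mul1r => /(_ hz).
  by apply: eq_hasmean => w _; rewrite mul1r.
have Lr z t : r1 < nm z < r2 -> 0 < t -> r1 < t * nm z < r2 -> L (t%:C%C * z) = L z.
  move=> hz t0 ht; have h1 := hL' z hz t t0 ht.
  apply: hasmean_unique h1; apply: LF.
  by rewrite nmM nm_real ger0_norm // ltW.
have dL z : r1 < nm z < r2 -> dif L z.
  move=> /andP[z1 z2].
  pose d := Num.min ((nm z - r1) / 2) ((r2 - nm z) / 2).
  have d0 : 0 < d by rewrite lt_min; apply/andP; split; lra.
  have d1 : d <= (nm z - r1) / 2 by rewrite ge_min lexx.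
  have d2 : d <= (r2 - nm z) / 2 by rewrite ge_min lexx orbT.
  have nb w : nm (w - z) < d -> nm z - d < nm w < nm z + d.
    move=> h; have := nm_sub w z; have := nm_sub z w; rewrite (nmBC z w) => ? ?.
    by apply/andP; split; lra.
  have [B _ hB] := @annulus_bounded R F (nm z - d) (nm z + d) ltac:(lra) ltac:(lra)
    (fun w hw => dF w ltac:(by case/andP: hw => ? ?; apply/andP; split; lra)).
  apply: (@dif_limit R (fun m z => cmean m (fun w => F (z * w))) L z d B d0).
  - move=> m w /nb/andP[w1 w2]; rewrite /cmean.
    apply: difM; first exact: dif_cst.
    apply: dif_sum => k _.
    have -> : (fun x => F (x * ee (k%:R / 2 ^+ m))) = (fun x => F (ee (k%:R / 2 ^+ m) * x)).
      by apply/funext => x; rewrite mulrC.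
    apply: dif_scale; apply: dF; rewrite nmM nm_ee mul1r.
    by apply/andP; split; lra.
  - move=> m w /nb/andP[w1 w2]; apply: cmean_le => a _; apply: hB.
    by rewrite nmM nm_ee mulr1; apply/andP; split; lra.
  - move=> w /nb/andP[w1 w2]; apply: LF.
    by apply/andP; split; lra.
have [c hc] := laurent_coef r10 dL.
have [[r hr]|none] := pselect (exists r, r1 < r < r2); last first.
  by exists 0 => z hz; exfalso; apply: none; exists (nm z).
have /andP[rr1 rr2] := hr; have r0 : 0 < r by exact: le_lt_trans rr1.
(* Scaling by t moves the circle of radius r to another circle of the annulus. As L (t z) = L z, the
   coefficient of exponent i - j is multiplied by t^(j-i), hence is 0 for i != j. *)
pose t := (r + r2) / 2 / r.
have tr : t * r = (r + r2) / 2 by rewrite divfK // gt_eqF.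
have t0 : 0 < t by rewrite divr_gt0 //; lra.
have t1 : t != 1 by apply/eqP => t1; move: tr; rewrite t1; lra.
have tC : t%:C%C != 0 :> R[i] by rewrite -nm_gt0 nm_real ger0_norm // ltW.
have cij i j : i != j -> c i j = 0.
  move=> ij; have h1 := hc i j r hr.
  have h2 := hc i j (t * r) ltac:(by rewrite tr; apply/andP; split; lra).
  have h3 : hasmean (fun z => t%:C%C^-1 ^+ i * t%:C%C ^+ j *
      (L (r%:C%C * z) * (r%:C%C * z)^-1 ^+ i * (r%:C%C * z) ^+ j)) (c i j).
    apply: eq_hasmean h2 => z z1; rewrite rmorphM /= -(mulrA t%:C%C r%:C%C z).
    rewrite Lr ?(nm_realM (ltW r0) z1) ?tr //; last by apply/andP; split; lra.
    by rewrite !invfM !exprMn; ring.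
  have := hasmean_unique h3 (hasmeanZ _ h1); move/eqP.
  rewrite -subr_eq0 -{1}[c i j]mul1r -mulrBl mulf_eq0 => /orP[|/eqP //].
  rewrite subr_eq0 eq_sym (negbTE (expr_quot_neq1 tC ij _)) // => k k0.
  by have := expf_eq1 t0 t1 k0; rewrite -(inj_eq (@complexI R)) rmorphXn.
exists (c 0 0) => z hz.
suff <- : L z = c 0 0 by exact: LF.
apply/eqP; rewrite -subr_eq0; apply/eqP.
pose c' i j := c i j - c 0 0 * (i == j)%:R.
apply: (@laurent_unique R (fun z => L z - c 0 0) r1 r2 c' r10) => //.
- by move=> w hw; apply: difB; [exact: dL|exact: dif_cst].
- move=> i j s hs; have s0 : 0 < s by case/andP: hs => h _; exact: le_lt_trans h.
  have sC : s%:C%C != 0 :> R[i] by rewrite -nm_gt0 nm_real ger0_norm // ltW.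
  have hm := @hasmeanZ R (- c 0 0 * (s%:C%C^-1 ^+ i * s%:C%C ^+ j)) _ _ (@hasmean_monom R j i).
  have -> : c' i j = c i j + - c 0 0 * (s%:C%C^-1 ^+ i * s%:C%C ^+ j) * (j == i)%:R.
    rewrite /c' [j == i]eq_sym; have [->|_] := eqVneq i j; last by rewrite !mulr0 subr0 addr0.
    by rewrite -exprMn mulVf // expr1n !mulr1.
  apply: eq_hasmean (hasmeanD (hc i j s hs) hm) => w w1.
  by rewrite !invfM !exprMn; ring.
- move=> i j; rewrite /c'; have [<-|ij] := eqVneq i j; last by rewrite cij // mulr0 subrr.
  rewrite mulr1; apply/eqP; rewrite subr_eq0; apply/eqP.
  apply: hasmean_unique (hc i i r hr) _; apply: eq_hasmean (hc 0%N 0%N r hr) => w w1.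
  have n0 : r%:C%C * w != 0 by rewrite -nm_gt0 (nm_realM (ltW r0) w1).
  by rewrite !expr0 !mulr1 -mulrA -exprMn mulVf // expr1n mulr1.
Qed.

(** Unlike in [laurent_coef], the base point z may have any phase, so that coefficients can be
    compared at z and at w z for a complex multiplier w. *)
Lemma laurent F (r1 r2 : R) : 0 <= r1 ->
  (forall z, r1 < nm z < r2 -> dif F z) ->
  exists c : nat -> nat -> R[i], forall i j z, r1 < nm z < r2 ->
    hasmean (fun w => F (z * w) * (z * w)^-1 ^+ i * (z * w) ^+ j) (c i j).
Proof.
move=> r10 dF.
have h (ij : nat * nat) : exists l, forall z, r1 < nm z < r2 ->
    hasmean (fun w => F (z * w) * (z * w)^-1 ^+ ij.1 * (z * w) ^+ ij.2) l.
  apply: (@circle_mean_phase (fun z => F z * z^-1 ^+ ij.1 * z ^+ ij.2)) => // z hz.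
  have z0 : z != 0.
    by case/andP: hz => hz _; rewrite -nm_gt0; exact: le_lt_trans hz.
  apply: difM; last by apply: difX; exact: dif_id.
  by apply: difM; [exact: dF|apply: difX; apply: difV => //; exact: dif_id].
have [c hc] := choice h.
by exists (fun i j => c (i, j)) => i j; exact: (hc (i, j)).
Qed.

Lemma laurent_eq0 F (r1 r2 : R) (c : nat -> nat -> R[i]) : 0 <= r1 ->
  (forall z, r1 < nm z < r2 -> dif F z) ->
  (forall i j z, r1 < nm z < r2 ->
    hasmean (fun w => F (z * w) * (z * w)^-1 ^+ i * (z * w) ^+ j) (c i j)) ->
  (forall i j, c i j = 0) ->
  forall z, r1 < nm z < r2 -> F z = 0.
Proof.
move=> r10 dF hc; apply: laurent_unique => // i j r hr; apply: hc.
by rewrite nm_real ger0_norm //; case/andP: hr => h _; exact: ltW (le_lt_trans r10 h).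
Qed.

(** Invariance under w on a single circle multiplies the coefficient of exponent i - j by w^(j-i).
    The multiplier may depend on i and j: the period q serves all pairs at once, whereas dyadic
    roots of unity must be chosen for each pair. *)
Lemma mult_periodic_const h (r1 r2 r : R) : 0 <= r1 ->
  (forall z, r1 < nm z < r2 -> dif h z) -> r1 < r < r2 ->
  (forall i j, i != j -> exists w, [/\ w != 0, w^-1 ^+ i * w ^+ j != 1,
     r1 < nm w * r < r2 & forall z, nm z = r -> h (w * z) = h z]) ->
  exists l, forall z, r1 < nm z < r2 -> h z = l.
Proof.
move=> r10 dh hr hw; have [c hc] := laurent r10 dh.
have r0 : 0 < r by case/andP: hr => s _; exact: le_lt_trans s.
have nr : nm r%:C%C = r by rewrite nm_real ger0_norm // ltW.
have cij i j : i != j -> c i j = 0.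
  move=> ij; have [w [w0 wij hwr hwz]] := hw i j ij.
  have h1 := hc i j r%:C%C ltac:(by rewrite nr).
  have h2 := hc i j (w * r%:C%C) ltac:(by rewrite nmM nr).
  have h3 : hasmean (fun z => w^-1 ^+ i * w ^+ j *
      (h (r%:C%C * z) * (r%:C%C * z)^-1 ^+ i * (r%:C%C * z) ^+ j)) (c i j).
    apply: eq_hasmean h2 => z z1; rewrite -(mulrA w) hwz ?nmM ?nr ?z1 ?mulr1 //.
    by rewrite !invfM !exprMn; ring.
  have := hasmean_unique h3 (hasmeanZ _ h1); move/eqP.
  rewrite -subr_eq0 -{1}[c i j]mul1r -mulrBl mulf_eq0 => /orP[|/eqP //].
  by rewrite subr_eq0 eq_sym (negbTE wij).
exists (c 0 0) => z hz; apply/eqP; rewrite -subr_eq0; apply/eqP.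
pose c' i j := c i j - c 0 0 * (i == j)%:R.
apply: (@laurent_eq0 (fun z => h z - c 0 0) r1 r2 c' r10) => //.
- by move=> w hw'; apply: difB; [exact: dh|exact: dif_cst].
- move=> i j s hs; have s0 : s != 0.
    by rewrite -nm_gt0; case/andP: hs => s0 _; exact: le_lt_trans s0.
  have hm := @hasmeanZ R (- c 0 0 * (s^-1 ^+ i * s ^+ j)) _ _ (@hasmean_monom R j i).
  have -> : c' i j = c i j + - c 0 0 * (s^-1 ^+ i * s ^+ j) * (j == i)%:R.
    rewrite /c' [j == i]eq_sym; have [->|_] := eqVneq i j; last by rewrite !mulr0 subr0 addr0.
    by rewrite -exprMn mulVf // expr1n !mulr1.
  apply: eq_hasmean (hasmeanD (hc i j s hs) hm) => w w1.
  by rewrite !invfM !exprMn; ring.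
- move=> i j; rewrite /c'; have [<-|ij] := eqVneq i j; last by rewrite cij // mulr0 subrr.
  rewrite mulr1; apply/eqP; rewrite subr_eq0; apply/eqP.
  apply: hasmean_unique (hc i i r%:C%C _) _; rewrite ?nr //.
  apply: eq_hasmean (hc 0%N 0%N r%:C%C _) => [w w1|]; last by rewrite nr.
  have n0 : r%:C%C * w != 0 by rewrite -nm_gt0 (nm_realM (ltW r0) w1).
  by rewrite !expr0 !mulr1 -mulrA -exprMn mulVf // expr1n mulr1.
Qed.

(* Theta functions of degree two with a given multiplier form a space of
   dimension at most two: their Laurent coefficients are determined by the
   coefficients of 1 and z. *)
Lemma theta2_dependent (f : 'I_3 -> R[i] -> R[i]) (p a : R[i]) :
  p != 0 -> a != 0 -> (forall k z, z != 0 -> dif (f k) z) ->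
  (forall k z, z != 0 -> f k (p * z) = a * z^-1 ^+ 2 * f k z) ->
  exists b : 'I_3 -> R[i], (exists k, b k != 0) /\
    forall z, z != 0 -> \sum_k b k * f k z = 0.
Proof.
move=> p0 a0 df fp.
have hz z : z != 0 -> 0 < nm z < nm z + 1 by move=> z0; rewrite nm_gt0 z0 ltrDl ltr01.
have hc k : exists c : nat -> nat -> R[i], forall i j z, z != 0 ->
    hasmean (fun w => f k (z * w) * (z * w)^-1 ^+ i * (z * w) ^+ j) (c i j).
  have h (ij : nat * nat) : exists l, forall z, z != 0 ->
      hasmean (fun w => f k (z * w) * (z * w)^-1 ^+ ij.1 * (z * w) ^+ ij.2) l.
    (* The punctured plane is exhausted by the annuli 0 < |z| < n + 2; all of them contain the unit
       circle, which identifies their coefficients. *)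
    have h2 (n : nat) : exists l, forall z, 0 < nm z < n.+2%:R ->
        hasmean (fun w => f k (z * w) * (z * w)^-1 ^+ ij.1 * (z * w) ^+ ij.2) l.
      have [|c hc] := @laurent (f k) 0 n.+2%:R (lexx _).
        by move=> z /andP[+ _]; rewrite nm_gt0; exact: df.
      by exists (c ij.1 ij.2); exact: hc.
    have [l hl] := choice h2.
    have ll n : l n = l 0%N.
      apply: hasmean_unique (hl n 1 _) (hl 0%N 1 _); rewrite nm1 ltr01 ltr1n //.
    exists (l 0%N) => z z0; have [n hn] := nat_above (nm z).
    rewrite -(ll n); apply: hl; rewrite nm_gt0 z0 /=; apply: lt_trans hn _.
    by rewrite ltr_nat.
  have [c hc] := choice h.
  by exists (fun i j => c (i, j)) => i j; exact: (hc (i, j)).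
have [c {}hc] := choice hc.
(* Three rows and only two columns, the coefficients of exponents 0 and 1, force a nonzero left
   kernel, whose elements are the sought relations. *)
pose A : 'M[R[i]]_(3, 2) := \matrix_(k, i) c k i 0%N.
have : kermx A != 0.
  apply/negP => /eqP/eqP; rewrite kermx_eq0 /row_free => /eqP rA.
  by have := rank_leq_col A; rewrite rA.
move=> /rowV0Pn[v /sub_kermxP vA v0].
exists (fun k => v 0 k); split.
  apply: contrapT => /forallNP nv; case/eqP: v0; apply/rowP => k.
  by rewrite mxE; apply/eqP/negPn/negP; exact: nv.
pose C i j := \sum_k v 0 k * c k i j.
have Cm i j z : z != 0 -> hasmean (fun w => (\sum_k v 0 k * f k (z * w)) *
    (z * w)^-1 ^+ i * (z * w) ^+ j) (C i j).
  move=> z0; have := @hasmean_sum R _ (index_enum 'I_3) _ _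
    (fun k => @hasmeanZ R (v 0 k) _ _ (hc k i j z z0)).
  apply: eq_hasmean => w w1; rewrite !big_distrl /=; apply: eq_bigr => k _.
  by ring.
have C1 i j : C i.+1 j.+1 = C i j.
  apply: eq_bigr => k _; congr (_ * _).
  apply: hasmean_unique (hc k i.+1 j.+1 1 (oner_neq0 _)) _.
  apply: eq_hasmean (hc k i j 1 (oner_neq0 _)) => w w1.
  have w0 : w != 0 by rewrite -nm_gt0 w1.
  by rewrite !mul1r exprSr exprS -!mulrA [w^-1 * _]mulrA mulVf // mul1r.
(* The multiplier links exponents differing by 2, so vanishing at exponents 0 and 1 spreads in both
   directions. *)
have C2 i j : C i j = a * (p^-1 ^+ i * p ^+ j) * C i.+2 j.
  rewrite /C big_distrr; apply: eq_bigr => k _ /=; rewrite mulrCA; congr (_ * _).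
  apply: hasmean_unique (hc k i j p p0) _.
  have := @hasmeanZ R (a * (p^-1 ^+ i * p ^+ j)) _ _ (hc k i.+2 j 1 (oner_neq0 _)).
  apply: eq_hasmean => w w1.
  have w0 : w != 0 by rewrite -nm_gt0 w1.
  by rewrite mul1r fp // invfM !exprMn !exprS; ring.
have pn0 i j : a * (p^-1 ^+ i * p ^+ j) != 0.
  by rewrite !mulf_neq0 ?expf_neq0 ?invr_eq0.
have Ci0 i : C i 0 = 0.
  have h k : C k 0 = 0 /\ C k.+1 0 = 0.
    elim: k => [|k [h1 h2]].
      have hA (e : 'I_2) : C e 0%N = 0.
        have := congr1 (fun M : 'rV_2 => M 0 e) vA; rewrite !mxE => <-.
        by apply: eq_bigr => l _; rewrite mxE.
      by split; [exact: (hA ord0)|exact: (hA (lift ord0 ord0))].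
    split=> //; move: h1; rewrite C2 => /eqP; rewrite mulf_eq0 (negbTE (pn0 _ _)).
    by move/eqP.
  by case: (h i).
have C0j j : C 0 j = 0.
  have h k : C 0 k = 0 /\ C 0 k.+1 = 0.
    elim: k => [|k [h1 h2]]; first by rewrite Ci0 C2 C1 Ci0 mulr0.
    by split=> //; rewrite C2 !C1 h1 mulr0.
  by case: (h j).
have C0 i j : C i j = 0.
  by elim: i j => [//|i IH] [|j] //; rewrite C1.
move=> z z0; apply: (@laurent_eq0 (fun z => \sum_k v 0 k * f k z) 0 (nm z + 1) C) => //.
- move=> w /andP[+ _]; rewrite nm_gt0 => w0; apply: dif_sum => k _.
  by apply: difM; [exact: dif_cst|exact: df].
- by move=> i j w /andP[+ _]; rewrite nm_gt0; exact: Cm.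
- exact: hz.
Qed.

(** The Laurent coefficients about a can be computed on a circle inside the small disc, where F
    vanishes. *)
Lemma zero_disc F a (r d : R) : 0 < d ->
  (forall z, nm (z - a) < r -> dif F z) ->
  (forall z, nm (z - a) < d -> F z = 0) ->
  forall z, nm (z - a) < r -> F z = 0.
Proof.
move=> d0 dF F0 z zr.
have sh w : a + w - a = w by rewrite addrC addKr.
have [->|za] := eqVneq z a; first by apply: F0; rewrite subrr nm0.
have dG w : 0 < nm w < r -> dif (fun w => F (a + w)) w.
  by move=> /andP[_ wr]; apply: dif_shift; apply: dF; rewrite sh.
have [c hc] := laurent_coef (lexx _) dG.
have nz : 0 < nm (z - a) by rewrite nm_gt0 subr_eq0.
have c0 i j : c i j = 0.
  pose s := Num.min (d / 2) (nm (z - a)).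
  have s0 : 0 < s by rewrite lt_min nz divr_gt0.
  have sd : s < d by rewrite gt_min; apply/orP; left; lra.
  have sr : s < r by apply: le_lt_trans zr; rewrite ge_min lexx orbT.
  apply: hasmean_unique (hc i j s _) _; first by rewrite s0.
  apply: eq_hasmean (hasmean_cst 0) => w w1.
  by rewrite F0 ?mul0r // sh (nm_realM (ltW s0) w1).
have := laurent_unique (lexx _) dG hc c0 (z := z - a).
by rewrite nz zr addrC subrK; exact.
Qed.

(** Analytic continuation from 1 to 0: at the infimum of the points of the segment around which F
    vanishes, [zero_disc] applied to a nearby centre reaches beyond, unless the infimum is 0. *)
Lemma identity_segment F :
  (forall t : R, 0 <= t <= 1 -> exists2 d : R, 0 < d &
     forall z, nm (z - t%:C%C) < d -> dif F z) ->
  (exists2 d : R, 0 < d & forall z, nm (z - 1) < d -> F z = 0) -> F 0 = 0.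
Proof.
move=> dF [d1 d10 F1].
pose good (t : R) := 0 <= t <= 1 /\ exists2 d : R, 0 < d &
  forall z, nm (z - t%:C%C) < d -> F z = 0.
have g1 : good 1 by split; [rewrite ler01 lexx|exists d1].
have hi : has_inf [set t | good t].
  by split; [exists 1|exists 0 => t [/andP[]]].
pose s := inf [set t | good t].
have s01 : 0 <= s <= 1.
  apply/andP; split; first by apply: lb_le_inf; [exists 1|move=> t [/andP[]]].
  by apply: ge_inf => //; exists 0 => t [/andP[]].
have [d d0 hd] := dF s s01.
have near z (t : R) : nm (z - s%:C%C) < d / 3 -> `|t - s| < d / 3 ->
    nm (z - t%:C%C) < 2 * d / 3.
  move=> h1 h2; apply: le_lt_trans (nm_dist z s%:C%C t%:C%C) _.
  by rewrite -rmorphB nm_real distrC; lra.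
have [t [[t01 [dt dt0 Ft]]] ts] : exists t, good t /\ t < s + d / 3.
  have [|t gt ts] := @inf_adherent _ [set t | good t] (d / 3) _ hi; first by lra.
  by exists t.
have st : s <= t by apply: ge_inf; [exists 0 => u [/andP[]]|split=> //; exists dt].
have tsd : `|t - s| < d / 3 by rewrite ger0_norm; lra.
have Fs z : nm (z - s%:C%C) < d / 3 -> F z = 0.
  move=> zs; apply: (@zero_disc F t%:C%C (2 * d / 3) dt) => // [w wt|]; last exact: near.
  apply: hd; apply: le_lt_trans (nm_dist w t%:C%C s%:C%C) _.
  by rewrite -rmorphB nm_real; lra.
have [s0|s0] := ltP 0 s; last first.
  have -> : (0 : R[i]) = 0%:C%C by [].
  apply: Fs; have -> : s = 0 by apply/le_anti; rewrite s0; case/andP: s01 => ->.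
  by rewrite subrr nm0; lra.
exfalso; pose u := Num.max 0 (s - d / 6).
have us : u < s by rewrite gt_max s0 /=; lra.
have u1 : s - u <= d / 6 by rewrite lerBlDr -lerBlDl le_max lexx orbT.
have : good u.
  split; first by rewrite le_max lexx /=; case/andP: s01 => _; lra.
  exists (d / 6); first by lra.
  move=> z zu; apply: Fs; apply: le_lt_trans (nm_dist z u%:C%C s%:C%C) _.
  by rewrite -rmorphB nm_real distrC ger0_norm; lra.
move=> /(ge_inf _)-/(_ (ex_intro _ 0 _)) h.
have : s <= u by apply: h => t' [/andP[]].
by lra.
Qed.

End Uniqueness.

(** * Theta functions and the elliptic gamma function *)

Section EllipticProducts.
Variable R : realType.
Local Notation dif f z := (differentiable (f : R[i]^o -> R[i]^o) (z : R[i]^o)).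
Implicit Types (p q x y z : R[i]).

Lemma tendsV (u : nat -> R[i]) l : l != 0 -> tends u l ->
  tends (fun n => (u n)^-1) l^-1.
Proof.
move=> l0 hu e e0; have nl : 0 < nm l by rewrite nm_gt0.
pose d := Num.min (nm l / 2) (e * (nm l * nm l) / 2).
have d0 : 0 < d by rewrite lt_min !divr_gt0 ?mulr_gt0.
have [N hN] := hu d d0; exists N => n /hN.
rewrite lt_min => /andP[h1 h2].
have un : nm l / 2 < nm (u n).
  by have := nm_sub l (u n); rewrite nmBC; lra.
have u0 : u n != 0 by rewrite -nm_gt0; lra.
have -> : (u n)^-1 - l^-1 = (l - u n) * ((u n)^-1 * l^-1) by field; rewrite u0 l0.
rewrite nmM nmBC nmM !nmV -invfM ltr_pdivrMr; last by rewrite mulr_gt0 // nm_gt0.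
apply: lt_le_trans h2 _; rewrite -mulrA ler_pM2l //.
have -> : nm l * nm l / 2 = nm l / 2 * nm l by ring.
by apply: ler_wpM2r; exact: ltW.
Qed.

(** From x y - 1 = (x - 1)(y - 1) + (x - 1) + (y - 1), and the same identity for exponentials. All
    convergence statements for the infinite products rest on this bound. *)
Lemma prod_near1 (I : Type) (s : seq I) (P : pred I) (a : I -> R[i]) :
  nm (\prod_(i <- s | P i) (1 - a i) - 1) <= expR (\sum_(i <- s | P i) nm (a i)) - 1.
Proof.
elim/big_ind2 : _ => [|s1 x s2 y h1 h2|i _].
- by rewrite subrr nm0 expR0 subrr.
- have -> : x * y - 1 = (x - 1) * (y - 1) + ((x - 1) + (y - 1)) by ring.
  apply: le_trans (nmD _ _) _; rewrite nmM expRD.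
  have := nmD (x - 1) (y - 1).
  have : nm (x - 1) * nm (y - 1) <= (expR s1 - 1) * (expR s2 - 1).
    by apply: ler_pM => //; exact: nm_ge0.
  lra.
- rewrite addrAC subrr add0r nmN; have := expR_ge1Dx (nm (a i)); lra.
Qed.

Definition epart p q N x : R[i] :=
  \prod_(j < N) \prod_(k < N) (1 - p ^+ j * q ^+ k * x).

(* E(x; p, q) = prod_{j, k >= 0} (1 - p^j q^k x); thus E(x; p, 0) is the
   q-shifted factorial (x; p), because 0 ^+ 0 = 1. *)
Definition ell p q x : R[i] := limn (fun N => epart p q N x : R[i]^o).

Lemma geom_le (P : R) N M : 0 <= P < 1 ->
  \sum_(j < M | (N <= j)%N) P ^+ j <= P ^+ N / (1 - P).
Proof.
move=> /andP[P0 P1].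
suff : \sum_(j < M | (N <= j)%N) P ^+ j * (1 - P) <= P ^+ N.
  by rewrite -big_distrl /= ler_pdivlMr // subr_gt0.
suff : \sum_(j < M | (N <= j)%N) P ^+ j * (1 - P) <= P ^+ N - P ^+ (maxn N M).
  by have := exprn_ge0 (maxn N M) P0; lra.
elim: M => [|M IH]; first by rewrite big_ord0 maxn0 subrr.
rewrite big_mkcond big_ord_recr -big_mkcond /=.
case: (leqP N M) => NM.
  rewrite (maxn_idPr (leqW NM)); move: IH; rewrite (maxn_idPr NM) exprS; lra.
rewrite addr0; move: IH; rewrite (maxn_idPl (ltnW NM)) (maxn_idPl _) //.
Qed.

(** A pair outside the square has j >= N or k >= N, which leaves two products of geometric sums. The
    bound is uniform in M. *)
Lemma tail_le (P Q : R) N M : 0 <= P < 1 -> 0 <= Q < 1 ->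
  \sum_(j < M) \sum_(k < M | ~~ ((j < N) && (k < N))%N) P ^+ j * Q ^+ k <=
  (P ^+ N + Q ^+ N) / ((1 - P) * (1 - Q)).
Proof.
move=> hP hQ; have /andP[P0 P1] := hP; have /andP[Q0 Q1] := hQ.
have P1' : 0 < 1 - P by lra.
have Q1' : 0 < 1 - Q by lra.
have sP : \sum_(j < M) P ^+ j <= (1 - P)^-1.
  by have := @geom_le P 0 M hP; rewrite expr0 mul1r.
have sQ : \sum_(j < M) Q ^+ j <= (1 - Q)^-1.
  by have := @geom_le Q 0 M hQ; rewrite expr0 mul1r.
apply: le_trans (_ : \sum_(j < M | (N <= j)%N) \sum_(k < M) P ^+ j * Q ^+ k +
   \sum_(j < M) \sum_(k < M | (N <= k)%N) P ^+ j * Q ^+ k <= _).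
  rewrite [X in _ <= X + _]big_mkcond -big_split /=; apply: ler_sum => j _.
  have h0 (T : pred 'I_M) : 0 <= \sum_(k < M | T k) P ^+ j * Q ^+ k.
    by apply: sumr_ge0 => k _; rewrite mulr_ge0 // exprn_ge0.
  have [jN|Nj] := ltnP j N => /=.
    by rewrite add0r (eq_bigl (fun k : 'I_M => (N <= k)%N)) // => k; rewrite -leqNgt.
  by rewrite -[X in X <= _]addr0; apply: lerD => //; exact: h0.
rewrite mulrDl; apply: lerD.
  under eq_bigr do rewrite -big_distrr.
  rewrite -big_distrl /= invfM mulrA; apply: ler_pM => //.
  - by apply: sumr_ge0 => k _; rewrite exprn_ge0.
  - by apply: sumr_ge0 => k _; rewrite exprn_ge0.
  - exact: geom_le.
under eq_bigr do rewrite -big_distrr.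
rewrite -big_distrl /= invfM mulrCA; apply: ler_pM => //.
- by apply: sumr_ge0 => k _; rewrite exprn_ge0.
- by apply: sumr_ge0 => k _; rewrite exprn_ge0.
- exact: geom_le.
Qed.

Lemma expR_small (c e : R) : 0 <= c -> 0 < e -> exists2 d : R, 0 < d &
  forall t, 0 <= t <= d -> expR (t * c) - 1 < e.
Proof.
move=> c0 e0.
have [d d0 hd] := real_derive_bound (is_derive_expR (0 : R)) ltr01.
exists (Num.min (d / 2 / (c + 1)) (e / 4 / (c + 1))).
  by rewrite lt_min !divr_gt0 //; lra.
move=> t /andP[t0]; rewrite le_min => /andP[].
rewrite (ler_pdivlMr _ _ (_ : 0 < c + 1)); last by lra.
rewrite (ler_pdivlMr _ _ (_ : 0 < c + 1)); last by lra.
move=> t1 t2.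
have tc : 0 <= t * c by rewrite mulr_ge0.
have := hd (t * c); rewrite ger0_norm // add0r expR0 mul1r => /(_ ltac:(nra)).
by move=> h; have := ler_norm (expR (t * c) - 1 - t * c); nra.
Qed.

Lemma pow_small (P e : R) : 0 <= P < 1 -> 0 < e -> exists N, forall n, (N <= n)%N -> P ^+ n < e.
Proof.
move=> /andP[P0 P1] e0.
have [|N _ hN] := (cvgrPdist_lt _ _).1 (@cvg_expr R P _) e e0.
  by rewrite ger0_norm.
by exists N => n /hN; rewrite sub0r normrN ger0_norm // exprn_ge0.
Qed.

Section Fixed.
Variables p q : R[i].
Hypotheses (p1 : nm p < 1) (q1 : nm q < 1).

Let S := ((1 - nm p) * (1 - nm q))^-1.

Let S0 : 0 <= S.
Proof. by rewrite invr_ge0 mulr_ge0 // subr_ge0 ltW. Qed.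

Let hP : 0 <= nm p < 1. Proof. by rewrite nm_ge0. Qed.
Let hQ : 0 <= nm q < 1. Proof. by rewrite nm_ge0. Qed.

Let rest N M x := \prod_(j < M) \prod_(k < M | ~~ ((j < N) && (k < N))%N)
  (1 - p ^+ j * q ^+ k * x).

Let restE N M x : (N <= M)%N -> epart p q M x = epart p q N x * rest N M x.
Proof.
move=> NM; rewrite /epart /rest [X in X * _](big_ord_widen M (fun j => \prod_(k < N) (1 - p ^+ j * q ^+ k * x)) NM).
rewrite [X in _ = X * _]big_mkcond -big_split; apply: eq_bigr => j _ /=.
rewrite (bigID (fun k : 'I_M => (j < N) && (k < N))%N) /=; congr (_ * _).
case: ifP => jN; last by rewrite big_pred0.
rewrite (big_ord_widen M (fun k => 1 - p ^+ j * q ^+ k * x) NM).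
exact: eq_bigl.
Qed.

Let rest_near1 N M x :
  nm (rest N M x - 1) <= expR ((nm p ^+ N + nm q ^+ N) * S * nm x) - 1.
Proof.
rewrite /rest pair_big_dep /=.
apply: le_trans (prod_near1 _ _ _) _; rewrite lerD2r ler_expR.
have := tail_le N M hP hQ; rewrite -/S pair_big_dep /= => h.
apply: le_trans (ler_wpM2r (nm_ge0 x) h); rewrite big_distrl /=.
by apply: ler_sum => i _; rewrite !nmM !nmX.
Qed.

Lemma epart_bound N x : nm (epart p q N x) <= expR (2 * S * nm x).
Proof.
have := @rest_near1 0 N x; have := restE x (leq0n N).
rewrite /epart big_ord0 mul1r => ->; rewrite !expr0.
have := nm_sub (rest 0 N x) 1; rewrite nm1; lra.
Qed.

Let tail_small x e : 0 < e -> exists N, forall n, (N <= n)%N ->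
  expR ((nm p ^+ n + nm q ^+ n) * S * nm x) - 1 < e.
Proof.
move=> e0; have c0 : 0 <= S * nm x by rewrite mulr_ge0 // nm_ge0.
have [d d0 hd] := expR_small c0 e0.
have [N1 h1] := @pow_small (nm p) (d / 2) hP ltac:(lra).
have [N2 h2] := @pow_small (nm q) (d / 2) hQ ltac:(lra).
exists (maxn N1 N2) => n; rewrite geq_max => /andP[/h1 a1 /h2 a2].
rewrite -mulrA; apply: hd; rewrite addr_ge0 ?exprn_ge0 ?nm_ge0 //=; lra.
Qed.

Lemma ellP x : tends (fun N => epart p q N x) (ell p q x).
Proof.
suff [l hl] : exists l, tends (fun N => epart p q N x) l.
  by have /tendsP/cvgC_lim := hl; rewrite -/(ell p q x) => ->.
have [|l /tendsP hl] := @cauchyC R (fun N => epart p q N x); last by exists l.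
move=> e e0; pose B := expR (2 * S * nm x).
have B0 : 0 < B by exact: expR_gt0.
have [N hN] := tail_small x (divr_gt0 e0 (mulr_gt0 (ltr0Sn R 1) B0)).
exists N => m n Nm Nn.
have key k : (N <= k)%N -> nm (epart p q k x - epart p q N x) < e / 2.
  move=> Nk; rewrite (restE x Nk) -{2}[epart p q N x]mulr1 -mulrBr nmM.
  have h1 := epart_bound N x; have h2 := rest_near1 N k x.
  have h3 := hN N (leqnn _).
  apply: le_lt_trans (_ : B * (e / (2 * B) - (e / (2 * B) - (expR ((nm p ^+ N + nm q ^+ N) * S * nm x) - 1))) < _).
    by apply: ler_pM; rewrite ?nm_ge0 //; lra.
  have -> : e / 2 = B * (e / (2 * B)) by field; rewrite gt_eqF.
  by rewrite ltr_pM2l //; lra.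
apply: le_lt_trans (nm_dist _ (epart p q N x) _) _.
by have := key m Nm; have := key n Nn; rewrite (nmBC (epart p q n x)); lra.
Qed.

(** The factors outside a large square have a product of modulus at least 1 / 2, so an infinite
    product can vanish only through one of its factors. *)
Lemma ell_eq0 x : ell p q x = 0 -> exists N, forall n, (N <= n)%N -> epart p q n x = 0.
Proof.
move=> E0.
have [N hN] := tail_small x (ltac:(lra) : 0 < 1 / 2).
have hr n : (N <= n)%N -> 1 / 2 <= nm (rest N n x).
  move=> Nn; have := hN N (leqnn _); have := rest_near1 N n x.
  by have := nm_sub 1 (rest N n x); rewrite nm1 nmBC; lra.
have [EN|EN] := eqVneq (epart p q N x) 0.
  by exists N => n /restE->; rewrite EN mul0r.
exfalso; have : nm (epart p q N x) / 2 <= nm (ell p q x).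
  apply: (@tends_ge _ _ _ _ N (ellP x)) => n Nn; rewrite (restE x Nn) nmM.
  by have := hr n Nn; have := nm_ge0 (epart p q N x); nra.
by rewrite E0 nm0; have : 0 < nm (epart p q N x); [rewrite nm_gt0|lra].
Qed.

Lemma ell_zero x : ell p q x = 0 -> exists j k, p ^+ j * q ^+ k * x = 1.
Proof.
move=> /ell_eq0[N /(_ N (leqnn _))/eqP]; rewrite prodf_seq_eq0 => /hasP[j _] /=.
rewrite prodf_seq_eq0 => /hasP[k _] /=; rewrite subr_eq0 => /eqP h.
by exists j, k.
Qed.

Lemma ell_neq0 x : nm x < 1 -> ell p q x != 0.
Proof.
move=> x1; apply/eqP => /ell_zero[j [k /(congr1 (@nm R))]].
rewrite !nmM !nmX nm1 => h.
have : nm p ^+ j * nm q ^+ k <= 1.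
  by rewrite mulr_ile1 ?exprn_ge0 ?exprn_ile1 ?nm_ge0 // ltW.
by have := nm_ge0 x; have : 0 <= nm p ^+ j * nm q ^+ k; [rewrite mulr_ge0 ?exprn_ge0 ?nm_ge0|nra].
Qed.

Lemma ell_dif x : dif (ell p q) x.
Proof.
apply: (@dif_limit R (epart p q) (ell p q) x 1 (expR (2 * S * (nm x + 1))) ltr01).
- move=> N z _; apply: dif_prod => j _; apply: dif_prod => k _.
  by apply: difB; [exact: dif_cst|apply: difM; [exact: dif_cst|exact: dif_id]].
- move=> N z zx; apply: le_trans (epart_bound N z) _; rewrite ler_expR.
  rewrite ler_wpM2l ?mulr_ge0 //; have := nm_sub z x; lra.
- by move=> z _; exact: ellP.
Qed.

Lemma ell_unique x l : tends (fun N => epart p q N x) l -> ell p q x = l.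
Proof. by move=> h; exact: tends_unique (ellP x) h. Qed.

End Fixed.

Lemma ellC p q x : ell p q x = ell q p x.
Proof.
rewrite /ell; set u := (fun N => _ : R[i]^o); set v := (fun N => _ : R[i]^o).
suff -> : u = v by []; apply/funext => N; rewrite /u /v /epart exchange_big /=.
by apply: eq_bigr => j _; apply: eq_bigr => k _; rewrite (mulrC (p ^+ _)).
Qed.

Lemma eq_tendsS (u v : nat -> R[i]) (l : R[i]) : (forall n, u n.+1 = v n.+1) -> tends u l -> tends v l.
Proof.
move=> uv h e /h[N hN]; exists N.+1 => -[//|n] Nn; rewrite -uv; apply: hN.
exact: leqW.
Qed.

Lemma epart0 p x N : epart p 0 N.+1 x = \prod_(j < N.+1) (1 - p ^+ j * x).
Proof.
apply: eq_bigr => j _; rewrite big_ord_recl expr0 mulr1 big1 ?mulr1 // => k _.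
by rewrite exprS mul0r mulr0 mul0r subr0.
Qed.

(** The partial products of the two sides differ by one column of factors 1 - p^j q^N x, whose
    product tends to 1. *)
Lemma ell_split p q x : nm p < 1 -> nm q < 1 ->
  ell p q x = ell p 0 x * ell p q (q * x).
Proof.
move=> p1 q1; have z1 : nm (0 : R[i]) < 1 by rewrite nm0.
have h1 := tendsM (ellP p1 z1 x) (ellP p1 q1 (q * x)).
have h2 : tends (fun N => \prod_(j < N) (1 - p ^+ j * (q ^+ N * x))) 1.
  move=> e e0.
  have c0 : 0 <= nm x / (1 - nm p) by rewrite divr_ge0 ?nm_ge0 // subr_ge0 ltW.
  have [d d0 hd] := expR_small c0 e0.
  have [N hN] := @pow_small (nm q) d ltac:(by rewrite nm_ge0) d0.
  exists N => n /hN/ltW hn; apply: le_lt_trans (prod_near1 _ _ _) _.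
  apply: le_lt_trans (hd (nm q ^+ n) ltac:(by rewrite exprn_ge0 ?nm_ge0)).
  rewrite lerD2r ler_expR; under eq_bigr do rewrite nmM nmX.
  rewrite -big_distrl /= nmM nmX mulrCA ler_wpM2l ?exprn_ge0 ?nm_ge0 //.
  rewrite mulrC ler_wpM2l ?nm_ge0 //.
  by have := @geom_le (nm p) 0 n; rewrite expr0 mul1r nm_ge0; apply.
have h3 := tendsM (ellP p1 q1 x) h2; rewrite mulr1 in h3.
apply: tends_unique h3 _; apply: eq_tendsS h1 => N.
rewrite epart0 /epart -!big_split; apply: eq_bigr => j _ /=.
rewrite mulrA -(big_ord_recr N.+1 (fun k => 1 - p ^+ j * q ^+ k * x)) big_ord_recl expr0 mulr1.
by congr (_ * _); apply: eq_bigr => k _; rewrite exprSr !mulrA.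
Qed.

Lemma ell00 x : ell 0 0 x = 1 - x.
Proof.
have z1 : nm (0 : R[i]) < 1 by rewrite nm0.
apply: ell_unique => //; apply: eq_tendsS (tends_cst (1 - x)) => N.
rewrite epart0 big_ord_recl expr0 mul1r big1 ?mulr1 // => k _.
by rewrite exprS !mul0r subr0.
Qed.

Lemma ell0S p x : nm p < 1 -> ell p 0 x = (1 - x) * ell p 0 (p * x).
Proof. move=> p1; have z1 : nm (0 : R[i]) < 1 by rewrite nm0.
by rewrite (ellC p 0 x) (ell_split _ z1 p1) ell00 (ellC 0 p (p * x)). Qed.

Lemma qpochE p : nm p < 1 -> qpoch p = ell p 0 p.
Proof.
move=> p1; symmetry; apply: ell_unique => //; first by rewrite nm0.
suff [l hl] : exists l, tends (fun N => \prod_(k < N) (1 - p ^+ k.+1)) l.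
  have /tendsP/cvgC_lim := hl; rewrite -/(qpoch p) => ->.
  by apply: eq_tendsS hl => N; rewrite epart0; apply: eq_bigr => j _; rewrite exprSr.
exists (ell p 0 p).
apply: eq_tendsS (ellP p1 (ltac:(by rewrite nm0) : nm (0 : R[i]) < 1) p) => N.
by rewrite epart0; apply: eq_bigr => j _; rewrite exprSr.
Qed.

Lemma egammaE p q x : nm p < 1 -> nm q < 1 ->
  egamma p q x = ell p q (p * q / x) / ell p q x.
Proof.
move=> p1 q1.
suff h : tends (fun N => epart p q N (p * q / x) / epart p q N x)
    (ell p q (p * q / x) / ell p q x).
  move/tendsP/cvgC_lim : h => <-; rewrite /egamma.
  set u := (fun N => _ : R[i]^o); set v := (fun N => _ : R[i]^o).
  suff -> : u = v by []; apply/funext => N; rewrite /u /v.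
  rewrite /epart -prodf_div; apply: eq_bigr => j _; rewrite -prodf_div.
  by apply: eq_bigr => k _; rewrite !exprSr; congr ((1 - _) / _); rewrite !mulrA; congr (_ * _); ring.
have [E0|E0] := eqVneq (ell p q x) 0; last first.
  by apply: tendsM; [exact: ellP|apply: tendsV => //; exact: ellP].
(* At a pole the partial denominators are eventually 0, so the quotients, and with them the limit,
   are 0 by the convention for division. *)
have [N hN] := ell_eq0 p1 q1 E0.
rewrite E0 invr0 mulr0 => e e0; exists N => n /hN ->.
by rewrite invr0 mulr0 subrr nm0.
Qed.

(** The multiplicative theta function (x; p)(p / x; p). *)
Definition theta p x : R[i] := ell p 0 x * ell p 0 (p / x).

Section Theta.
Variable p : R[i].
Hypotheses (p1 : nm p < 1) (p0 : p != 0).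

Lemma thetaE x : theta p x = (1 - x) * (ell p 0 (p * x) * ell p 0 (p / x)).
Proof. by rewrite /theta ell0S // mulrA. Qed.

Lemma theta1 : theta p 1 = 0.
Proof. by rewrite thetaE subrr mul0r. Qed.

Lemma thetaV x : x != 0 -> theta p x^-1 = - x^-1 * theta p x.
Proof.
by move=> x0; rewrite !thetaE invrK; set u := ell _ _ _; set v := ell _ _ _; field.
Qed.

Lemma theta_shift x : x != 0 -> theta p (p * x) = - x^-1 * theta p x.
Proof.
move=> x0; rewrite -thetaV // /theta invrK mulrC; congr (_ * _).
by rewrite invfM mulrA mulfV // mul1r.
Qed.

Lemma theta_dif x : x != 0 -> dif (theta p) x.
Proof.
move=> x0; have z1 : nm (0 : R[i]) < 1 by rewrite nm0.
apply: difM; first exact: ell_dif.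
have d1 : dif (fun y => p / y) x.
  exact: dif_div x0 (dif_cst _ _) (dif_id _).
exact: (@dif_comp R R[i]^o (ell p 0) _ x d1 (ell_dif p1 z1 _)).
Qed.

Lemma theta_neq0 x : x != 0 -> x != 1 -> nm p < nm x < (nm p)^-1 -> theta p x != 0.
Proof.
move=> x0 x1 /andP[h1 h2]; have z1 : nm (0 : R[i]) < 1 by rewrite nm0.
have np : 0 < nm p by rewrite nm_gt0.
rewrite thetaE; apply: mulf_neq0; first by rewrite subr_eq0 eq_sym.
apply: mulf_neq0; apply: ell_neq0 => //.
  by rewrite nmM -ltr_pdivlMl // mulr1.
by rewrite nmM nmV ltr_pdivrMr ?mul1r // nm_gt0.
Qed.

End Theta.

End EllipticProducts.

(** * The partial fraction identity for theta functions *)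

Section ThetaIdentity.
Variable R : realType.
Local Notation dif f z := (differentiable (f : R[i]^o -> R[i]^o) (z : R[i]^o)).
Variable p : R[i].
Hypotheses (p1 : nm p < 1) (p0 : p != 0).
Local Notation theta := (theta p).

Lemma theta_unshift (x : R[i]) : x != 0 -> theta (x / p) = - (x / p) * theta x.
Proof.
move=> x0; have xp0 : x / p != 0 by rewrite mulf_neq0 ?invr_eq0.
have := theta_shift p1 p0 xp0; rewrite mulrC divfK // => e; rewrite e.
by rewrite mulrA mulrNN mulfV // mul1r.
Qed.

Lemma theta_shiftn (x : R[i]) n : x != 0 -> (theta (p ^+ n * x) == 0) = (theta x == 0).
Proof.
move=> x0; elim: n => [|n IH]; first by rewrite expr0 mul1r.
rewrite exprS -mulrA theta_shift //; last by rewrite mulf_neq0 ?expf_neq0.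
by rewrite mulf_eq0 oppr_eq0 invr_eq0 mulf_eq0 expf_eq0 (negPf p0) (negPf x0) andbF IH.
Qed.

(** The zeros are the integral powers of p; two natural exponents stand for one integer. *)
Lemma theta_eq0 (x : R[i]) : x != 0 ->
  theta x = 0 <-> exists a b, p ^+ a * x = p ^+ b.
Proof.
have z1 : nm (0 : R[i]) < 1 by rewrite nm0.
move=> x0; split=> [/eqP|[a [b h]]].
  rewrite /theta mulf_eq0 => /orP[] /eqP /ell_zero => /(_ p1 z1) [j [k h]].
    exists j, 0%N; case: k h => [|k]; first by rewrite !expr0 mulr1.
    by rewrite exprS mul0r mulr0 mul0r => /eqP; rewrite eq_sym oner_eq0.
  exists 0%N, j.+1; case: k h => [|k].
    rewrite !expr0 mulr1 mul1r mulrA -exprSr => h.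
    by rewrite -[x]mul1r -h divfK.
  by rewrite exprS mul0r mulr0 mul0r => /eqP; rewrite eq_sym oner_eq0.
apply/eqP; rewrite -(theta_shiftn a) // h -[p ^+ b]mulr1 theta_shiftn ?oner_eq0 //.
by rewrite theta1.
Qed.

(** As functions of v, all [chi Y x] have the same multiplier (Y / p) v^(-2), independent of x, and
    thus lie in one space of dimension at most two. *)
Let chi (Y x v : R[i]) : R[i] := theta (x / v) * theta (x * v / Y).

Let chi_dif (Y x v : R[i]) : Y != 0 -> x != 0 -> v != 0 -> dif (chi Y x) v.
Proof.
move=> Y0 x0 v0; apply: difM.
  have d1 : dif (fun w => x / w) v by exact: dif_div v0 (dif_cst _ _) (dif_id _).
  have d2 : dif theta (x / v) by apply: theta_dif; rewrite ?mulf_neq0 ?invr_eq0.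
  exact: (@dif_comp R R[i]^o theta _ v d1 d2).
have d1 : dif (fun w => x * w / Y) v.
  by apply: difM; [apply: difM; [exact: dif_cst|exact: dif_id]|exact: dif_cst].
have d2 : dif theta (x * v / Y) by apply: theta_dif; rewrite ?mulf_neq0 ?invr_eq0.
exact: (@dif_comp R R[i]^o theta _ v d1 d2).
Qed.

Let chi_shift (Y x v : R[i]) : Y != 0 -> x != 0 -> v != 0 ->
  chi Y x (p * v) = (Y / p) * v^-1 ^+ 2 * chi Y x v.
Proof.
move=> Y0 x0 v0; rewrite /chi.
have -> : x / (p * v) = (x / v) / p by field; rewrite p0 v0.
have -> : x * (p * v) / Y = p * (x * v / Y) by field.
rewrite theta_unshift ?mulf_neq0 ?invr_eq0 // theta_shift ?mulf_neq0 ?invr_eq0 //.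
set a := theta _; set b := theta _; field.
by rewrite p0 v0 x0 Y0.
Qed.

(** Up to a common factor, the sum over a period annulus of the residues of the product over j of
    theta (z / y_j) / theta (z / x_j) against dz / z, a function that is p-periodic when the x_j and
    the y_j have the same product. *)
Definition theta_sum m (x y : 'I_m -> R[i]) :=
  \sum_k (\prod_j theta (x k / y j)) / \prod_(j | j != k) theta (x k / x j).

Lemma theta_neqS (x : R[i]) : x != 0 -> (theta x^-1 == 0) = (theta x == 0).
Proof. by move=> x0; rewrite thetaV // mulf_eq0 oppr_eq0 invr_eq0 (negPf x0). Qed.

Let theta_sum2 (x y : 'I_2 -> R[i]) :
  (forall i, x i != 0) -> (forall i, y i != 0) -> \prod_i x i = \prod_i y i ->
  theta_sum x y = 0.
Proof.
move=> x0 y0; rewrite /theta_sum !big_ord_recl !big_ord0.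
rewrite ![\prod_(_ | _) _]big_mkcond !big_ord_recl !big_ord0 /=.
set a := x ord0; set b := x (lift ord0 ord0).
set c := y ord0; set d := y (lift ord0 ord0).
have [a0 b0 c0 d0] : [/\ a != 0, b != 0, c != 0 & d != 0]
  by split; [exact: x0|exact: x0|exact: y0|exact: y0].
rewrite !mulr1 !addr0 !mul1r => h.
have -> : b / c = (a / d)^-1 by rewrite invf_div; apply/eqP; rewrite eqr_div // mulrC h mulrC.
have -> : b / d = (a / c)^-1.
  by rewrite invf_div; apply/eqP; rewrite eqr_div // mulrC h.
have -> : b / a = (a / b)^-1 by rewrite invf_div.
rewrite !thetaV ?mulf_neq0 ?invr_eq0 //.
have [->|t0] := eqVneq (theta (a / b)) 0; first by rewrite mulr0 invr0 !mulr0 addr0.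
have -> : d = a * b / c by rewrite h mulrAC mulfV // mul1r.
move: t0; set A := theta _; set B := theta _; set C := theta _ => t0; field.
by rewrite a0 b0 c0 t0.
Qed.

(** Induction on the number of points. With Y = y_0 y_1 fixed, the sum becomes a theta function
    [Phi] of degree two in v = y_0, which by induction has too many zeros to be nonzero. *)
Theorem theta_identity m (x y : 'I_m.+1 -> R[i]) :
  (forall i, x i != 0) -> (forall i, y i != 0) -> \prod_i x i = \prod_i y i ->
  (forall i j, i != j -> theta (x i / x j) != 0) -> theta_sum x y = 0.
Proof.
elim: m x y => [|[|m] IH] x y x0 y0 xy xne.
- move: xy; rewrite /theta_sum !big_ord1 => ->.
  by rewrite mulfV // theta1 // mul0r.
- exact: theta_sum2.
pose y0' := y ord0; pose y1' := y (lift ord0 ord0).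
pose Y : R[i] := y0' * y1'.
have Y0 : Y != 0 by exact: mulf_neq0 (y0 _) (y0 _).
pose c k := (\prod_(j < m.+1) theta (x k / y (lift ord0 (lift ord0 j)))) /
  \prod_(j | j != k) theta (x k / x j).
pose Phi v := \sum_k chi Y (x k) v * c k.
have -> : theta_sum x y = Phi y0'.
  apply: eq_bigr => k _; rewrite big_ord_recl big_ord_recl /c /chi -/y0' -/y1'.
  have -> : x k * y0' / Y = x k / y1' by rewrite /Y; field; rewrite !y0.
  set A := theta _; set B := theta _; set C := \prod_(_ < _) _; set D := \prod_(_ | _) _.
  by rewrite !mulrA.
(* At v = x_i the term k = i vanishes, and in the others theta (x_k / x_i) cancels; what is left is
   the identity without x_i, with y_0 and y_1 replaced by the single point Y / x_i. *)
have Phi0 i : Phi (x i) = 0.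
  rewrite /Phi (bigD1_ord i) //= {1}/chi mulfV // theta1 // !mul0r add0r.
  pose y2 (j : 'I_m.+2) := if unlift ord0 j is Some j' then
     y (lift ord0 (lift ord0 j')) else Y / x i.
  have y20 : y2 ord0 = Y / x i by rewrite /y2 unlift_none.
  have y2S j : y2 (lift ord0 j) = y (lift ord0 (lift ord0 j)) by rewrite /y2 liftK.
  rewrite -[RHS](@IH (fun k => x (lift i k)) y2) //.
  - apply: eq_bigr => k _; rewrite [in RHS]big_ord_recl /c y20.
    have -> : \prod_(j | j != lift i k) theta (x (lift i k) / x j) =
      theta (x (lift i k) / x i) * \prod_(j | j != k) theta (x (lift i k) / x (lift i j)).
      rewrite (bigD1_ord i) ?neq_lift //=; congr (_ * _).
      by apply: eq_bigl => j; rewrite (inj_eq lift_inj).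
    have tne : theta (x (lift i k) / x i) != 0 by apply: xne; rewrite eq_sym neq_lift.
    under [X in _ = _ * X / _]eq_bigr do rewrite y2S.
    rewrite /chi (_ : x (lift i k) / (Y / x i) = x (lift i k) * x i / Y); last by field; rewrite Y0 x0.
    move: tne; set A := theta _; set B := theta _; set C := \prod_(_ < _) _; set D := \prod_(_ | _) _ => tne.
    by rewrite invfM; set E := D^-1; field.
  - by move=> j; rewrite /y2; case: unliftP => [j' _|_] //; rewrite mulf_neq0 ?invr_eq0.
  - rewrite [RHS]big_ord_recl y20; under [X in _ = _ * X]eq_bigr do rewrite y2S.
    apply: (mulfI (x0 i)); rewrite [RHS]mulrA [x i * (Y / x i)]mulrC divfK //.
    have <- := bigD1_ord i (P := xpredT) (F := x) isT.
    by rewrite xy big_ord_recl big_ord_recl mulrA.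
  - by move=> j k jk; apply: xne; rewrite (inj_eq lift_inj).
(* If theta vanished at x_0 x_2 / Y and at x_1 x_2 / Y, it would vanish at their quotient x_0 / x_1,
   which is excluded. *)
have [i1 [i2 [ii hi]]] : exists i1 i2, i1 != i2 /\ theta (x i1 * x i2 / Y) != 0.
  pose o0 : 'I_m.+3 := ord0; pose o1 : 'I_m.+3 := lift ord0 ord0.
  pose o2 : 'I_m.+3 := lift ord0 (lift ord0 ord0).
  have [h1|h1] := eqVneq (theta (x o0 * x o2 / Y)) 0; last by exists o0, o2.
  have [h2|h2] := eqVneq (theta (x o1 * x o2 / Y)) 0; last by exists o1, o2.
  exfalso; have /eqP := xne o0 o1 isT; apply.
  move/theta_eq0 : h1 => []; first by rewrite !mulf_neq0 ?invr_eq0.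
  move=> a [b h1]; move/theta_eq0 : h2 => []; first by rewrite !mulf_neq0 ?invr_eq0.
  move=> a' [b' h2]; apply/theta_eq0; first by rewrite mulf_neq0 ?invr_eq0.
  exists (a + b')%N, (b + a')%N; rewrite !exprD -h1 -h2.
  by field; rewrite Y0 x0.
(* Three functions in a space of dimension at most two. Evaluated at x_i1 and x_i2, where [Phi]
   vanishes, a linear relation loses its [chi] terms, so [Phi] itself is 0. *)
pose f (k : 'I_3) : R[i] -> R[i] := nth Phi [:: Phi; chi Y (x i1); chi Y (x i2)] k.
have aY : Y / p != 0 by rewrite mulf_neq0 ?invr_eq0.
have dPhi z : z != 0 -> dif Phi z.
  by move=> z0; apply: dif_sum => k _; apply: difM; [exact: chi_dif|exact: dif_cst].
have sPhi z : z != 0 -> Phi (p * z) = Y / p * z^-1 ^+ 2 * Phi z.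
  by move=> z0; rewrite /Phi big_distrr; apply: eq_bigr => k _ /=; rewrite chi_shift // mulrA.
have [||b [[k0 bk0] hb]] := @theta2_dependent R f p (Y / p) p0 aY.
- by case=> [[|[|[|//]]] ?] z z0; rewrite /f /=; [exact: dPhi|exact: chi_dif|exact: chi_dif].
- by case=> [[|[|[|//]]] ?] z z0; rewrite /f /=; [exact: sPhi|exact: chi_shift|exact: chi_shift].
have {hb} hb z : z != 0 -> b ord0 * Phi z + (b (lift ord0 ord0) * chi Y (x i1) z +
    b (lift ord0 (lift ord0 ord0)) * chi Y (x i2) z) = 0.
  by move=> /hb; rewrite !big_ord_recl big_ord0 addr0.
have chi0 i : chi Y (x i) (x i) = 0 by rewrite /chi mulfV // theta1 // mul0r.
have b2 : b (lift ord0 (lift ord0 ord0)) = 0.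
  have := hb _ (x0 i1); rewrite Phi0 chi0 !mulr0 !add0r => /eqP.
  rewrite mulf_eq0 => /orP[/eqP //|]; rewrite /chi mulf_eq0 => /orP[h|].
    by have := xne i2 i1; rewrite eq_sym ii h => /(_ isT).
  by rewrite mulrC [x i2 * _]mulrC -[Y^-1 * _]mulrC (negPf hi).
have b1 : b (lift ord0 ord0) = 0.
  have := hb _ (x0 i2); rewrite Phi0 chi0 !mulr0 add0r addr0 => /eqP.
  rewrite mulf_eq0 => /orP[/eqP //|]; rewrite /chi mulf_eq0 (negPf hi) orbF => h.
  by have := xne i1 i2 ii; rewrite h.
have := hb _ (y0 ord0); rewrite b1 b2 !mul0r !addr0 => /eqP.
rewrite mulf_eq0 => /orP[/eqP b00|/eqP //].
case/eqP: bk0; case: k0 => [[|[|[|//]]] lt3].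
- by rewrite -b00; congr (b _); apply: val_inj.
- by rewrite -b1; congr (b _); apply: val_inj.
- by rewrite -b2; congr (b _); apply: val_inj.
Qed.

End ThetaIdentity.

(** * The elliptic gamma function and its functional equations *)

Section EllipticGamma.
Variable R : realType.
Local Notation dif f z := (differentiable (f : R[i]^o -> R[i]^o) (z : R[i]^o)).
Implicit Types (p q x y z : R[i]).

Lemma egammaC p q x : nm p < 1 -> nm q < 1 -> egamma p q x = egamma q p x.
Proof. by move=> p1 q1; rewrite (egammaE _ p1 q1) (egammaE _ q1 p1) (mulrC p q) (ellC p q x) (ellC p q (q * p / x)). Qed.

(* Gamma(y; p, q) = gamma_reg p q y / (1 - y), where gamma_reg is regular and
   nonzero at y = 1. *)
Definition gamma_reg p q y : R[i] :=
  ell p q (p * q / y) / (ell p 0 (p * y) * ell p q (q * y)).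

Section Fixed.
Variables p q : R[i].
Hypotheses (p1 : nm p < 1) (p0 : p != 0) (q1 : nm q < 1) (q0 : q != 0).

Let z1 : nm (0 : R[i]) < 1. Proof. by rewrite nm0. Qed.

Lemma egamma_reg y : egamma p q y = gamma_reg p q y / (1 - y).
Proof.
rewrite egammaE // (ell_split y p1 q1) (ell0S y p1) /gamma_reg.
set a := ell _ _ (p * q / y); set b := ell _ _ (p * y); set c := ell _ _ (q * y).
by rewrite -(mulrA (1 - y)) invfM mulrCA mulrC.
Qed.

Let npq : nm (p * q) < 1.
Proof. by rewrite nmM mulr_ilt1 ?nm_ge0. Qed.

Let ell_comp f y : dif f y -> dif (fun w => ell p q (f w)) y.
Proof. by move=> df; exact: (@dif_comp R R[i]^o (ell p q) f y df (ell_dif p1 q1 _)). Qed.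

Let dif_inv y a : y != 0 -> dif (fun w => a / w) y.
Proof. by move=> y0; exact: dif_div y0 (dif_cst _ _) (dif_id _). Qed.

Let dif_lin a y : dif (fun w => a * w) y.
Proof. by apply: difM; [exact: dif_cst|exact: dif_id]. Qed.

Let den_dif y : dif (fun y => ell p 0 (p * y) * ell p q (q * y)) y.
Proof.
apply: difM; last exact: ell_comp.
exact: (@dif_comp R R[i]^o (ell p 0) _ y (dif_lin p y) (ell_dif p1 z1 _)).
Qed.

Let den_neq0 y : nm p * nm y < 1 -> nm q * nm y < 1 ->
  ell p 0 (p * y) * ell p q (q * y) != 0.
Proof. by move=> h1 h2; apply: mulf_neq0; apply: ell_neq0; rewrite ?nmM. Qed.

Let num_neq0 y : nm (p * q) < nm y -> ell p q (p * q / y) != 0.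
Proof.
move=> h; apply: ell_neq0 => //.
by rewrite nmM nmV ltr_pdivrMr ?mul1r //; apply: le_lt_trans h; exact: nm_ge0.
Qed.

Let pos_neq0 y : nm (p * q) < nm y -> y != 0.
Proof. by move=> h; rewrite -nm_gt0; apply: le_lt_trans h; exact: nm_ge0. Qed.

Lemma gamma_reg_dif y : y != 0 -> nm p * nm y < 1 -> nm q * nm y < 1 ->
  dif (gamma_reg p q) y.
Proof.
move=> y0 h1 h2; apply: (dif_div (den_neq0 h1 h2) _ (den_dif y)).
by apply: ell_comp; exact: dif_inv.
Qed.

Lemma gamma_regV_dif y : nm (p * q) < nm y -> dif (fun y => (gamma_reg p q y)^-1) y.
Proof.
move=> h; rewrite (_ : (fun y => _) =
    fun y => (ell p 0 (p * y) * ell p q (q * y)) / ell p q (p * q / y)); last first.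
  by apply/funext => w; rewrite /gamma_reg invf_div.
apply: (dif_div (num_neq0 h) (den_dif y)).
by apply: ell_comp; apply: dif_inv; exact: pos_neq0.
Qed.

Lemma gamma_reg_neq0 y : nm (p * q) < nm y -> nm p * nm y < 1 -> nm q * nm y < 1 ->
  gamma_reg p q y != 0.
Proof.
by move=> h h1 h2; rewrite mulf_neq0 ?invr_eq0 ?num_neq0 ?den_neq0.
Qed.

Let unit_den y : nm y < 1 -> nm p * nm y < 1 /\ nm q * nm y < 1.
Proof. by move=> y1; split; rewrite mulr_ilt1 ?nm_ge0. Qed.

Let sub1 y : nm y < 1 -> 1 - y != 0.
Proof.
by move=> y1; rewrite subr_eq0; apply/eqP => e; move: y1; rewrite -e nm1 ltxx.
Qed.

Lemma egamma_dif y : 0 < nm y < 1 -> dif (egamma p q) y.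
Proof.
move=> /andP[y0 y1]; have [h1 h2] := unit_den y1; rewrite nm_gt0 in y0.
rewrite (_ : egamma p q = fun y => gamma_reg p q y / (1 - y)); last first.
  by apply/funext => w; rewrite egamma_reg.
apply: (dif_div (sub1 y1) (gamma_reg_dif y0 h1 h2)).
by apply: difB; [exact: dif_cst|exact: dif_id].
Qed.

Lemma egammaV_dif y : nm (p * q) < nm y -> dif (fun y => (egamma p q y)^-1) y.
Proof.
move=> h; rewrite (_ : (fun y => _) = fun y => (1 - y) * (gamma_reg p q y)^-1); last first.
  by apply/funext => w; rewrite egamma_reg invf_div mulrC.
apply: difM; last exact: gamma_regV_dif.
by apply: difB; [exact: dif_cst|exact: dif_id].
Qed.

Lemma egamma_neq0 y : nm (p * q) < nm y < 1 -> egamma p q y != 0.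
Proof.
move=> /andP[h y1]; have [h1 h2] := unit_den y1.
by rewrite egamma_reg mulf_neq0 ?gamma_reg_neq0 ?invr_eq0 ?sub1.
Qed.

Lemma egamma_refl y : nm (p * q) < nm y < 1 -> egamma p q y * egamma p q (p * q / y) = 1.
Proof.
move=> /andP[h y1]; have y0 := pos_neq0 h.
rewrite !egammaE // (_ : p * q / (p * q / y) = y); last by field; rewrite q0 p0 y0.
have := ell_neq0 p1 q1 y1; have := num_neq0 h.
by set a := ell _ _ _; set b := ell _ _ _ => a0 b0; rewrite mulrA divfK // mulfV.
Qed.

Lemma egamma_theta x : x != 0 -> nm x < 1 -> egamma p q (q * x) = theta p x * egamma p q x.
Proof.
move=> x0 x1; rewrite !egammaE // (ell_split x p1 q1).
rewrite (_ : p * q / (q * x) = p / x); last by field; rewrite q0 x0.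
rewrite (ell_split (p / x)) // (_ : q * (p / x) = p * q / x); last by field.
have h1 : ell p 0 x != 0 by exact: ell_neq0.
rewrite /theta; move: h1; set a := ell _ _ _; set b := ell _ _ _; set c := ell _ _ _; set d := ell _ _ _.
by move=> h1; rewrite invfM; set e := d^-1; field.
Qed.

(** Stated for reciprocals in order to cover |x| = 1, including the pole x = 1, where both sides are
    0. It is needed for the quotients z_i / z_j on the torus. *)
Lemma egammaV_theta x : nm p < nm x ->
  (egamma p q x)^-1 = theta p x * (egamma p q (q * x))^-1.
Proof.
move=> h; have x0 : x != 0 by rewrite -nm_gt0; apply: le_lt_trans h; exact: nm_ge0.
rewrite !egammaE // !invf_div (ell_split x p1 q1).
rewrite (_ : p * q / (q * x) = p / x); last by field; rewrite q0 x0.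
rewrite (ell_split (p / x)) // (_ : q * (p / x) = p * q / x); last by field.
have h1 : ell p 0 (p / x) != 0.
  by apply: ell_neq0 => //; rewrite nmM nmV ltr_pdivrMr ?mul1r // nm_gt0.
rewrite /theta; move: h1; set a := ell _ _ (p / x); set b := ell _ _ _; set c := ell _ _ _; set d := ell _ _ _.
by move=> h1; rewrite invfM; set e := d^-1; field.
Qed.

(** The leading coefficient at the pole, from which the factors (p;p) and (q;q) in the normalization
    of the integral arise. *)
Lemma gamma_reg1 : gamma_reg p q 1 = (qpoch p * qpoch q)^-1.
Proof.
rewrite /gamma_reg !mulr1 divr1 !qpochE // (ellC p q q) (ell_split q q1 p1).
rewrite (ellC q p) mulrA invfM mulrCA mulfV ?mulr1 //; exact: ell_neq0.
Qed.

Lemma qpoch_neq0 : qpoch p != 0.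
Proof. by rewrite qpochE // ell_neq0. Qed.

End Fixed.
End EllipticGamma.

(** * Torus integrals as limits of grid averages *)

Section RiemannSums.
Variable R : realType.
Notation mu := (@lebesgue_measure R).

Section RealFunction.
Variables (f : R -> R) (L : R).
Hypothesis fL : forall a b, `|f a - f b| <= L * `|a - b|.

Let L0 : 0 <= L.
Proof. by have := fL 1 0; rewrite subr0 normr1 mulr1; apply: le_trans. Qed.

Lemma lipschitz_continuous : continuous f.
Proof.
move=> x; apply/cvgrPdist_lt => e e0.
have L1 : 0 < L + 1 by rewrite ltr_wpDl.
have e1 : 0 < (L + 1)^-1 * e by rewrite mulr_gt0 ?invr_gt0.
apply/nbhs_ballP; exists ((L + 1)^-1 * e) => //= y xy.
apply: le_lt_trans (fL x y) _.
apply: le_lt_trans (_ : (L + 1) * `|x - y| < _); first by rewrite ler_wpM2r // lerDl.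
by rewrite -ltr_pdivlMl.
Qed.

Let cint (g : R -> R) (i : interval R) (a b : R) : continuous g ->
  [set` i] `<=` `[a, b] -> mu.-integrable [set` i] (EFin \o g).
Proof.
move=> cg iab; apply: (@integrableS _ _ _ mu `[a, b]%classic) => //.
apply: continuous_compact_integrable; first exact: segment_compact.
exact/continuous_subspaceT.
Qed.

Let fint (i : interval R) (a b : R) : [set` i] `<=` `[a, b] -> mu.-integrable [set` i] (EFin \o f).
Proof. by apply: cint; exact: lipschitz_continuous. Qed.

Let piece (a b : R) : a <= b ->
  `|\int[mu]_(x in `]a, b]) f x - f a * (b - a)| <= L * (b - a) ^+ 2.
Proof.
move=> ab; have ba : 0 <= b - a by rewrite subr_ge0.
have hi : mu.-integrable `]a, b] (EFin \o f).
  by apply: (@fint _ a b) => x; rewrite /= !in_itv /= => /andP[/ltW -> ->].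
have hc (r : R) : mu.-integrable `]a, b] (EFin \o (fun=> r)).
  apply: (@cint _ _ a b) => [x|x]; first exact: cvg_cst.
  by rewrite /= !in_itv /= => /andP[/ltW -> ->].
have mc (r : R) : \int[mu]_(x in `]a, b]) r = r * (b - a).
  rewrite (@Rintegral_cst _ _ R mu `]a, b]%classic (measurable_itv _) r).
  congr (_ * _); have := @lebesgue_measure_itv R `]a, b]; rewrite /= lte_fin => ->.
  by case: ltgtP ab => // -> _; rewrite subrr.
have fb x : `]a, b]%classic x -> `|f x - f a| <= L * (b - a).
  rewrite /= in_itv /= => /andP[ax xb]; apply: le_trans (fL _ _) _.
  by apply: ler_wpM2l => //; rewrite ger0_norm; lra.
have h1 : \int[mu]_(x in `]a, b]) f x <= (f a + L * (b - a)) * (b - a).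
  rewrite -mc; apply: le_Rintegral => // x /fb; rewrite ler_norml => /andP[_].
  by rewrite lerBlDl.
have h2 : (f a - L * (b - a)) * (b - a) <= \int[mu]_(x in `]a, b]) f x.
  rewrite -mc; apply: le_Rintegral => // x /fb; rewrite ler_norml => /andP[h _].
  by move: h; rewrite lerBrDl.
rewrite ler_norml; move: h1 h2; set I := \int[mu]_(x in _) _ => h1 h2.
by apply/andP; split; lra.
Qed.

Lemma riemann_sum M : (0 < M)%N ->
  `|\int[mu]_(x in `[0, 1]) f x - M%:R^-1 * \sum_(k < M) f (k%:R / M%:R)| <= L / M%:R.
Proof.
move=> M0; have MR : 0 < M%:R :> R by rewrite ltr0n.
have key k : `|\int[mu]_(x in `[0, k%:R / M%:R]) f x -
    M%:R^-1 * \sum_(j < k) f (j%:R / M%:R)| <= k%:R * (L / M%:R ^+ 2).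
  elim: k => [|k IH].
    by rewrite mul0r set_itv1 Rintegral_set1 big_ord0 mulr0 subrr normr0 mul0r.
  have kk : k%:R / M%:R <= k.+1%:R / M%:R :> R by rewrite ler_pM2r ?invr_gt0 // ler_nat.
  have k0 : 0 <= k%:R / M%:R :> R by rewrite divr_ge0.
  have := @Rintegral_itvB R f (BLeft 0) (BRight (k.+1%:R / M%:R)) (k%:R / M%:R).
  rewrite !bnd_simp => /(_ (@fint _ 0 (k.+1%:R / M%:R) (@subset_refl _ _)) k0 kk) e.
  have := piece kk; rewrite -e.
  have -> : k.+1%:R / M%:R - k%:R / M%:R = M%:R^-1 :> R.
    by rewrite -mulrBl -natrB ?subSnn ?mul1r // leqnSn.
  rewrite exprVn (_ : k.+1%:R = 1 + k%:R); last by rewrite -natr1 addrC.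
  rewrite big_ord_recr /= [M%:R^-1 * (_ + _)]mulrDr.
  move: IH; set A := \int[mu]_(x in _) _; set B := \int[mu]_(x in _) _.
  set s := M%:R^-1 * \sum_(i < k) _; set g := f _ => h1 h2.
  rewrite mulrDl mul1r.
  rewrite (_ : B - _ = (B - A - g * M%:R^-1) + (A - s)); last by ring.
  by apply: le_trans (ler_normD _ _) _; exact: lerD.
have := key M; rewrite divff ?gt_eqF //; congr (_ <= _).
by rewrite expr2 invfM mulrCA (mulrA M%:R) mulrCA mulrA divff ?gt_eqF // mul1r mulrC.
Qed.

End RealFunction.

Lemma ee_lipschitz (a b : R) : nm (ee a - ee b) <= 4 * pi * `|a - b|.
Proof.
have hc (x y : R) : `|cos x - cos y| <= `|x - y|.
  have [->|xy] := eqVneq x y; first by rewrite !subrr normr0.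
  wlog lxy : x y xy / x < y.
    move=> H; case: (ltgtP x y) xy => // h _; first by apply: H => //; rewrite lt_eqF.
    by rewrite distrC (distrC x); apply: H => //; rewrite lt_eqF.
  have [c _ e] := @MVT R cos (fun x => - sin x) x y lxy (fun x _ => is_derive_cos x) (continuous_subspaceT (@continuous_cos R)).
  rewrite distrC e normrM normrN (distrC x) ler_piMl // ler_norml sin_geN1 //=.
have hs (x y : R) : `|sin x - sin y| <= `|x - y|.
  have e t : sin t = - cos (t + pi / 2) :> R by rewrite cosDpihalf opprK.
  rewrite !e -opprD normrN; apply: le_trans (hc _ _) _.
  by rewrite opprD addrACA subrr addr0.
apply: le_trans (nm_le_ReIm _) _; rewrite /ee /=.
have := hc (2 * pi * a) (2 * pi * b); have := hs (2 * pi * a) (2 * pi * b).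
have pi0 : 0 < pi :> R := pi_gt0 R.
rewrite -mulrBr normrM (gtr0_norm (_ : 0 < 2 * pi :> R)); last by rewrite mulr_gt0.
lra.
Qed.

Lemma circle_integral_mean (h : R[i] -> R[i]) (L : R) : 0 <= L ->
  (forall z w, nm z = 1 -> nm w = 1 -> nm (h z - h w) <= L * nm (z - w)) ->
  forall m, nm (cmean m h - circle_integral h) <= 8 * pi * L / 2 ^+ m.
Proof.
move=> L0 hL m; have M0 : (0 < 2 ^ m)%N by rewrite expn_gt0.
have lip a b : nm (h (ee a) - h (ee b)) <= 4 * pi * L * `|a - b|.
  apply: le_trans (hL _ _ (nm_ee a) (nm_ee b)) _.
  by have := ler_wpM2l L0 (ee_lipschitz a b); rewrite (mulrC (4 * pi) L) -[X in _ -> _ <= X]mulrA.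
have l1 a b : `|complex.Re (h (ee a)) - complex.Re (h (ee b))| <= 4 * pi * L * `|a - b|.
  by apply: le_trans (lip a b); rewrite -raddfB; exact: nm_Re.
have l2 a b : `|complex.Im (h (ee a)) - complex.Im (h (ee b))| <= 4 * pi * L * `|a - b|.
  by apply: le_trans (lip a b); rewrite -raddfB; exact: nm_Im.
have := riemann_sum l1 M0; have := riemann_sum l2 M0; rewrite !natrX => r2 r1.
have -> : cmean m h = Complex
    ((2 ^+ m)^-1 * \sum_(k < 2 ^ m) complex.Re (h (ee (k%:R / 2 ^+ m))))
    ((2 ^+ m)^-1 * \sum_(k < 2 ^ m) complex.Im (h (ee (k%:R / 2 ^+ m)))).
  rewrite -!raddf_sum /cmean.
  have -> : (2 ^+ m)^-1 = ((2 ^+ m)^-1)%:C%C :> R[i] by have := dyadicC R 1 m; rewrite !div1r.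
  by case: (\sum_(_ < _) _) => x y; rewrite /= mulrC; simpc; rewrite !(mulrC (2 ^+ m)^-1).
apply: le_trans (nm_le_ReIm _) _; rewrite /circle_integral -/(ee _) /=.
rewrite distrC (addrC `|_|) distrC.
have -> : 8 * pi * L / 2 ^+ m = 4 * pi * L / 2 ^+ m + 4 * pi * L / 2 ^+ m by field; rewrite expf_neq0.
exact: lerD.
Qed.

Fixpoint gmean (m n : nat) (g : seq R[i] -> R[i]) : R[i] :=
  if n is n'.+1 then cmean m (fun z => gmean m n' (fun zs => g (z :: zs))) else g [::].

Definition useq n (zs : seq R[i]) := size zs = n /\ forall z, z \in zs -> nm z = 1.

Lemma useq_cons n z zs : nm z = 1 -> useq n zs -> useq n.+1 (z :: zs).
Proof. by move=> z1 [<- h]; split=> // w; rewrite inE => /orP[/eqP ->|/h]. Qed.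

Lemma cmeanB m (F G : R[i] -> R[i]) : cmean m F - cmean m G = cmean m (fun z => F z - G z).
Proof. by rewrite -mulN1r -cmeanZ -cmeanD; apply: eq_cmean => z _; rewrite mulN1r. Qed.

Lemma gmean_near m n g g' (e : R) : (forall zs, useq n zs -> nm (g zs - g' zs) <= e) ->
  nm (gmean m n g - gmean m n g') <= e.
Proof.
elim: n g g' => [|n IH] g g' h /=; first exact: h.
rewrite cmeanB; apply: cmean_le => a _; apply: IH => zs hzs; apply: h.
exact: useq_cons (nm_ee a) hzs.
Qed.

Lemma tends_dyadic (u : nat -> R[i]) l (c : R) :
  (forall m, nm (u m - l) <= c / 2 ^+ m) -> tends u l.
Proof.
move=> h e e0; have c0 : 0 <= c.
  by have := le_trans (nm_ge0 _) (h 0%N); rewrite expr0 divr1.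
have [||N hN] := @pow_small R 2^-1 (e / (c + 1)).
- by rewrite invr_ge0 ler0n invf_lt1 ?ltr1n.
- by rewrite divr_gt0 // ltr_wpDl.
exists N => n /hN; rewrite ltr_pdivlMr; last by rewrite ltr_wpDl.
move=> hn; apply: le_lt_trans (h n) _; apply: le_lt_trans hn.
by rewrite -exprVn mulrC ler_wpM2l ?exprn_ge0 ?invr_ge0 // lerDl.
Qed.

Definition lipseq n (g : seq R[i] -> R[i]) (L : R) := forall zs ws, useq n zs -> useq n ws ->
  nm (g zs - g ws) <= L * \sum_(i < n) nm (zs`_i - ws`_i).

(** Induction on the dimension. As a limit of averages, the inner integral inherits the Lipschitz
    constant L in the outer variable, so the one-dimensional estimate applies to it. *)
Lemma gmean_torus_integral n g (L : R) : 0 <= L -> lipseq n g L ->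
  forall m, nm (gmean m n g - torus_integral n g) <= n%:R * (8 * pi * L) / 2 ^+ m.
Proof.
move=> L0; elim: n g => [|n IH] g gL m.
  by rewrite /= subrr nm0 !mul0r.
have gz z : nm z = 1 -> lipseq n (fun zs => g (z :: zs)) L.
  move=> z1 zs ws hz hw; have := gL _ _ (useq_cons z1 hz) (useq_cons z1 hw).
  by rewrite big_ord_recl /= subrr nm0 add0r.
pose h z := torus_integral n (fun zs => g (z :: zs)).
have hL z w : nm z = 1 -> nm w = 1 -> nm (h z - h w) <= L * nm (z - w).
  move=> z1 w1.
  have t1 := tends_dyadic (IH _ (gz z z1)); have t2 := tends_dyadic (IH _ (gz w w1)).
  have := tendsD t1 (tendsZ (-1) t2); rewrite mulN1r => t.
  apply: (@tends_le _ _ _ _ 0%N t) => k _; rewrite mulN1r; apply: gmean_near => zs hzs.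
  apply: le_trans (gL _ _ (useq_cons z1 hzs) (useq_cons w1 hzs)) _.
  by rewrite big_ord_recl /= big1 ?addr0 // => i _; rewrite subrr nm0.
rewrite /= -/(h _); apply: le_trans (nm_dist _ (cmean m h) _) _.
have h1 : nm (cmean m (fun z => gmean m n (fun zs => g (z :: zs))) - cmean m h) <=
    n%:R * (8 * pi * L) / 2 ^+ m.
  by rewrite cmeanB; apply: cmean_le => a _; exact: IH (gz _ (nm_ee a)) m.
have h2 := circle_integral_mean L0 hL m.
apply: le_trans (lerD h1 h2) _; have -> : n.+1%:R = n%:R + 1 :> R by rewrite natr1.
set c := 8 * pi * L; rewrite [X in _ <= X / _]mulrDl mul1r mulrDl.
by [].
Qed.

End RiemannSums.

Section Cons.
Variables (A : Type) (n : nat).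

Definition ocons (a : A) (f : 'I_n -> A) : 'I_n.+1 -> A :=
  fun i => oapp f a (unlift ord0 i).

Lemma ocons0 a f : ocons a f ord0 = a.
Proof. by rewrite /ocons unlift_none. Qed.

Lemma oconsS a f i : ocons a f (lift ord0 i) = f i.
Proof. by rewrite /ocons liftK. Qed.

Lemma ocons_eta (f : 'I_n.+1 -> A) : ocons (f ord0) (fun i => f (lift ord0 i)) = f.
Proof. by apply/funext => i; case: (unliftP ord0 i) => [j|] ->; rewrite ?oconsS ?ocons0. Qed.

End Cons.

Lemma sum_ffun_recl (V : nmodType) (T : finType) n (P : pred {ffun 'I_n.+1 -> T})
    (F : {ffun 'I_n.+1 -> T} -> V) :
  \sum_(k | P k) F k =
  \sum_a \sum_(k : {ffun 'I_n -> T} | P [ffun i => ocons a k i]) F [ffun i => ocons a k i].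
Proof.
rewrite pair_big_dep /=.
rewrite (reindex (fun p : T * {ffun 'I_n -> T} => [ffun i => ocons p.1 p.2 i])) //=.
exists (fun k : {ffun 'I_n.+1 -> T} => (k ord0, [ffun i => k (lift ord0 i)])).
  by move=> [a k] _ /=; rewrite ffunE ocons0; congr pair; apply/ffunP => i; rewrite !ffunE oconsS.
move=> k _; apply/ffunP => i; rewrite ffunE /=.
by case: (unliftP ord0 i) => [j|] ->; rewrite ?oconsS ?ocons0 ?ffunE.
Qed.

(** * Symmetric averages over grids of roots of unity *)

Section Grid.
Variable R : realType.
Implicit Types (m n : nat).

(** Exponents modulo 2^m. The successor form gives the ordinal its additive group structure, of
    which [rou] is a character. *)
Definition grid m := 'I_((2 ^ m).-1.+1).

Definition rou m (k : grid m) : R[i] := ee (k%:R / 2 ^+ m).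

Lemma rou_mod m k : ee ((k %% 2 ^ m)%N%:R / 2 ^+ m) = ee (k%:R / 2 ^+ m) :> R[i].
Proof.
have M0 : (2 : R) ^+ m != 0 by rewrite expf_neq0.
rewrite [in RHS](divn_eq k (2 ^ m)) natrD natrM natrX mulrDl mulfK //.
by rewrite eeD ee_nat mul1r.
Qed.

Lemma rouD m (a b : grid m) : rou (a + b) = rou a * rou b.
Proof.
have -> : rou (a + b) = ee (((a + b) %% 2 ^ m)%N%:R / 2 ^+ m).
  by rewrite /rou /=; congr (ee (_%:R / _)); congr (_ %% _)%N; rewrite prednK ?expn_gt0.
by rewrite rou_mod natrD mulrDl eeD.
Qed.

Lemma nm_rou m (a : grid m) : nm (rou a) = 1. Proof. exact: nm_ee. Qed.

Lemma rou_neq0 m (a : grid m) : rou a != 0. Proof. exact: ee_neq0. Qed.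

Lemma rou0 m : rou (0 : grid m) = 1. Proof. by rewrite /rou mul0r ee0. Qed.

Lemma rouN m (a : grid m) : rou (- a) = (rou a)^-1.
Proof. by apply: (mulfI (rou_neq0 a)); rewrite -rouD subrr rou0 mulfV // rou_neq0. Qed.

Lemma rou_sum m (I : Type) (s : seq I) (P : pred I) (k : I -> grid m) :
  rou (\sum_(i <- s | P i) k i) = \prod_(i <- s | P i) rou (k i).
Proof. by apply: (big_morph _ (@rouD m) (rou0 m)). Qed.

Lemma rou_root m e : (e <= m)%N -> exists k : grid m, rou k = ee (1 / 2 ^+ e).
Proof.
move=> em; have lt : (2 ^ (m - e) < (2 ^ m).-1.+1)%N \/ e = 0%N.
  case: e em => [|e] em; [by right|left]; rewrite prednK ?expn_gt0 // ltn_exp2l //.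
  by rewrite ltn_subrL (leq_trans _ em).
case: lt => [lt|->].
  exists (Ordinal lt); rewrite /rou /= natrX; congr ee.
  rewrite -[in X in _ / X](subnK em) exprD invfM mulrA mulfV ?expf_neq0 //.
by exists 0; rewrite rou0 expr0 divr1 ee1.
Qed.

Lemma cmean_grid m (F : R[i] -> R[i]) : cmean m F = (2 ^+ m)^-1 * \sum_(a : grid m) F (rou a).
Proof.
rewrite /cmean /rou /grid; congr (_ * _).
by rewrite -(big_mkord xpredT (fun k => F (ee (k%:R / 2 ^+ m)))) -(big_mkord xpredT (fun k => F (ee (k%:R / 2 ^+ m)))) prednK ?expn_gt0.
Qed.

(* Dyadic grids are used because they are nested, so that the means of a
   Lipschitz function form a Cauchy sequence. *)
Definition tmean m n (F : ('I_n.+1 -> R[i]) -> R[i]) : R[i] :=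
  (2 ^+ m)^-1 ^+ n *
  \sum_(k : {ffun 'I_n.+1 -> grid m} | \sum_i k i == 0) F (fun i => rou (k i)).

Lemma tmean_free m n F : @tmean m n F = (2 ^+ m)^-1 ^+ n *
  \sum_(k : {ffun 'I_n -> grid m})
     F (ocons (\prod_i rou (k i))^-1 (fun i => rou (k i))).
Proof.
congr (_ * _); rewrite sum_ffun_recl (exchange_big_dep xpredT) //=.
apply: eq_bigr => k _; rewrite (big_pred1 (- \sum_i k i)).
  congr (F _); apply/funext => i; rewrite ffunE.
  by case: (unliftP ord0 i) => [j|] ->; rewrite ?oconsS ?ocons0 // rouN rou_sum.
move=> a; rewrite big_ord_recl ffunE ocons0.
by under eq_bigr do rewrite ffunE oconsS; rewrite addr_eq0.
Qed.

Lemma gmean_grid m n g : gmean m n g = (2 ^+ m)^-1 ^+ n *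
  \sum_(k : {ffun 'I_n -> grid m}) g [seq rou (k i) | i <- enum 'I_n].
Proof.
elim: n g => [|n IH] g /=.
  rewrite expr0 mul1r (eq_bigr (fun=> g [::])) => [|k _]; last first.
    by rewrite (size0nil (s := enum 'I_0)) // size_enum_ord.
  by rewrite sumr_const card_ffun !card_ord expn0.
rewrite cmean_grid sum_ffun_recl exprS -mulrA; congr (_ * _).
rewrite big_distrr; apply: eq_bigr => a _ /=; rewrite IH; congr (_ * _).
apply: eq_bigr => k _; congr g; rewrite enum_ordSl /= ffunE ocons0; congr (_ :: _).
by rewrite -map_comp; apply: eq_map => i /=; rewrite ffunE oconsS.
Qed.

Lemma tmean_gmean m n F : @tmean m n F =
  gmean m n (fun zs => F (fun i => ((\prod_(w <- zs) w)^-1 :: zs)`_i)).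
Proof.
rewrite gmean_grid tmean_free; congr (_ * _); apply: eq_bigr => k _; congr (F _).
apply/funext => i; case: (unliftP ord0 i) => [j|] ->; rewrite ?oconsS ?ocons0 /=.
  by rewrite add0n (nth_map j) ?size_enum_ord // nth_ord_enum.
by rewrite big_map big_enum.
Qed.

Definition utorus n (z : 'I_n.+1 -> R[i]) := (forall i, nm (z i) = 1) /\ \prod_i z i = 1.

Lemma grid_utorus m n (k : {ffun 'I_n.+1 -> grid m}) :
  \sum_i k i == 0 -> utorus (fun i => rou (k i)).
Proof. by move=> /eqP k0; split=> [i|]; [exact: nm_rou|rewrite -rou_sum k0 rou0]. Qed.

Lemma eq_tmean m n F G : (forall z, utorus z -> F z = G z) -> @tmean m n F = tmean m G.
Proof. by move=> FG; congr (_ * _); apply: eq_bigr => k /grid_utorus/FG. Qed.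

Lemma tmeanD m n F G : @tmean m n (fun z => F z + G z) = tmean m F + tmean m G.
Proof. by rewrite /tmean big_split mulrDr. Qed.

Lemma tmeanZ m n a F : @tmean m n (fun z => a * F z) = a * tmean m F.
Proof. by rewrite /tmean -big_distrr mulrCA. Qed.

Lemma tmean_cst m n a : @tmean m n (fun=> a) = a.
Proof.
rewrite tmean_free sumr_const card_ffun !card_ord prednK ?expn_gt0 //.
by rewrite -[a *+ _]mulr_natl natrX natrX mulrA -exprMn mulVf ?expr1n ?mul1r // expf_neq0 // pnatr_eq0.
Qed.

Lemma tmean_le m n F (B : R) : (forall z, utorus z -> nm (F z) <= B) -> nm (@tmean m n F) <= B.
Proof.
move=> FB; rewrite /tmean nmM nmX nmV nm_2X.
have -> : B = (2 ^+ m)^-1 ^+ n * \sum_(k : {ffun 'I_n.+1 -> grid m} | \sum_i k i == 0) B.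
  have := @tmean_cst m n B%:C%C; rewrite /tmean => /(congr1 (@complex.Re R)) /=.
  rewrite -rmorph_sum /=; have -> : (2 ^+ m)^-1 = ((2 ^+ m)^-1)%:C%C :> R[i].
    by have := dyadicC R 1 m; rewrite !div1r.
  set c : R := 2 ^- m; set S : R := \sum_(_ | _) _.
  by rewrite -[c%:C%C ^+ n](rmorphXn (real_complex R)) -[X in complex.Re X](rmorphM (real_complex R)) /= => <-.
apply: ler_wpM2l; first by rewrite exprn_ge0 // invr_ge0 exprn_ge0.
apply: le_trans (nm_sum _ _ _) _; apply: ler_sum => k /grid_utorus; exact: FB.
Qed.

Lemma tmean_perm m n F (s : 'I_n.+1 -> 'I_n.+1) : bijective s ->
  tmean m (fun z => F (fun i => z (s i))) = tmean m F.
Proof.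
move=> [s' sK s'K]; congr (_ * _).
pose f (k : {ffun 'I_n.+1 -> grid m}) : {ffun 'I_n.+1 -> grid m} := [ffun i => k (s' i)].
rewrite (reindex f) /=; last first.
  exists (fun k : {ffun 'I_n.+1 -> grid m} => [ffun i => k (s i)]) => k _; apply/ffunP => i; rewrite !ffunE.
    by rewrite sK.
  by rewrite s'K.
apply: eq_big => [k|k _].
  rewrite (reindex s) /=; last by exists s' => i _; rewrite ?sK ?s'K.
  by under eq_bigr do rewrite ffunE sK.
by congr (F _); apply/funext => i; rewrite ffunE sK.
Qed.

Lemma tmean_inv m n F : tmean m (fun z : 'I_n.+1 -> R[i] => F (fun i => (z i)^-1)) = tmean m F.
Proof.
congr (_ * _); rewrite (reindex_inj (@oppr_inj {ffun 'I_n.+1 -> grid m})) /=.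
apply: eq_big => [k|k _].
  by under eq_bigr do rewrite ffunE; rewrite sumrN oppr_eq0.
by congr (F _); apply/funext => i; rewrite ffunE rouN invrK.
Qed.

Lemma tmean_rot m n F (w : 'I_n.+1 -> grid m) : \sum_i w i = 0 ->
  tmean m (fun z => F (fun i => rou (w i) * z i)) = tmean m F.
Proof.
move=> w0; congr (_ * _).
rewrite [RHS](reindex_inj (@addrI {ffun 'I_n.+1 -> grid m} [ffun i => w i])) /=.
apply: eq_big => [k|k _].
  by under [in RHS]eq_bigr do rewrite !ffunE; rewrite big_split /= w0 add0r.
by congr (F _); apply/funext => i; rewrite !ffunE rouD.
Qed.

(** Once a coordinate a has been split off, the remaining ones must have product 1 / a; they are
    obtained from a point of product 1 by correcting its head. *)
Definition head_div n a (z : 'I_n.+1 -> R[i]) : 'I_n.+1 -> R[i] :=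
  fun i => if i == ord0 then z i / a else z i.

Lemma tmean_split m n F : @tmean m n.+1 F =
  cmean m (fun a => tmean m (fun z => F (ocons a (head_div a z)))).
Proof.
rewrite cmean_grid {1}/tmean exprS -mulrA; congr (_ * _).
rewrite sum_ffun_recl big_distrr; apply: eq_bigr => a _ /=; congr (_ * _).
pose c : {ffun 'I_n.+1 -> grid m} := [ffun i => if i == ord0 then - a else 0].
rewrite (reindex_inj (@addrI {ffun 'I_n.+1 -> grid m} c)) /=.
apply: eq_big => [k|k _].
  have h i : ([ffun i0 => ocons a (c + k) i0] : {ffun 'I_n.+2 -> grid m}) (lift ord0 i) =
      (if i == ord0 then - a else 0) + k i by rewrite ffunE oconsS !ffunE.
  rewrite big_ord_recl ffunE ocons0 (eq_bigr _ (fun i _ => h i)).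
  rewrite big_split /= -big_mkcond big_pred1_eq addrA subrr add0r.
  by [].
congr (F _); apply/funext => i; rewrite ffunE.
case: (unliftP ord0 i) => [j|] ->; rewrite ?oconsS ?ocons0 // !ffunE /head_div.
by case: ifP => _; rewrite ?add0r // addrC rouD rouN.
Qed.

End Grid.

(** * Holomorphic dependence of torus means, and contour shifts *)

Section Admissible.
Variable R : realType.
Local Notation dif f z := (differentiable (f : R[i]^o -> R[i]^o) (z : R[i]^o)).
Implicit Types (m n : nat).

Definition unitv n (z : 'I_n -> R[i]) := forall i, nm (z i) = 1.

Definition sdist n (z w : 'I_n -> R[i]) : R := \sum_i nm (z i - w i).

Lemma sdist_ge0 n (z w : 'I_n -> R[i]) : 0 <= sdist z w.
Proof. by apply: sumr_ge0 => i _; exact: nm_ge0. Qed.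

Lemma sdist_ge n (z w : 'I_n -> R[i]) i : nm (z i - w i) <= sdist z w.
Proof. by rewrite /sdist (bigD1 i) //= lerDl; apply: sumr_ge0 => j _; exact: nm_ge0. Qed.

(* Under these conditions the mean of F t over the torus is holomorphic in t. *)
Definition adm n (c : R[i]) (F : R[i] -> ('I_n -> R[i]) -> R[i]) :=
  exists d B L : R, [/\ 0 < d, 0 <= B, 0 <= L &
    forall t, nm (t - c) < d ->
      (forall z, unitv z -> dif (F^~ z) t /\ nm (F t z) <= B) /\
      (forall z w, unitv z -> unitv w -> nm (F t z - F t w) <= L * sdist z w)].

Lemma adm_near n c (F : R[i] -> ('I_n -> R[i]) -> R[i]) : adm c F ->
  exists2 d : R, 0 < d & forall t, nm (t - c) < d -> adm t F.
Proof.
move=> [d [B [L [d0 B0 L0 h]]]]; exists (d / 2); first by rewrite divr_gt0.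
move=> t tc; exists (d / 2), B, L; split=> //; first by rewrite divr_gt0.
move=> s st; apply: h; apply: le_lt_trans (nm_dist _ t _) _; lra.
Qed.

Lemma eq_adm n c (F G : R[i] -> ('I_n -> R[i]) -> R[i]) :
  (forall t z, F t z = G t z) -> adm c F -> adm c G.
Proof. by move=> FG; have -> : F = G by do 2! apply/funext => ?; exact: FG. Qed.

Lemma adm_cst n c (g : R[i] -> R[i]) (d : R) : 0 < d ->
  (forall t, nm (t - c) < d -> dif g t) -> @adm n c (fun t _ => g t).
Proof.
move=> d0 dg; have gc : dif g c by apply: dg; rewrite subrr nm0.
have [e e0 he] := (contCP _ _).1 (differentiable_continuous gc) 1 ltr01.
exists (Num.min d e), (nm (g c) + 1), 0; split.
- by rewrite lt_min d0.
- by rewrite addr_ge0 ?nm_ge0.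
- exact: lexx.
move=> t; rewrite lt_min => /andP[td te]; split=> [z _|z w _ _].
  split; first exact: dg.
  by have := he t te; have := nm_sub (g t) (g c); lra.
by rewrite subrr nm0 mul0r.
Qed.

Lemma admM n c (F G : R[i] -> ('I_n -> R[i]) -> R[i]) : adm c F -> adm c G ->
  adm c (fun t z => F t z * G t z).
Proof.
move=> [d [B [L [d0 B0 L0 h]]]] [d' [B' [L' [d0' B0' L0' h']]]].
exists (Num.min d d'), (B * B'), (L * B' + B * L'); split.
- by rewrite lt_min d0.
- exact: mulr_ge0.
- by rewrite addr_ge0 ?mulr_ge0.
move=> t; rewrite lt_min => /andP[/h[h1 h2] /h'[h1' h2']]; split=> [z z1|z w z1 w1].
  have [a b] := h1 z z1; have [a' b'] := h1' z z1; split; first exact: difM.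
  by rewrite nmM; apply: ler_pM => //; exact: nm_ge0.
have -> : F t z * G t z - F t w * G t w = (F t z - F t w) * G t z + F t w * (G t z - G t w).
  by ring.
apply: le_trans (nmD _ _) _; rewrite !nmM mulrDl.
have [_ b] := h1 w w1; have [_ b'] := h1' z z1.
apply: lerD; first by rewrite mulrAC; apply: ler_pM; rewrite ?nm_ge0 // h2.
by rewrite -mulrA; apply: ler_pM; rewrite ?nm_ge0 // h2'.
Qed.

Lemma admD n c (F G : R[i] -> ('I_n -> R[i]) -> R[i]) : adm c F -> adm c G ->
  adm c (fun t z => F t z + G t z).
Proof.
move=> [d [B [L [d0 B0 L0 h]]]] [d' [B' [L' [d0' B0' L0' h']]]].
exists (Num.min d d'), (B + B'), (L + L'); split.
- by rewrite lt_min d0.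
- exact: addr_ge0.
- exact: addr_ge0.
move=> t; rewrite lt_min => /andP[/h[h1 h2] /h'[h1' h2']]; split=> [z z1|z w z1 w1].
  have [a b] := h1 z z1; have [a' b'] := h1' z z1; split; first exact: difD.
  by apply: le_trans (nmD _ _) _; exact: lerD.
rewrite opprD addrACA; apply: le_trans (nmD _ _) _; rewrite mulrDl.
by apply: lerD; [exact: h2|exact: h2'].
Qed.

Lemma adm_one n c : @adm n c (fun _ _ => 1).
Proof. by apply: (@adm_cst n c (fun=> 1) 1 ltr01) => t _; exact: dif_cst. Qed.

Lemma adm_prod n c (I : Type) (s : seq I) (P : pred I)
    (F : I -> R[i] -> ('I_n -> R[i]) -> R[i]) :
  (forall i, P i -> adm c (F i)) -> adm c (fun t z => \prod_(i <- s | P i) F i t z).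
Proof.
move=> hF; elim: s => [|i s IH].
  by apply: eq_adm (adm_one n c) => t z; rewrite big_nil.
case Pi : (P i).
  by apply: eq_adm (admM (hF i Pi) IH) => t z; rewrite big_cons Pi.
by apply: eq_adm IH => t z; rewrite big_cons Pi.
Qed.

(** On the torus a factor phi (g t om z) with |om z| = 1 sees only the modulus |g t|, so annuli are
    the relevant domains of holomorphy. *)
Definition annular (phi : R[i] -> R[i]) (c : R[i]) := exists r1 r2 : R,
  [/\ 0 <= r1, r1 < nm c < r2 & forall y, r1 < nm y < r2 -> dif phi y].

(** The unimodular functions in question are z_i, 1 / z_i and z_i / z_j; the constant 2 covers the
    last. *)
Definition umono n (om : ('I_n -> R[i]) -> R[i]) :=
  (forall z, unitv z -> nm (om z) = 1) /\
  (forall z w, unitv z -> unitv w -> nm (om z - om w) <= 2 * sdist z w).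

(** [taylor2] at an increment of modulus e / 8 bounds the derivative by 17 B / e; adding the
    quadratic remainder stays below 32 B / e. Beyond distance e / 4 the trivial bound 2 B
    suffices. *)
Lemma dif_bounded_lipschitz phi y (e B : R) : 0 < e -> 0 <= B ->
  (forall w, nm (w - y) < e -> dif phi w) -> (forall w, nm (w - y) < e -> nm (phi w) <= B) ->
  forall w, nm (w - y) < e -> nm (phi w - phi y) <= 32 * B / e * nm (w - y).
Proof.
move=> e0 B0 dphi hB w wy.
pose F h := phi (y + h).
have sh h : y + h - y = h by rewrite addrC addKr.
have FB h : nm h < e -> nm (F h) <= B by move=> he; apply: hB; rewrite sh.
have [|c hc] := @taylor2 R F e B e0 B0 _ FB.
  by move=> h he; apply: dif_shift; apply: dphi; rewrite sh.
have F0 : F 0 = phi y by rewrite /F addr0.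
have Fw : F (w - y) = phi w by rewrite /F addrC subrK.
have pB := FB 0 ltac:(by rewrite nm0); have qB := FB _ wy.
have cB : nm c <= 17 * B / e.
  pose h : R[i] := (e / 8)%:C%C.
  have nh : nm h = e / 8 by rewrite nm_real ger0_norm // divr_ge0 // ltW.
  have := hc h; rewrite nh => /(_ ltac:(lra)) h1.
  have h2 := FB h ltac:(rewrite nh; lra).
  have : nm (c * h) <= 2 * B + 8 * B / e ^+ 2 * (e / 8) ^+ 2.
    rewrite (_ : c * h = F h - F 0 - (F h - F 0 - c * h)); last by ring.
    apply: le_trans (nmB _ _) _; have := nmB (F h) (F 0); lra.
  rewrite nmM nh (_ : 8 * B / e ^+ 2 * (e / 8) ^+ 2 = B / 8); last by field; rewrite gt_eqF.
  by rewrite ler_pdivlMr // => h3; lra.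
have [we|we] := ltP (nm (w - y)) (e / 4); last first.
  rewrite -Fw -F0; apply: le_trans (nmB _ _) _.
  apply: le_trans (_ : 32 * B / e * (e / 4) <= _).
    by rewrite (_ : 32 * B / e * (e / 4) = 8 * B); [lra|field; rewrite gt_eqF].
  by apply: ler_wpM2l => //; rewrite divr_ge0 ?mulr_ge0 // ltW.
have := hc _ we; rewrite F0 Fw => h1.
rewrite (_ : phi w - phi y = phi w - phi y - c * (w - y) + c * (w - y)); last by ring.
apply: le_trans (nmD _ _) _; rewrite nmM.
have h2 : 8 * B / e ^+ 2 * nm (w - y) ^+ 2 <= 2 * B / e * nm (w - y).
  rewrite (_ : 2 * B / e * nm (w - y) = 8 * B / e ^+ 2 * (e / 4 * nm (w - y))); last by field; rewrite gt_eqF.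
  apply: ler_wpM2l; first by rewrite divr_ge0 ?mulr_ge0 ?exprn_ge0 // ltW.
  by rewrite expr2 ler_wpM2r ?nm_ge0 // ltW.
have h3 := ler_wpM2r (nm_ge0 (w - y)) cB.
apply: le_trans (lerD (le_trans h1 h2) h3) _.
rewrite -mulrDl; apply: ler_wpM2r; first exact: nm_ge0.
by rewrite -mulrDl ler_pM2r ?invr_gt0 //; lra.
Qed.

Lemma annulus_lipschitz phi (r1 r2 s1 s2 : R) : 0 <= r1 -> r1 < s1 -> s1 <= s2 -> s2 < r2 ->
  (forall y, r1 < nm y < r2 -> dif phi y) ->
  exists B L : R, [/\ 0 <= B, 0 <= L,
    forall y, s1 <= nm y <= s2 -> nm (phi y) <= B &
    forall y w, s1 <= nm y <= s2 -> s1 <= nm w <= s2 -> nm (phi w - phi y) <= L * nm (w - y)].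
Proof.
move=> r10 rs ss sr dphi.
pose e := Num.min ((s1 - r1) / 2) ((r2 - s2) / 2).
have e0 : 0 < e by rewrite lt_min !divr_gt0 // subr_gt0.
have e1 : e <= (s1 - r1) / 2 by rewrite ge_min lexx.
have e2 : e <= (r2 - s2) / 2 by rewrite ge_min lexx orbT.
have [|||B B0 hB] := @annulus_bounded R phi (s1 - e) (s2 + e).
- clear -r10 rs e0 e1; lra.
- clear -ss e0; lra.
- by move=> z /andP[h1 h2]; apply: dphi; apply/andP; split; clear -h1 h2 e1 e2 e0 rs sr; lra.
have near y w : s1 <= nm y <= s2 -> nm (w - y) < e -> s1 - e <= nm w <= s2 + e.
  move=> /andP[h1 h2] h3; have := nm_sub w y; have := nm_sub y w; rewrite (nmBC y).
  by clear -h1 h2 h3 => h4 h5; apply/andP; split; lra.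
exists B, (32 * B / e); split=> //.
- by rewrite divr_ge0 ?mulr_ge0 // ltW.
- by move=> y /andP[h1 h2]; apply: hB; apply/andP; split; clear -h1 h2 e0; lra.
move=> y w hy hw; have [we|we] := ltP (nm (w - y)) e.
  apply: (@dif_bounded_lipschitz phi y e B) => // v hv; last exact/hB/near/hv.
  have /andP[h1 h2] := near y v hy hv.
  by apply: dphi; apply/andP; split; clear -h1 h2 e1 e2 e0 rs sr; lra.
apply: le_trans (nmB _ _) _.
have h1 := hB y (near y y hy ltac:(by rewrite subrr nm0)).
have h2 := hB w (near w w hw ltac:(by rewrite subrr nm0)).
apply: le_trans (_ : 32 * B / e * e <= _).
  by rewrite divfK ?gt_eqF //; clear -h1 h2 B0; lra.
by apply: ler_wpM2l => //; rewrite divr_ge0 ?mulr_ge0 // ltW.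
Qed.

Lemma adm_comp n c phi (g : R[i] -> R[i]) (om : ('I_n -> R[i]) -> R[i]) (d : R) :
  annular phi (g c) -> 0 < d -> (forall t, nm (t - c) < d -> dif g t) -> umono om ->
  adm c (fun t z => phi (g t * om z)).
Proof.
move=> [r1 [r2 [r10 /andP[gr1 gr2] dphi]]] d0 dg [om1 omL].
have gc : dif g c by apply: dg; rewrite subrr nm0.
pose s1 := (r1 + nm (g c)) / 2; pose s2 := (nm (g c) + r2) / 2.
have [h1 h2 h3] : [/\ r1 < s1, s1 <= s2 & s2 < r2].
  by split; rewrite /s1 /s2; clear -gr1 gr2; lra.
have [B [L [B0 L0 hB hL]]] := annulus_lipschitz r10 h1 h2 h3 dphi.
pose eta := Num.min (nm (g c) - s1) (s2 - nm (g c)).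
have eta0 : 0 < eta by rewrite lt_min; apply/andP; split; rewrite /s1 /s2; clear -gr1 gr2; lra.
have [e e0 he] := (contCP _ _).1 (differentiable_continuous gc) eta eta0.
have ht t : nm (t - c) < e -> s1 <= nm (g t) <= s2.
  move=> /he; rewrite lt_min => /andP[a b].
  have := nm_sub (g t) (g c); have := nm_sub (g c) (g t); rewrite (nmBC (g c)).
  by clear -a b => u v; apply/andP; split; lra.
exists (Num.min d e), B, (L * (2 * s2)); split.
- by rewrite lt_min d0.
- exact: B0.
- by rewrite mulr_ge0 // mulr_ge0 //; apply: le_trans h2; apply: le_trans (ltW h1).
move=> t; rewrite lt_min => /andP[td te]; have /andP[g1 g2] := ht t te.
have nu z : unitv z -> nm (g t * om z) = nm (g t) by move=> z1; rewrite nmM om1 // mulr1.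
split=> [z z1|z w z1 w1].
  split; last by apply: hB; rewrite nu // g1.
  have d1 : dif (fun t => g t * om z) t by apply: difM; [exact: dg|exact: dif_cst].
  have d2 : dif phi (g t * om z).
    by apply: dphi; rewrite nu //; apply/andP; split; clear -h1 h3 g1 g2; lra.
  exact: (@dif_comp R R[i]^o phi _ t d1 d2).
apply: le_trans (hL _ _ _ _) _; rewrite ?nu ?g1 //.
rewrite -mulrBr nmM -mulrA; apply: ler_wpM2l => //.
apply: le_trans (_ : s2 * (2 * sdist z w) <= _); last by rewrite mulrCA mulrA.
apply: ler_pM; [exact: nm_ge0|exact: nm_ge0|exact: g2|exact: omL].
Qed.

Lemma nm_inv_dist z w : nm z = 1 -> nm w = 1 -> nm (z^-1 - w^-1 : R[i]) = nm (z - w).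
Proof.
move=> z1 w1; have z0 : z != 0 by rewrite -nm_gt0 z1.
have w0 : w != 0 by rewrite -nm_gt0 w1.
rewrite (_ : z^-1 - w^-1 = (w - z) / (z * w)); last by field; rewrite z0 w0.
by rewrite nmM nmV nmM z1 w1 mulr1 invr1 mulr1 nmBC.
Qed.

Lemma nm_mul_dist (a b a' b' : R[i]) : nm b = 1 -> nm a' = 1 ->
  nm (a * b - a' * b') <= nm (a - a') + nm (b - b').
Proof.
move=> b1 a1; rewrite (_ : _ - _ = (a - a') * b + a' * (b - b')); last by ring.
by apply: le_trans (nmD _ _) _; rewrite !nmM b1 a1 mulr1 mul1r.
Qed.

Lemma umono_var n i : @umono n (fun z => z i).
Proof.
split=> [z|z w _ _]; first exact.
by apply: le_trans (sdist_ge z w i) _; rewrite ler_peMl ?sdist_ge0 // ler1n.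
Qed.

Lemma umono_inv n i : @umono n (fun z => (z i)^-1).
Proof.
split=> [z z1|z w z1 w1]; first by rewrite nmV z1 invr1.
rewrite nm_inv_dist // (le_trans (sdist_ge z w i)) //.
by rewrite ler_peMl ?sdist_ge0 // ler1n.
Qed.

Lemma umono_ratio n i j : @umono n (fun z => z i / z j).
Proof.
split=> [z z1|z w z1 w1]; first by rewrite nmM nmV !z1 invr1 mulr1.
apply: le_trans (nm_mul_dist _ _ _ _) _; rewrite ?nmV ?z1 ?w1 ?invr1 //.
rewrite nm_inv_dist //; have := sdist_ge z w i; have := sdist_ge z w j; lra.
Qed.

Lemma prod_useq n (zs : seq R[i]) : useq n zs -> nm (\prod_(w <- zs) w) = 1.
Proof.
move=> [_ h]; rewrite nm_prod big_seq_cond big1 // => i; rewrite andbT; exact: h.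
Qed.

Lemma useq_consE n z zs : useq n.+1 (z :: zs) -> nm (z : R[i]) = 1 /\ useq n zs.
Proof.
move=> [[sz] h]; split; first by apply: h; rewrite inE eqxx.
by split=> // x xz; apply: h; rewrite inE xz orbT.
Qed.

Lemma prod_dist n (zs ws : seq R[i]) : useq n zs -> useq n ws ->
  nm (\prod_(z <- zs) z - \prod_(w <- ws) w) <= \sum_(i < n) nm (zs`_i - ws`_i).
Proof.
elim: n zs ws => [|k IH] [|z zs] [|w ws]; try (by case); try (by move=> _ []).
  by rewrite !big_nil subrr nm0 big_ord0.
move=> /useq_consE[z1 hz] /useq_consE[w1 hw]; rewrite !big_cons big_ord_recl /=.
apply: le_trans (nm_mul_dist _ _ (prod_useq hz) w1) _.
by apply: lerD => //; exact: IH.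
Qed.

(** Otherwise all grid averages of z^(j-i) would be 1, whereas their limit is 0. *)
Lemma dyadic_root_neq1 i j : i != j ->
  exists k, (ee (1 / 2 ^+ k))^-1 ^+ i * ee (1 / 2 ^+ k) ^+ j != 1 :> R[i].
Proof.
move=> ij; apply: contrapT => hno.
have h k : (ee (1 / 2 ^+ k))^-1 ^+ i * ee (1 / 2 ^+ k) ^+ j = 1 :> R[i].
  by apply/eqP/negPn/negP => hk; apply: hno; exists k.
have h1 : hasmean (fun z : R[i] => z ^+ j * z^-1 ^+ i) 1.
  apply: eq_tends (tends_cst 1) => m; rewrite -[LHS](cmean_cst m); congr (_ * _).
  apply: eq_bigr => k _; have -> : k%:R / 2 ^+ m = (1 / 2 ^+ m) *+ k :> R by rewrite mulr_natl mul1r.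
  rewrite eeM; move: (h m); set w := ee _ => hm.
  rewrite -[LHS](expr1n _ k) -[in LHS]hm exprMn mulrC -exprVn -!exprM.
  by rewrite (mulnC k j) (mulnC k i).
have := hasmean_unique h1 (@hasmean_monom R j i).
by rewrite eq_sym (negPf ij) => /eqP; rewrite oner_eq0.
Qed.

Section Mean.
Variable n : nat.
Local Notation torusf := (('I_n.+1 -> R[i]) -> R[i]).

Definition torusB (F : torusf) := exists B L : R, [/\ 0 <= B, 0 <= L,
  forall z, unitv z -> nm (F z) <= B &
  forall z w, unitv z -> unitv w -> nm (F z - F w) <= L * sdist z w].

Lemma adm_torusB c F : adm c F -> torusB (F c).
Proof.
move=> [d [B [L [d0 B0 L0 h]]]]; have [|h1 h2] := h c; first by rewrite subrr nm0.
by exists B, L; split; [exact: B0|exact: L0|move=> z /h1[]|exact: h2].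
Qed.

(** For [torusB] functions this is the torus integral. Being a limit of symmetric averages, it
    inherits invariance under permutations and inversion from finite sums; for the iterated integral
    with z_0 eliminated these would be changes of variables. *)
Definition mu (F : torusf) : R[i] := limn (fun m => tmean m F : R[i]^o).

Let tseq (zs : seq R[i]) : 'I_n.+1 -> R[i] := fun i => ((\prod_(w <- zs) w)^-1 :: zs)`_i.

Let tseq_unit zs : useq n zs -> unitv (tseq zs).
Proof.
move=> hz i; rewrite /tseq; case: (unliftP ord0 i) => [j|] -> /=.
  by case: hz => sz h; rewrite add0n h // mem_nth // sz.
by rewrite nmV (prod_useq hz) invr1.
Qed.

Lemma tmean_torus_integral F : torusB F ->
  tends (fun m => tmean m F) (torus_integral n (fun zs => F (tseq zs))).
Proof.
move=> [B [L [B0 L0 hB hL]]].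
have L2 : 0 <= L * 2 by rewrite mulr_ge0.
have gL : lipseq n (fun zs => F (tseq zs)) (L * 2).
  move=> zs ws hz hw; apply: le_trans (hL _ _ (tseq_unit hz) (tseq_unit hw)) _.
  rewrite -mulrA; apply: ler_wpM2l => //; rewrite /sdist big_ord_recl /tseq /=.
  rewrite (nm_inv_dist (prod_useq hz) (prod_useq hw)) mulr_natl mulr2n.
  by apply: lerD => //; exact: prod_dist.
have h := gmean_torus_integral L2 gL.
apply: (@tends_dyadic R _ _ (n%:R * (8 * pi * (L * 2)))) => m.
by rewrite tmean_gmean; exact: h.
Qed.

Lemma muP F : torusB F -> tends (fun m => tmean m F) (mu F).
Proof.
move=> hF; have h := tmean_torus_integral hF.
by have /tendsP/cvgC_lim := h; rewrite -/(mu F) => ->.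
Qed.

Lemma mu_torus_integral F : torusB F -> torus_integral n (fun zs =>
  F (fun i => ((\prod_(w <- zs) w)^-1 :: zs)`_i)) = mu F.
Proof. by move=> hF; apply: tends_unique (tmean_torus_integral hF) (muP hF). Qed.

Lemma mu_unique F l : torusB F -> tends (fun m => tmean m F) l -> mu F = l.
Proof. by move=> hF; exact: tends_unique (muP hF). Qed.

Lemma eq_mu_tmean F G : (forall m, tmean m F = tmean m G) -> mu F = mu G.
Proof.
move=> h; rewrite /mu; set u := (fun m => _ : R[i]^o); set v := (fun m => _ : R[i]^o).
by suff -> : u = v by []; apply/funext => m; exact: h.
Qed.

Lemma eq_mu F G : (forall z, utorus z -> F z = G z) -> mu F = mu G.
Proof. by move=> FG; apply: eq_mu_tmean => m; exact: eq_tmean. Qed.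

Lemma mu_perm F s : bijective s -> mu (fun z => F (fun i => z (s i))) = mu F.
Proof. by move=> sb; apply: eq_mu_tmean => m; exact: tmean_perm. Qed.

Lemma mu_inv F : mu (fun z => F (fun i => (z i)^-1)) = mu F.
Proof. by apply: eq_mu_tmean => m; exact: tmean_inv. Qed.

Lemma torusB_adm F : torusB F -> forall c, adm c (fun _ => F).
Proof.
move=> [B [L [B0 L0 hB hL]]] c; exists 1, B, L; split; [exact: ltr01|exact: B0|exact: L0|].
move=> t _; split=> [z z1|]; last exact: hL.
by split; [exact: dif_cst|exact: hB].
Qed.

Lemma torusBD F G : torusB F -> torusB G -> torusB (fun z => F z + G z).
Proof. by move=> /torusB_adm hF /torusB_adm hG; exact: (adm_torusB (admD (hF 0) (hG 0))). Qed.

Lemma torusBM F G : torusB F -> torusB G -> torusB (fun z => F z * G z).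
Proof. by move=> /torusB_adm hF /torusB_adm hG; exact: (adm_torusB (admM (hF 0) (hG 0))). Qed.

Lemma torusB_cst a : torusB (fun=> a).
Proof.
by apply: (@adm_torusB 0 (fun _ _ => a)); apply: (@adm_cst n.+1 0 (fun=> a) 1 ltr01) => t _; exact: dif_cst.
Qed.

Lemma eq_torusB F G : F =1 G -> torusB F -> torusB G.
Proof. by move=> /funext ->. Qed.

Lemma muD F G : torusB F -> torusB G -> mu (fun z => F z + G z) = mu F + mu G.
Proof.
move=> hF hG; apply: mu_unique; first exact: torusBD.
by apply: eq_tends (tendsD (muP hF) (muP hG)) => m; rewrite tmeanD.
Qed.

Lemma muZ a F : torusB F -> mu (fun z => a * F z) = a * mu F.
Proof.
move=> hF; apply: mu_unique; first exact: torusBM (torusB_cst a) hF.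
by apply: eq_tends (tendsZ a (muP hF)) => m; rewrite tmeanZ.
Qed.

Lemma torusB_sum (I : Type) (s : seq I) (F : I -> torusf) :
  (forall i, torusB (F i)) -> torusB (fun z => \sum_(i <- s) F i z).
Proof.
move=> hF; elim: s => [|i s IH].
  by apply: eq_torusB (torusB_cst 0) => z; rewrite big_nil.
by apply: eq_torusB (torusBD (hF i) IH) => z; rewrite big_cons.
Qed.

Lemma mu_sum (I : Type) (s : seq I) (F : I -> torusf) : (forall i, torusB (F i)) ->
  mu (fun z => \sum_(i <- s) F i z) = \sum_(i <- s) mu (F i).
Proof.
move=> hF; elim: s => [|i s IH].
  rewrite big_nil; apply: mu_unique; first exact: torusB_sum.
  by apply: eq_tends (tends_cst 0) => m; under eq_tmean do rewrite big_nil; rewrite tmean_cst.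
rewrite big_cons -IH -muD //; last exact: torusB_sum.
by apply: eq_mu => z _; rewrite big_cons.
Qed.

Lemma mu_dif c F : adm c F -> dif (fun t => mu (F t)) c.
Proof.
move=> hF; have [d' d0' hd'] := adm_near hF.
have [d [B [L [d0 B0 L0 h]]]] := hF.
have dd : 0 < Num.min d d' by rewrite lt_min d0.
apply: (@dif_limit R (fun m t => tmean m (F t)) _ c (Num.min d d') B dd).
- move=> m t; rewrite lt_min => /andP[/h[h1 _] _]; rewrite /tmean.
  apply: difM; first exact: dif_cst.
  by apply: dif_sum => k _; case: (h1 (fun i => rou R (k i))) => // i; exact: nm_rou.
- move=> m t; rewrite lt_min => /andP[/h[h1 _] _]; apply: tmean_le => z [z1 _].
  by case: (h1 z z1).
- by move=> t; rewrite lt_min => /andP[_ /hd' hF']; apply: muP; exact: adm_torusB hF'.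
Qed.

(** For exponents of sum 0 the product of the coordinates is unchanged, so varying |t| deforms the
    contour within the hypersurface of product 1. *)
Definition zscale (d : 'I_n.+1 -> int) (t : R[i]) (z : 'I_n.+1 -> R[i]) : 'I_n.+1 -> R[i] :=
  fun i => t ^ (d i) * z i.

Lemma zscaleM d s t z : s != 0 -> t != 0 -> zscale d (s * t) z = zscale d t (zscale d s z).
Proof.
move=> s0 t0; apply/funext => i; rewrite /zscale mulrA (mulrC (t ^ _)).
by rewrite expfzMl.
Qed.

(** For m >= k the rotation permutes the grid, so the averages agree exactly. *)
Lemma mu_rot d F k : \sum_i d i = 0 -> torusB F ->
  torusB (fun z => F (zscale d (ee (1 / 2 ^+ k)) z)) ->
  mu (fun z => F (zscale d (ee (1 / 2 ^+ k)) z)) = mu F.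
Proof.
move=> d0 hF hG; apply: mu_unique => // e e0.
have [N hN] := muP hF e0; exists (maxn N k) => m.
rewrite geq_max => /andP[/hN h km]; suff -> : tmean m (fun z => F (zscale d (ee (1 / 2 ^+ k)) z)) = tmean m F by [].
have [w <-] := rou_root R km.
have w0 : rou R w != 0 := rou_neq0 R w.
have sd : \sum_i (w *~ d i) = 0 by rewrite -mulrz_sumr d0 mulr0z.
rewrite -(tmean_rot F sd); apply: eq_tmean => z _; congr (F _); apply/funext => i.
rewrite /zscale; congr (_ * _); case: (d i) => j /=; last first.
  rewrite NegzE mulrNz rouN -exprnN; congr (_^-1).
  by rewrite -pmulrn; elim: j.+1 => [|j' IH]; rewrite ?rou0 ?expr0 // mulrS rouD exprS IH.
by rewrite -pmulrn -exprnP; elim: j => [|j' IH]; rewrite ?rou0 ?expr0 // mulrS rouD exprS IH.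
Qed.

(** Contour deformation: the mean is holomorphic in t by [mu_dif] and invariant under all dyadic
    rotations of t by [mu_rot], hence constant. *)
Lemma mu_shift d F (r1 r2 : R) : \sum_i d i = 0 -> 0 <= r1 ->
  (forall t, r1 < nm t < r2 -> adm t (fun t z => F (zscale d t z))) ->
  forall s t, r1 < nm s < r2 -> r1 < nm t < r2 ->
  mu (fun z => F (zscale d s z)) = mu (fun z => F (zscale d t z)).
Proof.
move=> d0 r10 hF s t hs ht.
pose h t := mu (fun z => F (zscale d t z)).
have dh z : r1 < nm z < r2 -> dif h z by move=> hz; exact: mu_dif (hF z hz).
have t0 z : r1 < nm z -> z != 0.
  by move=> rz; rewrite -nm_gt0; apply: le_lt_trans rz.
have [|l hl] := @mult_periodic_const R h r1 r2 (nm s) r10 dh hs; last first.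
  by have := hl s hs; have := hl t ht; rewrite /h => -> ->.
move=> i j ij; have [k hk] := dyadic_root_neq1 ij.
exists (ee (1 / 2 ^+ k)); split.
- exact: ee_neq0.
- exact: hk.
- by rewrite nm_ee mul1r.
move=> z zs; have hz : r1 < nm z < r2 by rewrite zs.
have z0 : z != 0 by apply: t0; case/andP: hz.
have hwz : r1 < nm (ee (1 / 2 ^+ k) * z) < r2 by rewrite nmM nm_ee mul1r.
have e1 : (fun y => F (zscale d (ee (1 / 2 ^+ k) * z) y)) =
    fun y => F (zscale d z (zscale d (ee (1 / 2 ^+ k)) y)).
  by apply/funext => y; rewrite zscaleM // ee_neq0.
rewrite /h e1; apply: (@mu_rot d (fun y => F (zscale d z y)) k d0).
  exact: adm_torusB (hF z hz).
by rewrite -e1; exact: (adm_torusB (hF _ hwz)).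
Qed.

End Mean.

End Admissible.

(** Bernoulli's inequality. *)
Lemma pow_near1 (R : realType) (M : R) N : M < 1 -> exists rho : R, [/\ 0 < rho, rho < 1 & M < rho ^+ N].
Proof.
move=> M1; pose e := Num.min (2^-1 : R) ((1 - M) / 2 / N.+1%:R).
have N0 : 0 < N.+1%:R :> R by rewrite ltr0n.
have e0 : 0 < e by rewrite lt_min invr_gt0 ltr0n !divr_gt0 // subr_gt0.
have e1 : e <= 2^-1 by rewrite ge_min lexx.
have e2 : e * N.+1%:R <= (1 - M) / 2 by rewrite -ler_pdivlMr // ge_min lexx orbT.
have bern k : 1 - e * k%:R <= (1 - e) ^+ k.
  elim: k => [|k IH]; first by rewrite mulr0 subr0 expr0.
  have p0 : 0 <= (1 - e) ^+ k by rewrite exprn_ge0 //; lra.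
  have k0 : 0 <= k%:R :> R by [].
  rewrite exprS -natr1; have h1 : 0 <= e * (e * k%:R) by rewrite !mulr_ge0 // ltW.
  have h2 : (1 - e) * (1 - e * k%:R) <= (1 - e) * (1 - e) ^+ k by apply: ler_wpM2l => //; lra.
  lra.
exists (1 - e); split; [lra|lra|].
have := bern N; have : e * N%:R <= e * N.+1%:R by rewrite ler_pM2l // ler_nat.
lra.
Qed.

Lemma finite_bound (R : realType) (I : finType) (f : I -> R) : (forall i, f i < 1) ->
  exists2 M : R, 0 <= M < 1 & forall i, f i <= M.
Proof.
move=> f1; exists (\big[Order.max/0]_i f i); last by move=> i; exact: le_bigmax.
apply/andP; split; first exact: bigmax_ge_id.
by apply/bigmax_ltP; split=> // i _; exact: f1.
Qed.

(** * The difference equation *)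

Section Integrand.
Variable R : realType.
Local Notation dif f z := (differentiable (f : R[i]^o -> R[i]^o) (z : R[i]^o)).
Variables p q : R[i].
Local Notation G := (egamma p q).

Section Factors.
Variable n : nat.
Implicit Type z : 'I_n -> R[i].

Definition gpos a z := \prod_i G (a * z i).
Definition gneg a z := \prod_i G (a / z i).
(* Where z i = z j, the value 0 of egamma at its pole gives the correct value 0
   of the inverse. *)
Definition gvan z := \prod_i \prod_(j | j != i) (G (z i / z j))^-1.

(** The integrand. The numbers of parameters are left free, so that parameters can be split off or
    adjoined with [ocons]. *)
Definition kern k l (t : 'I_k -> R[i]) (u : 'I_l -> R[i]) z :=
  (\prod_r gpos (t r) z) * (\prod_s gneg (u s) z) * gvan z.

Lemma kern_consl k l a t (u : 'I_l -> R[i]) z :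
  kern (ocons a t : 'I_k.+1 -> R[i]) u z = gpos a z * kern t u z.
Proof.
rewrite /kern big_ord_recl ocons0 (eq_bigr (fun r => gpos (t r) z)) ?mulrA // => r _.
by rewrite oconsS.
Qed.

Lemma gvan_split k z : gvan z =
  (\prod_(i | i != k) ((G (z i / z k))^-1 * (G (z k / z i))^-1)) *
  \prod_(i | i != k) \prod_(j | (j != i) && (j != k)) (G (z i / z j))^-1.
Proof.
rewrite /gvan (bigD1 k) //= [X in _ * X](eq_bigr (fun i => (G (z i / z k))^-1 *
   \prod_(j | (j != i) && (j != k)) (G (z i / z j))^-1)); last first.
  by move=> i ik; rewrite (bigD1 k) 1?eq_sym.
by rewrite big_split /= mulrA -big_split /=; congr (_ * _); apply: eq_bigr => i _; rewrite mulrC.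
Qed.

Lemma gvan_eq0 z i j : nm p < 1 -> nm q < 1 -> i != j -> z i != 0 -> z i = z j -> gvan z = 0.
Proof.
move=> p1 q1 ij zi zij; rewrite /gvan (bigD1 i) //= (bigD1 j) 1?eq_sym //= -zij divff //.
by rewrite egamma_reg // subrr invr0 mulr0 invr0 !mul0r.
Qed.

End Factors.

Section Difference.
Variable n : nat.
Implicit Type z : 'I_n.+1 -> R[i].
Hypotheses (p1 : nm p < 1) (p0 : p != 0) (q1 : nm q < 1) (q0 : q != 0).
Variables (a b : R[i]) (t : 'I_n -> R[i]) (u : 'I_n.+2 -> R[i]).
Hypotheses (pa : nm p < nm a) (a1 : nm a < 1) (pb : nm p < nm b) (b1 : nm b < 1).
Hypotheses (t0 : forall r, t r != 0) (u0 : forall s, u s != 0) (u1 : forall s, nm (u s) < 1).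
Local Notation T := (\prod_r t r).
Hypothesis bal : a * b * T * \prod_s u s = p.

Let a0 : a != 0. Proof. by rewrite -nm_gt0; apply: le_lt_trans pa; exact: nm_ge0. Qed.
Let b0 : b != 0. Proof. by rewrite -nm_gt0; apply: le_lt_trans pb; exact: nm_ge0. Qed.
Let T0 : T != 0. Proof. by apply/prodf_neq0 => r _; exact: t0. Qed.

(** This and [gnegk k c] are [gpos (q * c)] and [gneg c] at the point obtained from z by dividing
    z_k by q; [gvank k] is [gvan] there up to theta factors. *)
Definition gposk k c z := G (c * z k) * \prod_(i | i != k) G (q * c * z i).
Definition gnegk k c z := G (q * c / z k) * \prod_(i | i != k) G (c / z i).
Definition gvank k z :=
  (\prod_(i | i != k) ((G (q * (z i / z k)))^-1 * (G (z k / z i))^-1)) *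
  \prod_(i | i != k) \prod_(j | (j != i) && (j != k)) (G (z i / z j))^-1.
(** This function has two readings. On the torus it is, up to a factor, a term of the theta identity
    that expresses the difference of the two integrands; at z = [qat k y] it is a term of a second
    theta identity in y. *)
Definition fterm k z := z k * theta p (T / z k) * gposk k a z * gposk k b z *
  (\prod_r gpos (t r) z) * (\prod_s gnegk k (u s) z) * gvank k z.

Section Pointwise.
Variable z : 'I_n.+1 -> R[i].
Hypothesis z1 : unitv z.

Let z0 i : z i != 0. Proof. by rewrite -nm_gt0 z1. Qed.

Lemma theta_neq0_unit c i : c != 0 -> nm p < nm c -> nm c < 1 -> theta p (c * z i) != 0.
Proof.
move=> c0 pc c1; have nc : nm (c * z i) = nm c by rewrite nmM z1 mulr1.
apply: theta_neq0 => //; first by rewrite mulf_neq0.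
  by apply/eqP => e; move: c1; rewrite -nc e nm1 ltxx.
rewrite nc pc /=; apply: lt_trans c1 _; rewrite invf_gt1 // nm_gt0 //.
Qed.

Lemma gposk_theta k c : c != 0 -> nm p < nm c -> nm c < 1 ->
  gpos c z * (\prod_i theta p (c * z i)) / theta p (c * z k)^-1 = - (c * z k) * gposk k c z.
Proof.
move=> c0 pc c1; rewrite /gpos -big_split /= (bigD1 k) //= thetaV ?mulf_neq0 //.
have := theta_neq0_unit k c0 pc c1; set th := theta p _ => th0.
rewrite /gposk (eq_bigr (fun i => G (q * c * z i))) => [|i ik]; last first.
  by rewrite -mulrA egamma_theta ?mulf_neq0 // ?nmM ?z1 ?mulr1 // mulrC.
set g := G _; set h := \prod_(_ | _) _; field.
by rewrite z0 c0 th0.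
Qed.

Lemma gnegk_theta k c : c != 0 -> nm c < 1 -> gneg c z * theta p (c / z k) = gnegk k c z.
Proof.
move=> c0 c1; rewrite /gneg /gnegk (bigD1 k) //= -mulrA.
rewrite egamma_theta ?mulf_neq0 ?invr_eq0 //; last by rewrite nmM nmV z1 invr1 mulr1.
by rewrite mulrC mulrA.
Qed.

Lemma theta_ratio_neq0 i j : injective z -> i != j -> theta p (z i / z j) != 0.
Proof.
move=> zi ij; have nz : nm (z i / z j) = 1 by rewrite nmM nmV !z1 invr1 mulr1.
apply: theta_neq0 => //; first by rewrite mulf_neq0 ?invr_eq0.
  by apply/eqP => /divr1_eq /zi /eqP; rewrite (negPf ij).
by rewrite nz p1 invf_gt1 // nm_gt0.
Qed.

Lemma gvank_theta k : injective z -> gvan z / \prod_(i | i != k) theta p (z i / z k) = gvank k z.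
Proof.
move=> zi; rewrite (gvan_split k) /gvank mulrAC; congr (_ * _).
rewrite -prodf_div; apply: eq_bigr => i ik.
have nz : nm (z i / z k) = 1 by rewrite nmM nmV !z1 invr1 mulr1.
have -> : (G (z i / z k))^-1 = theta p (z i / z k) * (G (q * (z i / z k)))^-1.
  by apply: egammaV_theta => //; rewrite nz.
have := theta_ratio_neq0 (i := i) (j := k) zi ik.
by set x := (G (q * _))^-1; set w := (G (z k / _))^-1; set th := theta p _ => th0; field.
Qed.

Lemma gvank_eq0 k : ~ injective z -> gvank k z = 0.
Proof.
move=> ninj; have [i [j [ij zij]]] : exists i j, i != j /\ z i = z j.
  apply: contrapT => h; apply: ninj => i j e; apply/eqP/negPn/negP => ij.
  by apply: h; exists i, j.
have g0 x : x = 1 -> (G x)^-1 = 0 by move=> ->; rewrite egamma_reg // subrr invr0 mulr0 invr0.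
wlog ik : i j ij zij / i != k.
  move=> H; have [ik|ik] := eqVneq i k; last exact: (H i j).
  by apply: (H j i) => //; rewrite eq_sym // -ik.
have [jk|jk] := eqVneq j k; rewrite /gvank.
  by rewrite (bigD1 i) //= (g0 (z k / z i)) ?mulr0 ?mul0r // -jk zij divff.
rewrite [X in _ * X = _](bigD1 i) //= [X in _ * (X * _) = _](bigD1 j) /=; last by rewrite jk eq_sym ij.
by rewrite (g0 (z i / z j)) ?mul0r ?mulr0 // zij divff.
Qed.

End Pointwise.

Lemma theta_ab : a != b -> theta p (a / b) != 0.
Proof.
move=> ab; apply: theta_neq0 => //; first by rewrite mulf_neq0 ?invr_eq0.
  by apply/eqP => /divr1_eq /eqP; rewrite (negPf ab).
have np : 0 < nm p by rewrite nm_gt0.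
rewrite nmM nmV ltr_pdivlMr ?nm_gt0 // ltr_pdivrMr ?nm_gt0 //; apply/andP; split.
  by apply: lt_trans pa; rewrite gtr_pMr.
by apply: lt_trans a1 _; rewrite ltr_pdivlMl // mulr1.
Qed.

(** The theta identity for the n + 3 points a, b, 1 / z_i against p / T and 1 / u_s. The terms of a
    and b form the left-hand side, the others the right-hand side, and [bal] is the condition of
    equal products. At coincident coordinates, where the identity does not apply, both sides are
    0. *)
Theorem difference_sum z : a != b -> utorus z ->
  gpos a z * gpos b z * kern t u z *
   (theta p (a * T) * (\prod_s theta p (a * u s)) * (\prod_i theta p (b * z i)) -
    theta p (b * T) * (\prod_s theta p (b * u s)) * (\prod_i theta p (a * z i))) =
  - (b * theta p (a / b)) * \sum_k fterm k z.
Proof.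
move=> ab [z1 zp]; have z0 i : z i != 0 by rewrite -nm_gt0 z1.
have [zi|ninj] := pselect (injective z); last first.
  have -> : \sum_k fterm k z = 0.
    by apply: big1 => k _; rewrite /fterm (gvank_eq0 z1 k ninj) mulr0.
  have [i [j [ij zij]]] : exists i j, i != j /\ z i = z j.
    apply: contrapT => h; apply: ninj => i j e; apply/eqP/negPn/negP => ij.
    by apply: h; exists i, j.
  by rewrite /kern (gvan_eq0 p1 q1 ij (z0 i) zij) !mulr0 mul0r.
pose X : 'I_n.+3 -> R[i] := ocons a (ocons b (fun i => (z i)^-1)).
pose Y : 'I_n.+3 -> R[i] := ocons (p / T) (fun s => (u s)^-1).
have X0 i : X i != 0.
  case: (unliftP ord0 i) => [j|] ->; rewrite /X ?oconsS ?ocons0 //.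
  by case: (unliftP ord0 j) => [j'|] ->; rewrite ?oconsS ?ocons0 ?invr_eq0.
have Y0 i : Y i != 0.
  by case: (unliftP ord0 i) => [j|] ->; rewrite /Y ?oconsS ?ocons0 ?mulf_neq0 ?invr_eq0.
have tab := theta_ab ab.
have Xa : X ord0 = a by rewrite /X ocons0.
have Xb : X (lift ord0 ord0) = b by rewrite /X oconsS ocons0.
have Xz i : X (lift ord0 (lift ord0 i)) = (z i)^-1 by rewrite /X !oconsS.
have az i : theta p (a * z i) != 0 by exact: theta_neq0_unit.
have bz i : theta p (b * z i) != 0 by exact: theta_neq0_unit.
have inv x : x != 0 -> theta p x != 0 -> theta p x^-1 != 0.
  by move=> x0; rewrite theta_neqS.
have XX i j : i != j -> theta p (X i / X j) != 0.
  have za k : (z k)^-1 / a = (a * z k)^-1 by rewrite invfM mulrC.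
  have zb k : (z k)^-1 / b = (b * z k)^-1 by rewrite invfM mulrC.
  case: (unliftP ord0 i) => [i'|] ->; last first.
    case: (unliftP ord0 j) => [j'|] -> //; rewrite Xa.
    by case: (unliftP ord0 j') => [k|] -> _; rewrite ?Xb // Xz invrK.
  case: (unliftP ord0 i') => [k|] ->.
    case: (unliftP ord0 j) => [j'|] ->; last by move=> _; rewrite Xz Xa za; exact: inv (mulf_neq0 a0 (z0 k)) (az k).
    case: (unliftP ord0 j') => [l|] ->; last by move=> _; rewrite Xz Xb zb; exact: inv (mulf_neq0 b0 (z0 k)) (bz k).
    rewrite !(inj_eq lift_inj) !Xz invrK mulrC => kl.
    by apply: theta_ratio_neq0 => //; rewrite eq_sym.
  case: (unliftP ord0 j) => [j'|] ->; last first.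
    by move=> _; rewrite Xa Xb -invf_div; apply: inv => //; rewrite mulf_neq0 ?invr_eq0.
  case: (unliftP ord0 j') => [l|] ->; last by rewrite eqxx.
  by rewrite Xb Xz invrK.
have XY : \prod_i X i = \prod_i Y i.
  have -> : \prod_i X i = a * (b * \prod_i (z i)^-1).
    by rewrite big_ord_recl big_ord_recl Xa Xb; do 2 congr (_ * _); apply: eq_bigr => i _; exact: Xz.
  have -> : \prod_i Y i = p / T * \prod_s (u s)^-1.
    by rewrite big_ord_recl /Y ocons0; congr (_ * _); apply: eq_bigr => s _; rewrite oconsS.
  rewrite prodfV zp invr1 mulr1.
  have U0 : \prod_s u s != 0 by apply/prodf_neq0 => s _; exact: u0.
  rewrite prodfV; move: U0 bal; set U := \prod_s u s => U0 <-; field.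
  by rewrite U0 T0.
have numE x : x != 0 -> \prod_j theta p (x / Y j) =
    - (x * T / p) * theta p (x * T) * \prod_s theta p (u s * x).
  move=> x0; rewrite big_ord_recl /Y ocons0; congr (_ * _).
    by rewrite invf_div mulrA theta_unshift ?mulf_neq0.
  by apply: eq_bigr => s _; rewrite oconsS invrK mulrC.
have den0 : \prod_(j | j != ord0) theta p (a / X j) = theta p (a / b) * \prod_i theta p (a * z i).
  rewrite big_mkcond big_ord_recl big_ord_recl /= mul1r Xb; congr (_ * _).
  by apply: eq_bigr => i _; rewrite Xz invrK.
have den1 : \prod_(j | j != lift ord0 ord0) theta p (b / X j) =
    - (a / b)^-1 * theta p (a / b) * \prod_i theta p (b * z i).
  rewrite big_mkcond big_ord_recl big_ord_recl /= mul1r Xa -thetaV ?mulf_neq0 ?invr_eq0 // invf_div.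
  by congr (_ * _); apply: eq_bigr => i _; rewrite Xz invrK.
have denS k : \prod_(j | j != lift ord0 (lift ord0 k)) theta p ((z k)^-1 / X j) =
    theta p (a * z k)^-1 * (theta p (b * z k)^-1 * \prod_(i | i != k) theta p (z i / z k)).
  rewrite big_mkcond big_ord_recl big_ord_recl /= Xa Xb -!invfM !(mulrC (z k)).
  congr (_ * (_ * _)); rewrite [RHS]big_mkcond; apply: eq_bigr => i _.
  by rewrite !(inj_eq lift_inj) Xz invrK mulrC.
have := theta_identity p1 p0 X0 Y0 XY XX; rewrite /theta_sum.
rewrite big_ord_recl big_ord_recl Xa Xb !numE // den0 den1.
set A := \prod_i theta p (a * z i); set B := \prod_i theta p (b * z i).
set Sg := \sum_k _; set F := \sum_k _; set M := _ * kern t u z.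
have A0 : A != 0 by apply/prodf_neq0 => i _; exact: az.
have B0 : B != 0 by apply/prodf_neq0 => i _; exact: bz.
have hk : M * A * B * Sg = - (a * b * T / p) * F.
  rewrite big_distrr /F big_distrr; apply: eq_bigr => k _ /=.
  rewrite Xz numE ?invr_eq0 // denS.
  have hA := gposk_theta z1 k a0 pa a1; have hB := gposk_theta z1 k b0 pb b1.
  have hU : (\prod_s gneg (u s) z) * \prod_s theta p (u s / z k) = \prod_s gnegk k (u s) z.
    by rewrite -big_split; apply: eq_bigr => s _; exact: gnegk_theta.
  have hV := gvank_theta z1 k zi.
  rewrite /M /kern /fterm -hU -hV (mulrC (z k)^-1 T).
  set PA := gpos a z; set PB := gpos b z; rewrite -/A -/PA in hA; rewrite -/B -/PB in hB.
  set GA := gposk k a z in hA *; set GB := gposk k b z in hB *.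
  rewrite (_ : - (a * b * T / p) * _ = (- (a * z k) * GA) * (- (b * z k) * GB) *
     (- (T / z k / p) * theta p (T / z k) * (\prod_r gpos (t r) z) *
     ((\prod_s gneg (u s) z) * \prod_s theta p (u s / z k)) *
     (gvan z / \prod_(i | i != k) theta p (z i / z k)))); last first.
    set x1 := theta _ _; set x2 := \prod_r _; set x3 := \prod_s _; set x4 := \prod_s _.
    set x5 := _ / _; clearbody GA GB x1 x2 x3 x4 x5; field.
    by rewrite p0 z0.
  rewrite -hA -hB !invfM.
  set x1 := theta _ _; set x2 := \prod_r _; set x3 := \prod_s _; set x4 := \prod_s _.
  set x5 := _^-1; set x6 := _^-1; set x7 := _^-1; set x8 := gvan z; set x9 := _^-1; set x10 := _^-1.
  ring.
have F0 : F = - (p / (a * b * T)) * (M * A * B * Sg).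
  by rewrite hk; field; rewrite p0 a0 b0 T0.
rewrite addrA => /eqP; rewrite addrC addr_eq0 => /eqP h0.
rewrite F0 h0.
have -> : \prod_s theta p (a * u s) = \prod_s theta p (u s * a) by apply: eq_bigr => s _; rewrite mulrC.
have -> : \prod_s theta p (b * u s) = \prod_s theta p (u s * b) by apply: eq_bigr => s _; rewrite mulrC.
move: tab; set x1 := theta p (a / b); set x2 := theta p (a * T); set x3 := theta p (b * T).
set x4 := \prod_s _; set x5 := \prod_s _ => tab.
field.
by rewrite A0 B0 tab p0 a0 b0 T0.
Qed.

End Difference.

Section Shifted.
Variable n : nat.
Hypotheses (p1 : nm p < 1) (p0 : p != 0) (q1 : nm q < 1) (q0 : q != 0).

Definition qat (k : 'I_n.+1) (y : 'I_n.+1 -> R[i]) : 'I_n.+1 -> R[i] :=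
  fun i => if i == k then q * y i else y i.

Variables (a b : R[i]) (t : 'I_n -> R[i]) (u : 'I_n.+2 -> R[i]).
Local Notation T := (\prod_r t r).
Variables (y : 'I_n.+1 -> R[i]) (rho : R).
Hypotheses (yr : forall i, nm (y i) = rho) (rho0 : 0 < rho).
Hypotheses (t0 : forall r, t r != 0) (t1 : forall r, nm (t r) * rho < 1).
Hypothesis (yq : \prod_i y i = q^-1).

Let y0 i : y i != 0. Proof. by rewrite -nm_gt0 yr. Qed.
Let T0 : T != 0. Proof. by apply/prodf_neq0 => r _; exact: t0. Qed.

Lemma gposk_qat k c : gposk k c (qat k y) = gpos (q * c) y.
Proof.
rewrite /gposk /gpos [RHS](bigD1 k) //= /qat eqxx /= mulrA (mulrC c q); congr (_ * _).
by apply: eq_bigr => i /negPf ->.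
Qed.

Lemma gpos_qat k r : gpos (t r) (qat k y) = theta p (t r * y k) * gpos (t r) y.
Proof.
rewrite /gpos (bigD1 k) //= [in RHS](bigD1 k) //= /qat eqxx mulrCA.
rewrite egamma_theta ?mulf_neq0 ?nmM ?yr // -mulrA; congr (_ * (_ * _)).
by apply: eq_bigr => i /negPf ->.
Qed.

Lemma gnegk_qat k c : gnegk k c (qat k y) = gneg c y.
Proof.
rewrite /gnegk /gneg [RHS](bigD1 k) //= /qat eqxx /=; congr (_ * _).
  by congr (G _); field; rewrite q0 y0.
by apply: eq_bigr => i /negPf ->.
Qed.

Lemma theta_ratio_neq0' i j : injective y -> i != j -> theta p (y i / y j) != 0.
Proof.
move=> yi ij; have ny : nm (y i / y j) = 1 by rewrite nmM nmV !yr mulfV ?gt_eqF.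
apply: theta_neq0 => //; first by rewrite mulf_neq0 ?invr_eq0.
  by apply/eqP => /divr1_eq /yi /eqP; rewrite (negPf ij).
by rewrite ny p1 invf_gt1 // nm_gt0.
Qed.

Lemma gvank_qat k : injective y ->
  gvank k (qat k y) = gvan y / \prod_(i | i != k) theta p (y k / y i).
Proof.
move=> yi; rewrite (gvan_split k) /gvank mulrAC; congr (_ * _); last first.
  apply: eq_bigr => i ik; apply: eq_bigr => j /andP[_ jk].
  by rewrite /qat (negPf ik) (negPf jk).
rewrite -prodf_div; apply: eq_bigr => i ik; rewrite /qat eqxx (negPf ik).
have ny : nm (y k / y i) = 1 by rewrite nmM nmV !yr mulfV ?gt_eqF.
have -> : (G (y k / y i))^-1 = theta p (y k / y i) * (G (q * (y k / y i)))^-1.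
  by apply: egammaV_theta => //; rewrite ny.
have -> : q * (y i / (q * y k)) = y i / y k by field; rewrite q0 y0.
rewrite -(mulrA q); have ki : k != i by rewrite eq_sym.
have := theta_ratio_neq0' yi ki; set x := (G (y i / _))^-1; set w := (G (q * _))^-1.
by set th := theta p _ => th0; field.
Qed.

Lemma gvank_qat_eq0 k : ~ injective y -> gvank k (qat k y) = 0.
Proof.
move=> ninj; have [i [j [ij yij]]] : exists i j, i != j /\ y i = y j.
  apply: contrapT => h; apply: ninj => i j e; apply/eqP/negPn/negP => ij.
  by apply: h; exists i, j.
have g0 x : x = 1 -> (G x)^-1 = 0 by move=> ->; rewrite egamma_reg // subrr invr0 mulr0 invr0.
wlog ik : i j ij yij / i != k.
  move=> H; have [ik|ik] := eqVneq i k; last exact: (H i j).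
  by apply: (H j i) => //; rewrite eq_sym // -ik.
have [jk|jk] := eqVneq j k; rewrite /gvank.
  rewrite (bigD1 i) //= (g0 (q * (qat k y i / qat k y k))) ?mul0r //.
  by rewrite /qat eqxx (negPf ik) yij -jk; field; rewrite q0 y0.
rewrite [X in _ * X = _](bigD1 i) //= [X in _ * (X * _) = _](bigD1 j) /=; last by rewrite jk eq_sym ij.
by rewrite (g0 (qat k y i / qat k y j)) ?mul0r ?mulr0 // /qat (negPf ik) (negPf jk) yij divff.
Qed.

(** After the substitution all gamma factors are common to the n + 1 terms; what remains is the
    theta identity for the points y_i against T / q and 1 / t_r, whose product is 1 / q. *)
Theorem shifted_sum : \sum_k fterm a b t u k (qat k y) = 0.
Proof.
have [yi|ninj] := pselect (injective y); last first.
  by rewrite big1 // => k _; rewrite /fterm gvank_qat_eq0 ?mulr0.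
pose Y : 'I_n.+1 -> R[i] := ocons (T / q) (fun r => (t r)^-1).
have Y0 i : Y i != 0.
  by case: (unliftP ord0 i) => [j|] ->; rewrite /Y ?oconsS ?ocons0 ?mulf_neq0 ?invr_eq0.
have YY : \prod_i y i = \prod_i Y i.
  rewrite yq big_ord_recl /Y ocons0 [X in _ = _ * X](eq_bigr (fun r => (t r)^-1)) => [|r _]; last by rewrite oconsS.
  by rewrite prodfV mulrAC mulfV // mul1r.
have := theta_identity p1 p0 y0 Y0 YY (fun i j => theta_ratio_neq0' yi).
rewrite /theta_sum => h.
pose S := gpos (q * a) y * gpos (q * b) y * (\prod_r gpos (t r) y) *
   (\prod_s gneg (u s) y) * gvan y.
rewrite -[RHS](mulr0 (- T * S)) -[in RHS]h big_distrr; apply: eq_bigr => k _.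
have e1 : \prod_r gpos (t r) (qat k y) = \prod_r (theta p (t r * y k) * gpos (t r) y).
  by apply: eq_bigr => r _; exact: gpos_qat.
have e2 : \prod_s gnegk k (u s) (qat k y) = \prod_s gneg (u s) y.
  by apply: eq_bigr => s _; exact: gnegk_qat.
have e3 : \prod_j theta p (y k / Y j) = theta p (y k / (T / q)) * \prod_r theta p (t r * y k).
  rewrite big_ord_recl /Y ocons0; congr (_ * _); apply: eq_bigr => r _.
  by rewrite oconsS invrK mulrC.
rewrite /= e3 /fterm !gposk_qat e1 e2 gvank_qat // {1 2}/qat eqxx big_split /=.
have -> : T / (q * y k) = (y k / (T / q))^-1 by field; rewrite q0 y0 T0.
have -> : theta p (y k / (T / q))^-1 = - (T / q / y k) * theta p (y k / (T / q)).
  have yt : y k / (T / q) != 0 by rewrite !mulf_neq0 ?invr_eq0 // mulf_neq0 ?invr_eq0.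
  by rewrite (thetaV p1 yt) invf_div.
have -> : q * y k * (- (T / q / y k) * theta p (y k / (T / q))) = - T * theta p (y k / (T / q)).
  by field; rewrite q0 y0.
rewrite /S; set v := theta p _; set e := _^-1.
set A := gpos _ _; set B := gpos _ _; set C := \prod_r gpos _ _.
set D := \prod_(r < n) theta p _; set E := \prod_(s < _) _.
ring.
Qed.

End Shifted.
End Integrand.

(** * Contour shifts in the difference equation *)

Section DifferenceEquation.
Variable R : realType.
Local Notation dif f z := (differentiable (f : R[i]^o -> R[i]^o) (z : R[i]^o)).
Variables p q : R[i].
Hypotheses (p1 : nm p < 1) (p0 : p != 0) (q1 : nm q < 1) (q0 : q != 0).
Local Notation G := (egamma p q).

Lemma annular_gamma c : 0 < nm c < 1 -> annular G c.
Proof. by move=> h; exists 0, 1; split=> // y; exact: egamma_dif. Qed.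

Lemma annular_gammaV c : nm (p * q) < nm c -> annular (fun y => (G y)^-1) c.
Proof.
move=> h; exists (nm (p * q)), (nm c + 1); split; first exact: nm_ge0.
  by rewrite h ltrDl ltr01.
by move=> y /andP[hy _]; exact: egammaV_dif.
Qed.

Lemma annular_punctured phi c : c != 0 -> (forall y, y != 0 -> dif phi y) -> annular phi c.
Proof.
move=> c0 h; exists 0, (nm c + 1); split=> //; first by rewrite nm_gt0 c0 ltrDl ltr01.
by move=> y /andP[y0 _]; apply: h; rewrite -nm_gt0.
Qed.

Lemma adm_gvan n c : adm c (fun _ z => gvan p q (z : 'I_n -> R[i])).
Proof.
apply: adm_prod => i _; apply: adm_prod => j _.
apply: (@eq_adm _ _ _ (fun _ z => (fun y => (G y)^-1) (1 * (z i / z j)))).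
  by move=> _ z; rewrite mul1r.
have h : annular (fun y => (G y)^-1) 1.
  by apply: annular_gammaV; rewrite nm1 nmM mulr_ilt1 ?nm_ge0.
apply: (@adm_comp R n c (fun y => (G y)^-1) (fun=> 1) (fun z => z i / z j) 1 h ltr01).
  by move=> t _; exact: dif_cst.
exact: umono_ratio.
Qed.

Lemma adm_kern n k l (t : 'I_k -> R[i] -> R[i]) (u : 'I_l -> R[i] -> R[i]) c (d : R) : 0 < d ->
  (forall r, 0 < nm (t r c) < 1) -> (forall s, 0 < nm (u s c) < 1) ->
  (forall r w, nm (w - c) < d -> dif (t r) w) -> (forall s w, nm (w - c) < d -> dif (u s) w) ->
  adm c (fun w z => kern p q (t^~ w) (u^~ w) (z : 'I_n -> R[i])).
Proof.
move=> d0 t1 u1 dt du; apply: admM; last exact: adm_gvan.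
apply: admM; apply: adm_prod => r _; apply: adm_prod => i _.
  by apply: (adm_comp (annular_gamma (t1 r)) d0 (dt r)); exact: umono_var.
by apply: (adm_comp (annular_gamma (u1 r)) d0 (du r)); exact: umono_inv.
Qed.

Lemma torusB_kern n k l (t : 'I_k -> R[i]) (u : 'I_l -> R[i]) :
  (forall r, 0 < nm (t r) < 1) -> (forall s, 0 < nm (u s) < 1) ->
  torusB (fun z : 'I_n.+1 -> R[i] => kern p q t u z).
Proof.
move=> t1 u1.
apply: (@adm_torusB R n 0 (fun _ z => kern p q t u z)).
apply: (@adm_kern n.+1 k l (fun r _ => t r) (fun s _ => u s) 0 1 ltr01) => // r w _; exact: dif_cst.
Qed.

Lemma dif_expz (m : int) (c : R[i]) : c != 0 -> dif (fun w => w ^ m) c.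
Proof.
move=> c0; case: m => m /=; first by apply: difX; exact: dif_id.
have -> : (fun w : R[i] => w ^ Negz m) = fun w => (w ^+ m.+1)^-1 by apply/funext => w; rewrite NegzE exprnN.
by apply: difV; [rewrite expf_neq0|apply: difX; exact: dif_id].
Qed.

Section Scaled.
Variables (n : nat) (d : 'I_n.+1 -> int) (c : R[i]) (phi : R[i] -> R[i]) (a : R[i]).
Hypothesis c0 : c != 0.

Let near0 w : nm (w - c) < nm c -> w != 0.
Proof. by move=> h; apply/eqP => w0; move: h; rewrite w0 sub0r nmN ltxx. Qed.

Let nc0 : 0 < nm c. Proof. by rewrite nm_gt0. Qed.

Lemma adm_scaled i : annular phi (a * c ^ d i) -> adm c (fun w z => phi (a * zscale d w z i)).
Proof.
move=> h; apply: (@eq_adm _ _ _ (fun w z => phi ((a * w ^ d i) * z i))).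
  by move=> w z; rewrite /zscale mulrA.
apply: (adm_comp (g := fun w => a * w ^ d i) h nc0); last exact: umono_var.
by move=> w /near0 w0; apply: difM; [exact: dif_cst|exact: dif_expz].
Qed.

Lemma adm_scaled_inv i : annular phi (a / c ^ d i) -> adm c (fun w z => phi (a / zscale d w z i)).
Proof.
move=> h; apply: (@eq_adm _ _ _ (fun w z => phi ((a / w ^ d i) * (z i)^-1))).
  by move=> w z; rewrite /zscale invfM mulrA.
apply: (adm_comp (g := fun w => a / w ^ d i) h nc0); last exact: umono_inv.
move=> w /near0 w0; apply: difM; first exact: dif_cst.
by apply: difV; [rewrite expfz_neq0|exact: dif_expz].
Qed.

Lemma adm_scaled_ratio i j : annular phi (a * (c ^ d i / c ^ d j)) ->
  adm c (fun w z => phi (a * (zscale d w z i / zscale d w z j))).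
Proof.
move=> h; apply: (@eq_adm _ _ _ (fun w z => phi ((a * (w ^ d i / w ^ d j)) * (z i / z j)))).
  by move=> w z; rewrite /zscale invfM -mulrA; congr (phi (_ * _)); ring.
apply: (adm_comp (g := fun w => a * (w ^ d i / w ^ d j)) h nc0); last exact: umono_ratio.
move=> w /near0 w0; apply: difM; first exact: dif_cst.
apply: difM; first exact: dif_expz.
by apply: difV; [rewrite expfz_neq0|exact: dif_expz].
Qed.

End Scaled.

Lemma complex_root n (c : R[i]) : c != 0 -> exists k, k ^+ n.+1 = c.
Proof.
move=> /cexp_onto[w <-]; exists (cexp (w / n.+1%:R)).
have h m : cexp (w / n.+1%:R) ^+ m = cexp (m%:R * (w / n.+1%:R)).
  elim: m => [|m IH]; first by rewrite mul0r cexp0 expr0.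
  by rewrite exprS IH -cexpD; congr cexp; rewrite -natr1; ring.
by rewrite h mulrC divfK // pnatr_eq0.
Qed.

Section Equation.
Variable n : nat.
Variables (a b : R[i]) (t : 'I_n -> R[i]) (u : 'I_n.+2 -> R[i]).
Hypotheses (pa : nm p < nm a) (a1 : nm a < 1) (pb : nm p < nm b) (b1 : nm b < 1).
Hypotheses (t0 : forall r, t r != 0) (u0 : forall s, u s != 0) (u1 : forall s, nm (u s) < 1).
Local Notation T := (\prod_r t r).
Hypothesis bal : a * b * T * \prod_s u s = p.

Let a0 : a != 0. Proof. by rewrite -nm_gt0; apply: le_lt_trans pa; exact: nm_ge0. Qed.
Let b0 : b != 0. Proof. by rewrite -nm_gt0; apply: le_lt_trans pb; exact: nm_ge0. Qed.
Let T0 : T != 0. Proof. by apply/prodf_neq0 => r _; exact: t0. Qed.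

(** If kap^(n+1) = q, scaling z by 1 / kap with these exponents gives [qat k] of z / kap: coordinate
    k becomes kap^n z_k = q z_k / kap. *)
Definition kexp (k : 'I_n.+1) (i : 'I_n.+1) : int := if i == k then - n%:Z else 1.

Lemma kexp_sum k : \sum_i kexp k i = 0.
Proof.
rewrite (bigD1 k) //= /kexp eqxx (eq_bigr (fun=> 1)) => [|i /negPf -> //].
by rewrite sumr_const cardC1 card_ord /= natz addNr.
Qed.

(** Each bound keeps the arguments of one family of factors inside their annulus of holomorphy while
    the scale is c, so that no pole is met. *)
Lemma adm_fterm k c : c != 0 ->
  nm a < nm c ^+ n -> nm b < nm c ^+ n -> (forall r, nm (t r) < nm c ^+ n) ->
  nm q * nm c <= 1 -> (forall r, nm (t r) * nm c < 1) ->
  nm q * nm c ^+ n <= 1 -> (forall s, nm (u s) < nm c) ->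
  nm p < nm c ^+ n.+1 -> nm (p * q) * nm c ^+ n.+1 < 1 ->
  adm c (fun w z => fterm p q a b t u k (zscale (kexp k) w z)).
Proof.
move=> c0 h1 h1' h2 h3 h4 h5 h6 h7 h8.
have nc : 0 < nm c by rewrite nm_gt0.
have ek : c ^ kexp k k = c ^- n by rewrite /kexp eqxx exprnN.
have ei i : i != k -> c ^ kexp k i = c by rewrite /kexp => /negPf ->.
have ncn : 0 < nm c ^+ n by rewrite exprn_gt0.
have hpos e : e != 0 -> nm e < 1 -> nm e < nm c ^+ n ->
    adm c (fun w z => gposk p q k e (zscale (kexp k) w z)).
  move=> e0 e1 en; apply: admM.
    apply: adm_scaled => //; rewrite ek; apply: annular_gamma.
    by rewrite nmM nmV nmX divr_gt0 ?nm_gt0 //= ltr_pdivrMr // mul1r.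
  apply: adm_prod => i ik; apply: adm_scaled => //; rewrite ei //; apply: annular_gamma.
  rewrite !nmM !mulr_gt0 ?nm_gt0 //= mulrAC; apply: le_lt_trans e1.
  by rewrite ler_piMl ?nm_ge0.
rewrite /fterm; apply: admM; last first.
  apply: admM; apply: adm_prod => i ik.
    apply: admM.
      apply: (@adm_scaled_ratio n (kexp k) c (fun y => (G y)^-1) q c0 i k).
      rewrite ek ei // invrK -exprS; apply: annular_gammaV.
      by rewrite !nmM mulrC ltr_pM2l ?nm_gt0 // nmX.
    apply: (@eq_adm _ _ _ (fun w z => (G (1 * (zscale (kexp k) w z k / zscale (kexp k) w z i)))^-1)).
      by move=> w z; rewrite mul1r.
    apply: (@adm_scaled_ratio n (kexp k) c (fun y => (G y)^-1) 1 c0 k i).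
    rewrite ek ei // mul1r -invfM -exprSr; apply: annular_gammaV.
    by rewrite nmV nmX -[_^-1]mul1r ltr_pdivlMr ?exprn_gt0.
  apply: adm_prod => j /andP[ji jk].
  apply: (@eq_adm _ _ _ (fun w z => (G (1 * (zscale (kexp k) w z i / zscale (kexp k) w z j)))^-1)).
    by move=> w z; rewrite mul1r.
  apply: (@adm_scaled_ratio n (kexp k) c (fun y => (G y)^-1) 1 c0 i j).
  rewrite !ei // mul1r divff //; apply: annular_gammaV.
  by rewrite nm1 nmM mulr_ilt1 ?nm_ge0.
apply: admM; last first.
  apply: adm_prod => s _; apply: admM.
    apply: adm_scaled_inv => //; rewrite ek invrK; apply: annular_gamma.
    rewrite !nmM nmX !mulr_gt0 ?nm_gt0 //= mulrAC; apply: le_lt_trans (u1 s).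
    by rewrite ler_piMl ?nm_ge0.
  apply: adm_prod => i ik; apply: adm_scaled_inv => //; rewrite ei //; apply: annular_gamma.
  by rewrite nmM nmV divr_gt0 ?nm_gt0 //= ltr_pdivrMr // mul1r.
apply: admM; last first.
  apply: adm_prod => r _; apply: adm_prod => i _; apply: adm_scaled => //; apply: annular_gamma.
  have [->|ik] := eqVneq i k; last by rewrite ei // nmM mulr_gt0 ?nm_gt0 //= h4.
  by rewrite ek nmM nmV nmX divr_gt0 ?nm_gt0 //= ltr_pdivrMr // mul1r.
apply: admM; last exact: hpos.
apply: admM; last exact: hpos.
apply: admM.
  apply: (@eq_adm _ _ _ (fun w z => id (1 * zscale (kexp k) w z k))).
    by move=> w z; rewrite mul1r.
  apply: (@adm_scaled n (kexp k) c id 1) => //.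
  apply: annular_punctured => [|y _]; last exact: dif_id.
  by rewrite mul1r expfz_neq0.
apply: (@adm_scaled_inv n (kexp k) c (theta p) T) => //.
apply: annular_punctured => [|y y0]; last exact: theta_dif.
by rewrite mulf_neq0 ?invr_eq0 ?expfz_neq0.
Qed.

Hypotheses (n0 : (0 < n)%N) (tq : forall r, nm (t r) ^+ n.+1 < nm q).

(** The annulus rho < |c| < 1 / (|kap| rho) contains the scales 1 and 1 / kap, that is, the torus
    and the shifted contour. The number rho is taken so close to 1 that rho^(n+1) exceeds all moduli
    that must be beaten. *)
Let root_bounds (kap : R[i]) : kap ^+ n.+1 = q -> exists rho : R,
  [/\ 0 < rho, rho < 1, rho < (nm kap)^-1 &
  [/\ nm kap < 1, (forall r, nm (t r) < nm kap) &
  forall c, rho < nm c < (nm kap * rho)^-1 ->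
    forall k, adm c (fun w z => fterm p q a b t u k (zscale (kexp k) w z))]].
Proof.
move=> hk; pose v := nm kap.
have vq : v ^+ n.+1 = nm q by rewrite -nmX hk.
have v0 : 0 <= v := nm_ge0 kap.
have vp : 0 < v.
  by rewrite lt_neqAle v0 andbT eq_sym; apply/eqP => e; move: q0; rewrite -nm_gt0 -vq e exprS mul0r ltxx.
have v1 : v < 1.
  by rewrite ltNge; apply/negP => h; have := exprn_ege1 n.+1 h; rewrite vq leNgt q1.
have tv r : nm (t r) < v.
  by rewrite -(@ltr_pXn2r _ n.+1) ?nnegrE ?nm_ge0 // vq.
have tv1 r : nm (t r) / v < 1 by rewrite ltr_pdivrMr // mul1r.
have [M1 /andP[M10 M11] hM1] := finite_bound tv1.
have [M2 /andP[M20 M21] hM2] := finite_bound u1.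
pose M := \big[Order.max/0]_(x <- [:: M1; M2; nm a; nm b; nm p; v]) x.
have MM x : x \in [:: M1; M2; nm a; nm b; nm p; v] -> x <= M.
  by move=> xi; apply: (@le_bigmax_seq _ _ _ _ _ x xpredT id).
have M1' : M < 1.
  by rewrite /M !big_cons big_nil !gt_max M11 M21 a1 b1 p1 v1 ltr01.
have [rho [r0 r1 rM]] := @pow_near1 R M n.+1 M1'.
have rn1 : rho ^+ n.+1 <= rho by rewrite exprS; apply: ler_piMr; [exact: ltW|apply: exprn_ile1; exact: ltW].
have rn : rho ^+ n.+1 <= rho ^+ n by rewrite exprS; apply: ler_piMl; [apply: exprn_ge0; exact: ltW|exact: ltW].
have hm x : x \in [:: M1; M2; nm a; nm b; nm p; v] -> x < rho ^+ n.+1.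
  by move=> /MM h; apply: le_lt_trans h rM.
exists rho; split=> //.
  by apply: lt_trans r1 _; rewrite invf_gt1.
split=> // c /andP[rc cr] k.
have x0 : 0 < nm c by apply: lt_trans rc.
have vx : v * nm c * rho < 1.
  by move: cr; rewrite -[_^-1]mul1r ltr_pdivlMr ?mulr_gt0 // => cr;
    rewrite (_ : v * nm c * rho = nm c * (nm kap * rho)) //; rewrite /v; ring.
have vx0 : 0 <= v * nm c by rewrite mulr_ge0 // ltW.
have vxr0 : 0 <= v * nm c * rho by rewrite mulr_ge0 // ltW.
have rcn m : rho ^+ m <= nm c ^+ m by apply: lerXn2r; rewrite ?nnegrE; apply: ltW.
have small x : x < rho ^+ n.+1 -> x < nm c ^+ n.
  by move=> h; apply: lt_le_trans (rcn n); apply: lt_le_trans rn.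
apply: adm_fterm.
- by rewrite -nm_gt0.
- by apply: small; apply: hm; rewrite !inE eqxx !orbT.
- by apply: small; apply: hm; rewrite !inE eqxx !orbT.
- move=> r; apply: small; apply: le_lt_trans (_ : M1 < _); last by apply: hm; rewrite !inE eqxx.
  apply: le_trans (hM1 r); rewrite ler_pdivlMr // ler_piMr ?nm_ge0 // ltW //.
- rewrite -vq exprSr -mulrA; apply: le_trans (ltW vx); rewrite mulrC; apply: ler_wpM2l => //.
  apply: le_trans rn1; apply: ltW; apply: le_lt_trans (hm v _); last by rewrite !inE eqxx !orbT.
  by case: (n) n0 => // m _; rewrite exprS ler_piMr // exprn_ile1 // ltW.
- move=> r; apply: le_lt_trans vx.
  rewrite (_ : nm (t r) * nm c = v * nm c * (nm (t r) / v)); last by field; rewrite gt_eqF.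
  apply: ler_wpM2l => //; apply: le_trans (hM1 r) _; apply: le_trans rn1.
  by apply/ltW/hm; rewrite !inE eqxx.
- rewrite -vq exprS -mulrA -exprMn; apply: le_trans (_ : rho ^+ n * (v * nm c) ^+ n <= _).
    apply: ler_wpM2r; first exact: exprn_ge0.
    by apply: le_trans rn; apply/ltW/hm; rewrite !inE eqxx !orbT.
  by rewrite -exprMn mulrC exprn_ile1 // ltW.
- move=> s; apply: le_lt_trans (hM2 s) _; apply: lt_trans rc; apply: lt_le_trans rn1.
  by apply: hm; rewrite !inE eqxx !orbT.
- by apply: lt_le_trans (rcn n.+1); apply: hm; rewrite !inE eqxx !orbT.
- rewrite nmM -vq -mulrA -exprMn; apply: le_lt_trans (_ : rho ^+ n.+1 * (v * nm c) ^+ n.+1 < _).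
    apply: ler_wpM2r; first exact: exprn_ge0.
    by apply/ltW/hm; rewrite !inE eqxx !orbT.
  by rewrite -exprMn mulrC exprn_ilt1.
Qed.

(** Each term is moved by its own contour shift; afterwards the sum vanishes pointwise by
    [shifted_sum]. *)
Lemma sum_mu_fterm : (forall k, torusB (fun z => fterm p q a b t u k z)) /\
  \sum_k mu (fun z => fterm p q a b t u k z) = 0.
Proof.
have [kap hk] := complex_root n q0.
have [rho [r0 r1 rk [k1 tk hadm]]] := root_bounds hk.
have k0 : 0 < nm kap.
  by rewrite nm_gt0; apply/eqP => e; move: q0; rewrite -hk e exprS mul0r eqxx.
have kap0 : kap != 0 by rewrite -nm_gt0.
have krho : nm kap * rho < 1 by rewrite mulr_ilt1 // ltW.
have hs1 : rho < nm (1 : R[i]) < (nm kap * rho)^-1.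
  by rewrite nm1 r1 /= invf_gt1 // mulr_gt0.
have hsk : rho < nm kap^-1 < (nm kap * rho)^-1.
  by rewrite nmV rk /= ltf_pV2 ?posrE ?mulr_gt0 // gtr_pMr.
have e1 z k : zscale (kexp k) 1 z = z :> ('I_n.+1 -> R[i]).
  by apply/funext => i; rewrite /zscale exp1rz mul1r.
have tB k : torusB (fun z => fterm p q a b t u k z).
  have := adm_torusB (hadm 1 hs1 k).
  by apply: eq_torusB => z; rewrite e1.
split=> //.
have sh k : mu (fun z => fterm p q a b t u k z) =
    mu (fun z => fterm p q a b t u k (zscale (kexp k) kap^-1 z)).
  rewrite -(@mu_shift R n (kexp k) (fterm p q a b t u k) rho _ (kexp_sum k) (ltW r0) _ 1 kap^-1 hs1 hsk).
    by apply: eq_mu => z _; rewrite e1.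
  by move=> c hc; exact: hadm.
rewrite (eq_bigr _ (fun k _ => sh k)) -mu_sum; last by move=> k; exact: adm_torusB (hadm _ hsk k).
rewrite (@eq_mu _ _ _ (fun=> 0)).
  apply: mu_unique; first exact: torusB_cst.
  by apply: eq_tends (tends_cst 0) => m; rewrite tmean_cst.
move=> z [z1 zp]; pose y i := kap^-1 * z i.
have hq k : zscale (kexp k) kap^-1 z = qat q k y.
  apply/funext => i; rewrite /zscale /qat /y /kexp; have [->|//] := eqVneq i k.
  by rewrite exprz_inv opprK -exprnP -hk exprSr mulrA mulfK.
under eq_bigr do rewrite hq.
apply: (@shifted_sum R p q n p1 p0 q1 q0 a b t u y (nm kap)^-1) => //.
- by move=> i; rewrite /y nmM nmV z1 mulr1.
- by rewrite invr_gt0.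
- by move=> r; rewrite ltr_pdivrMr // mul1r.
- by rewrite /y big_split /= zp mulr1 prodr_const card_ord exprVn hk.
Qed.

Theorem difference_equation0 : a != b ->
  mu (fun z : 'I_n.+1 -> R[i] => kern p q (ocons a (ocons (q * b) t)) u z) *
    (theta p (a * T) * \prod_s theta p (a * u s)) =
  mu (fun z : 'I_n.+1 -> R[i] => kern p q (ocons (q * a) (ocons b t)) u z) *
    (theta p (b * T) * \prod_s theta p (b * u s)).
Proof.
move=> ab; have [tB hsum] := sum_mu_fterm.
set g1 := theta p (a * T) * _; set g2 := theta p (b * T) * _.
have qn c : c != 0 -> nm c < 1 -> 0 < nm (q * c) < 1.
  by move=> c0 c1; rewrite nm_gt0 mulf_neq0 //= nmM mulr_ilt1 ?nm_ge0.
have tn r : 0 < nm (t r) < 1.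
  rewrite nm_gt0 t0 /=; have := lt_trans (tq r) q1.
  by apply: contraTT; rewrite -!leNgt => h; exact: exprn_ege1.
have un s : 0 < nm (u s) < 1 by rewrite nm_gt0 u0 u1.
have an : 0 < nm a < 1 by rewrite nm_gt0 a0.
have bn : 0 < nm b < 1 by rewrite nm_gt0 b0.
have cons_n k (x : R[i]) (y : 'I_k -> R[i]) : 0 < nm x < 1 -> (forall r, 0 < nm (y r) < 1) ->
    forall r, 0 < nm (ocons x y r) < 1.
  by move=> hx hy r; case: (unliftP ord0 r) => [r'|] ->; rewrite ?oconsS ?ocons0.
have B1 : torusB (fun z : 'I_n.+1 -> R[i] => kern p q (ocons a (ocons (q * b) t)) u z).
  by apply: torusB_kern => //; apply: (cons_n); [exact: an|apply: (cons_n); [exact: qn|exact: tn]].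
have B2 : torusB (fun z : 'I_n.+1 -> R[i] => kern p q (ocons (q * a) (ocons b t)) u z).
  by apply: torusB_kern => //; apply: (cons_n); [exact: qn|apply: (cons_n); [exact: bn|exact: tn]].
apply/eqP; rewrite -subr_eq0; apply/eqP.
rewrite !(mulrC (mu _)) -mulNr -(muZ _ B1) -(muZ _ B2)
  -(muD (torusBM (torusB_cst _ _) B1) (torusBM (torusB_cst _ _) B2)).
have := hsum; rewrite -mu_sum // => hs.
rewrite (@eq_mu _ _ _ (fun z => - (b * theta p (a / b)) * \sum_k fterm p q a b t u k z)).
  by rewrite muZ ?hs ?mulr0 //; exact: torusB_sum.
move=> z zu; have [z1 _] := zu.
rewrite -(difference_sum p1 p0 q1 q0 pa a1 pb b1 t0 u0 u1 bal ab zu) !kern_consl.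
have sh c : c != 0 -> nm c < 1 -> gpos p q (q * c) z = (\prod_i theta p (c * z i)) * gpos p q c z.
  move=> c0 c1; rewrite /gpos -big_split; apply: eq_bigr => i _ /=.
  rewrite -mulrA egamma_theta //; first by rewrite mulf_neq0 // -nm_gt0 z1.
  by rewrite nmM z1 mulr1.
rewrite (sh b) // (sh a) //.
by rewrite /g1 /g2; set x1 := theta _ _; set x2 := \prod_s _; set x3 := \prod_i _; set x4 := theta p (b * T); set x5 := \prod_s _; set x6 := \prod_i _; ring.
Qed.

End Equation.
End DifferenceEquation.

#[local] Opaque egamma mu.

Lemma div_cross (K : fieldType) (m1 m2 g x1 x2 : K) : g * x2 != 0 -> g * x1 != 0 ->
  m1 * x1 = m2 * x2 -> m1 / (g * x2) = m2 / (g * x1).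
Proof.
by move=> h2 h1 h; apply/eqP; rewrite eqr_div // !(mulrCA _ g) h.
Qed.

(** * Invariance of the quotient of the two sides *)

Section Ratio.
Variable R : realType.
Local Notation dif f z := (differentiable (f : R[i]^o -> R[i]^o) (z : R[i]^o)).

Lemma nm_prod_lt1 (I : finType) (P : pred I) (f : I -> R[i]) i : P i ->
  (forall i, P i -> nm (f i) < 1) -> nm (\prod_(i | P i) f i) < 1.
Proof.
move=> Pi f1; rewrite (bigD1 i) //= nmM; apply: le_lt_trans (f1 i Pi).
rewrite ler_piMr ?nm_ge0 // nm_prod; apply: prodr_ile1 => j /andP[Pj _].
by rewrite nm_ge0 ltW // f1.
Qed.

(** The right-hand side of the theorem. *)
Definition gg p q m (t u : 'I_m -> R[i]) : R[i] :=
  (\prod_r \prod_s egamma p q (t r * u s)) *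
  \prod_r (egamma p q ((\prod_s u s) / u r) * egamma p q ((\prod_s t s) / t r)).

Definition inD (c : R[i]) m (t u : 'I_m -> R[i]) :=
  [/\ forall r, 0 < nm (t r) < 1, forall s, 0 < nm (u s) < 1 &
      (\prod_r t r) * (\prod_s u s) = c].

(* The quotient of the two sides, up to a constant factor. *)
Definition cratio p q n (t u : 'I_n.+2 -> R[i]) : R[i] :=
  mu (fun z : 'I_n.+1 -> R[i] => kern p q t u z) / gg p q t u.

Lemma kern_sym p q n k l (t : 'I_k -> R[i]) (u : 'I_l -> R[i]) (z : 'I_n -> R[i]) :
  nm p < 1 -> nm q < 1 -> kern p q t u z = kern q p t u z.
Proof.
move=> p1 q1; have e : egamma p q = egamma q p by apply/funext => x; exact: egammaC.
by rewrite /kern /gpos /gneg /gvan e.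
Qed.

Lemma gg_sym p q m (t u : 'I_m -> R[i]) : nm p < 1 -> nm q < 1 -> gg p q t u = gg q p t u.
Proof.
move=> p1 q1; have e : egamma p q = egamma q p by apply/funext => x; exact: egammaC.
by rewrite /gg e.
Qed.

Lemma cratio_sym p q n (t u : 'I_n.+2 -> R[i]) : nm p < 1 -> nm q < 1 ->
  cratio p q t u = cratio q p t u.
Proof.
move=> p1 q1; have e (z : 'I_n.+1 -> R[i]) (_ : utorus z) : kern p q t u z = kern q p t u z by exact: kern_sym.
exact: (congr2 (fun x y : R[i] => x / y) (eq_mu e) (gg_sym t u p1 q1)).
Qed.

Section Fixed.
Variables p q : R[i].
Hypotheses (p1 : nm p < 1) (p0 : p != 0) (q1 : nm q < 1) (q0 : q != 0).
Local Notation G := (egamma p q).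

Lemma kern_perm n k l (t : 'I_k -> R[i]) (u : 'I_l -> R[i]) (z : 'I_n -> R[i]) s :
  bijective s -> kern p q (fun r : 'I_k => t (s r)) u z = kern p q t u z.
Proof.
by move=> [s' sK s'K]; rewrite /kern [in RHS](reindex s) //; exists s' => i _; rewrite ?sK ?s'K.
Qed.

Lemma gg_perm m (t u : 'I_m -> R[i]) s : bijective s ->
  gg p q (fun r => t (s r)) u = gg p q t u.
Proof.
move=> [s' sK s'K]; have bs : {on [pred i | true], bijective s} by exists s' => i _; rewrite ?sK ?s'K.
have e (F : 'I_m -> R[i]) : \prod_r F (s r) = \prod_r F r by rewrite [RHS](reindex s).
rewrite /gg !big_split /= (e t) (e (fun r => \prod_s0 G (t r * u s0))).
by rewrite (e (fun r => G ((\prod_r t r) / t r))).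
Qed.

Lemma cratio_perm n (t u : 'I_n.+2 -> R[i]) s : bijective s ->
  cratio p q (fun r => t (s r)) u = cratio p q t u.
Proof.
move=> bs; have e (z : 'I_n.+1 -> R[i]) (_ : utorus z) :
    kern p q (fun r => t (s r)) u z = kern p q t u z by exact: kern_perm.
by rewrite /cratio (gg_perm _ _ bs) (eq_mu e).
Qed.

Lemma gvan_inv n (z : 'I_n -> R[i]) : gvan p q (fun i => (z i)^-1) = gvan p q z.
Proof.
rewrite /gvan (exchange_big_dep xpredT) //=; apply: eq_bigr => i _.
by apply: eq_big => [j|j _]; [rewrite eq_sym|rewrite invrK mulrC].
Qed.

Lemma kern_inv n k l (t : 'I_k -> R[i]) (u : 'I_l -> R[i]) (z : 'I_n -> R[i]) :
  kern p q t u (fun i => (z i)^-1) = kern p q u t z.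
Proof.
have e1 c : gpos p q c (fun i => (z i)^-1) = gneg p q c z by [].
have e2 c : gneg p q c (fun i => (z i)^-1) = gpos p q c z.
  by apply: eq_bigr => i _; rewrite invrK.
rewrite /kern gvan_inv (mulrC (\prod_r gpos p q (t r) _)).
by under [X in X * _ * _ = _]eq_bigr do rewrite e2.
Qed.

Lemma gg_swap m (t u : 'I_m -> R[i]) : gg p q t u = gg p q u t.
Proof.
rewrite /gg exchange_big (eq_bigr (fun r => \prod_s G (u r * t s))) => [|r _]; last first.
  by apply: eq_bigr => s _; rewrite mulrC.
by rewrite !big_split /= [X in _ * X = _]mulrC.
Qed.

Lemma cratio_swap n (t u : 'I_n.+2 -> R[i]) : cratio p q t u = cratio p q u t.
Proof.
have e (z : 'I_n.+1 -> R[i]) (_ : utorus z) : kern p q t u (fun i => (z i)^-1) = kern p q u t z.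
  exact: kern_inv.
by rewrite /cratio gg_swap -mu_inv (eq_mu e).
Qed.

Section Domain.
Variable m : nat.
Variables (t u : 'I_m.+2 -> R[i]).
Hypothesis hD : inD (p * q) t u.

Let t1 r : 0 < nm (t r) < 1. Proof. by case: hD. Qed.
Let u1 s : 0 < nm (u s) < 1. Proof. by case: hD. Qed.
Let t0 r : t r != 0. Proof. by rewrite -nm_gt0; case/andP: (t1 r). Qed.
Let u0 s : u s != 0. Proof. by rewrite -nm_gt0; case/andP: (u1 s). Qed.

Let other (r : 'I_m.+2) : exists r', r' != r.
Proof.
have [->|h] := eqVneq r ord0; last by exists ord0; rewrite eq_sym.
by exists (lift ord0 ord0).
Qed.

Let rest_lt1 (v : 'I_m.+2 -> R[i]) r : (forall s, 0 < nm (v s) < 1) ->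
  nm (\prod_(s | s != r) v s) < 1.
Proof.
move=> v1; have [r' h] := other r; apply: (nm_prod_lt1 (i := r')) => // s _.
by case/andP: (v1 s).
Qed.

Let all_lt1 (v : 'I_m.+2 -> R[i]) : (forall s, 0 < nm (v s) < 1) -> nm (\prod_s v s) < 1.
Proof. by move=> v1; apply: (nm_prod_lt1 (i := ord0)) => // s _; case/andP: (v1 s). Qed.

Let above x y : x != 0 -> x * y = p * q -> nm y < 1 -> nm (p * q) < nm x.
Proof. by move=> x0 <- y1; rewrite nmM gtr_pMr // nm_gt0. Qed.

(** The complementary parameters have a product of modulus less than 1, while the total product is
    pq. The lower bound keeps the gamma value nonzero. *)
Lemma inD_tu r s : nm (p * q) < nm (t r * u s) < 1.
Proof.
apply/andP; split; last first.
  have /andP[_ a] := t1 r; have /andP[_ b] := u1 s.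
  by rewrite nmM mulr_ilt1 ?nm_ge0.
have [_ _ h] := hD.
apply: (above (y := (\prod_(r' | r' != r) t r') * \prod_(s' | s' != s) u s')).
- by rewrite mulf_neq0.
- by rewrite -h [X in _ = X * _](bigD1 r) //= [X in _ = _ * X](bigD1 s) //= mulrACA.
by rewrite nmM mulr_ilt1 ?nm_ge0 ?rest_lt1.
Qed.

Lemma inD_restu r : nm (p * q) < nm ((\prod_s u s) / u r) < 1.
Proof.
have e : (\prod_s u s) / u r = \prod_(s | s != r) u s by rewrite (bigD1 r) //= mulrC mulKf.
rewrite e rest_lt1 // andbT; have [_ _ h] := hD.
apply: (above (y := u r * \prod_s t s)).
- by apply/prodf_neq0 => s _.
- by rewrite -h mulrA -[X in X * _]mulrC -(bigD1 r (P := xpredT) (F := u)) //= mulrC.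
by rewrite nmM mulr_ilt1 ?nm_ge0 ?all_lt1 //; case/andP: (u1 r).
Qed.

Lemma inD_restt r : nm (p * q) < nm ((\prod_s t s) / t r) < 1.
Proof.
have e : (\prod_s t s) / t r = \prod_(s | s != r) t s by rewrite (bigD1 r) //= mulrC mulKf.
rewrite e rest_lt1 // andbT; have [_ _ h] := hD.
apply: (above (y := t r * \prod_s u s)).
- by apply/prodf_neq0 => s _.
- by rewrite -h mulrA -[X in X * _]mulrC -(bigD1 r (P := xpredT) (F := t)) //=.
by rewrite nmM mulr_ilt1 ?nm_ge0 ?all_lt1 //; case/andP: (t1 r).
Qed.

Lemma gg_neq0 : gg p q t u != 0.
Proof.
rewrite mulf_neq0 //; apply/prodf_neq0 => r _.
  by apply/prodf_neq0 => s _; apply: egamma_neq0 => //; exact: inD_tu.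
by rewrite mulf_neq0 //; apply: egamma_neq0 => //; [exact: inD_restu|exact: inD_restt].
Qed.

End Domain.

Lemma cratio_dif n (t u : 'I_n.+2 -> R[i] -> R[i]) c (d : R) : 0 < d ->
  (forall r w, nm (w - c) < d -> dif (t r) w) -> (forall s w, nm (w - c) < d -> dif (u s) w) ->
  inD (p * q) (t^~ c) (u^~ c) -> dif (fun w => cratio p q (t^~ w) (u^~ w)) c.
Proof.
move=> d0 dt du hD; have [t1 u1 _] := hD.
have cc : nm (c - c) < d by rewrite subrr nm0.
have dG f : dif f c -> nm (p * q) < nm (f c) < 1 -> dif (fun w => G (f w)) c.
  move=> df /andP[h1 h2]; apply: (@dif_comp R R[i]^o G f c df).
  by apply: egamma_dif => //; rewrite h2 andbT; apply: le_lt_trans h1; exact: nm_ge0.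
have t0 r : t r c != 0 by rewrite -nm_gt0; case/andP: (t1 r).
have u0 s : u s c != 0 by rewrite -nm_gt0; case/andP: (u1 s).
apply: dif_div; first exact: gg_neq0.
  apply: (@mu_dif R n c (fun w z => kern p q (t^~ w) (u^~ w) z)).
  exact: adm_kern d0 t1 u1 dt du.
apply: difM; apply: dif_prod => r _.
  apply: dif_prod => s _; apply: (dG (fun w => t r w * u s w)); last exact: (inD_tu hD).
  by apply: difM; [exact: dt|exact: du].
apply: difM.
  apply: (dG (fun w => (\prod_s u s w) / u r w)); last exact: (inD_restu hD).
  by apply: dif_div => //; [apply: dif_prod => s _; exact: du|exact: du].
apply: (dG (fun w => (\prod_s t s w) / t r w)); last exact: (inD_restt hD).
by apply: dif_div => //; [apply: dif_prod => s _; exact: dt|exact: dt].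
Qed.

Lemma gg_cons2 n (x y : R[i]) (t : 'I_n -> R[i]) (u : 'I_n.+2 -> R[i]) : x != 0 -> y != 0 ->
  gg p q (ocons x (ocons y t)) u =
  (\prod_s G (x * u s)) * (\prod_s G (y * u s)) * (\prod_r \prod_s G (t r * u s)) *
  (\prod_r G ((\prod_s u s) / u r)) * (G (x * \prod_r t r) * G (y * \prod_r t r)) *
  \prod_r G (x * y * (\prod_s t s) / t r).
Proof.
move=> x0 y0.
have pE (F : R[i] -> R[i]) : \prod_r F (ocons x (ocons y t) r) = F x * (F y * \prod_r F (t r)).
  rewrite big_ord_recl big_ord_recl !oconsS !ocons0; do 2 congr (_ * _).
  by apply: eq_bigr => r _; rewrite !oconsS.
rewrite /gg (pE (fun c => \prod_s G (c * u s))) big_split /= (pE id) /=.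
rewrite (pE (fun c => G (x * (y * \prod_r t r) / c))).
rewrite (_ : x * (y * _) / x = y * \prod_r t r); last by rewrite mulrC mulKf.
rewrite (_ : x * (y * _) / y = x * \prod_r t r); last by rewrite mulrCA mulrC mulKf.
rewrite (mulrA x y).
by set A := \prod_s _; set B := \prod_s _; set C := \prod_r _; set D := \prod_r _; set E := G _; set F := G _; ring.
Qed.

(** The theta factors in the difference equation of the integral are those by which [gg] changes
    according to the functional equation of the gamma function. *)
Lemma cratio_step n (a b : R[i]) (t : 'I_n -> R[i]) (u : 'I_n.+2 -> R[i]) : (0 < n)%N ->
  nm p < nm a < 1 -> nm p < nm b < 1 -> (forall r, t r != 0) ->
  (forall r, nm (t r) ^+ n.+1 < nm q) ->
  (forall s, 0 < nm (u s) < 1) -> a * b * (\prod_r t r) * \prod_s u s = p ->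
  cratio p q (ocons a (ocons (q * b) t)) u = cratio p q (ocons (q * a) (ocons b t)) u.
Proof.
move=> n0 /andP[pa a1] /andP[pb b1] t0 tq hu bal.
have u0 s : u s != 0 by rewrite -nm_gt0; case/andP: (hu s).
have u1 s : nm (u s) < 1 by case/andP: (hu s).
have a0 : a != 0 by rewrite -nm_gt0; apply: le_lt_trans pa; exact: nm_ge0.
have b0 : b != 0 by rewrite -nm_gt0; apply: le_lt_trans pb; exact: nm_ge0.
(* The theta identity needs distinct points; for a = b the two parameter lists differ by a
   transposition. *)
have [<-|ab] := eqVneq a b.
  pose s := tperm (ord0 : 'I_n.+2) (lift ord0 ord0).
  rewrite -(@cratio_perm n _ u s); last exact: injF_bij (@perm_inj _ _).
  congr (cratio p q _ u); apply/funext => r; rewrite /s.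
  case: tpermP => [->|->|]; rewrite ?oconsS ?ocons0 //.
  case: (unliftP ord0 r) => [r'|] -> //; rewrite !oconsS.
  by case: (unliftP ord0 r') => [r''|] -> //; rewrite !oconsS.
have tn r : nm (t r) < 1.
  by rewrite ltNge; apply/negP => h; have := exprn_ege1 n.+1 h; rewrite leNgt (lt_trans (tq r) q1).
have T0 : \prod_r t r != 0 by apply/prodf_neq0 => r _.
have T1 : nm (\prod_r t r) <= 1.
  by rewrite nm_prod; apply: prodr_ile1 => r _; rewrite nm_ge0 ltW.
have hy (x y : R[i]) : 0 < nm x < 1 -> 0 < nm y < 1 -> x * y = q * a * b ->
    inD (p * q) (ocons x (ocons y t)) u.
  move=> hx hy xy; split=> //.
    move=> r; case: (unliftP ord0 r) => [r'|] ->; rewrite ?oconsS ?ocons0 //.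
    case: (unliftP ord0 r') => [r''|] ->; rewrite ?oconsS ?ocons0 //.
    by rewrite nm_gt0 t0 tn.
  rewrite big_ord_recl big_ord_recl !oconsS !ocons0 -bal (eq_bigr t) => [|r _].
    by rewrite !mulrA xy; ring.
  by rewrite !oconsS.
have qn c : c != 0 -> nm c < 1 -> 0 < nm (q * c) < 1.
  by move=> c0 c1; rewrite nm_gt0 mulf_neq0 //= nmM mulr_ilt1 ?nm_ge0.
have an : 0 < nm a < 1 by rewrite nm_gt0 a0.
have bn : 0 < nm b < 1 by rewrite nm_gt0 b0.
have d1 := hy a (q * b) an (qn b b0 b1) ltac:(ring).
have d2 := hy (q * a) b (qn a a0 a1) bn (erefl _).
have g1 := gg_neq0 d1; have g2 := gg_neq0 d2.
have := difference_equation0 p1 p0 q1 q0 pa a1 pb b1 t0 u0 u1 bal n0 tq ab.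
set th1 := _ * \prod_s theta p (a * u s); set th2 := _ * \prod_s theta p (b * u s) => h.
pose g := (\prod_s G (a * u s)) * (\prod_s G (b * u s)) * (\prod_r \prod_s G (t r * u s)) *
  (\prod_r G ((\prod_s u s) / u r)) * (G (a * \prod_r t r) * G (b * \prod_r t r)) *
  \prod_r G (q * a * b * (\prod_s t s) / t r).
have sh c v : c != 0 -> nm c < 1 -> v != 0 -> nm v <= 1 -> G (q * c * v) = theta p (c * v) * G (c * v).
  move=> c0 c1 v0 v1; rewrite -mulrA egamma_theta ?mulf_neq0 //.
  by rewrite nmM; apply: le_lt_trans c1; rewrite ler_piMr ?nm_ge0.
have shu c : c != 0 -> nm c < 1 ->
    \prod_s G (q * c * u s) = (\prod_s theta p (c * u s)) * \prod_s G (c * u s).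
  by move=> c0 c1; rewrite -big_split; apply: eq_bigr => s _; apply: sh => //; exact: ltW.
have e1 : gg p q (ocons a (ocons (q * b) t)) u = g * th2.
  rewrite gg_cons2 ?mulf_neq0 // shu // sh // /g /th2 (mulrCA a q b) (mulrA q a b).
  set x1 := \prod_s _; set x2 := \prod_s _; set x3 := \prod_s _; set x4 := \prod_r _.
  set x5 := \prod_r _; set x6 := \prod_r G _; set x7 := G _; set x8 := theta _ _; set x9 := G _.
  ring.
have e2 : gg p q (ocons (q * a) (ocons b t)) u = g * th1.
  rewrite gg_cons2 ?mulf_neq0 // shu // sh // /g /th1.
  set x1 := \prod_s _; set x2 := \prod_s _; set x3 := \prod_s _; set x4 := \prod_r _.
  set x5 := \prod_r _; set x6 := \prod_r G _; set x7 := theta _ _; set x8 := G _; set x9 := G _.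
  ring.
rewrite e1 in g1; rewrite e2 in g2; rewrite /cratio e1 e2.
exact: div_cross g1 g2 h.
Qed.

End Fixed.
End Ratio.

(** * Propagating the invariance in logarithmic coordinates *)

Section Near.
Variable R : realType.

Definition nearc (c : R[i]) (P : R[i] -> Prop) :=
  exists2 d : R, 0 < d & forall z, nm (z - c) < d -> P z.

Lemma nearc_and c P Q : nearc c P -> nearc c Q -> nearc c (fun z => P z /\ Q z).
Proof.
move=> [d d0 hP] [e e0 hQ]; exists (Num.min d e); first by rewrite lt_min d0.
by move=> z; rewrite lt_min => /andP[/hP ? /hQ ?].
Qed.

Lemma nearc_all (I : finType) c (P : I -> R[i] -> Prop) :
  (forall i, nearc c (P i)) -> nearc c (fun z => forall i, P i z).
Proof.
move=> h; have [d hd] := choice (fun i => (ltac:(by case: (h i) => d d0 hP; exists d) :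
  exists d : R, 0 < d /\ forall z, nm (z - c) < d -> P i z)).
exists (\big[Order.min/1]_i d i).
  by apply/bigmin_gtP; split=> // i _; case: (hd i).
move=> z hz i; case: (hd i) => _; apply; apply: lt_le_trans hz _.
exact: bigmin_le.
Qed.

Lemma nearc_mono c (P Q : R[i] -> Prop) : (forall z, P z -> Q z) -> nearc c P -> nearc c Q.
Proof. by move=> PQ [d d0 h]; exists d => // z /h/PQ. Qed.

Lemma realCD (x y : R) : (x + y)%:C%C = x%:C%C + y%:C%C :> R[i].
Proof. exact: (rmorphD (real_complex R)). Qed.

Lemma realCM (x y : R) : (x * y)%:C%C = x%:C%C * y%:C%C :> R[i].
Proof. exact: (rmorphM (real_complex R)). Qed.

Lemma realCV (x : R) : x^-1%:C%C = x%:C%C^-1 :> R[i].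
Proof. exact: (fmorphV (real_complex R)). Qed.

Lemma realCn k : (k%:R : R)%:C%C = k%:R :> R[i].
Proof. exact: (rmorph_nat (real_complex R)). Qed.

Lemma sum_ocons_real n (x y : R) :
  \sum_(r < n.+2) ocons x%:C%C (ocons x%:C%C (fun=> y%:C%C)) r = (2 * x + n%:R * y)%:C%C :> R[i].
Proof.
rewrite big_ord_recl big_ord_recl !oconsS !ocons0 (eq_bigr (fun=> y%:C%C)) => [|i _]; last by rewrite !oconsS.
rewrite sumr_const card_ord -[_ *+ _]mulr_natl addrA realCD !realCM !realCn.
by rewrite (mulr_natl x%:C%C 2) mulr2n.
Qed.

Lemma Re_subC_div (x : R[i]) (y : R) k :
  complex.Re ((x - y%:C%C) / k%:R) = (complex.Re x - y) / k%:R.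
Proof.
rewrite -realCn -realCV; set c := k%:R^-1.
by case: x => a b; rewrite /= ; ring.
Qed.

(** The parameter of the segment is complex, so that functions along it are holomorphic in w. *)
Definition aff (a b w : R[i]) : R[i] := (1 - w) * a + w * b.

Lemma aff_near (a b c : R[i]) (B : R) : complex.Re (aff a b c) < B ->
  nearc c (fun z => complex.Re (aff a b z) < B).
Proof.
move=> h; have N0 : 0 < nm (b - a) + 1 by have := nm_ge0 (b - a); lra.
exists ((B - complex.Re (aff a b c)) / (nm (b - a) + 1)).
  by rewrite divr_gt0 // subr_gt0.
move=> z; rewrite ltr_pdivlMr // => hz.
have -> : aff a b z = aff a b c + (z - c) * (b - a) by rewrite /aff; ring.
rewrite raddfD /=; have := le_trans (ler_norm _) (nm_Re ((z - c) * (b - a))).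
rewrite nmM => h1; have := nm_ge0 (z - c); have := nm_ge0 (b - a).
move: h1 hz; set x := complex.Re _; set y := complex.Re _; set s := nm _; set t := nm _.
by clear => *; nra.
Qed.

Lemma aff_near_gt (a b c : R[i]) (B : R) : B < complex.Re (aff a b c) ->
  nearc c (fun z => B < complex.Re (aff a b z)).
Proof.
have e w : aff (- a) (- b) w = - aff a b w by rewrite /aff; ring.
move=> h; have := @aff_near (- a) (- b) c (- B).
rewrite e raddfN /= ltrN2 => /(_ h); apply: nearc_mono => z.
by rewrite e raddfN /= ltrN2.
Qed.

Lemma aff_lt0 (a b : R[i]) (t : R) : complex.Re a < 0 -> complex.Re b < 0 -> 0 <= t <= 1 ->
  complex.Re (aff a b t%:C%C) < 0.
Proof.
case: a => a1 a2; case: b => b1 b2 /= a0 b0 /andP[t0 t1].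
rewrite /aff /=; simpc; rewrite /= ?subr0 ?mul0r ?subr0.
have [->|tn] := eqVneq t 0; first by nra.
have : 0 < t by rewrite lt_neqAle eq_sym tn.
nra.
Qed.

Lemma sum_aff (I : finType) (v w : I -> R[i]) z :
  \sum_i aff (v i) (w i) z = (1 - z) * (\sum_i v i) + z * \sum_i w i.
Proof. by rewrite big_split -!mulr_sumr. Qed.

Lemma aff0 (a b : R[i]) : aff a b 0 = a.
Proof. by rewrite /aff subr0 mul1r mul0r addr0. Qed.

Lemma aff1 (a b : R[i]) : aff a b 1 = b.
Proof. by rewrite /aff subrr mul1r mul0r add0r. Qed.

Lemma nm_cexp_lt1 (a : R[i]) : (nm (cexp a) < 1) = (complex.Re a < 0).
Proof. by rewrite nm_cexp expR_lt1. Qed.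

End Near.

Section Exchange.
Variable R : realType.
Local Notation dif f z := (differentiable (f : R[i]^o -> R[i]^o) (z : R[i]^o)).

Section Fixed.
Variables p q : R[i].
Hypotheses (p1 : nm p < 1) (p0 : p != 0) (q1 : nm q < 1) (q0 : q != 0).
Variable n : nat.
Hypothesis n0 : (0 < n)%N.

Lemma inD_cons2 c (x y : R[i]) (t : 'I_n -> R[i]) (u : 'I_n.+2 -> R[i]) :
  inD c (ocons x (ocons y t)) u <-> [/\ 0 < nm x < 1, 0 < nm y < 1, forall r, 0 < nm (t r) < 1,
    forall s, 0 < nm (u s) < 1 & x * (y * \prod_r t r) * (\prod_s u s) = c].
Proof.
have e : \prod_r ocons x (ocons y t) r = x * (y * \prod_r t r).
  rewrite big_ord_recl big_ord_recl !oconsS !ocons0; do 2 congr (_ * _).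
  by apply: eq_bigr => r _; rewrite !oconsS.
rewrite /inD e; split=> [[h1 h2 h3]|[hx hy ht hu h]]; split=> //.
- by have := h1 ord0; rewrite ocons0.
- by have := h1 (lift ord0 ord0); rewrite oconsS ocons0.
- by move=> r; have := h1 (lift ord0 (lift ord0 r)); rewrite !oconsS.
- move=> r; case: (unliftP ord0 r) => [r'|] ->; rewrite ?oconsS ?ocons0 //.
  by case: (unliftP ord0 r') => [r''|] ->; rewrite ?oconsS ?ocons0.
Qed.

(** The quotient as a function h of s satisfies h (q s) = h s on the circle |s| = 1 / rq, by
    [cratio_step] with a = s x and b = y / (q s). With rq = sqrt |q| the circle is mapped to |s| =
    rq, and the windows for x and y say exactly that |p| < |a|, |b| < 1. *)
Lemma cratio_small (rq : R) (x y : R[i]) (t : 'I_n -> R[i]) (u : 'I_n.+2 -> R[i]) :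
  0 < rq -> rq ^+ 2 = nm q -> inD (p * q) (ocons x (ocons y t)) u ->
  nm p * rq < nm x < rq -> nm p * rq < nm y < rq -> (forall r, nm (t r) ^+ n.+1 < nm q) ->
  forall s, nm y < nm s < (nm x)^-1 ->
  cratio p q (ocons (s * x) (ocons (y / s) t)) u = cratio p q (ocons x (ocons y t)) u.
Proof.
move=> rq0 rq2 /inD_cons2[/andP[hx0 hx1] /andP[hy0 hy1] ht hu bal] /andP[x1 x2] /andP[y1 y2] tq s hs.
pose h s := cratio p q (ocons (s * x) (ocons (y / s) t)) u.
have x0 : x != 0 by rewrite -nm_gt0.
have y0 : y != 0 by rewrite -nm_gt0.
have s0 w : nm y < nm w -> w != 0 by move=> hw; rewrite -nm_gt0; apply: lt_trans hw.
have rq1 : rq < 1.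
  by rewrite ltNge; apply/negP => hr; move: q1; rewrite -rq2 ltNge exprn_ege1.
have dh w : nm y < nm w < (nm x)^-1 -> dif h w.
  move=> /andP[w1 w2]; have w0 := s0 w w1; have nw : 0 < nm w by rewrite nm_gt0.
  pose T (r : 'I_n.+2) (v : R[i]) := ocons (v * x) (ocons (y / v) t) r.
  apply: (@cratio_dif R p q p1 q1 n T (fun s _ => u s) w (nm w) nw).
  - move=> r v hv; have v0 : v != 0 by apply/eqP => v0; move: hv; rewrite v0 sub0r nmN ltxx.
    case: (unliftP ord0 r) => [r'|] ->; last first.
      rewrite (_ : T ord0 = fun v => v * x); last by apply/funext => v'; rewrite /T ocons0.
      by apply: difM; [exact: dif_id|exact: dif_cst].
    case: (unliftP ord0 r') => [r''|] ->.
      rewrite (_ : T _ = fun=> t r''); last by apply/funext => v'; rewrite /T !oconsS.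
      exact: dif_cst.
    rewrite (_ : T _ = fun v => y / v); last by apply/funext => v'; rewrite /T oconsS ocons0.
    exact: dif_div v0 (dif_cst _ _) (dif_id _).
  - by move=> r v _; exact: dif_cst.
  apply/inD_cons2; split=> //.
  - by rewrite nmM mulr_gt0 //= -ltr_pdivlMr // div1r.
  - by rewrite nmM nmV divr_gt0 //= ltr_pdivrMr // mul1r.
  - by rewrite -bal; field.
have ri : rq^-1 ^+ 2 = (nm q)^-1 by rewrite exprVn rq2.
have nq0 : 0 < nm q by rewrite nm_gt0.
have q_rq : nm q * rq^-1 = rq by rewrite -rq2 expr2 mulfK // gt_eqF.
have hr : nm y < rq^-1 < (nm x)^-1.
  apply/andP; split; last by rewrite ltf_pV2 // posrE.
  by apply: lt_trans hy1 _; rewrite invf_gt1.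
have [|l hl] := @mult_periodic_const R h (nm y) (nm x)^-1 rq^-1 (ltW hy0) dh hr.
  move=> i j ij; exists q; split=> //.
  - apply: expr_quot_neq1 => // k k0; apply/eqP => /(congr1 (@nm R)).
    rewrite nmX nm1 => /eqP; rewrite pexpr_eq1 ?nm_ge0 // => /eqP e.
    by move: q1; rewrite e ltxx.
  - rewrite q_rq y2 /=; apply: lt_trans rq1 _; rewrite invf_gt1 //.
  move=> z nz; have z0 : z != 0 by rewrite -nm_gt0 nz invr_gt0.
  rewrite /h -mulrA.
  have := @cratio_step R p q p1 p0 q1 q0 n (z * x) (y / (q * z)) t u n0.
  rewrite (_ : q * (y / (q * z)) = y / z); last by field; rewrite q0 z0.
  move=> -> //.
  + rewrite nmM nz [_ * nm x]mulrC ltr_pdivlMr // ltr_pdivrMr // mul1r x1 x2 //.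
  + rewrite !nmM nmV nmM nz q_rq ltr_pdivlMr // ltr_pdivrMr // mul1r y1 y2 //.
  + by move=> r; rewrite -nm_gt0; case/andP: (ht r).
  apply: (mulIf q0); rewrite -[RHS]bal; field; by rewrite q0 z0.
have h1 : h 1 = cratio p q (ocons x (ocons y t)) u by rewrite /h mul1r divr1.
rewrite -h1 -/(h s) (hl s hs) (hl 1) // nm1 hy1 /= invf_gt1 //.
Qed.

Section Line.
Variables (lam : R[i]) (a a' b : 'I_n.+2 -> R[i]).
Hypotheses (alt : forall r, complex.Re (a r) < 0) (alt' : forall r, complex.Re (a' r) < 0)
  (blt : forall r, complex.Re (b r) < 0).
Hypothesis arest : forall r, a' (lift ord0 (lift ord0 r)) = a (lift ord0 (lift ord0 r)).
Hypothesis asum : a' ord0 + a' (lift ord0 ord0) = a ord0 + a (lift ord0 ord0).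
Hypotheses (hlam : \sum_r a r + \sum_r b r = lam) (elam : cexp lam = p * q).
Variables (c0 c1 : R).
(** Logarithms of parameters satisfying the hypotheses of [cratio_small]: c0 puts the first two into
    the window, c1 makes the others small enough. [bbase] spreads the rest of the prescribed sum
    evenly over the u_s. *)
Let base : 'I_n.+2 -> R[i] := ocons c0%:C%C (ocons c0%:C%C (fun=> c1%:C%C)).
Let bbase : 'I_n.+2 -> R[i] := fun=> (lam - \sum_r base r) / n.+2%:R.

Let E (v : 'I_n.+2 -> R[i]) (w : 'I_n.+2 -> R[i]) (z : R[i]) (r : 'I_n.+2) := cexp (aff (v r) (w r) z).

Let base0 : base ord0 = c0%:C%C. Proof. by rewrite /base ocons0. Qed.
Let base1 : base (lift ord0 ord0) = c0%:C%C. Proof. by rewrite /base oconsS ocons0. Qed.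
Let baseS r : base (lift ord0 (lift ord0 r)) = c1%:C%C. Proof. by rewrite /base !oconsS. Qed.

Let hsum (v : 'I_n.+2 -> R[i]) z : \sum_r v r + \sum_r b r = lam ->
  (\prod_r E v base z r) * (\prod_r E b bbase z r) = p * q.
Proof.
move=> hv; have S : \sum_(r < n.+2) bbase r = lam - \sum_r base r.
  by rewrite sumr_const card_ord /= -[_ *+ _]mulr_natr divfK // pnatr_eq0.
rewrite /E -!cexp_sum -cexpD -elam; congr cexp; rewrite !sum_aff S -hv; ring.
Qed.

Let sum2 (v : 'I_n.+2 -> R[i]) : \sum_r v r = v ord0 + v (lift ord0 ord0) + \sum_r v (lift ord0 (lift ord0 r)).
Proof. by rewrite big_ord_recl big_ord_recl addrA. Qed.

Let asum' : \sum_r a' r + \sum_r b r = lam.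
Proof. by rewrite -hlam !sum2 asum; congr (_ + _ + _); apply: eq_bigr => r _; rewrite arest. Qed.

Variables (rq lp : R).
Hypotheses (rq0 : 0 < rq) (rq2 : rq ^+ 2 = nm q) (rqE : rq = expR lp) (lq : R) (lqE : nm p = expR lq).
Hypotheses (h0 : lq + lp < c0) (h0' : c0 < lp) (c00 : c0 < 0).
Hypotheses (h1 : n.+1%:R * c1 < 2 * lp) (c10 : c1 < 0).
Hypothesis (hb : forall r, complex.Re (bbase r) < 0).

Let base_lt0 r : complex.Re (base r) < 0.
Proof.
case: (unliftP ord0 r) => [r'|] ->; last by rewrite base0.
by case: (unliftP ord0 r') => [r''|] ->; rewrite ?baseS ?base1.
Qed.

Let E_dif v w r z : dif (fun z => E v w z r) z.
Proof.
have d1 : dif (fun z => aff (v r) (w r) z) z.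
  apply: difD; apply: difM; try exact: dif_cst; last exact: dif_id.
  by apply: difB; [exact: dif_cst|exact: dif_id].
rewrite /E; exact: (@dif_comp R R[i]^o (@cexp R) (fun z => aff (v r) (w r) z) z d1 (cexp_diff _)).
Qed.

Let E_lt1 v w r z : complex.Re (aff (v r) (w r) z) < 0 -> 0 < nm (E v w z r) < 1.
Proof. by move=> h; rewrite nm_gt0 cexp_neq0 nm_cexp_lt1. Qed.

Let F v z := cratio p q (E v base z) (E b bbase z).

Let F_dif v z : \sum_r v r + \sum_r b r = lam ->
  (forall r, complex.Re (aff (v r) (base r) z) < 0) ->
  (forall r, complex.Re (aff (b r) (bbase r) z) < 0) -> dif (F v) z.
Proof.
move=> hv h2 h3.
apply: (@cratio_dif R p q p1 q1 n (fun r z => E v base z r) (fun r z => E b bbase z r) z 1 ltr01).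
- by move=> r w _; exact: E_dif.
- by move=> r w _; exact: E_dif.
by split; [move=> r; exact: E_lt1|move=> r; exact: E_lt1|exact: hsum].
Qed.

(** Both parameter systems are joined to the base point by segments, along which negative real parts
    persist by convexity. The difference of the quotients is holomorphic there and vanishes near the
    base point by [cratio_small]. *)
Lemma exchange_line : cratio p q (fun r => cexp (a r)) (fun r => cexp (b r)) =
  cratio p q (fun r => cexp (a' r)) (fun r => cexp (b r)).
Proof.
have E0 v w : E v w 0 = fun r => cexp (v r) by apply/funext => r; rewrite /E aff0.
suff : F a 0 - F a' 0 = 0 by rewrite /F !E0 => /eqP; rewrite subr_eq0 => /eqP.
apply: (@identity_segment R (fun z => F a z - F a' z)).
  move=> t ht.
  have n1 v : (forall r, complex.Re (v r) < 0) ->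
      nearc t%:C%C (fun z => forall r, complex.Re (aff (v r) (base r) z) < 0).
    by move=> hv; apply: nearc_all => r; apply: aff_near; exact: aff_lt0.
  have n2 : nearc t%:C%C (fun z => forall r, complex.Re (aff (b r) (bbase r) z) < 0).
    by apply: nearc_all => r; apply: aff_near; exact: aff_lt0.
  have [d d0 hd] := nearc_and (n1 a alt) (nearc_and (n1 a' alt') n2).
  exists d; first exact: d0.
  move=> z /hd[g1 [g2 g3]].
  by apply: difB; apply: F_dif.
have rb (w : 'I_n.+2 -> R[i]) (r : 'I_n.+2) : complex.Re (aff (w r) (base r) 1) = complex.Re (base r).
  by rewrite aff1.
have near_base v : nearc 1 (fun z => forall r, complex.Re (aff (v r) (base r) z) < 0).
  by apply: nearc_all => r; apply: aff_near; rewrite aff1.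
have n2 : nearc 1 (fun z => forall r, complex.Re (aff (b r) (bbase r) z) < 0).
  by apply: nearc_all => r; apply: aff_near; rewrite aff1.
have n3 : nearc 1 (fun z => forall r, complex.Re (aff (a (lift ord0 (lift ord0 r)))
     (base (lift ord0 (lift ord0 r))) z) < 2 * lp / n.+1%:R).
  apply: nearc_all => r; apply: aff_near; rewrite aff1 baseS /=.
  by rewrite ltr_pdivlMr ?ltr0n // mulrC.
have lo r : base r = c0%:C%C -> nearc 1 (fun z => lq + lp < complex.Re (aff (a r) (base r) z) /\
    complex.Re (aff (a r) (base r) z) < lp).
  move=> br; apply: nearc_and; [apply: aff_near_gt|apply: aff_near]; by rewrite aff1 br.
have [d d0 hd] := nearc_and (nearc_and (near_base a) (nearc_and (near_base a') n2))
  (nearc_and n3 (nearc_and (lo _ base0) (lo _ base1))).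
exists d => // z /hd[[g1 [g2 g3]] [g4 [[g5 g6] [g7 g8]]]].
pose x := E a base z ord0; pose y := E a base z (lift ord0 ord0).
pose t r := E a base z (lift ord0 (lift ord0 r)).
(* The exchange factor: it is the quotient of the first coordinates, and its inverse that of the
   second ones because [asum] and the equal base values c0 fix their product. *)
pose s := cexp (aff (a' ord0) (base ord0) z - aff (a ord0) (base ord0) z).
have ea : E a base z = ocons x (ocons y t).
  by rewrite -[LHS]ocons_eta -[X in ocons _ X]ocons_eta.
have sx : s * x = E a' base z ord0 by rewrite /s /x /E -cexpD subrK.
have ys : y / s = E a' base z (lift ord0 ord0).
  rewrite /y /s /E -cexpN -cexpD; congr cexp; rewrite /aff base0 base1.
  have -> : a' (lift ord0 ord0) = a ord0 + a (lift ord0 ord0) - a' ord0 by rewrite -asum; ring.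
  ring.
have ea' : E a' base z = ocons (s * x) (ocons (y / s) t).
  rewrite sx ys -[LHS]ocons_eta -[X in ocons _ X]ocons_eta; do 2 congr (ocons _ _).
  by apply/funext => r; rewrite /t /E arest.
have sne : s != 0 by exact: cexp_neq0.
have xne : x != 0 by exact: cexp_neq0.
apply/eqP; rewrite subr_eq0; apply/eqP; rewrite /F ea' ea; symmetry.
apply: (@cratio_small rq x y t (E b bbase z) rq0 rq2).
- rewrite -ea; split; [by move=> r; exact: E_lt1|by move=> r; exact: E_lt1|exact: hsum].
- by rewrite /x /E nm_cexp lqE rqE -expRD !ltr_expR g5 g6.
- by rewrite /y /E nm_cexp lqE rqE -expRD !ltr_expR g7 g8.
- move=> r; rewrite /t /E nm_cexp -rq2 rqE -!expRM_natl ltr_expR.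
  by have := g4 r; rewrite ltr_pdivlMr ?ltr0n // mulrC.
apply/andP; split.
  have : nm (y / s) < 1 by rewrite ys nm_cexp_lt1.
  by rewrite nmM nmV ltr_pdivrMr ?mul1r // nm_gt0.
have : nm (s * x) < 1 by rewrite sx nm_cexp_lt1.
by rewrite nmM -ltr_pdivlMr ?nm_gt0 // div1r.
Qed.

End Line.

Lemma exchange01 (t t' u : 'I_n.+2 -> R[i]) : nm p <= nm q -> inD (p * q) t u -> inD (p * q) t' u ->
  (forall r, t' (lift ord0 (lift ord0 r)) = t (lift ord0 (lift ord0 r))) ->
  t' ord0 * t' (lift ord0 ord0) = t ord0 * t (lift ord0 ord0) ->
  cratio p q t u = cratio p q t' u.
Proof.
move=> pq [t1 u1 bal] [t1' _ _] trest tprod.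
have logs (v : 'I_n.+2 -> R[i]) : (forall r, 0 < nm (v r) < 1) ->
    exists l : 'I_n.+2 -> R[i], forall r, complex.Re (l r) < 0 /\ cexp (l r) = v r.
  move=> hv; suff h r : exists l : R[i], complex.Re l < 0 /\ cexp l = v r.
    by have [l hl] := choice h; exists l.
  have /andP[v0 v1] := hv r; rewrite nm_gt0 in v0.
  by have [l hl] := cexp_onto v0; exists l; split=> //; rewrite -nm_cexp_lt1 hl.
have [a ha] := logs t t1; have [b hb] := logs u u1.
have /andP[n00 n01] := t1' ord0; rewrite nm_gt0 in n00.
have [l hl] := cexp_onto n00.
(* Only the logarithm of the first new parameter is chosen freely; the second is defined by the sum,
   so that both systems have logarithms of the same total. *)
pose a' : 'I_n.+2 -> R[i] := ocons l (ocons (a ord0 + a (lift ord0 ord0) - l)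
   (fun r => a (lift ord0 (lift ord0 r)))).
have ea' r : cexp (a' r) = t' r.
  rewrite /a'; case: (unliftP ord0 r) => [r'|] ->; last by rewrite ocons0.
  case: (unliftP ord0 r') => [r''|] ->; rewrite oconsS.
    by rewrite oconsS trest; case: (ha (lift ord0 (lift ord0 r''))).
  rewrite ocons0 cexpD cexpN cexpD hl; case: (ha ord0) => _ ->; case: (ha (lift ord0 ord0)) => _ ->.
  by rewrite -tprod mulrC mulKf.
have et : t = fun r => cexp (a r) by apply/funext => r; case: (ha r).
have eu : u = fun r => cexp (b r) by apply/funext => r; case: (hb r).
have et' : t' = fun r => cexp (a' r) by apply/funext => r; rewrite ea'.
pose lam := \sum_r a r + \sum_r b r.
have elam : cexp lam = p * q by rewrite /lam cexpD !cexp_sum -bal et eu.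
(* As |p| <= |q|, the total logarithm has real part at most -2 L. Subtracting 2 c0 + n c1 leaves the
   u_s at most -L / (n+1) + (n+2) e, which is -L / (2 (n+1)) by the choice of e, hence negative. *)
pose L := - ln (nm q); pose e := L / (2 * n.+1%:R * n.+2%:R).
have nq0 : 0 < nm q by rewrite nm_gt0.
have np0 : 0 < nm p by rewrite nm_gt0.
have L0 : 0 < L by rewrite oppr_gt0 ln_lt0 // nq0.
have N1 : 1 <= n.+1%:R :> R by rewrite ler1n.
have N2 : n.+2%:R = n.+1%:R + 1 :> R by rewrite natr1.
have NN : n.+1%:R = n%:R + 1 :> R by rewrite natr1.
have e0 : 0 < e by rewrite divr_gt0 // !mulr_gt0 // ltr0n.
have ee : e * (2 * n.+1%:R * n.+2%:R) = L by rewrite divfK // gt_eqF // !mulr_gt0 // ltr0n.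
have eL : e < L.
  have H (N : R) : 1 <= N -> 1 < 2 * N * (N + 1) by move=> ?; nra.
  by rewrite -ee ltr_pMr // N2; exact: H.
have lpq : ln (nm p) <= - L by rewrite opprK ler_ln.
pose c0 := - L / 2 - e; pose c1 := - L / n.+1%:R - e.
have dL : 0 < L / n.+1%:R by rewrite divr_gt0 // ltr0n.
have reLam : complex.Re lam <= - (2 * L).
  have : expR (complex.Re lam) = nm p * nm q by rewrite -nm_cexp elam nmM.
  move=> h; have : complex.Re lam = ln (nm p) + ln (nm q) by rewrite -lnM ?posrE // -h expRK.
  by move=> ->; rewrite -[ln (nm q)]opprK -/L; move: lpq; lra.
rewrite et et' eu.
apply: (@exchange_line lam a a' b _ _ _ _ _ _ elam c0 c1 (expR (- L / 2)) (- L / 2) _ _ (erefl _) (ln (nm p))).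
- by move=> r; case: (ha r).
- by move=> r; rewrite -nm_cexp_lt1 ea'; case/andP: (t1' r).
- by move=> r; case: (hb r).
- by move=> r; rewrite /a' !oconsS.
- by rewrite /a' oconsS !ocons0 addrC subrK.
- by [].
- exact: expR_gt0.
- by rewrite -expRM_natl mulrC divfK // opprK lnK.
- by rewrite lnK.
- by rewrite /c0; move: lpq eL; lra.
- by rewrite /c0; move: e0; lra.
- by rewrite /c0; move: e0 L0; lra.
- rewrite /c1 mulrBr mulrCA mulfV ?pnatr_eq0 // mulr1.
  have : 0 < n.+1%:R * e by rewrite mulr_gt0 // ltr0n.
  by set x := _ * e; lra.
- by rewrite /c1 mulNr; move: dL e0; move: (L / _) (e) => x y; lra.
move=> r; rewrite sum_ocons_real.
rewrite Re_subC_div.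
rewrite pmulr_llt0 ?invr_gt0 ?ltr0n //.
have h2 : n%:R * (L / n.+1%:R) = L - L / n.+1%:R.
  by rewrite NN; field; rewrite -NN pnatr_eq0.
have h3 : n.+2%:R * e = L / n.+1%:R / 2.
  have H (N M w : R) : N != 0 -> M != 0 -> M * (w / (2 * N * M)) = w / N / 2.
    by move=> ? ?; field; apply/andP.
  by apply: H; rewrite pnatr_eq0.
have -> : n%:R * c1 = - (L - L / n.+1%:R) - n%:R * e by rewrite /c1 mulNr mulrBr mulrN h2.
rewrite /c0.
have H (v x y N w : R) : (N + 2) * y = x / 2 -> 0 < x -> v <= - (2 * w) ->
    v - (2 * (- w / 2 - y) + (- (w - x) - N * y)) < 0.
  by rewrite mulrDl => h ? ?; move: h; set k := N * y; lra.
apply: H => //; rewrite -h3 N2 NN; congr (_ * _); ring.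
Qed.

End Fixed.
End Exchange.

(** * Dependence on the products of the parameters only *)

Section Canonical.
Variable R : realType.
Variables p q : R[i].
Hypotheses (p1 : nm p < 1) (p0 : p != 0) (q1 : nm q < 1) (q0 : q != 0).

Lemma inD_perm c m (t u : 'I_m -> R[i]) s : bijective s ->
  inD c t u -> inD c (fun r => t (s r)) u.
Proof.
move=> [s' sK s'K] [ht hu h]; split=> //.
by rewrite -h [in RHS](reindex s) //; exists s' => i _; rewrite ?sK ?s'K.
Qed.

Lemma inD_swap c m (t u : 'I_m -> R[i]) : inD c t u -> inD c u t.
Proof. by move=> [ht hu h]; split=> //; rewrite mulrC. Qed.

(** A transposition brings the exchanged parameter to the second place; if |p| > |q|, the roles of p
    and q are swapped. *)
Lemma exchange0 n (t t' u : 'I_n.+2 -> R[i]) r : (0 < n)%N ->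
  inD (p * q) t u -> inD (p * q) t' u ->
  (forall i, i != ord0 -> i != lift ord0 r -> t' i = t i) ->
  t' ord0 * t' (lift ord0 r) = t ord0 * t (lift ord0 r) ->
  cratio p q t u = cratio p q t' u.
Proof.
move=> n0 ht ht' tr tp; pose s := tperm (lift ord0 ord0) (lift ord0 r : 'I_n.+2).
have bs : bijective s by exact: injF_bij (@perm_inj _ _).
have s0 : s ord0 = ord0 by rewrite tpermD.
have s1 : s (lift ord0 ord0) = lift ord0 r by rewrite tpermL.
have trs i : t' (s (lift ord0 (lift ord0 i))) = t (s (lift ord0 (lift ord0 i))).
  by apply: tr; rewrite -?[X in _ != X]s0 -?[X in _ != X]s1 (inj_eq (@perm_inj _ s)).
have tps : t' (s ord0) * t' (s (lift ord0 ord0)) = t (s ord0) * t (s (lift ord0 ord0)).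
  by rewrite s0 s1.
rewrite -(cratio_perm p q t u bs) -(cratio_perm p q t' u bs).
have /orP[pq|qp] := le_total (nm p) (nm q).
  by apply: exchange01 => //; exact: inD_perm.
rewrite ![cratio p q _ u]cratio_sym //.
by apply: exchange01 => //; rewrite mulrC; exact: inD_perm.
Qed.

(** The parameters after t_0 are set to e one by one, while t_0 absorbs the factors t_r / e. These
    have modulus at most 1, so t_0 never leaves the unit disc. *)
Lemma canonical_form n (t u : 'I_n.+2 -> R[i]) (e : R) : (0 < n)%N -> 0 < e < 1 ->
  (forall r, nm (t r) <= e) -> inD (p * q) t u ->
  exists t', [/\ inD (p * q) t' u, forall r, t' (lift ord0 r) = e%:C%C &
    cratio p q t u = cratio p q t' u].
Proof.
move=> n0 /andP[e0 e1] te ht.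
have ee : nm e%:C%C = e by rewrite nm_real gtr0_norm.
suff [t' [h1 h2 h3 h4]] : exists t', [/\ inD (p * q) t' u, forall r, nm (t' r) <= e,
    forall r, r \in enum 'I_n.+1 -> t' (lift ord0 r) = e%:C%C & cratio p q t u = cratio p q t' u].
  by exists t'; split=> // r; apply: h3; rewrite mem_enum.
elim: (enum _) => [|r s [t' [h1 h2 h3 h4]]]; first by exists t; split.
pose t'' i := if i == ord0 then t' ord0 * t' (lift ord0 r) / e%:C%C
  else if i == lift ord0 r then e%:C%C else t' i.
have [ht' hu hp] := h1.
have t00 : t'' ord0 = t' ord0 * t' (lift ord0 r) / e%:C%C by rewrite /t'' eqxx.
have t0r : t'' (lift ord0 r) = e%:C%C by rewrite /t'' eqxx.
have ec0 : e%:C%C != 0 :> R[i] by rewrite -nm_gt0 ee.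
have tp : t'' ord0 * t'' (lift ord0 r) = t' ord0 * t' (lift ord0 r).
  by rewrite t00 t0r divfK.
have n0' : nm (t'' ord0) <= nm (t' ord0).
  rewrite t00 !nmM nmV ee -mulrA ler_piMr ?nm_ge0 // ler_pdivrMr // mul1r; exact: h2.
have tr i : i != ord0 -> i != lift ord0 r -> t'' i = t' i.
  by rewrite /t'' => /negbTE-> /negbTE->.
have h1' : inD (p * q) t'' u.
  split=> // [i|]; last first.
    rewrite -hp; congr (_ * _).
    rewrite (bigD1 ord0) // (bigD1 (lift ord0 r)) //= mulrA tp.
    rewrite [RHS](bigD1 ord0) // (bigD1 (lift ord0 r)) //= mulrA; congr (_ * _).
    by apply: eq_bigr => i /andP[? ?]; exact: tr.
  have [->|i0] := eqVneq i ord0.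
    rewrite (le_lt_trans n0') ?andbT; last by case/andP: (ht' ord0).
    rewrite t00 !nmM nmV ee divr_gt0 // mulr_gt0 //; first by case/andP: (ht' ord0).
    by case/andP: (ht' (lift ord0 r)).
  have [->|ir] := eqVneq i (lift ord0 r); first by rewrite t0r ee e0.
  by rewrite tr.
exists t''; split=> //.
- move=> i; have [->|i0] := eqVneq i ord0; first exact: le_trans n0' _.
  have [->|ir] := eqVneq i (lift ord0 r); first by rewrite t0r ee.
  by rewrite tr.
- move=> i; rewrite inE => /orP[/eqP->//|is_].
  have [->//|ir] := eqVneq i r.
  have ir' : lift ord0 i != lift ord0 r by apply: contraNneq ir => /lift_inj ->.
  by rewrite tr //; exact: h3.
- by rewrite h4; apply: (exchange0 (r := r)).
Qed.

(** With e the largest modulus in both systems, the canonical forms coincide: t_0 is determined by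
    the product. *)
Lemma cratio_indep_t n (t t' u : 'I_n.+2 -> R[i]) : (0 < n)%N ->
  inD (p * q) t u -> inD (p * q) t' u -> cratio p q t u = cratio p q t' u.
Proof.
move=> n0 ht ht'.
have [M /andP[M0 M1] hM] : exists2 M : R, 0 <= M < 1 & forall r, nm (t r) <= M /\ nm (t' r) <= M.
  have [|M1 /andP[? ?] h1] := @finite_bound R _ (fun r => nm (t r)).
    by move=> r; case: ht => /(_ r) /andP[].
  have [|M2 /andP[? ?] h2] := @finite_bound R _ (fun r => nm (t' r)).
    by move=> r; case: ht' => /(_ r) /andP[].
  exists (Order.max M1 M2); first by rewrite le_max gt_max; apply/andP; split; [apply/orP; left|apply/andP].
  by move=> r; rewrite !le_max h1 h2 orbT.
have Mr : 0 < M.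
  by apply: lt_le_trans (hM ord0).1; case: ht => /(_ ord0) /andP[].
have hMM : 0 < M < 1 by rewrite Mr.
have [v [[v1 u1 hv] ve ->]] := canonical_form n0 hMM (fun r => (hM r).1) ht.
have [v' [[v1' _ hv'] ve' ->]] := canonical_form n0 hMM (fun r => (hM r).2) ht'.
suff -> : v = v' by [].
apply/funext => i; case: (unliftP ord0 i) => [r|] ->; first by rewrite ve ve'.
have Mc0 : M%:C%C != 0 :> R[i] by rewrite -nm_gt0 nm_real gtr0_norm.
have U0 : \prod_s u s != 0 by apply/prodf_neq0 => s _; rewrite -nm_gt0; case/andP: (u1 s).
move: hv'; rewrite -hv => /(mulIf U0); rewrite !big_ord_recl.
have e (w : 'I_n.+2 -> R[i]) : (forall r, w (lift ord0 r) = M%:C%C) ->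
    w (lift ord0 ord0) * \prod_(i0 < n) w (lift ord0 (lift ord0 i0)) = M%:C%C ^+ n.+1.
  by move=> h; rewrite h exprS; congr (_ * _); rewrite (eq_bigr (fun=> M%:C%C)) ?prodr_const ?card_ord.
by rewrite !e // => /mulIf -> //; rewrite expf_neq0.
Qed.

Lemma cratio_indep n (t u t' u' : 'I_n.+2 -> R[i]) : (0 < n)%N ->
  inD (p * q) t u -> inD (p * q) t' u' -> \prod_r t r = \prod_r t' r ->
  cratio p q t u = cratio p q t' u'.
Proof.
move=> n0 h h' e.
have h2 : inD (p * q) t' u by case: h h' => ? ? ? [? ? ?]; split=> //; rewrite -e.
rewrite (cratio_indep_t n0 h h2) [LHS]cratio_swap [RHS]cratio_swap.
by apply: cratio_indep_t => //; exact: inD_swap.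
Qed.

End Canonical.

(** * Pinching the torus *)

Section Lagrange.
Variable F : fieldType.

(** Lagrange interpolation of the constant 1 at the nodes 1 / x_k, as an identity of polynomials in
    s of degree less than the number of nodes. *)
Lemma lagrange_one (I : finType) (P : pred I) (x : I -> F) s : (exists i, P i) ->
  (forall i, P i -> x i != 0) -> (forall i j, P i -> P j -> i != j -> x i != x j) ->
  \sum_(k | P k) \prod_(i | P i && (i != k)) ((1 - s * x i) / (1 - x i / x k)) = 1.
Proof.
move=> [i0 Pi0] x0 xd.
pose f k : {poly F} := \prod_(i | P i && (i != k)) ((1 - x i / x k)^-1 *: (1 - x i *: 'X)).
pose g : {poly F} := \sum_(k | P k) f k - 1.
have fE k v : (f k).[v] = \prod_(i | P i && (i != k)) ((1 - v * x i) / (1 - x i / x k)).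
  rewrite horner_prod; apply: eq_bigr => i _.
  by rewrite hornerZ !hornerE mulrC [x i * v]mulrC.
have dis i k : P i -> P k -> i != k -> 1 - x i / x k != 0.
  by move=> Pi Pk ik; rewrite subr_eq0 eq_sym -(mulfV (x0 _ Pk)) (inj_eq (mulIf _)) ?invr_neq0 ?x0 // xd.
have fk k l : P k -> P l -> (f k).[(x l)^-1] = (k == l)%:R.
  move=> Pk Pl; rewrite fE; have [->|kl] := eqVneq k l.
    by rewrite big1 // => i /andP[Pi il]; rewrite mulrC [_ * x i]mulrC mulVf // dis.
  by rewrite (bigD1 l) ?Pl 1?eq_sym //= mulVf ?x0 // subrr !mul0r.
suff g0 : g = 0.
  have : g.[s] = 0 by rewrite g0 horner0.
  rewrite /g hornerD hornerN hornerC horner_sum => /subr0_eq /(etrans _); apply.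
  by apply: eq_bigr => k _; rewrite fE.
apply: (@roots_geq_poly_eq0 _ _ [seq (x k)^-1 | k in P]).
- apply/allP => y /mapP[l]; rewrite mem_enum => Pl ->; rewrite rootE /g hornerD hornerN hornerC horner_sum.
  rewrite (bigD1 l) //= fk // eqxx big1 ?addr0 ?subrr // => k /andP[Pk kl].
  by rewrite fk // (negbTE kl).
- rewrite map_inj_in_uniq ?enum_uniq // => i j; rewrite !mem_enum => Pi Pj /invr_inj xij.
  by apply/eqP; apply: contraT => ij; move: (xd _ _ Pi Pj ij); rewrite xij eqxx.
have c0 : (0 < #|P|)%N by apply/card_gt0P; exists i0.
rewrite size_map -cardE (leq_trans (size_polyD _ _)) // size_polyN size_poly1 geq_max c0 andbT.
apply: (leq_trans (size_sum _ _ _)); apply/bigmax_leqP => k Pk.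
have cP : #|[pred i | P i && (i != k)]|.+1 = #|P|.
  by rewrite [RHS](cardD1 k) [k \in P]Pk add1n; congr _.+1; apply: eq_card => i; rewrite !inE andbC.
apply: (leq_trans (size_poly_prod_leq _ _)); rewrite leq_subLR -cP.
have -> : (#|[pred i | P i && (i != k)]| + #|[pred i | P i && (i != k)]|.+1 =
   (\sum_(i | P i && (i != k)) 2).+1)%N by rewrite sum_nat_const muln2 -addnn addnS.
rewrite ltnS; apply: leq_sum => i _; rewrite (leq_trans (size_scale_leq _ _)) //.
rewrite (leq_trans (size_polyD _ _)) // size_poly1 size_polyN geq_max /=.
by rewrite (leq_trans (size_scale_leq _ _)) // size_polyX.
Qed.

End Lagrange.

(** * The Poisson kernel on grid averages *)

Section Poisson.
Variable R : realType.
Local Notation dif f z := (differentiable (f : R[i]^o -> R[i]^o) (z : R[i]^o)).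

(** The mean does not depend on the radius, which is sent to 0. *)
Lemma mean_value (F : R[i] -> R[i]) (r : R) : 1 < r -> (forall z, nm z < r -> dif F z) ->
  hasmean F (F 0).
Proof.
move=> r1 dF; have [l hl] := @circle_mean R F 0 r (lexx _) (fun z h => dF z (andP h).2).
have h1 : hasmean F l.
  have := hl 1; rewrite ltr01 r1 => /(_ isT) /tendsP.
  by apply: eq_tends => m; apply: eq_cmean => z _; rewrite mul1r.
suff -> : F 0 = l by [].
apply/eqP; rewrite -subr_eq0 -nm_eq0 eq_le nm_ge0 andbT; apply/ler_addgt0Pr => e e0; rewrite add0r.
have /contCP /(_ e e0) [d d0 hd] : {for (0 : R[i]^o), continuous (F : R[i]^o -> R[i]^o)}.
  by apply: differentiable_continuous; apply: dF; rewrite nm0 (lt_trans _ r1).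
pose s := Order.min (d / 2) 1.
have s0 : 0 < s by rewrite lt_min ltr01 divr_gt0.
have sr : s < r by rewrite gt_min r1 orbT.
have sd : s < d by rewrite gt_min; apply/orP; left; lra.
move: (hl s); rewrite s0 sr => /(_ isT) /tendsP hs.
have h2 : tends (fun m => cmean m (fun z => F (s%:C%C * z) - F 0)) (l - F 0).
  apply: (@eq_hasmean _ (fun z => F (s%:C%C * z) + (- F 0))) => //.
  by apply: hasmeanD => //; exact: hasmean_cst.
rewrite nmBC; apply: (tends_le (N := 0%N) h2) => m _.
apply: cmean_le => a _; apply: ltW; apply: hd.
by rewrite subr0 nmM nm_real nm_ee mulr1 gtr0_norm.
Qed.

Lemma nm_sqr (w : R[i]) : ((nm w) ^+ 2)%:C%C = w * w^*.
Proof. by rewrite rmorphXn /= -nmE normCK. Qed.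

Lemma conj_unit (z : R[i]) : nm z = 1 -> z^* = z^-1.
Proof.
move=> z1; have z0 : z != 0 by rewrite -nm_gt0 z1.
by apply: (mulfI z0); rewrite -nm_sqr z1 expr1n mulfV.
Qed.

Lemma conj_real (s : R) : (s%:C%C)^* = s%:C%C :> R[i].
Proof. by apply/eqP; rewrite eq_complex /= oppr0 !eqxx. Qed.

Lemma add_conj (w : R[i]) : w + w^* = (2 * complex.Re w)%:C%C.
Proof. by case: w => a b; apply/eqP; rewrite eq_complex /= subrr mulr2n mulrDl mul1r !eqxx. Qed.

Section Kernel.
Variable s : R.
Hypotheses (s0 : 0 < s) (s1 : s < 1).
Local Notation S := (s%:C%C : R[i]).

(** The Poisson kernel at the point s of the disc, written as a rational function, holomorphic for s
    < |z| < 1 / s. *)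
Definition pk (z : R[i]) : R[i] := (1 - S ^+ 2) / ((1 - S * z) * (1 - S / z)).
Definition hk (z : R[i]) : R[i] := (1 - S * z)^-1.

Let S0 : S != 0. Proof. by rewrite -nm_gt0 nm_real normr_gt0 gt_eqF. Qed.
Let nS : nm S = s. Proof. by rewrite nm_real gtr0_norm. Qed.

Lemma unit_sub_neq0 z : nm z = 1 -> 1 - S * z != 0.
Proof.
move=> z1; rewrite subr_eq0; apply/eqP => h.
have e : 1 = s by rewrite -nm1 h nmM z1 nS mulr1.
by move: (s1); rewrite -e ltxx.
Qed.

(** Both the kernel and its product with |z - 1|^2 are affine in the real part of [hk], so the
    single limit [hk_mean] controls all grid averages needed. *)
Lemma pk_facts z : nm z = 1 -> [/\ nm (pk z) = 2 * complex.Re (hk z) - 1,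
  pk z = hk z + (hk z)^* - 1 &
  nm (pk z) * nm (z - 1) ^+ 2 =
    (2 - 2 * s) - 2 * (1 - s) ^+ 2 / s * (complex.Re (hk z) - 1)].
Proof.
move=> z1; have z0 : z != 0 by rewrite -nm_gt0 z1.
have d0 := unit_sub_neq0 z1.
have d1 : 1 - S / z != 0 by apply: unit_sub_neq0; rewrite nmV z1 invr1.
have hc : (hk z)^* = (1 - S / z)^-1.
  rewrite /hk fmorphV; congr (_^-1); rewrite rmorphB rmorphM /=.
  by congr (_ - _ * _); [exact: rmorph1|exact: conj_real|exact: conj_unit].
have e1 : pk z = hk z + (hk z)^* - 1.
  rewrite hc /pk /hk; field; rewrite d0 z0 !andbT /=.
  by apply: contraNneq d1 => h; rewrite -(mulfV z0) -mulrBl h mul0r.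
have e2 : pk z = ((1 - s ^+ 2) * nm (hk z) ^+ 2)%:C%C.
  by rewrite rmorphM /= nm_sqr hc /pk /hk rmorphB rmorphXn rmorph1 /= invfM.
have e3 : nm (pk z) = 2 * complex.Re (hk z) - 1.
  have p0 : 0 <= (1 - s ^+ 2) * nm (hk z) ^+ 2.
    by rewrite mulr_ge0 ?sqr_ge0 // subr_ge0 expr_le1 // ltW.
  have : pk z = (2 * complex.Re (hk z) - 1)%:C%C.
    by rewrite e1 add_conj rmorphB rmorph1.
  by rewrite e2 nm_real ger0_norm // => /(congr1 (@complex.Re R)).
split=> //.
have e4 : ((nm (z - 1)) ^+ 2)%:C%C = (z - 1) * (z^-1 - 1).
  by rewrite nm_sqr rmorphB rmorph1 /= conj_unit.
have e5 : pk z * ((z - 1) * (z^-1 - 1)) =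
    (2 - 2 * S) - (1 - S) ^+ 2 / S * (hk z + (hk z)^* - 2).
  rewrite hc /pk /hk; field; rewrite d0 z0 S0 !andbT /=.
  by apply: contraNneq d1 => h; rewrite -(mulfV z0) -mulrBl h mul0r.
have e6 : pk z = (nm (pk z))%:C%C by rewrite e3 e1 add_conj rmorphB rmorph1.
have : (nm (pk z) * nm (z - 1) ^+ 2)%:C%C =
  ((2 - 2 * s) - (1 - s) ^+ 2 / s * (2 * complex.Re (hk z) - 2))%:C%C :> R[i].
  rewrite rmorphM /= e4 -e6 e5 add_conj.
  by rewrite !(rmorphB, rmorphM, rmorphXn, rmorph1, rmorphMn, fmorphV) /=.
move=> /(congr1 (@complex.Re R)) /= ->.
by field; rewrite gt_eqF.
Qed.

Lemma hk_mean : hasmean hk 1.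
Proof.
have -> : 1 = hk 0 by rewrite /hk mulr0 subr0 invr1.
apply: (@mean_value _ s^-1) => [|z zs]; first by rewrite invf_gt1.
apply: difV; last by apply: difB; [exact: dif_cst|apply: difM; [exact: dif_cst|exact: dif_id]].
rewrite subr_eq0; apply/eqP => h.
move: zs; rewrite -(ltr_pM2l s0) mulfV ?gt_eqF // -nS -nmM -h nm1 ltxx.
by [].
Qed.

Lemma pk_mean : hasmean pk 1.
Proof.
move=> e e0; have [N hN] := hk_mean (divr_gt0 e0 (ltr0n R 2)).
exists N => m /hN h.
have -> : cmean m pk - 1 = (cmean m hk - 1) + (cmean m hk - 1)^*.
  have -> : cmean m pk = cmean m hk + cmean m (fun z => (hk z)^*) + (-1).
    rewrite -(cmean_cst m (-1)) -!cmeanD; apply: eq_cmean => z z1.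
    by case: (pk_facts z1).
  have -> : cmean m (fun z => (hk z)^*) = (cmean m hk)^*.
    by rewrite /cmean rmorphM fmorphV rmorphXn /= rmorph_nat rmorph_sum.
  by rewrite rmorphB rmorph1; ring.
rewrite (le_lt_trans (nmD _ _)) //.
have -> : nm (cmean m hk - 1)^* = nm (cmean m hk - 1) by rewrite /nm norm_conjC.
lra.
Qed.

(* The Poisson kernel is nonnegative with mean 1, and its mean against
   [|z - 1|^2] is [2 - 2 s]. *)
Lemma pk_approx (e : R) : 0 < e -> 2 - 2 * s <= e ^+ 2 -> exists N, forall m, (N <= m)%N ->
  forall (f : R[i] -> R[i]) K, 0 <= K -> (forall z, nm z = 1 -> nm (f z) <= K * nm (z - 1)) ->
  nm (cmean m (fun z => pk z * f z)) <= 5 * K * e.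
Proof.
move=> e0 se.
have [N hN] := hk_mean ltr01.
have [N' hN'] := @hk_mean (s * e ^+ 2 / 2) (divr_gt0 (mulr_gt0 s0 (exprn_gt0 _ e0)) (ltr0n R 2)).
exists (maxn N N') => m; rewrite geq_max => /andP[/hN h /hN' h'] f K K0 fK.
pose x z := complex.Re (hk z).
pose b := 2 * (1 - s) ^+ 2 / s.
(* A majorant from |z - 1| <= e + |z - 1|^2 / e, with both parts rewritten by [pk_facts]. Their
   averages are at most 3 e and 2 e. *)
pose g z := K * (e * (2 * x z - 1) + ((2 - 2 * s) - b * (x z - 1)) / e).
have ree : complex.Re (cmean m hk) = (2 ^+ m)^-1 * \sum_(k < 2 ^ m) x (ee (k%:R / 2 ^+ m)).
  rewrite /cmean /x -[in RHS]raddf_sum /=.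
  have -> : (2 : R[i]) ^+ m = (2 ^+ m)%:C%C by rewrite rmorphXn rmorphMn rmorph1.
  by rewrite -fmorphV; case: (\sum_(_ < _) _) => u v /=; rewrite mul0r subr0.
have rh1 : `|complex.Re (cmean m hk) - 1| < 1.
  by apply: le_lt_trans h; rewrite -[1 in X in `|X|]/(complex.Re (1 : R[i])) -raddfB nm_Re.
have rh2 : `|complex.Re (cmean m hk) - 1| < s * e ^+ 2 / 2.
  by apply: le_lt_trans h'; rewrite -[1 in X in `|X|]/(complex.Re (1 : R[i])) -raddfB nm_Re.
have : nm (cmean m (fun z => pk z * f z)) <= (2 ^+ m)^-1 * \sum_(k < 2 ^ m) g (ee (k%:R / 2 ^+ m)).
  apply: cmean_bound => a _; have := nm_ee a; set z := ee a => z1.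
  have [e1 _ e3] := pk_facts z1; rewrite nmM /g /x -e1 /b -e3.
  apply: (@le_trans _ _ (nm (pk z) * (K * nm (z - 1)))); first by rewrite ler_wpM2l ?nm_ge0 ?fK.
  have H (P D : R) : 0 <= P -> 0 <= D -> P * (K * D) <= K * (e * P + P * D ^+ 2 / e).
    move=> P0 D0; rewrite mulrCA ler_wpM2l // [e * P]mulrC -mulrA -mulrDr ler_wpM2l //.
    rewrite -(ler_pM2r e0) mulrDl divfK ?gt_eqF //; nra.
  exact: H (nm_ge0 _) (nm_ge0 _).
move=> /le_trans; apply.
have -> : (2 ^+ m)^-1 * \sum_(k < 2 ^ m) g (ee (k%:R / 2 ^+ m)) =
   K * (e * (2 * complex.Re (cmean m hk) - 1) +
    ((2 - 2 * s) - b * (complex.Re (cmean m hk) - 1)) / e).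
  rewrite (eq_bigr (fun k : 'I_(2 ^ m) => K * (2 * e - b / e) * x (ee (k%:R / 2 ^+ m)) +
     K * (((2 - 2 * s) + b) / e - e))); last by move=> k _; rewrite /g; ring.
  rewrite big_split /= -mulr_sumr sum_cst mulrDr mulKf ?gt_eqF ?exprn_gt0 //.
  by rewrite mulrCA -ree; ring.
rewrite -mulrA mulrCA ler_wpM2l //.
move: rh1 rh2; move: (complex.Re _) => X; rewrite !ltr_norml => /andP[a1 a2] /andP[a3 a4].
have bb : b * (1 - X) <= e ^+ 2.
  rewrite /b; have -> : 2 * (1 - s) ^+ 2 / s * (1 - X) = (1 - s) ^+ 2 * (2 * (1 - X) / s) by ring.
  have h1 : 2 * (1 - X) / s <= e ^+ 2 by rewrite ler_pdivrMr // [_ * s]mulrC; lra.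
  apply: (@le_trans _ _ ((1 - s) ^+ 2 * e ^+ 2)); first by rewrite ler_wpM2l ?sqr_ge0.
  have H (v : R) : 0 < v -> v < 1 -> (1 - v) ^+ 2 <= 1 by move=> ? ?; rewrite expr2; nra.
  by rewrite ler_piMl ?sqr_ge0 //; exact: H.
have h3 : ((2 - 2 * s) - b * (X - 1)) / e <= 2 * e.
  rewrite ler_pdivrMr //; have -> : b * (X - 1) = - (b * (1 - X)) by ring.
  by move: bb; rewrite expr2 in se *; move: (b * _) => w; lra.
have h4 : e * (2 * X - 1) <= e * 3 by rewrite ler_pM2l //; lra.
apply: (le_trans (lerD h4 h3)); lra.
Qed.
End Kernel.
End Poisson.

(** * Partial fractions for the Vandermonde factor *)

Section VanP.
Variables (F : fieldType) (I : finType).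
Implicit Types (P : pred I) (z : I -> F) (s : F).

Definition vanP P z := \prod_(i | P i) \prod_(j | P j && (j != i)) (1 - z i / z j).

Lemma vanP_split P k z : P k -> vanP P z =
  (\prod_(i | P i && (i != k)) (1 - z i / z k)) * (\prod_(i | P i && (i != k)) (1 - z k / z i)) *
  vanP (fun i => P i && (i != k)) z.
Proof.
move=> Pk; rewrite /vanP (bigD1 k) //= mulrC.
rewrite (eq_bigr (fun i => (1 - z i / z k) * \prod_(j | (P j && (j != k)) && (j != i)) (1 - z i / z j))).
  by rewrite big_split /= -!mulrA; congr (_ * _); rewrite mulrC.
move=> i /andP[Pi ik]; rewrite (bigD1 k) /=; last by rewrite Pk eq_sym.
by congr (_ * _); apply: eq_bigl => j; rewrite andbAC.
Qed.

Lemma vanP_eq0 P z i j : P i -> P j -> i != j -> z i != 0 -> z i = z j -> vanP P z = 0.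
Proof.
move=> Pi Pj ij zi e; rewrite /vanP (bigD1 i) //= (bigD1 j) /=; last by rewrite Pj eq_sym.
by rewrite e divff -?e // subrr !mul0r.
Qed.

Lemma vanP_inv P z : vanP P (fun i => (z i)^-1) = vanP P z.
Proof.
rewrite /vanP (exchange_big_dep P) /=; last by move=> i j _ /andP[].
apply: eq_bigr => j Pj; apply: eq_big => [i|i _]; last by rewrite invrK mulrC.
by rewrite Pj eq_sym.
Qed.

(* Lagrange interpolation with denominators cleared, so that it also holds at
   coincident points, where all terms vanish. *)
Lemma vanP_sum P z s : (exists i, P i) -> (forall i, z i != 0) ->
  \sum_(k | P k) (\prod_(i | P i && (i != k)) (1 - s * z i)) *
    (\prod_(i | P i && (i != k)) (1 - z k / z i)) * vanP (fun i => P i && (i != k)) z = vanP P z.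
Proof.
move=> exP z0.
have [zd|] := pselect (forall i j, P i -> P j -> i != j -> z i != z j).
  rewrite -[RHS]mul1r -[X in _ = X * _](@lagrange_one F I P z s) // mulr_suml.
  apply: eq_bigr => k Pk; rewrite (vanP_split _ Pk) big_split /= !mulrA; congr (_ * _ * _).
  rewrite -mulrA -big_split /= [X in _ = _ * X]big1 ?mulr1 // => i /andP[Pi ik].
  rewrite mulVf // subr_eq0 eq_sym -(mulfV (z0 k)) (inj_eq (mulIf _)) ?invr_neq0 //.
  exact: zd.
move=> nd; have [i [j [Pi Pj ij e]]] : exists i j, [/\ P i, P j, i != j & z i = z j].
  apply: contrapT => h; apply: nd => i j Pi Pj ij; apply/eqP => e.
  by apply: h; exists i, j.
rewrite [RHS](vanP_eq0 Pi Pj ij (z0 i) e) big1 // => k Pk.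
have van k' l : P l -> k' = k -> l != k' -> z l = z k' ->
    \prod_(i | P i && (i != k)) (1 - z k / z i) = 0.
  move=> Pl -> lk el; rewrite (bigD1 l) /= ?Pl ?lk // -el divff ?subrr ?mul0r //.
have [ik|ik] := eqVneq i k; first by rewrite (van i j) ?mulr0 ?mul0r // eq_sym.
have [jk|jk] := eqVneq j k; first by rewrite (van j i) ?mulr0 ?mul0r.
by rewrite (@vanP_eq0 _ z i j) ?mulr0 ?Pi ?Pj.
Qed.

Lemma vanP_sumV P z s : (exists i, P i) -> (forall i, z i != 0) ->
  \sum_(k | P k) (\prod_(i | P i && (i != k)) (1 - s / z i)) *
    (\prod_(i | P i && (i != k)) (1 - z i / z k)) * vanP (fun i => P i && (i != k)) z = vanP P z.
Proof.
move=> exP z0; rewrite -(vanP_inv P) -(@vanP_sum P (fun i => (z i)^-1) s) //; last first.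
  by move=> i; rewrite invr_neq0.
apply: eq_bigr => k _; rewrite vanP_inv; congr (_ * _ * _).
by apply: eq_bigr => i _; rewrite invrK mulrC.
Qed.

Definition wvan k l z :=
  (\prod_(i | (i != k) && (i != l)) (1 - z k / z i)) *
  (\prod_(i | (i != k) && (i != l)) (1 - z i / z l)) * vanP (fun i => (i != k) && (i != l)) z.

(** Among its poles only 1 - s z_k and 1 - s / z_k pinch the unit circle as s tends to 1; the factor
    1 - z_k / z_l tempers the third. *)
Definition pole k l s z := wvan k l z *
  ((1 - z k / z l) / ((1 - s * z k) * (1 - s / z k) * (1 - s / z l))).

Lemma vanP_poles z s : (forall k, exists l : I, l != k) -> (exists k : I, true) -> (forall i, z i != 0) ->
  (forall i, 1 - s * z i != 0) -> (forall i, 1 - s / z i != 0) ->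
  vanP predT z / \prod_i ((1 - s * z i) * (1 - s / z i)) =
  \sum_k \sum_(l | l != k) pole k l s z.
Proof.
move=> other exk z0 a0 b0; rewrite -(@vanP_sum predT z s) // mulr_suml.
apply: eq_bigr => k _ /=.
rewrite -(@vanP_sumV (fun i => i != k) z s) // mulr_sumr mulr_suml.
apply: eq_bigr => l lk.
rewrite /pole /wvan big_split /= [\prod_i (1 - s * z i)](bigD1 k) //=.
rewrite [\prod_i (1 - s / z i)](bigD1 k) //= [\prod_(i | i != k) (1 - s / z i)](bigD1 l) //=.
rewrite [\prod_(i | i != k) (1 - z k / z i)](bigD1 l) //=.
have p0 : \prod_(i | i != k) (1 - s * z i) != 0 by apply/prodf_neq0.
have p1 : \prod_(i | (i != k) && (i != l)) (1 - s / z i) != 0 by apply/prodf_neq0.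
move: p0 p1 (a0 k) (b0 k) (b0 l).
move: (vanP _ z) (\prod_(i | i != k) _) (\prod_(i | _ && _) (1 - s / _)) => v x y.
move: (\prod_(i | _ && _) (1 - z k / _)) (\prod_(i | _ && _) (1 - _ / z l)) => a b.
move: (1 - s * z k) (1 - s / z k) (1 - s / z l) (1 - z k / z l) => e f g h.
by move=> ? ? ? ? ?; field; apply/and5P; split.
Qed.

Lemma eq_vanP P Q z : P =1 Q -> vanP P z = vanP Q z.
Proof.
move=> e; apply: eq_big => [i|i _]; first exact: e.
by apply: eq_bigl => j; rewrite e.
Qed.

Section Reindex.
Variable sg : I -> I.
Hypothesis bs : bijective sg.
Let ib : injective sg. Proof. exact: bij_inj. Qed.
Let on P : {on P, bijective sg}.
Proof. by case: bs => t h1 h2; exists t => i _; rewrite ?h1 ?h2. Qed.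

Lemma vanP_perm P z : vanP (fun i => P (sg i)) (fun i => z (sg i)) = vanP P z.
Proof.
rewrite /vanP [RHS](reindex sg (on _)) //; apply: eq_bigr => i _.
by rewrite [RHS](reindex sg (on _)) //; apply: eq_bigl => j; rewrite (inj_eq ib).
Qed.

Lemma pole_perm k l s z : pole k l s (fun i => z (sg i)) = pole (sg k) (sg l) s z.
Proof.
rewrite /pole /wvan -(vanP_perm (fun i => (i != sg k) && (i != sg l))).
rewrite (eq_vanP _ (Q := fun i => (i != k) && (i != l))); last by move=> i; rewrite !(inj_eq ib).
congr (_ * _ * _ * _).
- by rewrite [RHS](reindex sg (on _)) //; apply: eq_bigl => i; rewrite !(inj_eq ib).
- by rewrite [RHS](reindex sg (on _)) //; apply: eq_bigl => i; rewrite !(inj_eq ib).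
Qed.
End Reindex.

End VanP.

Lemma perm_pair n (k l : 'I_n.+2) : l != k ->
  exists2 s : 'I_n.+2 -> 'I_n.+2, bijective s & s ord0 = k /\ s (lift ord0 ord0) = l.
Proof.
move=> lk; pose s1 := tperm ord0 k; pose j := s1 l.
have j0 : j != ord0.
  by apply: contraNneq lk => h; rewrite -(tpermK ord0 k l) -/s1 -/j h tpermL.
pose s2 := tperm (lift ord0 ord0) j.
exists (fun i => s1 (s2 i)).
  by apply: bij_comp; exact: injF_bij (@perm_inj _ _).
have -> : s2 ord0 = ord0 by rewrite /s2 tpermD.
by rewrite /s2 tpermL /j /s1 tpermK tpermL.
Qed.

Section PoissonMu.
Variable R : realType.
Local Notation dif f z := (differentiable (f : R[i]^o -> R[i]^o) (z : R[i]^o)).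

Lemma unitv_ocons n (a : R[i]) (z : 'I_n -> R[i]) : nm a = 1 -> unitv z -> unitv (ocons a z).
Proof.
move=> a1 z1 i; case: (unliftP ord0 i) => [j|] ->; first by rewrite oconsS.
by rewrite ocons0.
Qed.

Lemma sdist_ocons n (a b : R[i]) (z w : 'I_n -> R[i]) :
  sdist (ocons a z) (ocons b w) = nm (a - b) + sdist z w.
Proof. by rewrite /sdist big_ord_recl !ocons0; congr (_ + _); apply: eq_bigr => i _; rewrite !oconsS. Qed.

Lemma adm_ocons n c (F : R[i] -> ('I_n.+1 -> R[i]) -> R[i]) : adm c F ->
  adm c (fun w z => F w (ocons 1 z)).
Proof.
move=> [d [B [L [d0 B0 L0 h]]]]; exists d, B, L; split=> // t /h [h1 h2]; split=> [z z1|z w z1 w1].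
  by apply: h1; apply: unitv_ocons; rewrite ?nm1.
have := h2 _ _ (unitv_ocons (nm1 R) z1) (unitv_ocons (nm1 R) w1).
by rewrite sdist_ocons subrr nm0 add0r.
Qed.

Lemma torusB_var n (phi : R[i] -> R[i]) (i : 'I_n.+1) : annular phi 1 ->
  torusB (fun z : 'I_n.+1 -> R[i] => phi (z i)).
Proof.
move=> h; have : adm 1 (fun t (z : 'I_n.+1 -> R[i]) => phi (1 * z i)).
  apply: (@adm_comp R n.+1 1 phi (fun=> 1) (fun z => z i) 1 h ltr01).
    by move=> t _; exact: dif_cst.
  exact: umono_var.
by move=> /adm_torusB; apply: eq_torusB => z; rewrite mul1r.
Qed.

Lemma annular_geom (c : R[i]) : 0 < nm c < 1 -> annular (fun y => (1 - y)^-1) c.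
Proof.
move=> c1; exists 0, 1; split; [exact: lexx|exact: c1|move=> y /andP[_ y1]].
apply: difV; last by apply: difB; [exact: dif_cst|exact: dif_id].
by rewrite subr_eq0; apply/eqP => h; rewrite -h nm1 ltxx in y1.
Qed.

Lemma pk_annular (s : R) : 0 < s -> s < 1 -> annular (pk s) 1.
Proof.
move=> s0 s1; exists s, s^-1; split; first exact: ltW.
  by rewrite nm1 s1 invf_gt1.
have nS : nm (s%:C%C : R[i]) = s by rewrite nm_real gtr0_norm.
move=> y /andP[sy ys].
have y0 : y != 0 by rewrite -nm_gt0 (lt_trans s0).
have dy : dif (fun y => 1 - s%:C%C * y) y.
  by apply: difB; [exact: dif_cst|apply: difM; [exact: dif_cst|exact: dif_id]].
have dy' : dif (fun y => 1 - s%:C%C / y) y.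
  by apply: difB; [exact: dif_cst|apply: difM; [exact: dif_cst|apply: difV => //; exact: dif_id]].
apply: dif_div; [|exact: dif_cst|exact: difM].
rewrite mulf_neq0 // subr_eq0; apply/eqP => h; have := congr1 (@nm R) h.
  by rewrite nm1 nmM nS => e; move: ys; rewrite -(ltr_pM2l s0) -e mulfV ?gt_eqF // ltxx.
rewrite nm1 nmM nmV nS => e; move: sy; rewrite -(ltr_pM2r (x := (nm y)^-1)) ?invr_gt0 ?nm_gt0 //.
by rewrite -e mulfV ?nm_eq0 // ltxx.
Qed.

(** With z_0 = a split off, replacing a by 1 costs at most 2 L |a - 1|, once for z_0 and once for
    the compensating coordinate; [pk_approx] averages this against the kernel. *)
Lemma poisson_mu n (F : ('I_n.+2 -> R[i]) -> R[i]) (s e L : R) : 0 < s -> s < 1 -> 0 < e ->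
  2 - 2 * s <= e ^+ 2 -> torusB F -> 0 <= L ->
  (forall z w, unitv z -> unitv w -> nm (F z - F w) <= L * sdist z w) ->
  nm (mu (fun z => pk s (z ord0) * F z) - mu (fun w => F (ocons 1 w))) <= 10 * L * e.
Proof.
move=> s0 s1 e0 se bF L0 lF.
have bP : torusB (fun z : 'I_n.+2 -> R[i] => pk s (z ord0)) by apply: torusB_var; exact: pk_annular.
have bF1 : torusB (fun w : 'I_n.+1 -> R[i] => F (ocons 1 w)).
  case: bF => B [L' [B0 L0' h1 h2]]; exists B, L'; split=> // [z z1|z w z1 w1].
    by apply: h1; apply: unitv_ocons; rewrite ?nm1.
  have := h2 _ _ (unitv_ocons (nm1 R) z1) (unitv_ocons (nm1 R) w1).
  by rewrite sdist_ocons subrr nm0 add0r.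
have [N hN] := pk_approx s0 s1 e0 se.
have lim : tends (fun m => tmean m (fun z => pk s (z ord0) * F z) +
    (-1) * (cmean m (pk s) * tmean m (fun w : 'I_n.+1 -> R[i] => F (ocons 1 w))))
    (mu (fun z => pk s (z ord0) * F z) + (-1) * (1 * mu (fun w => F (ocons 1 w)))).
  apply: tendsD; first by apply: muP; exact: torusBM.
  by apply: tendsZ; apply: tendsM; [exact: pk_mean|exact: muP].
move: lim; rewrite mul1r mulN1r => lim.
apply: (tends_le (N := N) lim) => m mN.
have -> : tmean m (fun z => pk s (z ord0) * F z) +
    (-1) * (cmean m (pk s) * tmean m (fun w : 'I_n.+1 -> R[i] => F (ocons 1 w))) =
  cmean m (fun a => pk s a *
    tmean m (fun w => F (ocons a (head_div a w)) + (-1) * F (ocons 1 w))).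
  rewrite tmean_split.
  set Y := tmean m (fun w : 'I_n.+1 -> R[i] => F (ocons 1 w)).
  rewrite mulN1r [cmean m (pk s) * Y]mulrC -mulNr -cmeanZ -cmeanD; apply: eq_cmean => a a1.
  rewrite tmeanD !tmeanZ -/Y mulrDr mulN1r mulrN mulNr [Y * _]mulrC; congr (_ - _).
  rewrite -tmeanZ; apply: eq_tmean => w _; by rewrite ocons0.
have -> : 10 * L * e = 5 * (2 * L) * e by ring.
apply: hN => //; first by rewrite mulr_ge0.
move=> a a1; apply: tmean_le => w [w1 _]; rewrite mulN1r.
have us : unitv (head_div a w).
  by move=> i; rewrite /head_div; case: eqP => _; rewrite ?nmM ?nmV ?a1 ?invr1 ?mulr1 w1.
apply: (le_trans (lF _ _ (unitv_ocons a1 us) (unitv_ocons (nm1 R) w1))).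
rewrite sdist_ocons /sdist big_ord_recl big1 => [|i _]; last by rewrite /head_div /= subrr nm0.
rewrite /head_div eqxx addr0.
have -> : nm (w ord0 / a - w ord0) = nm (a - 1).
  rewrite -{2}[w ord0]mulr1 -mulrBr nmM w1 mul1r -(nm_inv_dist a1 (nm1 R)) invr1 //.
by rewrite -mulr2n -mulr_natl; lra.
Qed.

End PoissonMu.

(** * The residue at the pinch *)

Section Residue.
Variable R : realType.
Local Notation dif f z := (differentiable (f : R[i]^o -> R[i]^o) (z : R[i]^o)).
Variables p q : R[i].
Hypotheses (p1 : nm p < 1) (p0 : p != 0) (q1 : nm q < 1) (q0 : q != 0).
Local Notation g := (gamma_reg p q).
Local Notation i0 := (ord0).
Local Notation i1 := (lift ord0 ord0).

Definition kreg n k l (t : 'I_k -> R[i]) (u : 'I_l -> R[i]) (z : 'I_n -> R[i]) : R[i] :=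
  ((\prod_r gpos p q (t r) z) * (\prod_s gneg p q (u s) z)) *
  \prod_i \prod_(j | j != i) (g (z i / z j))^-1.

(** The kernel with t_0 = u_0 = a, freed of the factors 1 - z_i / z_j and of the poles 1 - a z_i and
    1 - a / z_i; it is regular at a = 1. *)
Definition hreg n k l (a : R[i]) (t : 'I_k -> R[i]) (u : 'I_l -> R[i]) (z : 'I_n -> R[i]) : R[i] :=
  (\prod_i (g (a * z i) * g (a / z i))) * kreg t u z.

Lemma kern_kreg n k l (t : 'I_k -> R[i]) (u : 'I_l -> R[i]) (z : 'I_n -> R[i]) :
  kern p q t u z = kreg t u z * vanP predT z.
Proof.
rewrite /kern /kreg -[RHS]mulrA; congr (_ * _).
rewrite /vanP -big_split; apply: eq_bigr => i _ /=; rewrite -big_split; apply: eq_bigr => j _ /=.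
by rewrite egamma_reg // invf_div mulrC.
Qed.

Lemma kern_hreg n k l (a : R[i]) (t : 'I_k -> R[i]) (u : 'I_l -> R[i]) (z : 'I_n -> R[i]) :
  kern p q (ocons a t : 'I_k.+1 -> R[i]) (ocons a u : 'I_l.+1 -> R[i]) z =
  hreg a t u z * (vanP predT z / \prod_i ((1 - a * z i) * (1 - a / z i))).
Proof.
rewrite kern_kreg /hreg /kreg !big_ord_recl !ocons0.
have -> : \prod_(i < k) gpos p q (ocons a t (lift ord0 i)) z = \prod_r gpos p q (t r) z.
  by apply: eq_bigr => r _; rewrite oconsS.
have -> : \prod_(i < l) gneg p q (ocons a u (lift ord0 i)) z = \prod_s gneg p q (u s) z.
  by apply: eq_bigr => r _; rewrite oconsS.
have -> : gpos p q a z = \prod_i g (a * z i) / \prod_i (1 - a * z i).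
  by rewrite -prodf_div; apply: eq_bigr => i _; rewrite egamma_reg.
have -> : gneg p q a z = \prod_i g (a / z i) / \prod_i (1 - a / z i).
  by rewrite -prodf_div; apply: eq_bigr => i _; rewrite egamma_reg.
rewrite !big_split /= invfM.
set A := \prod_i g (a * z i); set B := \prod_i g (a / z i); set C := \prod_r _; set D := \prod_s _.
set E := \prod_i \prod_(j | _) _; set V := vanP _ _.
move: A B C D E V (\prod_i (1 - a * z i))^-1 (\prod_i (1 - a / z i))^-1 => A B C D E V x y; ring.
Qed.

Section Reindexing.
Variables (n k l : nat) (t : 'I_k -> R[i]) (u : 'I_l -> R[i]) (z : 'I_n -> R[i]) (sg : 'I_n -> 'I_n).
Hypothesis bs : bijective sg.
Let on (P : pred 'I_n) : {on P, bijective sg}.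
Proof. by case: bs => s' h1 h2; exists s' => i _; rewrite ?h1 ?h2. Qed.

Lemma kreg_perm : kreg t u (fun i => z (sg i)) = kreg t u z.
Proof.
rewrite /kreg; congr (_ * _ * _).
- by apply: eq_bigr => r _; rewrite /gpos [RHS](reindex sg (on _)).
- by apply: eq_bigr => r _; rewrite /gneg [RHS](reindex sg (on _)).
rewrite [RHS](reindex sg (on _)); apply: eq_bigr => i _.
by rewrite [RHS](reindex sg (on _)); apply: eq_bigl => j; rewrite (inj_eq (bij_inj bs)).
Qed.

Lemma hreg_perm (a : R[i]) : hreg a t u (fun i => z (sg i)) = hreg a t u z.
Proof. by rewrite /hreg kreg_perm [in RHS](reindex sg (on _)). Qed.
End Reindexing.

(* Up to symmetrization, the kernel with t_0 = u_0 = a is the Poisson kernel of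
   z_0 times fa / (1 - a ^+ 2), minus fb; the pole of fb at a = 1 does not pinch
   the torus. *)
Definition fa n k l (a : R[i]) (t : 'I_k -> R[i]) (u : 'I_l -> R[i]) (z : 'I_n.+2 -> R[i]) : R[i] :=
  hreg a t u z * wvan i0 i1 z.

Definition fb n k l (a : R[i]) (t : 'I_k -> R[i]) (u : 'I_l -> R[i]) (z : 'I_n.+2 -> R[i]) : R[i] :=
  fa a t u z * ((z i0 / z i1) * ((1 - a * z i0)^-1 * (1 - a / z i1)^-1)).

Section Adm.
Variables (n k l : nat) (c : R[i]) (d M : R).
Variables (lam : 'I_n -> R[i] -> R[i]) (a : R[i] -> R[i]).
Variables (t : 'I_k -> R[i] -> R[i]) (u : 'I_l -> R[i] -> R[i]).
Hypotheses (d0 : 0 < d).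
Hypothesis lamd : forall i w, nm (w - c) < d -> dif (lam i) w /\ lam i w != 0.
Hypothesis ad : forall w, nm (w - c) < d -> dif a w.
Hypothesis td : forall r w, nm (w - c) < d -> dif (t r) w.
Hypothesis ud : forall s w, nm (w - c) < d -> dif (u s) w.
Hypotheses (M0 : 0 < M) (pM : nm p <= M) (qM : nm q <= M).
Hypotheses (a0 : a c != 0) (a1 : nm (a c) <= 1).
Hypothesis t1 : forall r, 0 < nm (t r c) <= M.
Hypothesis u1 : forall s, 0 < nm (u s c) <= M.
Hypothesis lam1 : forall i, M < nm (lam i c) < M^-1.

Let cc : nm (c - c) < d. Proof. by rewrite subrr nm0. Qed.
Let l0 i : lam i c != 0. Proof. by case: (lamd i cc). Qed.
Let ln i : 0 < nm (lam i c). Proof. by rewrite nm_gt0. Qed.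
Let lM i : M * nm (lam i c) < 1.
Proof. by case/andP: (lam1 i) => _; rewrite -(ltr_pM2l M0) mulfV ?gt_eqF. Qed.
Let lV i : M / nm (lam i c) < 1.
Proof. by rewrite ltr_pdivrMr // mul1r; case/andP: (lam1 i). Qed.

Lemma adm_mul_var phi (b : R[i] -> R[i]) i : annular phi (b c * lam i c) ->
  (forall w, nm (w - c) < d -> dif b w) -> adm c (fun w z => phi (b w * (lam i w * z i))).
Proof.
move=> h bd; apply: (@eq_adm R n c (fun w z => phi ((b w * lam i w) * z i))).
  by move=> w z; rewrite mulrA.
apply: (adm_comp (g := fun w => b w * lam i w) h d0); last exact: umono_var.
by move=> w wd; apply: difM; [exact: bd|case: (lamd i wd)].
Qed.

Lemma adm_div_var phi (b : R[i] -> R[i]) i : annular phi (b c / lam i c) ->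
  (forall w, nm (w - c) < d -> dif b w) -> adm c (fun w z => phi (b w / (lam i w * z i))).
Proof.
move=> h bd; apply: (@eq_adm R n c (fun w z => phi ((b w / lam i w) * (z i)^-1))).
  by move=> w z; rewrite invfM mulrA.
apply: (adm_comp (g := fun w => b w / lam i w) h d0); last exact: umono_inv.
by move=> w wd; case: (lamd i wd) => h1 h2; apply: dif_div => //; exact: bd.
Qed.

Lemma adm_ratio_var phi i j : annular phi (lam i c / lam j c) ->
  adm c (fun w z => phi (lam i w * z i / (lam j w * z j))).
Proof.
move=> h; apply: (@eq_adm R n c (fun w z => phi ((lam i w / lam j w) * (z i / z j)))).
  by move=> w z; rewrite mulrACA -invfM.
apply: (adm_comp (g := fun w => lam i w / lam j w) h d0); last exact: umono_ratio.
by move=> w wd; case: (lamd i wd) => h1 h2; case: (lamd j wd) => h3 h4; apply: dif_div.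
Qed.

Let annular_g (y : R[i]) : y != 0 -> M * nm y < 1 -> annular g y.
Proof.
move=> y0 yM; exists 0, M^-1; split; first exact: lexx.
  by rewrite nm_gt0 y0 /= -(ltr_pM2l M0) mulfV ?gt_eqF.
move=> v /andP[v0]; rewrite -(ltr_pM2l M0) mulfV ?gt_eqF // => vM.
apply: gamma_reg_dif => //; first by rewrite -nm_gt0.
- by apply: le_lt_trans vM; rewrite ler_pM2r.
- by apply: le_lt_trans vM; rewrite ler_pM2r.
Qed.

Let annular_gV (y : R[i]) : nm (p * q) < nm y -> annular (fun y => (g y)^-1) y.
Proof.
move=> y0; exists (nm (p * q)), (nm y + 1); split; first exact: nm_ge0.
  by rewrite y0 ltrDl ltr01.
by move=> v /andP[v0 _]; exact: gamma_regV_dif.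
Qed.

Let annular_1m (y : R[i]) : y != 0 -> annular (fun y : R[i] => 1 - y) y.
Proof. by move=> y0; apply: (annular_punctured y0) => v _; apply: difB; [exact: dif_cst|exact: dif_id]. Qed.

Lemma adm_kreg : adm c (fun w z => kreg (t^~ w) (u^~ w) (fun i => lam i w * z i)).
Proof.
apply: admM; first apply: admM.
- apply: adm_prod => r _; apply: adm_prod => i _.
  apply: (adm_mul_var (phi := egamma p q)); last exact: td.
  apply: annular_gamma => //; have /andP[h0 h1] := t1 r; rewrite nmM mulr_gt0 //=.
  by apply: le_lt_trans (lM i); rewrite ler_pM2r.
- apply: adm_prod => r _; apply: adm_prod => i _.
  apply: (adm_div_var (phi := egamma p q)); last exact: ud.
  apply: annular_gamma => //; have /andP[h0 h1] := u1 r; rewrite nmM nmV divr_gt0 //=.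
  by apply: le_lt_trans (lV i); rewrite ler_pM2r // invr_gt0.
apply: adm_prod => i _; apply: adm_prod => j _.
apply: (adm_ratio_var (phi := fun y => (g y)^-1)); apply: annular_gV.
rewrite !nmM nmV ltr_pdivlMr //.
apply: (@le_lt_trans _ _ (M * (M * nm (lam j c)))).
  by rewrite mulrA ler_pM2r // ler_pM // nm_ge0.
by apply: (@lt_trans _ _ M); [rewrite gtr_pMr|case/andP: (lam1 i)].
Qed.

(** The poles at |a| = 1 having been divided out, the limit value a = 1 is included. The factors
    [lam] rescale the contour; they are 1 on the torus. *)
Lemma adm_hreg : adm c (fun w z => hreg (a w) (t^~ w) (u^~ w) (fun i => lam i w * z i)).
Proof.
apply: admM; last exact: adm_kreg.
have aM i : M * nm (a c * lam i c) < 1.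
  by apply: le_lt_trans (lM i); rewrite nmM ler_pM2l // ler_piMl // ltW.
have aV i : M * nm (a c / lam i c) < 1.
  apply: le_lt_trans (lV i); rewrite nmM nmV ler_pM2l // ler_piMl // invr_ge0 ltW //.
apply: adm_prod => i _; apply: admM.
  by apply: (adm_mul_var (phi := g)) => //; apply: annular_g; rewrite ?mulf_neq0.
by apply: (adm_div_var (phi := g)) => //; apply: annular_g; rewrite ?mulf_neq0 ?invr_neq0.
Qed.

Lemma adm_one_sub i j : adm c (fun w z => 1 - lam i w * z i / (lam j w * z j)).
Proof. by apply: (adm_ratio_var (phi := fun y => 1 - y)); apply: annular_1m; rewrite mulf_neq0 ?invr_neq0. Qed.

Lemma adm_wvan i j : adm c (fun w z => wvan i j (fun i => lam i w * z i)).
Proof.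
apply: admM; first apply: admM; apply: adm_prod => i' _; first exact: adm_one_sub.
  exact: adm_one_sub.
by apply: adm_prod => j' _; exact: adm_one_sub.
Qed.

Lemma adm_geom_mul i : nm (a c * lam i c) < 1 -> adm c (fun w z => (1 - a w * (lam i w * z i))^-1).
Proof.
move=> h; apply: (adm_mul_var (phi := fun y => (1 - y)^-1)) => //.
by apply: annular_geom; rewrite h nm_gt0 mulf_neq0.
Qed.

Lemma adm_geom_div i : nm (a c / lam i c) < 1 -> adm c (fun w z => (1 - a w / (lam i w * z i))^-1).
Proof.
move=> h; apply: (adm_div_var (phi := fun y => (1 - y)^-1)) => //.
by apply: annular_geom; rewrite h nm_gt0 mulf_neq0 ?invr_neq0.
Qed.

Lemma adm_ratio_id i j : adm c (fun w z => lam i w * z i / (lam j w * z j)).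
Proof.
apply: (adm_ratio_var (phi := id)); apply: annular_punctured; first by rewrite mulf_neq0 ?invr_neq0.
by move=> y _; exact: dif_id.
Qed.
End Adm.

Section FamilyBounds.
Variables (n k l : nat) (c : R[i]) (d M : R).
Variables (lam : 'I_n.+2 -> R[i] -> R[i]) (a : R[i] -> R[i]).
Variables (t : 'I_k -> R[i] -> R[i]) (u : 'I_l -> R[i] -> R[i]).
Hypotheses (d0 : 0 < d).
Hypothesis lamd : forall i w, nm (w - c) < d -> dif (lam i) w /\ lam i w != 0.
Hypothesis ad : forall w, nm (w - c) < d -> dif a w.
Hypothesis td : forall r w, nm (w - c) < d -> dif (t r) w.
Hypothesis ud : forall s w, nm (w - c) < d -> dif (u s) w.
Hypotheses (M0 : 0 < M) (pM : nm p <= M) (qM : nm q <= M).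
Hypotheses (a0 : a c != 0) (a1 : nm (a c) <= 1).
Hypothesis t1 : forall r, 0 < nm (t r c) <= M.
Hypothesis u1 : forall s, 0 < nm (u s c) <= M.
Hypothesis lam1 : forall i, M < nm (lam i c) < M^-1.

Lemma adm_fa : adm c (fun w z => fa (a w) (t^~ w) (u^~ w) (fun i => lam i w * z i)).
Proof. 
apply: admM; last exact: (adm_wvan d0 lamd).
exact: (adm_hreg d0 lamd ad td ud M0 pM qM a0 a1 t1 u1 lam1).
 Qed.

Lemma adm_fb : nm (a c * lam i0 c) < 1 -> nm (a c / lam i1 c) < 1 ->
  adm c (fun w z => fb (a w) (t^~ w) (u^~ w) (fun i => lam i w * z i)).
Proof.
move=> h0 h1; apply: admM; first exact: adm_fa.
apply: admM; first exact: (adm_ratio_id d0 lamd).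
apply: admM; first exact: (adm_geom_mul d0 lamd ad a0 h0).
exact: (adm_geom_div d0 lamd ad a0 h1).
Qed.
End FamilyBounds.

Section Fixed.
Variables (n k l : nat) (M s : R) (t : 'I_k -> R[i]) (u : 'I_l -> R[i]).
Hypotheses (M0 : 0 < M) (M1 : M < 1) (pM : nm p <= M) (qM : nm q <= M).
Hypothesis t1 : forall r, 0 < nm (t r) <= M.
Hypothesis u1 : forall s, 0 < nm (u s) <= M.
Hypotheses (s0 : 0 < s) (s1 : s < 1).
Local Notation S := (s%:C%C : R[i]).

Let S0 : S != 0. Proof. by rewrite -nm_gt0 nm_real normr_gt0 gt_eqF. Qed.
Let nS : nm S = s. Proof. by rewrite nm_real gtr0_norm. Qed.
Let nS1 : nm S <= 1. Proof. by rewrite nS ltW. Qed.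

Let one_lam i w : nm (w - 1) < 1 -> dif ((fun (_ : 'I_n.+2) _ => 1 : R[i]) i) w /\ (1 : R[i]) != 0.
Proof. by move=> _; split; [exact: dif_cst|exact: oner_neq0]. Qed.

Let cst (b w : R[i]) : nm (w - 1) < 1 -> dif (fun=> b) w.
Proof. by move=> _; exact: dif_cst. Qed.

Let one_bd : M < nm (1 : R[i]) < M^-1.
Proof. by rewrite nm1 M1 invf_gt1. Qed.

Let one_mul (z : 'I_n.+2 -> R[i]) : (fun i => 1 * z i) = z.
Proof. by apply/funext => i; rewrite mul1r. Qed.

Lemma torusB_fa : torusB (fun z : 'I_n.+2 -> R[i] => fa S t u z).
Proof.
have := @adm_fa n k l 1 1 M (fun _ _ => 1) (fun=> S) (fun r _ => t r) (fun r _ => u r) ltr01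
  one_lam (cst S) (fun r => cst (t r)) (fun r => cst (u r)) M0 pM qM S0 nS1 t1 u1 (fun=> one_bd).
by move=> /adm_torusB; apply: eq_torusB => z; rewrite one_mul.
Qed.

Lemma torusB_fb : torusB (fun z : 'I_n.+2 -> R[i] => fb S t u z).
Proof.
have h0 : nm (S * 1) < 1 by rewrite mulr1 nS.
have h1 : nm (S / 1) < 1 by rewrite divr1 nS.
have := @adm_fb n k l 1 1 M (fun _ _ => 1) (fun=> S) (fun r _ => t r) (fun r _ => u r) ltr01
  one_lam (cst S) (fun r => cst (t r)) (fun r => cst (u r)) M0 pM qM S0 nS1 t1 u1 (fun=> one_bd) h0 h1.
by move=> /adm_torusB; apply: eq_torusB => z; rewrite one_mul.
Qed.

Lemma torusB_pole i j : torusB (fun z : 'I_n.+2 -> R[i] => hreg S t u z * pole i j S z).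
Proof.
have h0 : nm (S * 1) < 1 by rewrite mulr1 nS.
have h1 : nm (S / 1) < 1 by rewrite divr1 nS.
have hh := @adm_hreg n.+2 k l 1 1 M (fun _ _ => 1) (fun=> S) (fun r _ => t r) (fun r _ => u r) ltr01
  one_lam (cst S) (fun r => cst (t r)) (fun r => cst (u r)) M0 pM qM S0 nS1 t1 u1 (fun=> one_bd).
have hw := @adm_wvan n.+2 1 1 (fun _ _ => 1) ltr01 one_lam i j.
have hr := @adm_one_sub n.+2 1 1 (fun _ _ => 1) ltr01 one_lam i j.
have hm := @adm_geom_mul n.+2 1 1 (fun _ _ => 1) (fun=> S) ltr01 one_lam (cst S) S0 i h0.
have hd e := @adm_geom_div n.+2 1 1 (fun _ _ => 1) (fun=> S) ltr01 one_lam (cst S) S0 e h1.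
have := admM hh (admM hw (admM hr (admM (admM hm (hd i)) (hd j)))).
move=> /adm_torusB; apply: eq_torusB => z; rewrite one_mul /pole; congr (_ * (_ * _)).
by rewrite !mul1r !invfM.
Qed.

(** By symmetry all (n+2)(n+1) ordered pairs in [vanP_poles] contribute equally. The identity (1 -
    z_0 / z_1) / (1 - s / z_1) = 1 - (z_0 / z_1)(1 - s / z_0) / (1 - s / z_1) separates the Poisson
    kernel from [fb]. *)
Lemma mu_kern_poles :
  mu (fun z : 'I_n.+2 -> R[i] => kern p q (ocons S t : 'I_k.+1 -> R[i]) (ocons S u : 'I_l.+1 -> R[i]) z) =
  (n.+2 * n.+1)%:R * ((1 - S ^+ 2)^-1 * mu (fun z : 'I_n.+2 -> R[i] => pk s (z i0) * fa S t u z) -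
    mu (fun z : 'I_n.+2 -> R[i] => fb S t u z)).
Proof.
pose F i j (z : 'I_n.+2 -> R[i]) := if j != i then hreg S t u z * pole i j S z else 0.
have bF i j : torusB (F i j).
  by rewrite /F; case: (j != i); [exact: torusB_pole|exact: torusB_cst].
have -> : mu (fun z : 'I_n.+2 -> R[i] => kern p q (ocons S t : 'I_k.+1 -> R[i]) (ocons S u : 'I_l.+1 -> R[i]) z) =
    mu (fun z => \sum_i \sum_j F i j z).
  apply: eq_mu => z [z1 _]; rewrite kern_hreg vanP_poles.
  - rewrite mulr_sumr; apply: eq_bigr => i _; rewrite mulr_sumr big_mkcond; apply: eq_bigr => j _.
    by rewrite /F; case: (j != i).
  - move=> i; have [->|h] := eqVneq i ord0; last by exists ord0; rewrite eq_sym.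
    by exists (lift ord0 ord0).
  - by exists ord0.
  - by move=> i; rewrite -nm_gt0 z1.
  - by move=> i; exact: unit_sub_neq0.
  - by move=> i; apply: unit_sub_neq0 => //; rewrite nmV z1 invr1.
rewrite mu_sum => [|i]; last by apply: torusB_sum.
under eq_bigr do rewrite mu_sum //.
have muF i j : j != i -> mu (F i j) = mu (fun z : 'I_n.+2 -> R[i] => hreg S t u z * pole i0 i1 S z).
  move=> ji; have [sg bs [e0 e1]] := perm_pair ji.
  rewrite -[RHS](mu_perm _ bs); apply: eq_mu => z _.
  by rewrite /F ji (hreg_perm _ _ _ bs) (pole_perm bs) e0 e1.
have muF0 i : mu (F i i) = 0.
  have e := muZ 0 (bF i i); rewrite mul0r in e; rewrite -[RHS]e.
  by apply: eq_mu => z _; rewrite /F eqxx mul0r.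
pose X := mu (fun z : 'I_n.+2 -> R[i] => hreg S t u z * pole i0 i1 S z).
rewrite (eq_bigr (fun=> n.+1%:R * X)) => [|i _]; last first.
  rewrite (bigD1 i) //= muF0 add0r (eq_bigr (fun=> X)) => [|j ji]; last exact: muF.
  rewrite sumr_const mulr_natl; congr (_ *+ _).
  transitivity #|predC1 i|; first by apply: eq_card.
  by rewrite cardC1 card_ord.
rewrite sumr_const card_ord -[_ *+ n.+2]mulr_natl mulrA -natrM; congr (_ * _).
have bpk : torusB (fun z : 'I_n.+2 -> R[i] => pk s (z i0) * fa S t u z).
  by apply: torusBM; [apply: torusB_var; exact: pk_annular|exact: torusB_fa].
rewrite -(muZ _ bpk) -[X in _ + X]mulN1r -(muZ _ torusB_fb) -muD; last first.
- by apply: torusBM; [exact: torusB_cst|exact: torusB_fb].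
- by apply: torusBM; [exact: torusB_cst|exact: bpk].
apply: eq_mu => z [z1 _].
have c0 := unit_sub_neq0 s0 s1 (z1 i0).
have c1 := unit_sub_neq0 s0 s1 (z1 i1).
have inv1 (v : R[i]) : nm v = 1 -> nm v^-1 = 1 by move=> h; rewrite nmV h invr1.
have c2 := unit_sub_neq0 s0 s1 (inv1 _ (z1 i0)).
have c3 := unit_sub_neq0 s0 s1 (inv1 _ (z1 i1)).
have zn0 : z i0 != 0 by rewrite -nm_gt0 z1.
have zn1 : z i1 != 0 by rewrite -nm_gt0 z1.
have c4 : 1 - S ^+ 2 != 0.
  rewrite subr_eq0; apply/eqP => h; have := congr1 (@nm R) h; rewrite nm1 nmX nS => e.
  by have := expr_lt1 (isT : (0 < 2)%N) (ltW s0); rewrite -e ltxx s1.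
rewrite /pole /fb /fa /pk; move: (hreg _ _ _ _) (wvan _ _ _) c0 c1 c2 c3 zn0 zn1 c4 => A B.
move: (z i0) (z i1) => x y; move: (S) => v c0 c1 c2 c3 x0 y0 c4.
have h2 : x - v != 0 by apply: contraNneq c2 => h; rewrite -(mulfV x0) -mulrBl h mul0r.
have h3 : y - v != 0 by apply: contraNneq c3 => h; rewrite -(mulfV y0) -mulrBl h mul0r.
by field; rewrite c0 c4 h2 h3 x0 y0.
Qed.

Definition pinch_shift (i : 'I_n.+2) : int := if i == i0 then 1 else if i == i1 then -1 else 0.

(** The geometric factors of [fb] have their poles at z_0 = 1 / s and z_1 = s. Moving z_0 inwards
    and z_1 outwards by a fixed factor keeps the contour away from both as s tends to 1. *)
Lemma mu_fb_shift (rho : R) : M < rho -> rho < 1 -> M < s ->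
  mu (fun z : 'I_n.+2 -> R[i] => fb S t u z) =
  mu (fun z => fb S t u (zscale pinch_shift rho%:C%C z)).
Proof.
move=> Mr r1 Ms; have Mi : 0 < M^-1 by rewrite invr_gt0.
have sM : s^-1 < M^-1 by rewrite ltf_pV2 ?posrE.
have s1' : 1 < s^-1 by rewrite invf_gt1.
have rr : nm rho%:C%C = rho by rewrite nm_real gtr0_norm // (lt_trans M0).
have := @mu_shift R n.+1 pinch_shift (fun z => fb S t u z) M s^-1 _ (ltW M0) _ 1 rho%:C%C.
rewrite nm1 rr Mr M1 s1' (lt_trans r1 s1').
have e1 z : zscale pinch_shift 1 z = z by apply/funext => i; rewrite /zscale exp1rz mul1r.
have <- : mu (fun z => fb S t u (zscale pinch_shift 1 z)) = mu (fun z : 'I_n.+2 -> R[i] => fb S t u z).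
  by apply: eq_mu => z _; rewrite e1.
apply=> //.
  by rewrite /pinch_shift !big_ord_recl /= big1 ?addr0 ?addrN.
move=> c /andP[cM cs].
have c0 : c != 0 by rewrite -nm_gt0 (lt_trans M0).
have far w : nm (w - c) < nm c -> w != 0.
  by apply: contraTneq => ->; rewrite sub0r nmN ltxx.
have cMi : nm c < M^-1 by exact: lt_trans sM.
have cs1 : s * nm c < 1 by rewrite -(ltr_pM2l s0) mulfV ?gt_eqF // in cs.
apply: (@adm_fb n k l c (nm c) M (fun i w => w ^ pinch_shift i) (fun=> S) (fun r _ => t r) (fun r _ => u r)) => //.
- by rewrite nm_gt0.
- by move=> i w /far w0; split; [exact: dif_expz|exact: expfz_neq0].
- move=> i; rewrite /pinch_shift; case: ifP => _; first by rewrite expr1z cM cMi.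
  case: ifP => _; last by rewrite expr0z nm1 M1 invf_gt1.
  rewrite exprN1 nmV ltf_pV2 ?posrE ?nm_gt0 // cM andbT.
  by rewrite -(ltr_pM2r (x := nm c)) ?nm_gt0 // mulVf ?nm_eq0 // -(ltr_pM2l (x := M^-1)) // mulKf ?gt_eqF // mulr1.
- by rewrite /pinch_shift eqxx expr1z nmM nS.
by rewrite /pinch_shift eqxx /= exprN1 invrK nmM nS.
Qed.
End Fixed.

Lemma dif_tends (f : R[i] -> R[i]) (x : nat -> R[i]) c : dif f c -> tends x c ->
  tends (fun m => f (x m)) (f c).
Proof.
move=> df hx e e0.
have /contCP /(_ e e0) [d d0 hd] : {for (c : R[i]^o), continuous (f : R[i]^o -> R[i]^o)}.
  exact: differentiable_continuous.
by have [N hN] := hx d d0; exists N => m /hN h; exact: hd.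
Qed.

Section Limit.
Variables (n k l : nat) (M d : R) (t : 'I_k -> R[i] -> R[i]) (u : 'I_l -> R[i] -> R[i]).
Hypotheses (M0 : 0 < M) (M1 : M < 1) (pM : nm p <= M) (qM : nm q <= M) (d0 : 0 < d).
Hypothesis td : forall r w, nm (w - 1) < d -> dif (t r) w.
Hypothesis ud : forall r w, nm (w - 1) < d -> dif (u r) w.
Hypothesis t1 : forall r w, nm (w - 1) < d -> 0 < nm (t r w) <= M.
Hypothesis u1 : forall r w, nm (w - 1) < d -> 0 < nm (u r w) <= M.
Variable sq : nat -> R.
Hypotheses (sM : forall m, M < sq m < 1) (sd : forall m, nm ((sq m)%:C%C - 1) < d).
Hypothesis sl : tends (fun m => (sq m)%:C%C) 1.
Local Notation S m := ((sq m)%:C%C : R[i]).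

Let cc : nm ((1 : R[i]) - 1) < d. Proof. by rewrite subrr nm0. Qed.
Let s0 m : 0 < sq m. Proof. by case/andP: (sM m) => h _; exact: lt_trans h. Qed.
Let s1 m : sq m < 1. Proof. by case/andP: (sM m). Qed.
Let one_bd : M < nm (1 : R[i]) < M^-1. Proof. by rewrite nm1 M1 invf_gt1. Qed.
Let n1 : nm (1 : R[i]) <= 1. Proof. by rewrite nm1. Qed.
Let idd w : nm (w - 1) < d -> dif id w. Proof. by move=> _; exact: dif_id. Qed.
Let one_mul (z : 'I_n.+2 -> R[i]) : (fun i => 1 * z i) = z.
Proof. by apply/funext => i; rewrite mul1r. Qed.

Lemma adm_fa1 : adm 1 (fun w (z : 'I_n.+2 -> R[i]) => fa w (t^~ w) (u^~ w) z).
Proof.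
have one_lam (i : 'I_n.+2) (w : R[i]) : nm (w - 1) < d ->
    dif ((fun (_ : 'I_n.+2) _ => 1 : R[i]) i) w /\ (1 : R[i]) != 0.
  by move=> _; split; [exact: dif_cst|exact: oner_neq0].
have := @adm_fa n k l 1 d M (fun _ _ => 1) id t u d0 one_lam idd td ud M0 pM qM (oner_neq0 _) n1
  (fun r => t1 r cc) (fun r => u1 r cc) (fun=> one_bd).
by apply: eq_adm => w z; rewrite one_mul.
Qed.

Lemma tends_mu_fa : tends (fun m => mu (fun z : 'I_n.+2 -> R[i] =>
    pk (sq m) (z i0) * fa (S m) (t^~ (S m)) (u^~ (S m)) z))
  (mu (fun w : 'I_n.+1 -> R[i] => fa 1 (t^~ 1) (u^~ 1) (ocons 1 w))).
Proof.
have limF : tends (fun m => mu (fun w : 'I_n.+1 -> R[i] => fa (S m) (t^~ (S m)) (u^~ (S m)) (ocons 1 w)))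
    (mu (fun w : 'I_n.+1 -> R[i] => fa 1 (t^~ 1) (u^~ 1) (ocons 1 w))).
  apply: (@dif_tends (fun v => mu (fun w : 'I_n.+1 -> R[i] => fa v (t^~ v) (u^~ v) (ocons 1 w)))) => //.
  by apply: mu_dif; exact: (adm_ocons adm_fa1).
have [d' [B [L [d0' B0 L0 hL]]]] := adm_fa1.
move=> e e0.
have [N1 h1] := limF (e / 2) (divr_gt0 e0 (ltr0n R 2)).
(* Makes the error 10 L x of [poisson_mu] less than e / 2; its condition 2 - 2 s <= x^2 holds for m
   large. *)
pose x := e / (20 * (L + 1)).
have x0 : 0 < x by rewrite divr_gt0 // mulr_gt0 // ltr_wpDl.
have xL : 10 * L * x < e / 2.
  have : x * (20 * (L + 1)) = e by rewrite divfK // mulf_neq0 ?pnatr_eq0 // gt_eqF // ltr_wpDl.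
  by move: x x0 => x x0 h; nra.
have [N2 h2] := sl d0'.
have [N3 h3] := sl (divr_gt0 (exprn_gt0 2 x0) (ltr0n R 2)).
exists (maxn N1 (maxn N2 N3)) => m; rewrite !geq_max => /and3P[/h1 a1 /h2 a2 /h3 a3].
apply: (le_lt_trans (nm_dist _ (mu (fun w : 'I_n.+1 -> R[i] => fa (S m) (t^~ (S m)) (u^~ (S m)) (ocons 1 w))) _)).
rewrite [ltRHS](_ : e = e / 2 + e / 2); last by rewrite -splitr.
apply: ltrD a1; apply: le_lt_trans xL.
have tS r : 0 < nm (t r (S m)) <= M by exact: t1.
have uS r : 0 < nm (u r (S m)) <= M by exact: u1.
apply: (poisson_mu (s0 m) (s1 m) x0) => //.
- have := le_lt_trans (nm_Re _) a3; rewrite raddfB /= ltr_norml => /andP[+ _].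
  by move: (x ^+ 2) (sq m) => y v; lra.
- exact: (torusB_fa n M0 M1 pM qM tS uS (s0 m) (s1 m)).
- by case: (hL _ a2).
Qed.

(** On the shifted contour the [fb] part is continuous at s = 1, so the factor 1 - s^2 annihilates
    it; the Poisson part converges to the slice z_0 = 1. *)
Lemma residue_limit : tends (fun m => (1 - S m ^+ 2) *
    mu (fun z : 'I_n.+2 -> R[i] => kern p q (ocons (S m) (t^~ (S m)) : 'I_k.+1 -> R[i])
      (ocons (S m) (u^~ (S m)) : 'I_l.+1 -> R[i]) z))
  ((n.+2 * n.+1)%:R * mu (fun w : 'I_n.+1 -> R[i] => fa 1 (t^~ 1) (u^~ 1) (ocons 1 w))).
Proof.
pose rho := (1 + M) / 2.
have Mr : M < rho by rewrite /rho; move: M1; lra.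
have r1 : rho < 1 by rewrite /rho; move: M1; lra.
have r0 : 0 < rho by exact: lt_trans M0 Mr.
have rr : nm rho%:C%C = rho by rewrite nm_real gtr0_norm.
have rn : rho%:C%C != 0 :> R[i] by rewrite -nm_gt0 rr.
have one_lam (i : 'I_n.+2) (w : R[i]) : nm (w - 1) < d ->
    dif ((fun (i : 'I_n.+2) _ => rho%:C%C ^ pinch_shift i : R[i]) i) w /\ (rho%:C%C : R[i]) ^ pinch_shift i != 0.
  by move=> _; split; [exact: dif_cst|exact: expfz_neq0].
have lamM (i : 'I_n.+2) : M < nm ((rho%:C%C : R[i]) ^ pinch_shift i) < M^-1.
  have rMi : rho < M^-1 by apply: (lt_trans r1); rewrite invf_gt1.
  rewrite /pinch_shift; case: (i == i0); first by rewrite expr1z rr Mr.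
  case: (i == i1); last by rewrite expr0z nm1 M1 invf_gt1.
  rewrite exprN1 nmV rr ltf_pV2 ?posrE // Mr andbT (lt_trans M1) // invf_gt1 //.
have hfb : adm 1 (fun w z => fb w (t^~ w) (u^~ w) (fun i : 'I_n.+2 => rho%:C%C ^ pinch_shift i * z i)).
  apply: (@adm_fb n k l 1 d M (fun i _ => rho%:C%C ^ pinch_shift i) id t u d0 one_lam idd td ud M0 pM qM
    (oner_neq0 _) n1 (fun r => t1 r cc) (fun r => u1 r cc) lamM).
    by rewrite /pinch_shift eqxx expr1z mul1r rr.
  by rewrite /pinch_shift eqxx /= exprN1 invrK mul1r rr.
pose X v := mu (fun z => fb v (t^~ v) (u^~ v) (fun i : 'I_n.+2 => rho%:C%C ^ pinch_shift i * z i)).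
have limB : tends (fun m => X (S m)) (X 1) by apply: (@dif_tends X) => //; exact: mu_dif.
have lim1 : tends (fun m => 1 - S m ^+ 2) 0.
  have dq : dif (fun v : R[i] => 1 - v ^+ 2) 1.
    by apply: difB; [exact: dif_cst|apply: difX; exact: dif_id].
  by have := dif_tends dq sl; rewrite expr1n subrr.
have lim := tendsZ (n.+2 * n.+1)%:R (tendsD tends_mu_fa (tendsZ (-1) (tendsM lim1 limB))).
rewrite mul0r mulr0 addr0 in lim.
apply: eq_tends lim => m.
have tS r : 0 < nm (t r (S m)) <= M by exact: t1.
have uS r : 0 < nm (u r (S m)) <= M by exact: u1.
rewrite (mu_kern_poles n M0 M1 pM qM tS uS (s0 m) (s1 m)).
have Ms : M < sq m by case/andP: (sM m).
rewrite (mu_fb_shift n M0 M1 pM qM tS uS (s0 m) (s1 m) Mr r1 Ms) -/(X (S m)).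
have c4 : 1 - S m ^+ 2 != 0.
  rewrite subr_eq0; apply/eqP => h; have := congr1 (@nm R) h.
  rewrite nm1 nmX nm_real gtr0_norm // => e.
  by have := expr_lt1 (isT : (0 < 2)%N) (ltW (s0 m)); rewrite -e ltxx s1.
have H (N A B D : R[i]) : D != 0 -> N * (A + -1 * (D * B)) = D * (N * (D^-1 * A - B)).
  by move=> ?; field.
exact: H.
Qed.
End Limit.

End Residue.

Lemma prod_ord_recl_pred (K : comNzRingType) n (P : pred 'I_n.+1) (F : 'I_n.+1 -> K) :
  \prod_(i | P i) F i =
  (if P ord0 then F ord0 else 1) * \prod_(i < n | P (lift ord0 i)) F (lift ord0 i).
Proof. by rewrite big_mkcond big_ord_recl -big_mkcond. Qed.

(** * The value of the quotient *)

Section Value.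
Variable R : realType.
Local Notation dif f z := (differentiable (f : R[i]^o -> R[i]^o) (z : R[i]^o)).
Variables p q : R[i].
Hypotheses (p1 : nm p < 1) (p0 : p != 0) (q1 : nm q < 1) (q0 : q != 0).
Local Notation g := (gamma_reg p q).
Local Notation G := (egamma p q).

Let pq1 : nm (p * q) < 1.
Proof. by rewrite nmM mulr_ilt1 ?nm_ge0. Qed.

Let g_unit_neq0 (y : R[i]) : nm y = 1 -> g y != 0.
Proof. by move=> y1; apply: gamma_reg_neq0; rewrite ?y1 ?mulr1. Qed.

Section AtOne.
Variables (n k l : nat) (t : 'I_k -> R[i]) (u : 'I_l -> R[i]).

Definition vterm (j : 'I_n.+1) (w : 'I_n.+1 -> R[i]) :=
  (\prod_(i | i != j) (1 - 1 / w i)) * (\prod_(i | i != j) (1 - w i / w j)) *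
  vanP (fun i => i != j) w.

(** At a = z_0 = 1 the factors of [hreg] at w_i cancel the regular parts of the reciprocals that
    pair z_0 with w_i, and the integrand of rank one less appears. *)
Lemma fa_at1 (w : 'I_n.+1 -> R[i]) : unitv w -> fa p q 1 t u (ocons 1 w) =
  (g 1 * g 1 * (\prod_r G (t r) * \prod_s G (u s))) * (kreg p q t u w * vterm ord0 w).
Proof.
move=> w1; have li (i j : 'I_n.+1) : (lift ord0 i != lift ord0 j :> 'I_n.+2) = (i != j).
  by apply/negbLR; rewrite negbK; apply/eqP/eqP => [/lift_inj //|->].
have l0 (i : 'I_n.+1) : (lift ord0 i != ord0 :> 'I_n.+2) by [].
have l0' (i : 'I_n.+1) : (ord0 != lift ord0 i :> 'I_n.+2) by [].
rewrite /fa; have -> : wvan ord0 (lift ord0 ord0) (ocons 1 w) = vterm ord0 w :> R[i].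
  rewrite /wvan /vterm /vanP !prod_ord_recl_pred /= !mul1r.
  congr (_ * _ * _).
  - by apply: eq_big => [i|i _]; rewrite ?li ?ocons0 ?oconsS.
  - by apply: eq_big => [i|i _]; rewrite ?li ?oconsS.
  apply: eq_bigr => i _; rewrite [LHS]prod_ord_recl_pred /= mul1r.
  by apply: eq_big => [j|j _]; rewrite ?li ?oconsS.
rewrite mulrA; congr (_ * _); rewrite /hreg big_ord_recl ocons0 divr1 mulr1.
have -> : \prod_(i < n.+1) (g (1 * ocons 1 w (lift ord0 i)) * g (1 / ocons 1 w (lift ord0 i))) =
    \prod_i g (w i) * \prod_i g (w i)^-1.
  by rewrite -big_split; apply: eq_bigr => i _; rewrite oconsS mul1r div1r.
have -> : kreg p q t u (ocons 1 w) = (\prod_r G (t r) * \prod_s G (u s)) * kreg p q t u w *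
    ((\prod_i g (w i))^-1 * (\prod_i g (w i)^-1)^-1).
  rewrite /kreg.
  have -> : \prod_r gpos p q (t r) (ocons 1 w) = \prod_r G (t r) * \prod_r gpos p q (t r) w.
    rewrite -big_split; apply: eq_bigr => r _; rewrite /gpos big_ord_recl ocons0 mulr1 /=.
    by congr (_ * _); apply: eq_bigr => i _; rewrite oconsS.
  have -> : \prod_r gneg p q (u r) (ocons 1 w) = \prod_r G (u r) * \prod_r gneg p q (u r) w.
    rewrite -big_split; apply: eq_bigr => r _; rewrite /gneg big_ord_recl ocons0 divr1 /=.
    by congr (_ * _); apply: eq_bigr => i _; rewrite oconsS.
  rewrite big_ord_recl prod_ord_recl_pred /= mul1r.
  rewrite (eq_bigr (fun i => (g (w i)^-1)^-1)) => [|i _]; last by rewrite ocons0 oconsS div1r.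
  rewrite [\prod_(i < n.+1) \prod_(j | j != lift ord0 i) _](eq_bigr (fun i => (g (w i))^-1 *
     \prod_(j | j != i) (g (w i / w j))^-1)) => [|i _]; last first.
    rewrite prod_ord_recl_pred /= ocons0 oconsS divr1; congr (_ * _).
    by apply: eq_big => [j|j _]; rewrite ?li ?oconsS.
  rewrite big_split /= -!prodfV.
  set A := \prod_r G _; set B := \prod_r G _; set C := \prod_r gpos _ _ _ _; set D := \prod_s gneg _ _ _ _.
  set E := \prod_i \prod_(j | _) _.
  move: A B C D E (\prod_i (g (w i))^-1) (\prod_i (g (w i)^-1)^-1) => A B C D E x y; ring.
have a0 : \prod_i g (w i) != 0 by apply/prodf_neq0 => i _; exact: g_unit_neq0.
have b0 : \prod_i g (w i)^-1 != 0.
  by apply/prodf_neq0 => i _; apply: g_unit_neq0; rewrite nmV w1 invr1.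
move: (\prod_r G _ * _) (kreg _ _ _ _ _) (g 1) a0 b0 => A K x.
move: (\prod_i g (w i)) (\prod_i g (w i)^-1) => a b a0 b0.
by field; apply/andP.
Qed.

Lemma vterm_perm (j : 'I_n.+1) (w : 'I_n.+1 -> R[i]) sg : bijective sg ->
  vterm j (fun i => w (sg i)) = vterm (sg j) w.
Proof.
move=> bs; have on (P : pred 'I_n.+1) : {on P, bijective sg}.
  by case: bs => s' h1 h2; exists s' => i _; rewrite ?h1 ?h2.
have ib i : (sg i != sg j) = (i != j) by rewrite (inj_eq (bij_inj bs)).
have -> : vterm (sg j) w = (\prod_(i | i != sg j) (1 - 1 / w i)) *
    (\prod_(i | i != sg j) (1 - w i / w (sg j))) * vanP (fun i => i != j) (fun i => w (sg i)).
  by rewrite /vterm -(vanP_perm bs); congr (_ * _); apply: eq_vanP => i; rewrite ib.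
rewrite /vterm; congr (_ * _ * _).
- by rewrite [RHS](reindex sg (on _)); apply: eq_bigl => i; rewrite ib.
- by rewrite [RHS](reindex sg (on _)); apply: eq_bigl => i; rewrite ib.
Qed.

(** Interpolation at s = 1: symmetrizing the slice restores the full Vandermonde factor. *)
Lemma vterm_sum (w : 'I_n.+1 -> R[i]) : unitv w -> \sum_j vterm j w = vanP predT w.
Proof.
move=> w1; rewrite -[RHS](@vanP_sumV _ _ predT w 1) //; first by exists ord0.
by move=> i; rewrite -nm_gt0 w1.
Qed.

Section Bounded.
Variable M : R.
Hypotheses (M0 : 0 < M) (M1 : M < 1) (pM : nm p <= M) (qM : nm q <= M).
Hypothesis t1 : forall r, 0 < nm (t r) <= M.
Hypothesis u1 : forall s, 0 < nm (u s) <= M.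

Lemma mu_fa_at1 : n.+1%:R * mu (fun w : 'I_n.+1 -> R[i] => fa p q 1 t u (ocons 1 w)) =
  (g 1 * g 1 * (\prod_r G (t r) * \prod_s G (u s))) * mu (fun w : 'I_n.+1 -> R[i] => kern p q t u w).
Proof.
have one_lam (i : 'I_n.+1) (w : R[i]) : nm (w - 1) < 1 ->
    dif ((fun (_ : 'I_n.+1) _ => 1 : R[i]) i) w /\ (1 : R[i]) != 0.
  by move=> _; split; [exact: dif_cst|exact: oner_neq0].
have cst (b w : R[i]) : nm (w - 1) < 1 -> dif (fun=> b) w by move=> _; exact: dif_cst.
have one_bd (i : 'I_n.+1) : M < nm ((fun (_ : 'I_n.+1) (_ : R[i]) => 1 : R[i]) i 1) < M^-1.
  by rewrite nm1 M1 invf_gt1.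
have hk := @adm_kreg R p q p1 q1 n.+1 k l 1 1 M (fun _ _ => 1) (fun r _ => t r) (fun r _ => u r) ltr01
  one_lam (fun r => cst (t r)) (fun r => cst (u r)) M0 pM qM t1 u1 one_bd.
have hs (i j : 'I_n.+1) := @adm_one_sub R n.+1 1 1 (fun _ _ => 1) ltr01 one_lam i j.
have hv (i j : 'I_n.+1) := @adm_div_var R n.+1 1 1 (fun _ _ => 1) ltr01 one_lam (fun y => 1 - y) (fun=> 1) i.
have one_mul (z : 'I_n.+1 -> R[i]) : (fun i => 1 * z i) = z.
  by apply/funext => i; rewrite mul1r.
have bV j : torusB (fun w : 'I_n.+1 -> R[i] => kreg p q t u w * vterm j w).
  apply: torusBM.
    by move: hk => /adm_torusB; apply: eq_torusB => z; rewrite one_mul.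
  have : adm 1 (fun (_ : R[i]) (w : 'I_n.+1 -> R[i]) => vterm j (fun i => 1 * w i)).
    apply: admM; first apply: admM; apply: adm_prod => i _.
    - apply: (hv i i) => //; rewrite divr1; apply: annular_punctured; first exact: oner_neq0.
      by move=> y _; apply: difB; [exact: dif_cst|exact: dif_id].
    - exact: hs.
    by apply: adm_prod => i' _; exact: hs.
  by move=> /adm_torusB; apply: eq_torusB => z; rewrite one_mul.
have -> : mu (fun w : 'I_n.+1 -> R[i] => kern p q t u w) =
    mu (fun w => \sum_j (kreg p q t u w * vterm j w)).
  by apply: eq_mu => w [w1 _]; rewrite kern_kreg // -mulr_sumr vterm_sum.
rewrite mu_sum //.
have e j : mu (fun w => kreg p q t u w * vterm j w) = mu (fun w => kreg p q t u w * vterm ord0 w).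
  pose sg := tperm ord0 j; have bs : bijective sg by exact: injF_bij (@perm_inj _ _).
  rewrite -[RHS](mu_perm _ bs); apply: eq_mu => w _.
  by rewrite (kreg_perm p q t u w bs) (vterm_perm _ _ bs) tpermL.
have -> : \sum_j mu (fun w => kreg p q t u w * vterm j w) =
    n.+1%:R * mu (fun w => kreg p q t u w * vterm ord0 w).
  by rewrite (eq_bigr _ (fun j _ => e j)) sumr_const card_ord mulr_natl.
rewrite mulrCA; congr (_ * _); rewrite -muZ //; apply: eq_mu => w [w1 _]; exact: fa_at1.
Qed.
End Bounded.
End AtOne.

Section GGLimit.
Variables (m : nat) (d : R) (t u : 'I_m.+2 -> R[i] -> R[i]).
Hypothesis d0 : 0 < d.
Hypothesis td : forall r w, nm (w - 1) < d -> dif (t r) w.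
Hypothesis ud : forall r w, nm (w - 1) < d -> dif (u r) w.
Hypothesis h1 : inD (p * q) (t^~ 1) (u^~ 1).
Variable x : nat -> R[i].
Hypothesis xl : tends x 1.
Hypothesis x0 : forall k, x k != 0.
Hypothesis x1 : forall k, nm (x k) < 1.

Let t1 r : 0 < nm (t r 1) < 1. Proof. by case: h1. Qed.
Let u1 r : 0 < nm (u r 1) < 1. Proof. by case: h1. Qed.
Let cc : nm ((1 : R[i]) - 1) < d. Proof. by rewrite subrr nm0. Qed.
Let dt r : dif (t r) 1. Proof. exact: td. Qed.
Let du r : dif (u r) 1. Proof. exact: ud. Qed.
Let tn r : t r 1 != 0. Proof. by rewrite -nm_gt0; case/andP: (t1 r). Qed.
Let un r : u r 1 != 0. Proof. by rewrite -nm_gt0; case/andP: (u1 r). Qed.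
Let dT : dif (fun w => \prod_r t r w) 1. Proof. by apply: dif_prod => r _; exact: dt. Qed.
Let dU : dif (fun w => \prod_r u r w) 1. Proof. by apply: dif_prod => r _; exact: du. Qed.

Let dG (f : R[i] -> R[i]) : dif f 1 -> 0 < nm (f 1) < 1 -> dif (fun w => G (f w)) 1.
Proof. by move=> df f1; exact: (dif_comp df (egamma_dif p1 q1 f1)). Qed.

Let dxM (f : R[i] -> R[i]) : dif f 1 -> dif (fun w => w * f w) 1.
Proof. by move=> df; apply: difM => //; exact: dif_id. Qed.

Lemma gg_cons_pair s (v w : 'I_m.+2 -> R[i]) : gg p q (ocons s v : 'I_m.+3 -> R[i]) (ocons s w) =
  G (s * s) * ((\prod_r G (s * w r)) * (\prod_r G (s * v r)) * (\prod_r \prod_l G (v r * w l)) *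
   (G (s * (\prod_r w r) / s) * G (s * (\prod_r v r) / s)) *
   (\prod_r (G (s * (\prod_l w l) / w r) * G (s * (\prod_l v l) / v r)))).
Proof.
rewrite /gg !(big_ord_recl m.+2) !ocons0.
have e (f : 'I_m.+2 -> R[i]) : \prod_(i < m.+2) ocons s f (lift ord0 i) = \prod_i f i.
  by apply: eq_bigr => i _; rewrite oconsS.
have e1 : \prod_(i < m.+2) G (s * ocons s w (lift ord0 i)) = \prod_r G (s * w r).
  by apply: eq_bigr => i _; rewrite oconsS.
have e2 : \prod_(i < m.+2) \prod_(l < m.+3) G (ocons s v (lift ord0 i) * ocons s w l) =
    (\prod_r G (s * v r)) * (\prod_r \prod_l G (v r * w l)).
  rewrite -big_split; apply: eq_bigr => i _; rewrite big_ord_recl ocons0 oconsS [v i * s]mulrC /=.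
  congr (_ * _); apply: eq_bigr => l _; rewrite oconsS //.
rewrite e1 e2 !e.
have e3 : \prod_(i < m.+2) (G (s * (\prod_l w l) / ocons s w (lift ord0 i)) *
     G (s * (\prod_l v l) / ocons s v (lift ord0 i))) =
   \prod_r (G (s * (\prod_l w l) / w r) * G (s * (\prod_l v l) / v r)).
  by apply: eq_bigr => i _; rewrite !oconsS.
rewrite e3 -!mulrA; congr (_ * _); congr (_ * _); congr (_ * _); congr (_ * _).
Qed.

(** Only the factor at x^2 is singular, and 1 - x^2 removes its pole. The gamma values at the
    products of the u_r and of the t_r, absent from the right-hand side of lower rank, cancel by
    reflection. *)
Lemma gg_limit : tends (fun k => (1 - x k ^+ 2) *
    gg p q (ocons (x k) (t^~ (x k)) : 'I_m.+3 -> R[i]) (ocons (x k) (u^~ (x k))))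
  (g 1 * (\prod_r G (t r 1) * \prod_s G (u s 1)) * gg p q (t^~ 1) (u^~ 1)).
Proof.
pose f w := g (w * w) * ((\prod_r G (w * u r w)) * (\prod_r G (w * t r w)) *
   (\prod_r \prod_l G (t r w * u l w)) *
   (G (\prod_r u r w) * G (\prod_r t r w)) *
   (\prod_r (G (w * (\prod_l u l w) / u r w) * G (w * (\prod_l t l w) / t r w)))).
have T1 (v : 'I_m.+2 -> R[i]) : (forall r, 0 < nm (v r) < 1) -> 0 < nm (\prod_r v r) < 1.
  move=> v1; apply/andP; split.
    by rewrite nm_gt0; apply/prodf_neq0 => r _; rewrite -nm_gt0; case/andP: (v1 r).
  by apply: (nm_prod_lt1 (i := ord0)) => // r _; case/andP: (v1 r).
have tT := T1 _ t1; have uT := T1 _ u1.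
have df : dif f 1.
  apply: difM.
    apply: (dif_comp (h := g)); first by apply: difM; exact: dif_id.
    by apply: gamma_reg_dif; rewrite ?mulr1 ?nm1 ?mulr1 // oner_neq0.
  apply: difM; first apply: difM; first apply: difM; first apply: difM.
  - by apply: dif_prod => r _; apply: dG; [exact: dxM|rewrite mul1r].
  - by apply: dif_prod => r _; apply: dG; [exact: dxM|rewrite mul1r].
  - apply: dif_prod => r _; apply: dif_prod => l _; apply: dG; first exact: difM.
    by have := inD_tu h1 r l; move=> /andP[_ ->]; rewrite nm_gt0 mulf_neq0.
  - by apply: difM; apply: dG.
  apply: dif_prod => r _; apply: difM; apply: dG.
  - by apply: dif_div => //; exact: dxM.
  - by rewrite mul1r; have /andP[h ->] := inD_restu h1 r; rewrite (le_lt_trans _ h) ?nm_ge0.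
  - by apply: dif_div => //; exact: dxM.
  - by rewrite mul1r; have /andP[h ->] := inD_restt h1 r; rewrite (le_lt_trans _ h) ?nm_ge0.
have lim := dif_tends df xl.
have -> : g 1 * (\prod_r G (t r 1) * \prod_s G (u s 1)) * gg p q (t^~ 1) (u^~ 1) = f 1.
  have hp : G (\prod_r u r 1) * G (\prod_r t r 1) = 1.
    case: (h1) => _ _ h; have U0 : \prod_r u r 1 != 0 by rewrite -nm_gt0; case/andP: uT.
    have -> : \prod_r t r 1 = p * q / \prod_r u r 1 by rewrite -h mulfK.
    apply: egamma_refl => //; case/andP: (uT) => _ ->; rewrite andbT -h nmM gtr_pMl ?nm_gt0 //.
    by case/andP: tT.
  rewrite /f hp !mulr1 /gg.
  have e (v : 'I_m.+2 -> R[i]) : \prod_r G (1 * v r) = \prod_r G (v r).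
    by apply: eq_bigr => r _; rewrite mul1r.
  rewrite (e (u^~ 1)) (e (t^~ 1)) !mul1r; move: (g 1) => g1.
  by rewrite -!mulrA; congr (_ * _); rewrite mulrCA.
apply: eq_tends lim => k; rewrite gg_cons_pair /f (egamma_reg p1 q1 (x k * x k)).
have nx := x1 k; have x0' := x0 k.
have c4 : 1 - x k * x k != 0.
  rewrite subr_eq0; apply/eqP => h; have := congr1 (@nm R) h; rewrite nm1 nmM => e.
  by have := mulr_ilt1 (nm_ge0 _) (nm_ge0 _) nx nx; rewrite -e ltxx.
rewrite ![x k * _ / x k]mulrAC !divff // !mul1r expr2.
have H (a b Z : R[i]) : a != 0 -> b * Z = a * (b / a * Z) by move=> ?; field.
exact: H.
Qed.
End GGLimit.

Lemma shrinking_sequence (d : R) : 0 < d -> d <= 1 -> exists sq : nat -> R,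
  (forall m, 1 - d < sq m < 1) /\ tends (fun m => (sq m)%:C%C) 1.
Proof.
move=> d0 d1; exists (fun m => 1 - d * (1 / 2) ^+ m.+1).
have h0 m : 0 < (1 / 2 : R) ^+ m.+1 by rewrite exprn_gt0 //; lra.
have h1 m : (1 / 2 : R) ^+ m.+1 < 1 by apply: exprn_ilt1 => //; lra.
split=> [m|].
  have := h0 m; have := h1 m; move: (_ ^+ _) => x; nra.
move=> e e0; have [|N hN] := @pow_small R (1 / 2) e _ e0; first lra.
exists N => m mN; have := hN m.+1 (leqW mN).
move=> h; apply: le_lt_trans h.
have -> : (1 - d * (1 / 2) ^+ m.+1)%:C%C - 1 = (- (d * (1 / 2) ^+ m.+1))%:C%C :> R[i].
  by rewrite rmorphB rmorph1 rmorphN /= addrAC subrr add0r.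
by rewrite nm_real normrN normrM !ger0_norm ?(ltW d0) ?(ltW (h0 _)) // ler_piMl // ltW.
Qed.

(** By [cratio_indep] the quotient is the same along a family that adjoins t_0 = u_0 = s to t' and
    u'; letting s tend to 1 evaluates it. *)
Lemma cratio_drop m (t u : 'I_m.+3 -> R[i]) (t' u' : 'I_m.+2 -> R[i]) :
  inD (p * q) t u -> inD (p * q) t' u' -> \prod_r t r = \prod_r t' r ->
  cratio p q t u = m.+2%:R * g 1 * cratio p q t' u'.
Proof.
move=> h h' e; have [t1 u1 hp] := h'.
have [N /andP[N0 N1] [[hNp hNq] hN]] : exists2 N : R, 0 < N < 1 &
    (nm p <= N /\ nm q <= N) /\ forall r, nm (t' r) <= N /\ nm (u' r) <= N.
  have [|N1 /andP[_ N11] hN1] := @finite_bound R _ (fun r => nm (t' r)).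
    by move=> r; case/andP: (t1 r).
  have [|N2 /andP[_ N21] hN2] := @finite_bound R _ (fun r => nm (u' r)).
    by move=> r; case/andP: (u1 r).
  exists (Order.max (Order.max N1 N2) (Order.max (nm p) (nm q))).
    by apply/andP; split; [rewrite !lt_max !nm_gt0 p0 !orbT|rewrite !gt_max p1 q1 N11 N21].
  split; first by rewrite !le_max !lexx !orbT.
  by move=> r; rewrite !le_max hN1 hN2 !orbT.
(* Room between N and 1: for |w| > N / M, division by w takes moduli up to N to moduli up to M. *)
pose M := (1 + N) / 2.
have M0 : 0 < M by rewrite /M; lra.
have M1 : M < 1 by rewrite /M; lra.
have NM : N < M by rewrite /M; lra.
pose d := Order.min (1 - N / M) (1 - M).
have d0 : 0 < d by rewrite lt_min !subr_gt0 M1 ltr_pdivrMr // mul1r NM.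
have dN : d <= 1 - N / M by rewrite ge_min lexx.
have dM : d <= 1 - M by rewrite ge_min lexx orbT.
have d1 : d <= 1 by move: dM M0; lra.
have [sq [sq1 sql]] := shrinking_sequence d0 d1.
have near w : nm (w - 1) < d -> N / M < nm w.
  by move=> hw; have := nm_sub 1 (1 - w); rewrite subKr nm1 [nm (1 - w)]nmBC; move: dN hw; lra.
have near0 w : nm (w - 1) < d -> w != 0.
  by move=> /near; rewrite -nm_gt0; apply: lt_trans; rewrite divr_gt0.
(* Dividing the first parameter by w compensates for the adjoined parameter w, so both products stay
   fixed. *)
pose fam (v : 'I_m.+2 -> R[i]) r w := if r == ord0 then v r / w else v r.
have fam1 v : (fam v)^~ 1 = v by apply/funext => r; rewrite /fam divr1; case: ifP.
have fd v r w : nm (w - 1) < d -> dif (fam v r) w.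
  move=> hw; rewrite /fam; case: (r == ord0); last exact: dif_cst.
  by apply: dif_div; [exact: near0|exact: dif_cst|exact: dif_id].
have fM v r w : (forall r, 0 < nm (v r) < 1) -> (forall r, nm (v r) <= N) -> nm (w - 1) < d ->
    0 < nm (fam v r w) <= M.
  move=> v1 vN hw; have /andP[v0 _] := v1 r; rewrite /fam; case: (r == ord0); last first.
    by rewrite v0 (le_trans (vN r)) // ltW.
  have w0 : 0 < nm w by rewrite nm_gt0 near0.
  rewrite nmM nmV divr_gt0 //= ler_pdivrMr // (le_trans (vN r)) //.
  by rewrite mulrC -ler_pdivrMr // ltW // near.
have t1M r w := fM t' r w t1 (fun r => (hN r).1).
have u1M r w := fM u' r w u1 (fun r => (hN r).2).
have sM k : M < sq k < 1 by have /andP[h1 ->] := sq1 k; rewrite andbT; move: dM h1; lra.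
have sd k : nm ((sq k)%:C%C - 1) < d.
  rewrite nmBC -[1]/(1%:C%C) -rmorphB nm_real.
  by have /andP[h1 h2] := sq1 k; rewrite gtr0_norm; [move: h1; lra|rewrite subr_gt0].
have s0 k : 0 < sq k by case/andP: (sM k) => hh _; exact: lt_trans hh.
have ns k : nm (sq k)%:C%C = sq k by rewrite nm_real gtr0_norm.
have prodf v k : (sq k)%:C%C * \prod_r fam v r (sq k)%:C%C = \prod_r v r.
  rewrite !big_ord_recl /fam /= mulrA [_ * (_ / _)]mulrC divfK //; last by rewrite -nm_gt0 ns.
have inDk k : inD (p * q) (ocons (sq k)%:C%C (fun r => fam t' r (sq k)%:C%C) : 'I_m.+3 -> R[i])
    (ocons (sq k)%:C%C (fun r => fam u' r (sq k)%:C%C)).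
  have sk : 0 < nm ((sq k)%:C%C : R[i]) < 1 by rewrite ns s0; case/andP: (sM k).
  split.
  - move=> r; case: (unliftP ord0 r) => [j|] ->; rewrite ?oconsS ?ocons0 //.
    by have /andP[-> h2] := t1M j _ (sd k); rewrite (le_lt_trans h2).
  - move=> r; case: (unliftP ord0 r) => [j|] ->; rewrite ?oconsS ?ocons0 //.
    by have /andP[-> h2] := u1M j _ (sd k); rewrite (le_lt_trans h2).
  rewrite -hp big_ord_recl ocons0 [X in _ * X]big_ord_recl ocons0; congr (_ * _).
    by rewrite -[RHS](prodf t' k); congr (_ * _); apply: eq_bigr => r _; rewrite oconsS.
  by rewrite -[RHS](prodf u' k); congr (_ * _); apply: eq_bigr => r _; rewrite oconsS.
have ck k : cratio p q (ocons (sq k)%:C%C (fun r => fam t' r (sq k)%:C%C) : 'I_m.+3 -> R[i])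
    (ocons (sq k)%:C%C (fun r => fam u' r (sq k)%:C%C)) = cratio p q t u.
  apply: cratio_indep => //.
  rewrite e big_ord_recl ocons0 -[RHS](prodf t' k); congr (_ * _).
  by apply: eq_bigr => r _; rewrite oconsS.
have x0 k : (sq k)%:C%C != 0 :> R[i] by rewrite -nm_gt0 ns.
have x1 k : nm ((sq k)%:C%C : R[i]) < 1 by rewrite ns; case/andP: (sM k).
have h1 : inD (p * q) ((fam t')^~ 1) ((fam u')^~ 1) by rewrite !fam1.
have limG := gg_limit d0 (fd t') (fd u') h1 sql x0 x1.
have limM := residue_limit p1 q1 m M0 M1 (le_trans hNp (ltW NM)) (le_trans hNq (ltW NM)) d0
  (fd t') (fd u') t1M u1M sM sd sql.
have limC := tendsZ (cratio p q t u) limG.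
(* Both sides are limits of (1 - s^2) times the integral along the family, once through the constant
   quotient and once through the residue. *)
have fin : cratio p q t u * (g 1 * (\prod_r G (t' r) * \prod_s G (u' s)) * gg p q t' u') =
    (m.+2 * m.+1)%:R * mu (fun w : 'I_m.+1 -> R[i] => fa p q 1 t' u' (ocons 1 w)).
  have et : (fun r => fam t' r 1) = t' := fam1 t'.
  have eu : (fun r => fam u' r 1) = u' := fam1 u'.
  move: limC limM; rewrite et eu => limC; apply: tends_unique.
  rewrite (eq_bigr (fun r => G (fam t' r 1))) => [|r _]; last by rewrite -{1}et.
  rewrite [\prod_s G (u' s)](eq_bigr (fun r => G (fam u' r 1))) => [|r _]; last by rewrite -{1}eu.
  apply: eq_tends limC => k; rewrite -(ck k) /cratio mulrCA; congr (_ * _).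
  by rewrite divfK //; exact: (gg_neq0 p1 q1 (inDk k)).
have t'M r : 0 < nm (t' r) <= M by have /andP[-> _] := t1 r; rewrite (le_trans (hN r).1) // ltW.
have u'M r : 0 < nm (u' r) <= M by have /andP[-> _] := u1 r; rewrite (le_trans (hN r).2) // ltW.
have fa1 := mu_fa_at1 m M0 M1 (le_trans hNp (ltW NM)) (le_trans hNq (ltW NM)) t'M u'M.
have gN := gg_neq0 p1 q1 h'.
have g1N : g 1 != 0 by apply: g_unit_neq0; exact: nm1.
have Gn (v v' : 'I_m.+2 -> R[i]) : inD (p * q) v v' -> \prod_r G (v r) != 0.
  move=> [v1 v1' hv]; apply/prodf_neq0 => r _; apply: egamma_neq0 => //.
  have /andP[vr0 ->] := v1 r; rewrite andbT -hv (bigD1 r) //= -mulrA nmM gtr_pMr //.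
  rewrite nmM mulrC; apply: (@le_lt_trans _ _ (nm (\prod_s v' s))).
    rewrite ler_piMr ?nm_ge0 // nm_prod; apply: prodr_ile1 => i _.
    by rewrite nm_ge0 /= ltW //; case/andP: (v1 i).
  by apply: (nm_prod_lt1 (i := ord0)) => // s _; case/andP: (v1' s).
have A1 := Gn _ _ h'; have A2 := Gn _ _ (inD_swap h').
rewrite natrM -[X in _ = X]mulrA fa1 in fin; move: fin; rewrite /cratio.
have H (c k x A B gg' mm : R[i]) : x != 0 -> A != 0 -> B != 0 -> gg' != 0 ->
    c * (x * (A * B) * gg') = k * (x * x * (A * B) * mm) -> c = k * x * (mm / gg').
  move=> x0' A0 B0 g0 hh; apply: (mulIf (mulf_neq0 (mulf_neq0 x0' (mulf_neq0 A0 B0)) g0)).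
  by rewrite hh; field.
exact: H.
Qed.

(** The torus is the single point z_0 = 1. By balancing, the four values at t_r u_s form two
    reflection pairs and cancel from [gg]. *)
Lemma cratio_base (t u : 'I_2 -> R[i]) : inD (p * q) t u -> cratio p q t u = 1.
Proof.
move=> h; have gN := gg_neq0 p1 q1 h; have [t1 u1 hp] := h.
have tn r : t r != 0 by rewrite -nm_gt0; case/andP: (t1 r).
have un r : u r != 0 by rewrite -nm_gt0; case/andP: (u1 r).
suff e : mu (fun z : 'I_1 -> R[i] => kern p q t u z) = gg p q t u by rewrite /cratio e divff.
have bc := @torusB_cst R 0 (gg p q t u).
have -> : mu (fun z : 'I_1 -> R[i] => kern p q t u z) = mu (fun _ : 'I_1 -> R[i] => gg p q t u).
  apply: eq_mu => z [_]; rewrite big_ord1 => z0.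
  rewrite /kern /gvan /gpos /gneg !big_ord_recl !big_ord0.
  rewrite big_pred0; last by move=> i; rewrite ord1.
  rewrite z0 !mulr1 !divr1 /gg !big_ord_recl !big_ord0 !mulr1.
  set a := t ord0; set b := t (lift ord0 ord0); set c := u ord0; set d := u (lift ord0 ord0).
  have tu x y x' y' : x * y * (x' * y') = p * q -> 0 < nm x < 1 -> 0 < nm y < 1 -> 0 < nm x' < 1 ->
     0 < nm y' < 1 -> G (x * x') * G (y * y') = 1.
    move=> hh /andP[x0 x1] /andP[y0 y1] /andP[x'0 x'1] /andP[y'0 y'1].
    have -> : y * y' = p * q / (x * x').
      rewrite -hh; field; by rewrite -!nm_gt0 x0 x'0.
    apply: egamma_refl => //; rewrite -hh !nmM.
    apply/andP; split; last by rewrite mulr_ilt1 ?nm_ge0.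
    have -> : nm x * nm y * (nm x' * nm y') = nm x * nm x' * (nm y * nm y') by ring.
    by rewrite gtr_pMr ?mulr_gt0 // mulr_ilt1 ?nm_ge0.
  have hp' : a * b * (c * d) = p * q by rewrite -hp !big_ord_recl !big_ord0 !mulr1.
  have e1 := tu _ _ _ _ hp' (t1 _) (t1 _) (u1 _) (u1 _).
  have hp2 : a * b * (d * c) = p * q by rewrite [d * c]mulrC.
  have e2 := tu _ _ _ _ hp2 (t1 _) (t1 _) (u1 _) (u1 _).
  have -> : c * d / c = d by rewrite mulrAC divff ?mul1r // un.
  have -> : c * d / d = c by rewrite mulfK // un.
  have -> : a * b / a = b by rewrite mulrAC divff ?mul1r // tn.
  have -> : a * b / b = a by rewrite mulfK // tn.
  move: e1 e2; move: (G (a * c)) (G (b * d)) (G (a * d)) (G (b * c)) => A B C D e1 e2.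
  have -> : A * C * (D * B) = 1.
    by rewrite -[RHS]mulr1 -{1}e1 -e2; ring.
  by rewrite mul1r; ring.
apply: mu_unique => //; apply: eq_tends (tends_cst _) => m; by rewrite tmean_cst.
Qed.

(** Merging the first two parameters preserves the products and lowers the rank, which supplies the
    smaller system for [cratio_drop]. *)
Lemma cratio_value m (t u : 'I_m.+2 -> R[i]) : inD (p * q) t u ->
  cratio p q t u = (m.+1)`!%:R * g 1 ^+ m.
Proof.
elim: m t u => [|m IH] t u h; first by rewrite cratio_base // expr0 mulr1.
pose merge (v : 'I_m.+3 -> R[i]) : 'I_m.+2 -> R[i] :=
  ocons (v ord0 * v (lift ord0 ord0)) (fun r => v (lift ord0 (lift ord0 r))).
have mp v : \prod_r merge v r = \prod_r v r.
  rewrite /merge big_ord_recl ocons0 [RHS]big_ord_recl [X in _ = _ * X]big_ord_recl mulrA.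
  by congr (_ * _); apply: eq_bigr => r _; rewrite oconsS.
have h' : inD (p * q) (merge t) (merge u).
  case: h => t1 u1 hp.
  have m1 v : (forall r, 0 < nm (v r) < 1) -> forall r, 0 < nm (merge v r) < 1.
    move=> v1 r; rewrite /merge; case: (unliftP ord0 r) => [j|] ->; rewrite ?oconsS ?ocons0 //.
    have /andP[a0 a1] := v1 ord0; have /andP[b0 b1] := v1 (lift ord0 ord0).
    by rewrite nmM mulr_gt0 //= mulr_ilt1 // ltW.
  by split; [exact: m1|exact: m1|rewrite !mp].
rewrite (cratio_drop h h'); last by rewrite mp.
by rewrite IH // [(m.+2)`!]factS natrM exprS; move: (g 1) => x; ring.
Qed.

End Value.

(** * Meromorphic continuation *)

Section TorusValue.
Variable R : realType.
Variables p q : R[i].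
Hypotheses (p1 : nm p < 1) (p0 : p != 0) (q1 : nm q < 1) (q0 : q != 0).
Local Notation G := (egamma p q).

Lemma prod_offdiag n (f : 'I_n -> 'I_n -> R[i]) :
  \prod_i \prod_(j | j != i) f i j = \prod_(i < n) \prod_(j < n | (i < j)%N) (f i j * f j i).
Proof.
under [RHS]eq_bigr do rewrite big_split /=.
rewrite big_split /= [X in _ * X](exchange_big_dep predT) //= -big_split /=.
apply: eq_bigr => i _; rewrite (bigID (fun j : 'I_n => (i < j)%N)) /=; congr (_ * _).
  by apply: eq_bigl => j; rewrite -(inj_eq val_inj) /=; case: ltngtP.
by apply: eq_bigl => j; rewrite -(inj_eq val_inj) /=; case: ltngtP.
Qed.

Lemma An_integrand_kern n (x : params R n) (s : seq R[i]) :
  An_integrand p q x s = kern p q (tpar x) (upar x) (fun i : 'I_n.+1 => s`_i).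
Proof.
rewrite /An_integrand /kern; congr (_ * _).
  rewrite (eq_bigr (fun i : 'I_n.+1 => (\prod_r G (tpar x r * s`_i)) * \prod_r G (upar x r / s`_i))).
    by rewrite big_split /= exchange_big [X in _ * X]exchange_big.
  by move=> i _; rewrite big_split.
rewrite /gvan (prod_offdiag (fun i j : 'I_n.+1 => (G (s`_i / s`_j))^-1)) -prodfV.
apply: eq_bigr => i _; rewrite -prodfV; apply: eq_bigr => j _; by rewrite invfM.
Qed.

(** The constant of [cratio_value] is the inverse of the normalization of the integral. *)
Lemma An_torus_value n (x : params R n) : balanced p q x -> torus_range x ->
  An_torus_integral p q x = gg p q (tpar x) (upar x).
Proof.
move=> [t0 u0 hp] hx.
have D : inD (p * q) (tpar x) (upar x).
  split=> [r|r|]; last by rewrite -big_split.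
  - have [_] := hx r; rewrite -normfV -[1]normr1 nm_lt nm1 nmV nm_gt0 t0 /=.
    by rewrite invf_gt1 // nm_gt0.
  - by have [+ _] := hx r; rewrite -[1]normr1 nm_lt nm1 nm_gt0 u0.
have [t1 u1 _] := D; have gN := gg_neq0 p1 q1 D.
rewrite /An_torus_integral.
have -> : (fun zs => An_integrand p q x ((\prod_(w <- zs) w)^-1 :: zs)) =
    (fun zs => kern p q (tpar x) (upar x) (fun i : 'I_n.+1 => ((\prod_(w <- zs) w)^-1 :: zs)`_i)).
  by apply/funext => zs; rewrite An_integrand_kern.
rewrite (mu_torus_integral (torusB_kern p1 q1 n t1 u1)).
have := cratio_value p1 p0 q1 q0 D; rewrite /cratio => /(canRL (divfK gN)) ->.
rewrite gamma_reg1 // exprVn exprMn_comm; last exact: mulrC.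
have Q0 : qpoch p ^+ n * qpoch q ^+ n != 0 by rewrite mulf_neq0 // expf_neq0 // qpoch_neq0.
have F0 : (n.+1)`!%:R != 0 :> R[i] by rewrite pnatr_eq0 -lt0n fact_gt0.
move: (qpoch p ^+ n * qpoch q ^+ n) ((n.+1)`!%:R : R[i]) Q0 F0 => a b a0 b0.
by field; rewrite a0 b0.
Qed.
End TorusValue.

Lemma finite_radius (R : realType) (I : finType) (P : I -> R -> Prop) :
  (forall r, exists2 e : R, 0 < e & P r e) ->
  (forall r (e e' : R), e' <= e -> P r e -> P r e') ->
  exists2 e : R, 0 < e & forall r, P r e.
Proof.
move=> h mono.
have [e e0 he] : exists2 e : R, 0 < e & forall r, r \in enum I -> P r e.
  elim: (enum I) => [|r s [e e0 he]]; first by exists 1.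
  have [e' e0' he'] := h r.
  exists (Order.min e e'); first by rewrite lt_min e0.
  move=> r'; rewrite inE => /orP[/eqP->|/he h'].
    by apply: mono he'; rewrite ge_min lexx orbT.
  by apply: mono h'; rewrite ge_min lexx.
by exists e => // r; apply: he; rewrite mem_enum.
Qed.

(** * Geometry of the parameter space *)

Section Params.
Variables (R : realType) (n : nat).
Local Notation V := (params R n).
Implicit Types x y z : V.

(** The product topology through coordinatewise distances in [R]. *)
Definition pnear (d : R) x y :=
  (forall r, nm (tpar y r - tpar x r) < d) /\ (forall r, nm (upar y r - upar x r) < d).

Lemma nbhs_pnear x (A : set V) : nbhs x A <-> exists2 d : R, 0 < d & forall y, pnear d x y -> A y.
Proof.
split=> [/nbhs_ballP[e /= /posc[d d0 ->] h]|[d d0 h]].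
  exists d => // y [h1 h2]; apply: h; split; split=> [|i j]; rewrite ?ltcR //.
    by rewrite -ball_normE /ball_ /= ord1 nmE ltcR nmBC; exact: h1.
  by rewrite -ball_normE /ball_ /= ord1 nmE ltcR nmBC; exact: h2.
apply/nbhs_ballP; exists d%:C%C; first by rewrite /= ltcR.
move=> y [[_ h1] [_ h2]]; apply: h; split=> r.
  have := h1 ord0 r; by rewrite -ball_normE /ball_ /= nmE ltcR nmBC.
have := h2 ord0 r; by rewrite -ball_normE /ball_ /= nmE ltcR nmBC.
Qed.

Lemma dif_tpar r x : differentiable (fun y => tpar y r : R[i]^o) x.
Proof.
apply: (@differentiable_comp _ _ _ _ (fun y : V => y.1) (fun M : 'rV[R[i]^o]_n.+2 => M ord0 r : R[i]^o)).
  have [f fE] : exists f : {linear V -> 'rV[R[i]^o]_n.+2}, (f : V -> _) = fst.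
    have fl : linear (fst : V -> 'rV[R[i]^o]_n.+2) by move=> a u v.
    by pose fM := GRing.isLinear.Build _ _ _ _ _ fl; pose f : {linear V -> 'rV[R[i]^o]_n.+2} := HB.pack (fst : V -> 'rV[R[i]^o]_n.+2) fM; exists f.
  rewrite -fE; apply: linear_differentiable; rewrite fE => y; exact: cvg_fst.
exact: differentiable_coord.
Qed.

Lemma dif_upar r x : differentiable (fun y => upar y r : R[i]^o) x.
Proof.
apply: (@differentiable_comp _ _ _ _ (fun y : V => y.2) (fun M : 'rV[R[i]^o]_n.+2 => M ord0 r : R[i]^o)).
  have [f fE] : exists f : {linear V -> 'rV[R[i]^o]_n.+2}, (f : V -> _) = snd.
    have fl : linear (snd : V -> 'rV[R[i]^o]_n.+2) by move=> a u v.
    by pose fM := GRing.isLinear.Build _ _ _ _ _ fl; pose f : {linear V -> 'rV[R[i]^o]_n.+2} := HB.pack (snd : V -> 'rV[R[i]^o]_n.+2) fM; exists f.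
  rewrite -fE; apply: linear_differentiable; rewrite fE => y; exact: cvg_snd.
exact: differentiable_coord.
Qed.

Lemma pnear_refl d x : 0 < d -> pnear d x x.
Proof. by move=> d0; split=> r; rewrite subrr nm0. Qed.

Lemma pnear_le d e x y : d <= e -> pnear d x y -> pnear e x y.
Proof. by move=> de [h1 h2]; split=> r; [have := h1 r|have := h2 r] => h; apply: lt_le_trans de. Qed.

Lemma pnear_shift d x y : pnear d x y -> exists2 e : R, 0 < e & forall z, pnear e y z -> pnear d x z.
Proof.
move=> [h1 h2].
have H (f : 'I_n.+2 -> R) : (forall r, f r < d) -> exists2 e : R, 0 < e & forall r, f r + e <= d.
  move=> fd; apply: finite_radius => [r|r e e' ee]; last by apply: le_trans; rewrite lerD2l.
  by exists (d - f r); [rewrite subr_gt0 fd|rewrite addrC subrK].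
have [e1 e10 he1] := H _ h1; have [e2 e20 he2] := H _ h2.
exists (Order.min e1 e2); first by rewrite lt_min e10.
move=> z [h3 h4]; split=> r.
  apply: le_lt_trans (nm_dist _ (tpar y r) _) _; apply: lt_le_trans (he1 r).
  by rewrite addrC ltrD2l; apply: lt_le_trans (h3 r) _; rewrite ge_min lexx.
apply: le_lt_trans (nm_dist _ (upar y r) _) _; apply: lt_le_trans (he2 r).
by rewrite addrC ltrD2l; apply: lt_le_trans (h4 r) _; rewrite ge_min lexx orbT.
Qed.

End Params.

Section Connected.
Variables (R : realType) (n : nat) (p q : R[i]).
Hypotheses (p0 : p != 0) (q0 : q != 0).
Local Notation V := (params R n).
Local Notation X := (@balanced R n p q).
Local Notation dif f z := (differentiable (f : R[i]^o -> R[i]^o) (z : R[i]^o)).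
Implicit Types x y z : V.

Definition mkpar (t u : 'I_n.+2 -> R[i]) : V := (\row_r t r, \row_r u r).

Lemma tpar_mk t u r : tpar (mkpar t u) r = t r. Proof. by rewrite /tpar mxE. Qed.
Lemma upar_mk t u r : upar (mkpar t u) r = u r. Proof. by rewrite /upar mxE. Qed.
Lemma par_eta x : mkpar (tpar x) (upar x) = x.
Proof. by case: x => a b; congr (_, _); apply/rowP => r; rewrite mxE. Qed.

(** Logarithms are ambiguous, so that of u_0 is defined from the others by the prescribed sum;
    balancing ensures that it is still a logarithm of u_0. *)
Lemma balanced_logs lam x : cexp lam = p * q -> X x -> exists a b : 'I_n.+2 -> R[i],
  [/\ forall r, cexp (a r) = tpar x r, forall r, cexp (b r) = upar x r &
      \sum_r a r + \sum_r b r = lam].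
Proof.
move=> elam [t0 u0 hp].
have [a ha] := choice (fun r => cexp_onto (t0 r)).
have [b hb] := choice (fun r => cexp_onto (u0 r)).
pose s := \sum_r a r + \sum_(r < n.+1) b (lift ord0 r).
exists a, (fun r => if r == ord0 then lam - s else b r); split=> //.
  move=> r; case: eqP => [->|//].
  rewrite cexpD cexpN elam /s cexpD !cexp_sum (eq_bigr _ (fun r _ => ha r)).
  rewrite (eq_bigr _ (fun r _ => hb (lift ord0 r))) -hp big_split /= (big_ord_recl n.+1 (upar x)).
  have T0 : \prod_r tpar x r != 0 by apply/prodf_neq0.
  have U0 : \prod_(i < n.+1) upar x (lift ord0 i) != 0 by apply/prodf_neq0.
  by move: T0 U0; move: (\prod_r _) (\prod_(i < n.+1) _) (upar x ord0) => A B c ? ?; field; apply/andP.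
rewrite (big_ord_recl n.+1 (fun r => if r == ord0 then _ else _)) /= /s.
by ring.
Qed.

(** The exponential of the segment between logarithms with the same sum stays on the
    hypersurface. *)
Lemma balanced_path x x' : X x -> X x' -> exists g : R -> V, [/\ g 0 = x, g 1 = x', forall s, X (g s) &
  forall s d, 0 < d -> exists2 e : R, 0 < e & forall s', `|s' - s| < e -> pnear d (g s) (g s')].
Proof.
move=> hx hx'; have [lam elam] : exists lam, cexp lam = p * q by apply: cexp_onto; rewrite mulf_neq0.
have [a [b [ha hb hs]]] := balanced_logs elam hx.
have [a' [b' [ha' hb' hs']]] := balanced_logs elam hx'.
pose f (v v' : 'I_n.+2 -> R[i]) (s : R) r := cexp (v r + s%:C%C * (v' r - v r)).
exists (fun s => mkpar (f a a' s) (f b b' s)).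
have f0 v v' : f v v' 0 = (fun r => cexp (v r)) by apply/funext => r; rewrite /f mul0r addr0.
have f1 v v' : f v v' 1 = (fun r => cexp (v' r)) by apply/funext => r; rewrite /f mul1r addrC subrK.
have cont v v' s d : 0 < d -> exists2 e : R, 0 < e & forall r s', `|s' - s| < e ->
    nm (f v v' s' r - f v v' s r) < d.
  move=> d0; apply: finite_radius => [r|r e e' ee h s' /lt_le_trans h']; last by apply: h; exact: h'.
  have /contCP /(_ d d0) [e e0 he] : {for (v r + s%:C%C * (v' r - v r) : R[i]^o), continuous (fun w : R[i]^o => cexp (w : R[i]) : R[i]^o)}.
    by apply: differentiable_continuous; exact: cexp_diff.
  have N0 : 0 < nm (v' r - v r) + 1 by rewrite ltr_wpDl ?nm_ge0.
  exists (e / (nm (v' r - v r) + 1)); first by rewrite divr_gt0.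
  move=> s'; rewrite ltr_pdivlMr // => h; apply: he.
  rewrite addrAC opprD addrA addrN sub0r addrC -mulrBl -rmorphB nmM nm_real.
  by apply: le_lt_trans h; rewrite ler_wpM2l ?normr_ge0 // lerDl.
split=> [|||s d d0].
- rewrite f0 f0 -[RHS]par_eta; congr mkpar; apply/funext => r /=; [exact: ha|exact: hb].
- rewrite f1 f1 -[RHS]par_eta; congr mkpar; apply/funext => r /=; [exact: ha'|exact: hb'].
- move=> s; split=> [r|r|]; rewrite ?tpar_mk ?upar_mk ?cexp_neq0 //.
  rewrite (eq_bigr (fun r => f a a' s r * f b b' s r)) => [|r _]; last by rewrite tpar_mk upar_mk.
  rewrite big_split /= /f -!cexp_sum -cexpD !big_split /= -!mulr_sumr !sumrB -elam; congr cexp.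
  move: hs hs'; move: (\sum_r a r) (\sum_r b r) (\sum_r a' r) (\sum_r b' r) => A B A' B' <- h.
  have -> : A + s%:C%C * (A' - A) + (B + s%:C%C * (B' - B)) = (A + B) + s%:C%C * ((A' + B') - (A + B)) by ring.
  by rewrite h subrr mulr0 addr0.
have [e1 e10 h1] := cont a a' s d d0; have [e2 e20 h2] := cont b b' s d d0.
exists (Order.min e1 e2); first by rewrite lt_min e10.
move=> s'; rewrite lt_min => /andP[k1 k2]; split=> r; rewrite ?tpar_mk ?upar_mk.
  exact: h1.
exact: h2.
Qed.

(** Connectedness as an induction principle: at the supremum of the times when P holds along a path,
    the local hypothesis carries P further. *)
Lemma balanced_propagate (P : V -> Prop) :
  (forall c, X c -> exists2 d : R, 0 < d & forall y z, pnear d c y -> pnear d c z -> X y -> X z -> P y -> P z) ->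
  forall x x', X x -> X x' -> P x -> P x'.
Proof.
move=> loc x x' hx hx' Px; have [g [g0 g1 gX gc]] := balanced_path hx hx'.
pose S := [set s : R | 0 <= s <= 1 /\ P (g s)].
have S0 : S 0 by split; [rewrite lexx ler01|rewrite g0].
have ubS : ubound S 1 by move=> s [/andP[]].
have hS : has_sup S by split; [exists 0|exists 1].
have [d d0 hd] := loc _ (gX (sup S)).
have [e e0 he] := gc (sup S) d d0.
have [s Ss sl] := sup_adherent e0 hS.
have ss := sup_upper_bound hS Ss.
have s1 : sup S <= 1 by apply: ge_sup => //; exists 0.
have s0 : 0 <= sup S by exact: sup_upper_bound hS _ S0.
have cl : pnear d (g (sup S)) (g s) by apply: he; rewrite ltr_norml; apply/andP; split; lra.
pose s' := Order.min 1 (sup S + e / 2).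
have s'1 : s' <= 1 by rewrite ge_min lexx.
have s'e : s' <= sup S + e / 2 by rewrite ge_min lexx orbT.
have s's : sup S <= s' by rewrite le_min s1 lerDl divr_ge0 // ltW.
have Ps' : P (g s').
  apply: (hd (g s)) => //; [|by case: Ss].
  by apply: he; rewrite ltr_norml; apply/andP; split; lra.
have Ss' : S s' by split=> //; apply/andP; split=> //; lra.
have s's' : s' <= sup S := sup_upper_bound hS Ss'.
suff -> : x' = g s' by [].
rewrite -g1; congr g; move: s's'; rewrite /s' /Order.min; case: ifP => // _; lra.
Qed.

Definition nonzero_params : set V := [set x | (forall r, tpar x r != 0) /\ (forall r, upar x r != 0)].

Lemma nonzero_open : open nonzero_params.
Proof.
rewrite openE => x [h1 h2]; apply/nbhs_pnear.
have [e e0 he] : exists2 e : R, 0 < e & forall r, e <= nm (tpar x r) /\ e <= nm (upar x r).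
  apply: finite_radius => [r|r e e' ee [? ?]]; last by split; apply: (le_trans ee).
  exists (Order.min (nm (tpar x r)) (nm (upar x r))); first by rewrite lt_min !nm_gt0 h1 h2.
  by rewrite !ge_min !lexx orbT.
exists e => // y [k1 k2]; split=> r.
  have [h _] := he r; apply: contraTneq (k1 r) => ->; by rewrite sub0r nmN -leNgt.
have [_ h] := he r; apply: contraTneq (k2 r) => ->; by rewrite sub0r nmN -leNgt.
Qed.

Definition uslack x := p * q / ((\prod_r tpar x r) * \prod_(r < n.+1) upar x (lift ord0 r)) - upar x ord0.
Definition udir : V := mkpar (fun=> 0) (fun r => (r == ord0)%:R).

(* The last coordinate can be solved for on the hypersurface; moving along it
   by [uslack] is a retraction onto the hypersurface. *)
Definition retract x : V := x + uslack x *: udir.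

Lemma uslack0 x : X x -> uslack x = 0.
Proof.
move=> [t0 u0 hp]; rewrite /uslack -hp big_split /= (big_ord_recl n.+1 (upar x)).
have T0 : \prod_r tpar x r != 0 by apply/prodf_neq0.
have U0 : \prod_(i < n.+1) upar x (lift ord0 i) != 0 by apply/prodf_neq0.
by move: T0 U0; move: (\prod_r _) (\prod_(i < n.+1) _) (upar x ord0) => A B c ? ?; field; apply/andP.
Qed.

Lemma tparD x y r : tpar (x + y) r = tpar x r + tpar y r. Proof. by rewrite /tpar /= mxE. Qed.
Lemma uparD x y r : upar (x + y) r = upar x r + upar y r. Proof. by rewrite /upar /= mxE. Qed.
Lemma tparZ (a : R[i]) x r : tpar (a *: x) r = a * tpar x r. Proof. by rewrite /tpar /= mxE. Qed.
Lemma uparZ (a : R[i]) x r : upar (a *: x) r = a * upar x r. Proof. by rewrite /upar /= mxE. Qed.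
Lemma tparB x y r : tpar (x - y) r = tpar x r - tpar y r. Proof. by rewrite /tpar /= !mxE. Qed.
Lemma uparB x y r : upar (x - y) r = upar x r - upar y r. Proof. by rewrite /upar /= !mxE. Qed.

Lemma tpar_retract x r : tpar (retract x) r = tpar x r.
Proof. by rewrite /retract tparD tparZ tpar_mk mulr0 addr0. Qed.
Lemma upar_retract x r : upar (retract x) r = upar x r + uslack x * (r == ord0)%:R.
Proof. by rewrite /retract uparD uparZ upar_mk. Qed.

Lemma retract_balanced x : nonzero_params x -> X (retract x).
Proof.
move=> [t0 u0].
have T0 : \prod_r tpar x r != 0 by apply/prodf_neq0.
have U0 : \prod_(i < n.+1) upar x (lift ord0 i) != 0 by apply/prodf_neq0.
have e0 : upar (retract x) ord0 = p * q / ((\prod_r tpar x r) * \prod_(r < n.+1) upar x (lift ord0 r)).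
  by rewrite upar_retract mulr1 /uslack addrC subrK.
have e1 r : upar (retract x) (lift ord0 r) = upar x (lift ord0 r).
  by rewrite upar_retract mulr0 addr0.
split=> [r|r|]; first by rewrite tpar_retract.
  case: (unliftP ord0 r) => [j|] ->; first by rewrite e1.
  by rewrite e0 !mulf_neq0 ?invr_neq0 ?mulf_neq0.
rewrite big_split /= (big_ord_recl n.+1 (upar _)) e0 (eq_bigr _ (fun r _ => e1 r)).
rewrite (eq_bigr _ (fun r _ => tpar_retract x r)).
by move: T0 U0; move: (\prod_r _) (\prod_(i < n.+1) _) => A B ? ?; field; apply/andP.
Qed.

Lemma dif_uslack x : nonzero_params x -> differentiable (uslack : V -> R[i]^o) x.
Proof.
move=> [t0 u0]; apply: difB; last exact: dif_upar.
apply: dif_div; [|exact: dif_cst|].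
  by rewrite mulf_neq0 //; apply/prodf_neq0.
apply: difM; apply: dif_prod => r _; [exact: dif_tpar|exact: dif_upar].
Qed.

Lemma pnear_retract (c : V) (d : R) : X c -> 0 < d -> exists2 d' : R, 0 < d' &
  forall y, pnear d' c y -> nonzero_params y /\ pnear d c (retract y).
Proof.
move=> hc d0; have nzc : nonzero_params c by case: hc.
have [d1 d10 h1] : exists2 d : R, 0 < d & forall y, pnear d c y -> nonzero_params y.
  apply/nbhs_pnear; move: nonzero_open; rewrite openE; exact.
have h2 : nbhs c [set y | nm (uslack y - uslack c) < d / 2].
  have /cvgrPdist_lt h := differentiable_continuous (dif_uslack nzc).
  have d2 : 0 < (d / 2)%:C%C :> R[i] by rewrite ltcR divr_gt0.
  by move: (h _ d2); apply: filterS => y /=; rewrite nmE ltcR nmBC.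
have [d2 d20 h2'] := (nbhs_pnear _ _).1 h2.
exists (Order.min d1 (Order.min d2 (d / 2))); first by rewrite !lt_min d10 d20 divr_gt0.
move=> y hy.
have k1 : pnear d1 c y by apply: pnear_le hy; rewrite ge_min lexx.
have k2 : pnear d2 c y by apply: pnear_le hy; rewrite !ge_min lexx orbT.
have [k3 k4] : pnear (d / 2) c y by apply: pnear_le hy; rewrite !ge_min lexx !orbT.
have := h2' _ k2; rewrite /= (uslack0 hc) subr0 => k5.
split; first exact: h1.
split=> r; first by rewrite tpar_retract; apply: lt_trans (k3 r) _; lra.
rewrite upar_retract addrAC; apply: le_lt_trans (nmD _ _) _.
have -> : d = d / 2 + d / 2 by rewrite -splitr.
apply: ltr_leD (k4 r) _; rewrite nmM; case: (r == ord0); rewrite ?nm1 ?nm0 ?mulr1 ?mulr0; first exact: ltW.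
by rewrite divr_ge0 // ltW.
Qed.

Definition segc y z (s : R[i]) : V := y + s *: (z - y).

Lemma dif_segc y z (s : R[i]) : differentiable (segc y z : R[i]^o -> V) (s : R[i]^o).
Proof.
apply: differentiableD; first exact: differentiable_cst.
by apply: differentiableZl; exact: dif_id.
Qed.

Lemma segc_pnear (c y z : V) (d : R) : 0 < d -> pnear d c y -> pnear d c z -> forall t : R, 0 <= t <= 1 ->
  exists2 e : R, 0 < e & forall s, nm (s - t%:C%C) < e -> pnear d c (segc y z s).
Proof.
move=> d0 [y1 y2] [z1 z2] t /andP[t0 t1].
have conv (a b v : R[i]) : nm (a - v) < d -> nm (b - v) < d -> nm (a + t%:C%C * (b - a) - v) < d.
  move=> ha hb.
  have -> : a + t%:C%C * (b - a) - v = (1 - t)%:C%C * (a - v) + t%:C%C * (b - v).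
    by rewrite rmorphB rmorph1; ring.
  apply: le_lt_trans (nmD _ _) _; rewrite !nmM !nm_real !ger0_norm ?subr_ge0 //.
  move: ha hb; move: (nm (a - v)) (nm (b - v)) => x w ha hb.
  have [t1e|tn] := eqVneq t 1; first by rewrite t1e subrr mul0r add0r mul1r.
  have : 0 < (1 - t) * (d - x) by rewrite mulr_gt0 ?subr_gt0 // lt_neqAle tn.
  have : 0 <= t * (d - w) by rewrite mulr_ge0 // subr_ge0 ltW.
  lra.
have kt : pnear d c (segc y z t%:C%C).
  by split=> r; rewrite /segc ?(tparD, uparD) ?(tparZ, uparZ) ?(tparB, uparB); apply: conv.
have [e e0 he] := pnear_shift kt.
exists (e / (2 * d)); first by rewrite divr_gt0 // mulr_gt0.
have step (a b v s : R[i]) : nm (a - v) < d -> nm (b - v) < d -> nm (s - t%:C%C) < e / (2 * d) ->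
    nm ((a + s * (b - a)) - (a + t%:C%C * (b - a))) < e.
  move=> ha hb; rewrite ltr_pdivlMr ?mulr_gt0 // => hs.
  have -> : (a + s * (b - a)) - (a + t%:C%C * (b - a)) = (s - t%:C%C) * (b - a) by ring.
  rewrite nmM; apply: le_lt_trans hs; rewrite ler_wpM2l ?nm_ge0 //.
  by apply: le_trans (nm_dist _ v _) _; rewrite [nm (v - a)]nmBC; lra.
move=> s hs; apply: he; split=> r; rewrite /segc ?(tparD, uparD) ?(tparZ, uparZ) ?(tparB, uparB).
  exact: step (y1 r) (z1 r) hs.
exact: step (y2 r) (z2 r) hs.
Qed.

(** D is composed with [retract] along the complex line through y and z. This gives a holomorphic
    function of one variable that vanishes near 1, and [identity_segment] yields its value at 0; the
    ends y and z, lying on the hypersurface, are fixed by [retract]. *)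
Lemma local_identity (D : V -> R[i]^o) (W : set V) c : X c -> open W -> W c ->
  (forall x, W x -> differentiable D x) ->
  exists2 d : R, 0 < d & (forall y, pnear d c y -> W y /\ nonzero_params y) /\
    forall y z, pnear d c y -> pnear d c z -> X y -> X z ->
    (exists2 e : R, 0 < e & forall w, X w -> pnear e z w -> D w = 0) -> D y = 0.
Proof.
move=> hc oW Wc dD.
have [d1 d10 h1] : exists2 d : R, 0 < d & forall y, pnear d c y -> W y.
  by apply/nbhs_pnear; move: oW; rewrite openE; exact.
have [d2 d20 h2] := pnear_retract hc d10.
exists (Order.min d1 d2); first by rewrite lt_min d10.
have dd1 : Order.min d1 d2 <= d1 by rewrite ge_min lexx.
have dd2 : Order.min d1 d2 <= d2 by rewrite ge_min lexx orbT.
split=> [y hy|y z hy hz Xy Xz [e e0 he]].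
  by split; [exact/h1/(pnear_le dd1)|case: (h2 y (pnear_le dd2 hy))].
have m0 : 0 < Order.min d1 d2 by rewrite lt_min d10.
have G s : pnear (Order.min d1 d2) c (segc y z s) ->
    differentiable ((fun s => retract (segc y z s)) : R[i]^o -> V) (s : R[i]^o) /\
    W (retract (segc y z s)) /\ X (retract (segc y z s)).
  move=> /(pnear_le dd2) /h2 [nz cl]; split; last by split; [exact: h1|exact: retract_balanced].
  apply: differentiableD; first exact: dif_segc.
  apply: differentiableZl.
  apply: (@differentiable_comp _ _ _ _ (segc y z : R[i]^o -> V) (uslack : V -> R[i]^o)); first exact: dif_segc.
  exact: dif_uslack.
have s0 : segc y z 0 = y by rewrite /segc scale0r addr0.
have s1 : segc y z 1 = z by rewrite /segc scale1r addrC subrK.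
have rX x : X x -> retract x = x by move=> hx; rewrite /retract uslack0 // scale0r addr0.
rewrite -(rX y Xy) -s0.
apply: (@identity_segment R (fun s => D (retract (segc y z s)))).
  move=> t t01; have [e' e0' he'] := segc_pnear m0 hy hz t01.
  exists e' => // s /he' /G [dG [WG _]].
  by apply: (@differentiable_comp _ _ _ _ ((fun s => retract (segc y z s)) : R[i]^o -> V) D) => //; exact: dD.
have t1 : 0 <= (1 : R) <= 1 by rewrite ler01 lexx.
have [e' e0' he'] := segc_pnear m0 hy hz t1.
have k1 : pnear (Order.min d1 d2) c (segc y z 1) by rewrite s1.
have [dG _] := G _ k1.
have /(_ [set w | pnear e z w]) cont := differentiable_continuous dG.
have nz : nbhs (retract (segc y z 1)) [set w | pnear e z w].
  by rewrite s1 rX //; apply/nbhs_pnear; exists e.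
have := cont nz; rewrite -nbhs_ballE => -[ee /= /posc[e2 e20 ->] h3].
exists (Order.min e2 e'); first by rewrite lt_min e20.
move=> s; rewrite lt_min => /andP[k2 k3].
apply: he; last by apply: h3; rewrite -ball_normE /ball_ /= nmE ltcR nmBC.
have [_ [_ ?]] := G s (he' s k3).
by [].
Qed.

End Connected.

(** * Existence and generic uniqueness of the continuation *)

Section Continuation.
Variables (R : realType) (n : nat) (p q : R[i]).
Hypotheses (p1 : nm p < 1) (p0 : p != 0) (q1 : nm q < 1) (q0 : q != 0).
Local Notation V := (params R n).
Local Notation X := (@balanced R n p q).
Implicit Types (x y z : V) (W : set V) (h D : V -> R[i]^o).

Lemma open_pnear W x : open W -> W x -> exists2 d : R, 0 < d & forall y, pnear d x y -> W y.
Proof. by move=> oW Wx; apply/nbhs_pnear; move: oW; rewrite openE; exact. Qed.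

Lemma pnear_open (c : V) (d : R) : open [set y | pnear d c y].
Proof. by rewrite openE => y /= /pnear_shift[e e0 he]; apply/nbhs_pnear; exists e. Qed.

Definition dense_on W h := forall x, X x -> W x -> forall e : R, 0 < e ->
  exists y, [/\ X y, W y, pnear e x y & h y != 0].

Lemma locally_nonzeroP W h : locally_nonzero_on X W h <-> dense_on W h.
Proof.
split=> [H x Xx Wx e e0|H x [Xx Wx] B /nbhs_pnear[e e0 he]].
  have [|y [[[Xy Wy] hy] k]] := H x (conj Xx Wx) [set y | pnear e x y].
    by apply/nbhs_pnear; exists e.
  by exists y.
by have [y [Xy Wy k hy]] := H x Xx Wx e e0; exists y; split; [|exact: he].
Qed.

Lemma dense_on_sub W W' h : open W' -> W' `<=` W -> dense_on W h -> dense_on W' h.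
Proof.
move=> oW' sub H x Xx Wx e e0; have [d d0 hd] := open_pnear oW' Wx.
have m0 : 0 < Order.min d e by rewrite lt_min d0.
have [y [Xy _ k hy]] := H x Xx (sub _ Wx) _ m0.
exists y; split=> //; first by apply: hd; apply: pnear_le k; rewrite ge_min lexx.
by apply: pnear_le k; rewrite ge_min lexx orbT.
Qed.

Lemma neq0_near h x : differentiable h x -> h x != 0 ->
  exists2 e : R, 0 < e & forall y, pnear e x y -> h y != 0.
Proof.
move=> dh hx; apply/nbhs_pnear.
have h0 : 0 < (nm (h x))%:C%C :> R[i] by rewrite ltcR nm_gt0.
have /cvgrPdist_lt /(_ _ h0) := differentiable_continuous dh.
apply: filterS => y /=; rewrite nmE ltcR; apply: contraTneq => ->.
by rewrite subr0 ltxx.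
Qed.

(** Where h1 is nonzero it remains so nearby, which leaves room to reach a point where h2 is nonzero
    too. *)
Lemma dense_onM W h1 h2 : open W -> (forall x, W x -> differentiable h1 x) ->
  dense_on W h1 -> dense_on W h2 -> dense_on W (fun x => h1 x * h2 x).
Proof.
move=> oW d1 H1 H2 x Xx Wx e e0.
have [y [Xy Wy k hy]] := H1 x Xx Wx e e0.
have [a a0 ha] := neq0_near (d1 y Wy) hy.
have [b b0 hb] := pnear_shift k.
have m0 : 0 < Order.min a b by rewrite lt_min a0.
have [z [Xz Wz l hz]] := H2 y Xy Wy _ m0.
exists z; split=> //; first by apply: hb; apply: pnear_le l; rewrite ge_min lexx orbT.
by rewrite mulf_neq0 // ha //; apply: pnear_le l; rewrite ge_min lexx.
Qed.

Lemma balanced_nonzero x : X x -> nonzero_params x.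
Proof. by case. Qed.

(** Vanishing near one point of the connected hypersurface would propagate to x0. *)
Lemma dense_nonzero D x0 : (forall x, nonzero_params x -> differentiable D x) ->
  X x0 -> D x0 != 0 -> dense_on (@nonzero_params R n) D.
Proof.
move=> dD X0 D0 x Xx Wx e e0; apply: contrapT => nex.
have Px : exists2 e : R, 0 < e & forall w, X w -> pnear e x w -> D w = 0.
  exists e => // w Xw k; apply/eqP; apply: contrapT => Dw; apply: nex; exists w; split=> //.
    exact: balanced_nonzero.
  exact/negP.
pose P x := exists2 e : R, 0 < e & forall w, X w -> pnear e x w -> D w = 0.
suff [e' e0' he'] : P x0 by move: D0; rewrite he' ?eqxx //; exact: pnear_refl.
apply: (@balanced_propagate R n p q p0 q0 P _ x x0 Xx X0 Px) => c Xc.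
have [d d0 [_ hd]] := local_identity p0 q0 Xc (@nonzero_open R n) (balanced_nonzero Xc) dD.
exists d => // y z cy cz Xy Xz Py.
have [b b0 hb] := pnear_shift cz.
by exists b => // w Xw k; apply: (hd w y) => //; exact: hb.
Qed.

(** Numerator and denominator are holomorphic wherever all parameters are nonzero. By the convention
    for division, the quotient agrees with [gg] even at zeros of the denominator. *)
Definition gg_num x : R[i]^o :=
  (\prod_r \prod_s ell p q (p * q / (tpar x r * upar x s))) *
  \prod_r (ell p q (p * q / ((\prod_s upar x s) / upar x r)) *
           ell p q (p * q / ((\prod_s tpar x s) / tpar x r))).

Definition gg_den x : R[i]^o :=
  (\prod_r \prod_s ell p q (tpar x r * upar x s)) *
  \prod_r (ell p q ((\prod_s upar x s) / upar x r) * ell p q ((\prod_s tpar x s) / tpar x r)).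

Lemma gg_quot x : gg p q (tpar x) (upar x) = gg_num x / gg_den x.
Proof.
rewrite /gg /gg_num /gg_den invfM mulrACA -!prodf_div; congr (_ * _).
  by apply: eq_bigr => r _; rewrite -prodf_div; apply: eq_bigr => s _; rewrite egammaE.
by apply: eq_bigr => r _; rewrite !egammaE // mulf_div.
Qed.

Section DifParams.
Variable x : V.
Hypothesis nz : nonzero_params x.
Let t0 r : tpar x r != 0. Proof. by case: nz. Qed.
Let u0 r : upar x r != 0. Proof. by case: nz. Qed.
Let dt r : differentiable (fun y => tpar y r : R[i]^o) x. Proof. exact: dif_tpar. Qed.
Let du r : differentiable (fun y => upar y r : R[i]^o) x. Proof. exact: dif_upar. Qed.
Let dT : differentiable (fun y => \prod_r tpar y r : R[i]^o) x. Proof. exact: dif_prod. Qed.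
Let dU : differentiable (fun y => \prod_r upar y r : R[i]^o) x. Proof. exact: dif_prod. Qed.
Let T0 : \prod_r tpar x r != 0. Proof. exact/prodf_neq0. Qed.
Let U0 : \prod_r upar x r != 0. Proof. exact/prodf_neq0. Qed.
Let dE (f : V -> R[i]^o) : differentiable f x -> differentiable (fun y => ell p q (f y) : R[i]^o) x.
Proof. by move=> df; apply: dif_comp => //; exact: ell_dif. Qed.

Lemma dif_gg_num : differentiable gg_num x.
Proof.
apply: difM.
  apply: dif_prod => r _; apply: dif_prod => s _; apply: dE.
  by apply: dif_div; [rewrite mulf_neq0|exact: dif_cst|exact: difM].
apply: dif_prod => r _; apply: difM; apply: dE; apply: dif_div; try exact: dif_cst.
- by rewrite mulf_neq0 ?invr_neq0.
- exact: dif_div.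
- by rewrite mulf_neq0 ?invr_neq0.
- exact: dif_div.
Qed.

Lemma dif_gg_den : differentiable gg_den x.
Proof.
apply: difM.
  by apply: dif_prod => r _; apply: dif_prod => s _; apply: dE; exact: difM.
by apply: dif_prod => r _; apply: difM; apply: dE; exact: dif_div.
Qed.
End DifParams.

(** All 2 n + 4 parameters are equal to one root of pq of that order. *)
Lemma base_point : exists2 x0, X x0 & forall r, nm (tpar x0 r) < 1 /\ nm (upar x0 r) < 1.
Proof.
have [w hw] := @complex_root R (n.+1 + n.+2) _ (mulf_neq0 p0 q0).
have w0 : w != 0 by apply: contraTneq (mulf_neq0 p0 q0) => w0; rewrite -hw w0 expr0n eqxx.
have w1 : nm w < 1.
  rewrite ltNge; apply/negP => h; have := exprn_ege1 (n.+1 + n.+2).+1 h.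
  by rewrite -nmX hw leNgt nmM mulr_ilt1 ?nm_ge0.
exists (mkpar (fun=> w) (fun=> w)); last by move=> r; rewrite tpar_mk upar_mk.
split=> [r|r|]; rewrite ?tpar_mk ?upar_mk //.
rewrite (eq_bigr (fun=> w * w)) => [|r _]; last by rewrite tpar_mk upar_mk.
by rewrite prodr_const card_ord -expr2 -exprM mul2n -addnn -hw.
Qed.

Lemma gg_den_dense : dense_on (@nonzero_params R n) gg_den.
Proof.
have [x0 X0 h0] := base_point.
apply: (dense_nonzero (x0 := x0)) => //; first exact: dif_gg_den.
have [t0 u0 hp] := X0.
have D : inD (p * q) (tpar x0) (upar x0).
  by split=> [r|r|]; rewrite ?nm_gt0 ?t0 ?u0 -?big_split //=; case: (h0 r).
apply: mulf_neq0; apply/prodf_neq0 => r _.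
  by apply/prodf_neq0 => s _; apply: ell_neq0 => //; case/andP: (inD_tu D r s).
by apply: mulf_neq0; apply: ell_neq0 => //; [case/andP: (inD_restu D r)|case/andP: (inD_restt D r)].
Qed.

Lemma gg_meromorphic : meromorphic_on X (fun x => gg p q (tpar x) (upar x)).
Proof.
move=> x Xx; exists (@nonzero_params R n), gg_num, gg_den; split.
- exact: balanced_nonzero.
- by split; [exact: nonzero_open|exact: dif_gg_num].
- by split; [exact: nonzero_open|exact: dif_gg_den].
- by apply/locally_nonzeroP; exact: gg_den_dense.
- by move=> y _ _ _; exact: gg_quot.
Qed.

(* The set of points near which two continuations agree generically is open
   and closed along paths, by the identity theorem applied to the difference of
   cross products of the local numerators and denominators. *)
Lemma continuation_unique (F : V -> R[i]^o) : meromorphic_on X F ->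
  (forall x, X x -> torus_range x -> F x = gg p q (tpar x) (upar x)) ->
  generically_on X (fun x => F x = gg p q (tpar x) (upar x)).
Proof.
move=> mF hF; have [x0 X0 h0] := base_point.
pose P x := exists W h, [/\ W x, holomorphic_on W h, locally_nonzero_on X W h &
  forall y, X y -> W y -> h y != 0 -> F y = gg p q (tpar y) (upar y)].
have P0 : P x0.
  have [d d0 hd] : exists2 d : R, 0 < d & forall r, nm (tpar x0 r) + d <= 1 /\ nm (upar x0 r) + d <= 1.
    apply: finite_radius => [r|r e e' ee [k1 k2]]; last first.
      by split; [apply: le_trans k1|apply: le_trans k2]; rewrite lerD2l.
    exists (Order.min (1 - nm (tpar x0 r)) (1 - nm (upar x0 r))).
      by have [k1 k2] := h0 r; rewrite lt_min !subr_gt0 k1 k2.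
    by split; rewrite -lerBrDl ge_min lexx ?orbT.
  exists [set y | pnear d x0 y], (fun=> 1); split.
  - exact: pnear_refl.
  - by split; [exact: pnear_open|move=> x _; exact: dif_cst].
  - apply/locally_nonzeroP => x Xx Wx e e0; exists x; split=> //; try exact: oner_neq0; exact: pnear_refl.
  move=> y Xy [k1 k2] _; apply: hF => // r; have [t0 _ _] := Xy; have [d1 d2] := hd r.
  split; rewrite -?normfV -[1]normr1 nm_lt nm1.
    by have := nm_sub (upar y r) (upar x0 r); have := k2 r; lra.
  rewrite nmV invf_gt1 ?nm_gt0 //.
  by have := nm_sub (tpar y r) (tpar x0 r); have := k1 r; lra.
move=> x Xx; apply: (@balanced_propagate R n p q p0 q0 P _ x0 x X0 Xx P0) => c Xc.
have [W [A [B [Wc [oW dA] [_ dB] nzB eF]]]] := mF c Xc.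
pose W0 := W `&` @nonzero_params R n.
have oW0 : open W0 by apply: openI => //; exact: nonzero_open.
(* Holomorphic near c, and zero exactly where the two quotients agree, as long as B and [gg_den] are
   nonzero. *)
pose D y := A y * gg_den y - gg_num y * B y : R[i]^o.
have dD y : W0 y -> differentiable (D : V -> R[i]^o) y.
  move=> [Wy ny]; apply: difB; apply: difM; [exact: dA|exact: dif_gg_den|exact: dif_gg_num|exact: dB].
have [d d0 [hd1 hd2]] := local_identity p0 q0 Xc oW0 (conj Wc (balanced_nonzero Xc)) dD.
have dBg : dense_on W0 (fun y => B y * gg_den y).
  apply: dense_onM => //; first by move=> y [Wy _]; exact: dB.
    by apply: (dense_on_sub (W := W)) => //; [move=> y []|exact/locally_nonzeroP].
  by apply: (dense_on_sub (W := @nonzero_params R n)) => //; [move=> y []|exact: gg_den_dense].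
have cross y : X y -> W0 y -> B y * gg_den y != 0 ->
    (F y == gg p q (tpar y) (upar y)) = (D y == 0).
  move=> Xy [Wy ny] nB; have [B0 G0] : B y != 0 /\ gg_den y != 0.
    by move: nB; rewrite mulf_eq0 negb_or => /andP.
  by rewrite eF // gg_quot eqr_div // subr_eq0.
exists d => // y z cy cz Xy Xz [Wh [h [Why [oWh dh] nzh hh]]].
(* A nonzero value of D would persist nearby, where by density some point has h, B and [gg_den]
   nonzero and hence D = 0. *)
have Dy : exists2 e : R, 0 < e & forall w, X w -> pnear e y w -> D w = 0.
  have [a a0 ha] := open_pnear oWh Why; have [b b0 hb] := pnear_shift cy.
  exists (Order.min a b); first by rewrite lt_min a0.
  move=> w Xw k; apply: contrapT => /eqP Dw.
  have Ww : (Wh `&` W0) w.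
    split; first by apply: ha; apply: pnear_le k; rewrite ge_min lexx.
    by have [] := hd1 w; first by apply: hb; apply: pnear_le k; rewrite ge_min lexx orbT.
  have oWW : open (Wh `&` W0) by exact: openI.
  have den : dense_on (Wh `&` W0) (fun y => h y * (B y * gg_den y)).
    apply: dense_onM => //; first by move=> v [Wv _]; exact: dh.
      by apply: (dense_on_sub (W := Wh) oWW) => [v []|]; last exact/locally_nonzeroP.
    by apply: (dense_on_sub (W := W0) oWW) => // v [].
  have [e e0 he] := neq0_near (dD w Ww.2) Dw.
  have [v [Xv [Whv W0v] kv hv]] := den w Xw Ww e e0.
  have [hv0 Bv0] : h v != 0 /\ B v * gg_den v != 0.
    by move: hv; rewrite mulf_eq0 negb_or => /andP.
  by move: (he v kv); rewrite -(cross v) // hh // eqxx.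
have D0 w : X w -> pnear d c w -> D w = 0 by move=> Xw kw; exact: (hd2 w y).
have oWd : open [set w | pnear d c w] by exact: pnear_open.
have Wd0 : [set w | pnear d c w] `<=` W0 by move=> w kw; case: (hd1 w kw).
exists [set w | pnear d c w], (fun w => B w * gg_den w); split=> //.
- split=> // w /Wd0 [Ww nw]; apply: difM; [exact: dB|exact: dif_gg_den].
- by apply/locally_nonzeroP; apply: (dense_on_sub (W := W0)).
by move=> w Xw kw nB; apply/eqP; rewrite cross //; [rewrite D0|exact: Wd0].
Qed.

End Continuation.

Theorem corollary4p2 (R : realType) (n : nat) (p q : R[i])
    (p_neq0 : 0 < `|p|) (p_lt1 : `|p| < 1)
    (q_neq0 : 0 < `|q|) (q_lt1 : `|q| < 1) :
  generically_on (@balanced R n p q) (fun x : params R n =>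
    let t := tpar x in
    let u := upar x in
    let T := \prod_(r < n.+2) t r in
    let U := \prod_(r < n.+2) u r in
    An_integral (@balanced R n p q) p q x =
    (\prod_(r < n.+2) \prod_(s < n.+2) egamma p q (t r * u s)) *
    \prod_(r < n.+2) (egamma p q (U / u r) * egamma p q (T / t r))).
Proof.
have p0 : p != 0 by rewrite -normr_gt0.
have q0 : q != 0 by rewrite -normr_gt0.
have p1 : nm p < 1 by rewrite -(nm1 R) -nm_lt normr1.
have q1 : nm q < 1 by rewrite -(nm1 R) -nm_lt normr1.
(* [An_integral] is a chosen continuation; the right-hand side shows that one exists, and the choice
   is immaterial generically. *)
have [|mF hF] := @xgetPex _ (fun=> 0) [set F | meromorphic_continuation (@balanced R n p q)
    (@torus_range R n) (An_torus_integral p q) F].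
  exists (fun x => gg p q (tpar x) (upar x)); split; first exact: gg_meromorphic.
  by move=> x Xx Dx; rewrite An_torus_value.
apply: (continuation_unique p1 p0 q1 q0 mF) => x Xx Dx.
by rewrite hF // An_torus_value.
Qed.
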